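(* Let $(U_\varphi,C)$ be a neighborhood formally equivalent to $(U_{1,0,0},C)$ with cocycle $\varphi=(\varphi_{i,i+1})_{i\in\mathbb Z_4}$ such that $$\varphi_{1,4}(X,Y)=(X(1+XY),\,Y(1+X^2Y)),\qquad\text{where }\varphi_{1,4}:=\varphi_{4,1}^{-1}.$$ Then all foliations $\hat{\mathcal F}_t$ belonging to the formal pencil $(\hat{\mathcal F}_t)_{t\in\mathbb P^1}$ on $(U_\varphi,C)$ are divergent.
   Context: Fix $\tau\in\mathbb C$, $\Im\tau>0$, $\varpi=\arg\tau\in]0,\pi[$, $q=e^{2i\pi\tau}$, $C=\mathbb C^*_z/\langle z\mapsto qz\rangle$, $\tilde C=\{y=0\}\subset\mathbb C^*_z\times\mathbb C_y$, $\xi=1/y$. $(U_{1,0,0},C)$ is the quotient of the germ $(\mathbb C^*_z\times\mathbb C_y,\tilde C)$ by $F_{1,0,0}(z,\xi)=(qz,\xi-1)$. A neighborhood $(U,C)$ (germ of smooth surface along $C$) formally equivalent to it (formal isomorphism inducing the identity on $C$) can be written $(\mathbb C^*_z\times\mathbb C_y,\tilde C)/\langle F\rangle$ with $F(z,y)=(qz+O(y^2),y+y^2+y^3+O(y^4))$, and there is a formal diffeomorphism $\hat\Psi=(z+\sum_{n\ge1}a_n(z)y^n,y+\sum_{n\ge2}b_n(z)y^n)$, $a_n,b_n\in\mathcal O(\mathbb C^* )$, with $\hat\Psi\circ F=F_{1,0,0}\circ\hat\Psi$. Pencil: on $U_{1,0,0}$, $\mathcal F_t$ is the foliation $\omega_0+t\omega_\infty=0$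 ($\mathcal F_\infty:\omega_\infty=0$), $\omega_0=d\xi$, $\omega_\infty=\frac1{2i\pi\tau}\frac{dz}{z}$. On $(U,C)$, $\hat{\mathcal F}_t=\hat\Psi^*\mathcal F_t$ (independent of $\hat\Psi$); it is convergent if it is a holomorphic foliation germ on $(U,C)$, divergent otherwise. Lines: in $\mathbb P^1_X\times\mathbb P^1_Y$ set $L_1=\{Y=0\}$, $L_2=\{X=\infty\}$, $L_3=\{Y=\infty\}$, $L_4=\{X=0\}$, $D=\bigcup L_i$, $p_{i,i+1}=L_i\cap L_{i+1}$ ($i\in\mathbb Z_4$). A cocycle is $\varphi=(\varphi_{i,i+1})_{i\in\mathbb Z_4}$ where $\varphi_{i,i+1}$ is a germ of biholomorphism at $p_{i,i+1}$ preserving the two branches of $D$ and tangent to the identity at $p_{i,i+1}$. $(U_\varphi,C)$ denotes a neighborhood formally equivalent to $(U_{1,0,0},C)$ whose cocycle is $\varphi$ (every cocycle occurs): let $I_1=]-\varpi,\pi-\varpi[$, $I_2=]-\pi,0[$, $I_3=I_1+\pi$, $I_4=I_2+\pi$ (values of $\arg\xi$ mod $2\pi$); for each $i$ there is a biholomorphism onto its image $\Psi_i$ on a transversely sectorial open set of opening $I_i=]\theta_1,\theta_2[$ (i.e. containing, for all large $c$ and small $\varepsilon>0$, some $\{\arg\xi\in]\theta_1+\varepsilon,\theta_2-\varepsilon[,|\xi|>R,e^{-c}<|z|<e^c\}$), with asymptotic expansion $\hat\Psi$ (uniform on these sets) and $\Psi_i\circ F=F_{1,0,0}\circ\Psi_i$;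 with $\Pi(z,\xi)=(e^{2i\pi\xi},ze^{2i\pi\tau\xi})$ the cocycle is given by $\Pi\circ\Psi_i=\varphi_{i,i+1}\circ\Pi\circ\Psi_{i+1}$ on overlaps. *)

(* Defs.v *)
From Stdlib Require Import Reals.
From Coquelicot Require Import Coquelicot.
Open Scope C_scope.

Notation C2 := (C * C)%type.
Notation C2_NormedModule :=
  (prod_NormedModule C_AbsRing C_NormedModule C_NormedModule).

Definition Cexp (z : C) : C :=
  ((exp (Re z) * cos (Im z))%R, (exp (Re z) * sin (Im z))%R).

Definition two_pi_i : C := RtoC (2 * PI)%R * Ci.

Definition qpar (tau : C) : C := Cexp (two_pi_i * tau).

Definition is_arg (z : C) (theta : R) : Prop :=
  z = RtoC (Cmod z) * (cos theta, sin theta).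

(* Complex (Frechet) differentiability: the derivative is C-linear. *)
Definition holo_at (f : C2 -> C2) (p : C2) : Prop :=
  ex_filterdiff (U := C2_NormedModule) (V := C2_NormedModule) f (locally p).

Definition holo_on (S : C2 -> Prop) (f : C2 -> C2) : Prop :=
  forall p, S p -> holo_at f p.

Definition image (S : C2 -> Prop) (f : C2 -> C2) : C2 -> Prop :=
  fun y => exists x, S x /\ f x = y.

Definition biholo_on (S : C2 -> Prop) (f : C2 -> C2) : Prop :=
  open S /\ holo_on S f /\ open (image S f) /\
  exists g : C2 -> C2, holo_on (image S f) g /\ forall p, S p -> g (f p) = p.

(* [bigO N f]: f = O(y^N) along {y = 0} in C^*_z x C_y, locally uniformly
   in z. *)
Definition bigO (N : nat) (f : C2 -> C) : Prop :=
  forall z0 : C, z0 <> 0 ->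
  exists K : R, locally (z0, RtoC 0)
    (fun p => (Cmod (f p) <= K * Cmod (snd p) ^ N)%R).

(* F is the gluing map in the coordinates (z,y), on an open neighborhood V of
   {y = 0}; (U,C) is the germ of the quotient by the group generated by F. *)
Definition is_neighborhood (tau : C) (V : C2 -> Prop) (F : C2 -> C2) : Prop :=
  (forall p, V p -> fst p <> 0 /\ fst (F p) <> 0) /\
  (forall z : C, z <> 0 -> V (z, RtoC 0)) /\
  biholo_on V F /\
  bigO 2 (fun p => fst (F p) - qpar tau * fst p) /\
  bigO 4 (fun p => snd (F p) - (snd p + snd p ^ 2 + snd p ^ 3)).

(* F_{1,0,0} in the coordinates (z,xi), and in the coordinates (z,y) with
   y = 1/xi, where xi - 1 becomes 1/(1/y - 1) = y/(1-y). *)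
Definition F100 (tau : C) (p : C2) : C2 := (qpar tau * fst p, snd p - 1).

Definition F100_y (tau : C) (p : C2) : C2 :=
  (qpar tau * fst p, snd p / (1 - snd p)).

(* (z + sum_{n>=1} a_n(z) y^n , y + sum_{n>=2} b_n(z) y^n); the values of
   [fd_a] at 0 and of [fd_b] at 0 and 1 are never used. *)
Record formal_diffeo := FormalDiffeo {
  fd_a : nat -> C -> C;
  fd_b : nat -> C -> C;
  fd_a_holo : forall n (z : C), (1 <= n)%nat -> z <> 0 -> ex_derive (fd_a n) z;
  fd_b_holo : forall n (z : C), (2 <= n)%nat -> z <> 0 -> ex_derive (fd_b n) z
}.

(* Truncation modulo y^(N+1) (for N >= 1; for N = 0 the term y is kept). *)
Definition jet (Psi : formal_diffeo) (N : nat) (p : C2) : C2 :=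
  (fst p + sum_n_m (fun n => fd_a Psi n (fst p) * snd p ^ n) 1 N,
   snd p + sum_n_m (fun n => fd_b Psi n (fst p) * snd p ^ n) 2 N).

(* Psi o F = F_{1,0,0} o Psi as formal power series in y, i.e. modulo y^(N+1)
   for every N.  As F preserves {y = 0}, both sides are determined modulo
   y^(N+1) by the truncation of Psi modulo y^(N+1). *)
Definition formal_conjugacy (tau : C) (F : C2 -> C2) (Psi : formal_diffeo) : Prop :=
  forall N : nat,
    bigO (N + 1) (fun p =>
      fst (jet Psi N (F p)) - fst (F100_y tau (jet Psi N p))) /\
    bigO (N + 1) (fun p =>
      snd (jet Psi N (F p)) - snd (F100_y tau (jet Psi N p))).

(* A 1-form A dz + B dy is given by p |-> (A p, B p). *)
Definition wedge (u v : C2) : C := fst u * snd v - snd u * fst v.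

Definition dz (f : C2 -> C) (p : C2) : C := C_derive (fun z => f (z, snd p)) (fst p).
Definition dy (f : C2 -> C) (p : C2) : C := C_derive (fun y => f (fst p, y)) (snd p).

Definition pullback (f : C2 -> C2) (eta : C2 -> C2) (p : C2) : C2 :=
  let A := fst (eta (f p)) in
  let B := snd (eta (f p)) in
  let f1 := fun x => fst (f x) in
  let f2 := fun x => snd (f x) in
  (A * dz f1 p + B * dz f2 p, A * dy f1 p + B * dy f2 p).

(* A regular holomorphic foliation is given by a nowhere zero field [eta] of
   covectors, which matters only up to pointwise rescaling and need not itself
   be continuous: near each point p it is proportional to a nowhere zero
   holomorphic 1-form [om]. *)
Definition generates_at (om eta : C2 -> C2) (p : C2) : Prop :=
  locally p (fun x => holo_at om x /\ om x <> (RtoC 0, RtoC 0) /\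
                      eta x <> (RtoC 0, RtoC 0) /\ wedge (om x) (eta x) = 0).

Definition is_foliation (W : C2 -> Prop) (eta : C2 -> C2) : Prop :=
  forall p, W p -> exists om : C2 -> C2, generates_at om eta p.

(* Germ along C of a foliation on the quotient by F: a foliation on an open
   neighborhood W of {y = 0} which is invariant under F. *)
Definition is_foliation_germ (V : C2 -> Prop) (F : C2 -> C2)
    (W : C2 -> Prop) (eta : C2 -> C2) : Prop :=
  open W /\ (forall p, W p -> V p) /\
  (forall z : C, z <> 0 -> W (z, RtoC 0)) /\
  is_foliation W eta /\
  forall p, W p -> W (F p) -> wedge (pullback F eta p) (eta p) = 0.

(* The projective line of parameters t; [None] is t = oo. *)
Definition P1 := option C.

(* Regular generator of F_t in the coordinates (z,y): as d xi = - dy / y^2,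
   this is y^2 (omega_0 + t omega_oo) for finite t, and omega_oo for t = oo. *)
Definition pencil (tau : C) (t : P1) (p : C2) : C2 :=
  match t with
  | Some t => (t * snd p ^ 2 / (two_pi_i * tau * fst p), - (1))
  | None => (1 / (two_pi_i * tau * fst p), RtoC 0)
  end.

(* The formal foliation Psi^* F_t is the formal completion of a holomorphic
   foliation germ on (U,C): the formal 1-forms defining both have zero wedge
   product.  The pullback of the form by the truncation of Psi modulo y^(N+1)
   agrees with the formal pullback modulo y^N, d/dy losing one order. *)
Definition convergent (tau : C) (V : C2 -> Prop) (F : C2 -> C2)
    (Psi : formal_diffeo) (t : P1) : Prop :=
  exists (W : C2 -> Prop) (eta : C2 -> C2),
    is_foliation_germ V F W eta /\
    forall (z0 : C) (om : C2 -> C2),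
      z0 <> 0 -> generates_at om eta (z0, RtoC 0) ->
      forall N : nat, exists K : R, locally (z0, RtoC 0) (fun p =>
        (Cmod (wedge (om p) (pullback (jet Psi N) (pencil tau t) p))
           <= K * Cmod (snd p) ^ N)%R).

Definition divergent (tau : C) (V : C2 -> Prop) (F : C2 -> C2)
    (Psi : formal_diffeo) (t : P1) : Prop :=
  ~ convergent tau V F Psi t.

Inductive Z4 := i1 | i2 | i3 | i4.

Definition next (i : Z4) : Z4 :=
  match i with i1 => i2 | i2 => i3 | i3 => i4 | i4 => i1 end.

Definition opening (varpi : R) (i : Z4) : R * R :=
  match i with
  | i1 => (- varpi, PI - varpi)%R
  | i2 => (- PI, 0)%R
  | i3 => (PI - varpi, 2 * PI - varpi)%R
  | i4 => (0, PI)%R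
  end.

(* Points (z,y), xi = 1/y, with arg xi in ]theta_1 + eps, theta_2 - eps[
   modulo 2 pi, |xi| > M and e^-c < |z| < e^c. *)
Definition sector (varpi : R) (i : Z4) (c eps M : R) (p : C2) : Prop :=
  snd p <> 0 /\
  (M < Cmod (/ snd p))%R /\
  (exists theta : R,
     (fst (opening varpi i) + eps < theta < snd (opening varpi i) - eps)%R /\
     is_arg (/ snd p) theta) /\
  (exp (- c) < Cmod (fst p) < exp c)%R.

(* The sectorial map [psi] goes from the coordinates (z,y) of the neighborhood
   to the coordinates (z,xi) of U_{1,0,0}. *)
Definition sectorial_normalization (tau : C) (varpi : R)
    (V : C2 -> Prop) (F : C2 -> C2) (Psi : formal_diffeo)
    (i : Z4) (S : C2 -> Prop) (psi : C2 -> C2) : Prop :=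
  (forall p, S p -> V p /\ snd p <> 0 /\ fst (psi p) <> 0 /\ snd (psi p) <> 0) /\
  biholo_on S psi /\
  (forall c eps : R, (0 < c)%R -> (0 < eps)%R ->
    exists M : R, (0 < M)%R /\
      (forall p, sector varpi i c eps M p -> S p) /\
      forall N : nat, exists K : R, forall p, sector varpi i c eps M p ->
        (Cmod (fst (psi p) - fst (jet Psi N p)) <= K * Cmod (snd p) ^ (N + 1))%R /\
        (Cmod (/ snd (psi p) - snd (jet Psi N p)) <= K * Cmod (snd p) ^ (N + 1))%R) /\
  (forall p, S p -> S (F p) -> psi (F p) = F100 tau (psi p)).

Definition Pi (tau : C) (p : C2) : C2 :=
  (Cexp (two_pi_i * snd p), fst p * Cexp (two_pi_i * tau * snd p)).

(* Coordinates of P^1 x P^1 centered at p_{i,i+1}; p_{1,2} = (oo,0),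
   p_{2,3} = (oo,oo), p_{3,4} = (0,oo), p_{4,1} = (0,0). *)
Definition corner_chart (i : Z4) (p : C2) : C2 :=
  match i with
  | i1 => (/ fst p, snd p)
  | i2 => (/ fst p, / snd p)
  | i3 => (fst p, / snd p)
  | i4 => p
  end.

Definition origin : C2 := (RtoC 0, RtoC 0).

(* A germ phi_{i,i+1}, written in the chart centered at p_{i,i+1}, where the
   two branches of D are the coordinate axes. *)
Definition cocycle_germ (f : C2 -> C2) : Prop :=
  f origin = origin /\
  (exists O : C2 -> Prop, O origin /\ biholo_on O f) /\
  locally origin (fun p => (fst p = RtoC 0 -> fst (f p) = RtoC 0) /\
                           (snd p = RtoC 0 -> snd (f p) = RtoC 0)) /\
  filterdiff (U := C2_NormedModule) (V := C2_NormedModule)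
    f (locally origin) (fun v => v).

(* [phi i] is phi_{i,i+1} in the chart centered at p_{i,i+1}.  Only the germ of
   [phi i] is used: on the overlap of the sectors, Pi o psi_{i+1} tends to
   p_{i,i+1} as |xi| -> oo. *)
Definition has_cocycle (tau : C) (varpi : R)
    (V : C2 -> Prop) (F : C2 -> C2) (Psi : formal_diffeo)
    (phi : Z4 -> C2 -> C2) : Prop :=
  (forall i, cocycle_germ (phi i)) /\
  exists (S : Z4 -> C2 -> Prop) (psi : Z4 -> C2 -> C2),
    (forall i, sectorial_normalization tau varpi V F Psi i (S i) (psi i)) /\
    forall i (c eps : R), (0 < c)%R -> (0 < eps)%R ->
      exists M : R, (0 < M)%R /\
        forall p, S i p -> S (next i) p ->
          sector varpi i c eps M p -> sector varpi (next i) c eps M p ->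
          corner_chart i (Pi tau (psi i p)) =
          phi i (corner_chart i (Pi tau (psi (next i) p))).

Definition germ_inverse (f g : C2 -> C2) : Prop :=
  f origin = origin /\ g origin = origin /\
  locally origin (fun p => f (g p) = p) /\
  locally origin (fun p => g (f p) = p).

Definition phi_14 (p : C2) : C2 :=
  let X := fst p in
  let Y := snd p in
  (X * (1 + X * Y), Y * (1 + X ^ 2 * Y)).

(* Main.v *)
(* Suppose that F_t converges to a foliation [eta].  In the sector of opening I_i, write
   [eta] in the coframe dX/X, dY/Y of (X, Y) = Pi o Psi_i, in which the foliation F_t is a
   constant line l0: then [eta] is the line l0 + f_i l1.  The slope f_i is invariant under F,
   so that it is a function of (X, Y), and it is small near C because [eta] is asymptotic to
   Psi^* F_t.  In the coordinates log X, log Y it is periodic and defined on wide strips,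
   where a bounded periodic holomorphic function is nearly constant: f_1 nearly depends only
   on Y, and f_4 only on X.  On the overlap, (X, Y) is changed by
   (X (1 + X Y), Y (1 + X^2 Y)), so that the line of slope f_1, transported by the
   derivative of this map, is the line of slope f_4.  Taking second differences in X and Y
   of this relation removes f_1 and f_4 up to negligible terms and leaves a (b - a) = 0 and
   b (2 b - a) = 0 for l0 = (a, b), whence l0 = 0, which is absurd. *)

Require Import Defs.
From Stdlib Require Import Reals Lra Lia ZArith ClassicalEpsilon.
From Coquelicot Require Import Coquelicot.
Open Scope C_scope.

(** * Complex differentiability *)

(** The two conditions come from first order terms: the transition adds [X Y (dX/X + dY/Y)] to
    [dX/X] and [X^2 Y (2 dX/X + dY/Y)] to [dY/Y], so the wedge product of the transported line with
    [(a, b)] is [X Y a (b - a) + X^2 Y b (2 b - a)], and the different degrees in X separate the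
    coefficients. At points [X = i lam], [Y = j lam] with [lam] small these terms have sizes [lam^2]
    and [lam^3], so each slope must be a function of one variable up to [o(lam^3)]. This precision
    is the obstacle. In the overlap y is of size [1 / |log lam|], so asymptotic expansions in y give
    only powers of [1 / |log lam|]. Convergence supplies the rest: the slope is an actual
    holomorphic function, its invariance under F continues it to strips whose width is a large
    multiple of [|log lam|], and periodicity on such a strip gives a decay exponential in
    [|log lam|], that is, a power of [lam]. The expansion of the normalizations is used only at
    fixed low orders, to make the slopes small and to show that the two normalizations nearly agree
    on the overlap. *)

Definition cdiff (f : C -> C) (z l : C) : Prop :=
  forall eps : R, (0 < eps)%R -> exists d : R, (0 < d)%R /\
    forall h : C, (Cmod h < d)%R ->
      (Cmod (f (z + h)%C - f z - l * h) <= eps * Cmod h)%R.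

(** Total differentiability with both partial derivatives displayed, so that the chain rule yields
    explicit expressions which [ring] and [field] handle. The sum of the moduli stands for the norm
    of C x C. *)
Definition hdiff (f : C2 -> C) (p : C2) (a b : C) : Prop :=
  forall eps : R, (0 < eps)%R -> exists d : R, (0 < d)%R /\
    forall h k : C, (Cmod h < d)%R -> (Cmod k < d)%R ->
      (Cmod (f (fst p + h, snd p + k)%C - f p - (a * h + b * k))
       <= eps * (Cmod h + Cmod k))%R.

Lemma Cmod_sub_le (a b : C) : (Cmod (a - b) <= Cmod a + Cmod b)%R.
Proof. unfold Cminus. rewrite <- (Cmod_opp b). apply Cmod_triangle. Qed.

Lemma Cmod_sub_sym (a b : C) : Cmod (a - b) = Cmod (b - a).
Proof. rewrite <- Cmod_opp. f_equal. ring. Qed.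

Lemma Cmod_sub_ge (a b : C) : (Cmod a - Cmod b <= Cmod (a - b))%R.
Proof.
  pose proof (Cmod_triangle (a - b) b). replace (a - b + b) with a in H by ring. lra.
Qed.

Lemma Cmod_add_ge (a b : C) : (Cmod a - Cmod b <= Cmod (a + b))%R.
Proof.
  pose proof (Cmod_sub_le (a + b) b). replace (a + b - b) with a in H by ring. lra.
Qed.

Lemma cdiff_ext (f g : C -> C) (z l : C) (d : R) :
  (0 < d)%R -> (forall h, (Cmod h < d)%R -> f (z + h) = g (z + h)) ->
  cdiff f z l -> cdiff g z l.
Proof.
  intros Hd E H eps He. destruct (H eps He) as [d' [Hd' H']].
  exists (Rmin d d'). split. now apply Rmin_pos.
  intros h Hh. pose proof (Rmin_l d d'). pose proof (Rmin_r d d').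
  rewrite <- E by lra.
  replace (g z) with (f z). apply H'; lra.
  rewrite <- (Cplus_0_r z). apply E. rewrite Cmod_0; lra.
Qed.

Lemma cdiff_ext_all (f g : C -> C) (z l l' : C) :
  (forall x, f x = g x) -> l = l' -> cdiff f z l -> cdiff g z l'.
Proof. intros E <- H. apply (cdiff_ext f g z l 1); auto. lra. Qed.

Lemma cdiff_const (c z : C) : cdiff (fun _ => c) z 0.
Proof.
  intros eps He. exists 1%R. split. lra. intros h _.
  replace (c - c - 0 * h) with (RtoC 0) by ring. rewrite Cmod_0.
  pose proof (Cmod_ge_0 h). nra.
Qed.

Lemma cdiff_id (z : C) : cdiff (fun x => x) z 1.
Proof.
  intros eps He. exists 1%R. split. lra. intros h _.
  replace (z + h - z - 1 * h) with (RtoC 0) by ring. rewrite Cmod_0.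
  pose proof (Cmod_ge_0 h). nra.
Qed.

Lemma cdiff_cont (f : C -> C) (z l : C) : cdiff f z l ->
  exists d : R, (0 < d)%R /\ forall h, (Cmod h < d)%R ->
    (Cmod (f (z + h)%C - f z) <= (Cmod l + 1) * Cmod h)%R.
Proof.
  intros H. destruct (H 1%R ltac:(lra)) as [d [Hd H']]. exists d; split; auto.
  intros h Hh. specialize (H' h Hh).
  pose proof (Cmod_triangle (f (z + h) - f z - l * h) (l * h)).
  rewrite Cmod_mult in H0.
  replace (f (z + h) - f z - l * h + l * h) with (f (z + h) - f z) in H0 by ring.
  lra.
Qed.

(** The sum and product rules below are this chain rule applied to addition and multiplication, seen
    as functions on C x C. *)
Lemma hdiff_comp (f : C2 -> C) (u v : C -> C) (w u' v' a b : C) :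
  hdiff f (u w, v w) a b -> cdiff u w u' -> cdiff v w v' ->
  cdiff (fun x => f (u x, v x)) w (a * u' + b * v').
Proof.
  intros Hf Hu Hv eps He.
  set (K := (Cmod u' + 1 + Cmod v' + 1)%R).
  assert (HK : (0 < K)%R) by (unfold K; pose proof (Cmod_ge_0 u'); pose proof (Cmod_ge_0 v'); lra).
  destruct (Hf (eps / (2 * K))%R ltac:(apply Rdiv_lt_0_compat; lra)) as [d1 [Hd1 H1]].
  set (A := (Cmod a + Cmod b + 1)%R).
  assert (HA : (0 < A)%R) by (unfold A; pose proof (Cmod_ge_0 a); pose proof (Cmod_ge_0 b); lra).
  destruct (Hu (eps / (2 * A))%R ltac:(apply Rdiv_lt_0_compat; lra)) as [d2 [Hd2 H2]].
  destruct (Hv (eps / (2 * A))%R ltac:(apply Rdiv_lt_0_compat; lra)) as [d3 [Hd3 H3]].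
  destruct (cdiff_cont _ _ _ Hu) as [d4 [Hd4 H4]].
  destruct (cdiff_cont _ _ _ Hv) as [d5 [Hd5 H5]].
  exists (Rmin (Rmin d2 d3) (Rmin (Rmin d4 d5) (d1 / K)))%R. split.
  repeat apply Rmin_pos; auto. now apply Rdiv_lt_0_compat.
  intros h Hh.
  apply Rmin_Rgt_l in Hh. destruct Hh as [Hh Hh']. apply Rmin_Rgt_l in Hh. destruct Hh as [h2 h3].
  apply Rmin_Rgt_l in Hh'. destruct Hh' as [Hh h1]. apply Rmin_Rgt_l in Hh. destruct Hh as [h4 h5].
  specialize (H2 h h2). specialize (H3 h h3). specialize (H4 h h4). specialize (H5 h h5).
  assert (HKh : (K * Cmod h < d1)%R).
  { apply Rmult_lt_reg_r with (/ K)%R. now apply Rinv_0_lt_compat.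
    replace (K * Cmod h * / K)%R with (Cmod h) by (field; lra). exact h1. }
  set (hu := u (w + h) - u w) in *. set (hv := v (w + h) - v w) in *.
  pose proof (Cmod_ge_0 h) as P0. pose proof (Cmod_ge_0 u') as P1. pose proof (Cmod_ge_0 v') as P2.
  specialize (H1 hu hv). simpl in H1.
  assert (Hs : (Cmod hu + Cmod hv <= K * Cmod h)%R) by (unfold K; nra).
  pose proof (Cmod_ge_0 hu) as P3. pose proof (Cmod_ge_0 hv) as P4.
  specialize (H1 ltac:(lra) ltac:(lra)).
  replace (u w + hu) with (u (w + h)) in H1 by (unfold hu; ring).
  replace (v w + hv) with (v (w + h)) in H1 by (unfold hv; ring).
  replace (f (u (w + h), v (w + h)) - f (u w, v w) - (a * u' + b * v') * h)
    with ((f (u (w + h), v (w + h)) - f (u w, v w) - (a * hu + b * hv))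
          + (a * (hu - u' * h) + b * (hv - v' * h))) by ring.
  eapply Rle_trans. apply Cmod_triangle.
  pose proof (Cmod_triangle (a * (hu - u' * h)) (b * (hv - v' * h))) as T.
  rewrite !Cmod_mult in T.
  assert (E1 : (eps / (2 * K) * (Cmod hu + Cmod hv) <= eps / 2 * Cmod h)%R).
  { apply Rle_trans with (eps / (2 * K) * (K * Cmod h))%R.
    apply Rmult_le_compat_l; auto. apply Rlt_le, Rdiv_lt_0_compat; lra.
    right. field. lra. }
  assert (E2 : (eps / (2 * A) * Cmod h * A = eps / 2 * Cmod h)%R) by (field; lra).
  pose proof (Cmod_ge_0 a). pose proof (Cmod_ge_0 b).
  assert (0 <= eps / (2 * A) * Cmod h)%R.
  { apply Rmult_le_pos; auto. apply Rlt_le, Rdiv_lt_0_compat; lra. }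
  assert (Cmod a * Cmod (hu - u' * h) <= Cmod a * (eps / (2 * A) * Cmod h))%R
    by (apply Rmult_le_compat_l; auto).
  assert (Cmod b * Cmod (hv - v' * h) <= Cmod b * (eps / (2 * A) * Cmod h))%R
    by (apply Rmult_le_compat_l; auto).
  unfold A in E2 at 2. nra.
Qed.

Lemma hdiff_plus_op (p : C2) : hdiff (fun q => fst q + snd q) p 1 1.
Proof.
  intros eps He. exists 1%R. split. lra. intros h k _ _. simpl.
  replace (fst p + h + (snd p + k) - (fst p + snd p) - (1 * h + 1 * k)) with (RtoC 0) by ring.
  rewrite Cmod_0. pose proof (Cmod_ge_0 h). pose proof (Cmod_ge_0 k). nra.
Qed.

Lemma hdiff_mult_op (p : C2) : hdiff (fun q => fst q * snd q) p (snd p) (fst p).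
Proof.
  intros eps He. exists eps. split. lra. intros h k Hh Hk. simpl.
  replace ((fst p + h) * (snd p + k) - fst p * snd p - (snd p * h + fst p * k))
    with (h * k) by ring.
  rewrite Cmod_mult. pose proof (Cmod_ge_0 h). pose proof (Cmod_ge_0 k). nra.
Qed.

Lemma cdiff_plus (f g : C -> C) (z a b : C) :
  cdiff f z a -> cdiff g z b -> cdiff (fun x => f x + g x) z (a + b).
Proof.
  intros Hf Hg.
  generalize (hdiff_comp _ f g z a b _ _ (hdiff_plus_op _) Hf Hg).
  apply cdiff_ext_all; intros; simpl; ring.
Qed.

Lemma cdiff_mult (f g : C -> C) (z a b : C) :
  cdiff f z a -> cdiff g z b -> cdiff (fun x => f x * g x) z (a * g z + f z * b).
Proof.
  intros Hf Hg.
  generalize (hdiff_comp _ f g z a b _ _ (hdiff_mult_op _) Hf Hg).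
  apply cdiff_ext_all; intros; simpl; ring.
Qed.

Lemma cdiff_scal (c : C) (f : C -> C) (z a : C) :
  cdiff f z a -> cdiff (fun x => c * f x) z (c * a).
Proof.
  intros H. generalize (cdiff_mult _ _ _ _ _ (cdiff_const c z) H).
  apply cdiff_ext_all; intros; ring.
Qed.

Lemma cdiff_minus (f g : C -> C) (z a b : C) :
  cdiff f z a -> cdiff g z b -> cdiff (fun x => f x - g x) z (a - b).
Proof.
  intros Hf Hg.
  generalize (cdiff_plus _ _ _ _ _ Hf (cdiff_scal (-(1)) _ _ _ Hg)).
  apply cdiff_ext_all; intros; ring.
Qed.

Lemma cdiff_comp (f u : C -> C) (w a b : C) :
  cdiff f (u w) a -> cdiff u w b -> cdiff (fun x => f (u x)) w (a * b).
Proof.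
  intros Hf Hu.
  assert (Hh : hdiff (fun q => f (fst q)) (u w, u w) a 0).
  { intros eps He. destruct (Hf eps He) as [d [Hd H]]. exists d; split; auto.
    intros h k Hh Hk. simpl. specialize (H h Hh).
    replace (a * h + 0 * k) with (a * h) by ring.
    pose proof (Cmod_ge_0 k). pose proof (Cmod_ge_0 h). nra. }
  generalize (hdiff_comp _ u u w b b _ _ Hh Hu Hu).
  apply cdiff_ext_all; intros; simpl; ring.
Qed.

Lemma cdiff_inv_id (z : C) : z <> 0 -> cdiff (fun x => / x) z (- (/ (z * z))).
Proof.
  intros Hz eps He. pose proof (proj1 (Cmod_gt_0 z) Hz) as Pz.
  set (r := Cmod z) in *.
  (* For |h| < r/2 one has |z + h| >= r/2, so the remainder h^2 / (z^2 (z + h)) is at most 2 |h|^2 /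
     r^3. *)
  exists (Rmin (r / 2) (eps * r ^ 3 / 2))%R. split.
  { apply Rmin_pos. lra. apply Rdiv_lt_0_compat; try lra. apply Rmult_lt_0_compat; auto.
    now apply pow_lt. }
  intros h Hh. apply Rmin_Rgt_l in Hh. destruct Hh as [h1 h2].
  assert (P : (r / 2 <= Cmod (z + h))%R) by (pose proof (Cmod_add_ge z h); fold r in H; lra).
  assert (Hzh : z + h <> 0) by (apply Cmod_gt_0; lra).
  replace (/ (z + h) - / z - - / (z * z) * h) with (h * h / (z * z * (z + h))) by (field; auto).
  rewrite Cmod_div by (repeat apply Cmult_neq_0; auto).
  rewrite !Cmod_mult. fold r. pose proof (Cmod_ge_0 h).
  apply Rle_div_l. apply Rlt_gt. apply Rmult_lt_0_compat; nra.
  assert (Cmod h * Cmod h <= Cmod h * (eps * r ^ 3 / 2))%R by (apply Rmult_le_compat_l; lra).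
  apply Rle_trans with (1 := H0).
  apply Rle_trans with (eps * Cmod h * (r * r * (r / 2)))%R. right; field.
  apply Rmult_le_compat_l. nra. apply Rmult_le_compat_l; nra.
Qed.

Lemma cdiff_inv (f : C -> C) (z a : C) : f z <> 0 ->
  cdiff f z a -> cdiff (fun x => / f x) z (- a / (f z * f z)).
Proof.
  intros Hz Hf.
  generalize (cdiff_comp _ _ _ _ _ (cdiff_inv_id _ Hz) Hf).
  apply cdiff_ext_all; intros; auto. field; auto.
Qed.

Lemma cdiff_derive (f : C -> C) (z l : C) :
  cdiff f z l <-> is_derive (K := C_AbsRing) (V := C_NormedModule) f z l.
Proof.
  split.
  - intros H. split. apply is_linear_scal_l.
    intros x Hx. apply (is_filter_lim_locally_unique (V := AbsRing_NormedModule C_AbsRing)) in Hx. subst x. intros eps.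
    destruct (H eps (cond_pos eps)) as [d [Hd H']].
    exists (mkposreal d Hd). change (forall y : C, ball (M := AbsRing_UniformSpace C_AbsRing) z d y ->
      (Cmod (f y - f z - (y - z)%C * l) <= eps * Cmod (y - z))%R). intros y Hy.
    assert (Hy' : (Cmod (y - z) < d)%R) by exact Hy.
    specialize (H' _ Hy'). replace (z + (y - z)) with y in H' by ring.
    change (Cmod (f y - f z - (y - z)%C * l) <= eps * Cmod (y - z))%R.
    now rewrite (Cmult_comm _ l).
  - intros [_ H] eps He.
    destruct (H z (fun P H => H) (mkposreal eps He)) as [d H'].
    exists d. split. apply cond_pos. intros h Hh.
    specialize (H' (z + h)).
    assert (B : ball (M := AbsRing_UniformSpace C_AbsRing) z d (z + h)).
    { change (Cmod (z + h - z) < d)%R. now replace (z + h - z) with h by ring. }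
    specialize (H' B).
    change (Cmod (f (z + h)%C - f z - (z + h - z) * l) <= eps * Cmod (z + h - z))%R in H'.
    replace (z + h - z) with h in H' by ring. now rewrite (Cmult_comm l).
Qed.

Lemma cdiff_C_derive (f : C -> C) (z l : C) : cdiff f z l -> C_derive f z = l.
Proof. intros H. apply is_C_derive_unique. now apply cdiff_derive. Qed.

Lemma cdiff_pow (n : nat) (z : C) : exists l, cdiff (fun x => x ^ n) z l.
Proof.
  induction n as [|n [l IH]].
  - exists 0. exact (cdiff_const 1 z).
  - exists (1 * z ^ n + z * l). exact (cdiff_mult (fun x => x) (fun x => x ^ n) z 1 l (cdiff_id z) IH).
Qed.

(** * The complex exponential *)

Lemma Cexp_add (a b : C) : Cexp (a + b) = Cexp a * Cexp b.
Proof.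
  unfold Cexp, Cmult, Re, Im. simpl. rewrite exp_plus, cos_plus, sin_plus. apply injective_projections; simpl; ring.
Qed.

Lemma Cmod_Cexp (a : C) : Cmod (Cexp a) = exp (Re a).
Proof.
  unfold Cmod, Cexp. simpl.
  replace (exp (Re a) * cos (Im a) * (exp (Re a) * cos (Im a) * 1) +
    exp (Re a) * sin (Im a) * (exp (Re a) * sin (Im a) * 1))%R
    with (exp (Re a) * exp (Re a) * (Rsqr (sin (Im a)) + Rsqr (cos (Im a))))%R
    by (unfold Rsqr; ring).
  rewrite sin2_cos2, Rmult_1_r. apply sqrt_square. apply Rlt_le, exp_pos.
Qed.

Lemma Cexp_neq_0 (a : C) : Cexp a <> 0.
Proof. apply Cmod_gt_0. rewrite Cmod_Cexp. apply exp_pos. Qed.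

Lemma Cexp_0 : Cexp 0 = 1.
Proof. unfold Cexp. simpl. rewrite exp_0, cos_0, sin_0. unfold RtoC. f_equal; ring. Qed.

Lemma Cexp_opp (a : C) : Cexp (- a) = / Cexp a.
Proof.
  assert (H : Cexp (- a) * Cexp a = 1).
  { rewrite <- Cexp_add. replace (- a + a) with (RtoC 0) by ring. apply Cexp_0. }
  replace (Cexp (- a)) with (Cexp (- a) * Cexp a / Cexp a) by (field; apply Cexp_neq_0).
  rewrite H. unfold Cdiv. ring.
Qed.

Lemma Cexp_R (r : R) : Cexp (RtoC r) = RtoC (exp r).
Proof. unfold Cexp. simpl. rewrite cos_0, sin_0. unfold RtoC. f_equal; ring. Qed.

Lemma Cmod_le_sum (z : C) : (Cmod z <= Rabs (Re z) + Rabs (Im z))%R.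
Proof.
  replace z with (RtoC (Re z) + Ci * RtoC (Im z)) at 1.
  2: destruct z; unfold RtoC, Ci, Cplus, Cmult; simpl; f_equal; ring.
  eapply Rle_trans. apply Cmod_triangle. rewrite Cmod_mult, Cmod_Ci, !Cmod_R. lra.
Qed.

Lemma Im_le_Cmod (c : C) : (Rabs (Im c) <= Cmod c)%R.
Proof. eapply Rle_trans. 2: apply Rmax_Cmod. apply Rmax_r. Qed.

Lemma derive_eps (f : R -> R) (x l eps : R) : is_derive f x l -> (0 < eps)%R ->
  exists d : R, (0 < d)%R /\ forall h, (Rabs h < d)%R ->
    (Rabs (f (x + h) - f x - l * h) <= eps * Rabs h)%R.
Proof.
  intros [_ H] He. destruct (H x (fun P H => H) (mkposreal eps He)) as [d H'].
  exists d. split. apply cond_pos. intros h Hh. specialize (H' (x + h)%R).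
  assert (B : ball (M := R_UniformSpace) x d (x + h)%R).
  { change (Rabs (x + h - x) < d)%R. now replace (x + h - x)%R with h by ring. }
  specialize (H' B).
  change (Rabs (f (x + h) - f x - (x + h - x) * l) <= eps * Rabs (x + h - x))%R in H'.
  replace (x + h - x)%R with h in H' by ring. now rewrite (Rmult_comm l).
Qed.

Lemma cdiff_Cexp_0 : cdiff Cexp 0 1.
Proof.
  intros eps He.
  destruct (derive_eps exp 0 1 (Rmin (eps / 8) 1)%R) as [d1 [Hd1 H1]].
  { auto_derive; auto. rewrite exp_0. ring. } { apply Rmin_pos; lra. }
  destruct (derive_eps cos 0 0 (Rmin (eps / 8) 1)%R) as [d2 [Hd2 H2]].
  { auto_derive; auto. rewrite sin_0. ring. } { apply Rmin_pos; lra. }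
  destruct (derive_eps sin 0 1 (Rmin (eps / 8) 1)%R) as [d3 [Hd3 H3]].
  { auto_derive; auto. rewrite cos_0. ring. } { apply Rmin_pos; lra. }
  exists (Rmin (Rmin d1 (Rmin d2 d3)) (Rmin 1 (eps / 16)))%R. split.
  repeat apply Rmin_pos; lra.
  intros h Hh.
  apply Rmin_Rgt_l in Hh. destruct Hh as [Hh Hh'].
  apply Rmin_Rgt_l in Hh. destruct Hh as [h1 Hh]. apply Rmin_Rgt_l in Hh. destruct Hh as [h2 h3].
  apply Rmin_Rgt_l in Hh'. destruct Hh' as [h4 h5].
  replace (0 + h) with h by ring. rewrite Cexp_0.
  destruct h as [a b]. set (m := Cmod (a, b)) in *.
  pose proof (re_le_Cmod (a, b)) as Ra. pose proof (Im_le_Cmod (a, b)) as Rb. simpl in Ra, Rb. fold m in Ra, Rb.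
  specialize (H1 a ltac:(lra)). specialize (H2 b ltac:(lra)). specialize (H3 b ltac:(lra)).
  rewrite Rplus_0_l in H1, H2, H3. rewrite exp_0 in H1. rewrite cos_0 in H2. rewrite sin_0 in H3.
  set (e := Rmin (eps / 8) 1) in *.
  assert (e1 : (e <= eps / 8)%R) by apply Rmin_l. assert (e2 : (e <= 1)%R) by apply Rmin_r.
  assert (e0 : (0 < e)%R) by (apply Rmin_pos; lra).
  set (E := (exp a - 1 - 1 * a)%R) in *. set (Cc := (cos b - 1 - 0 * b)%R) in *.
  set (Ss := (sin b - 0 - 1 * b)%R) in *.
  assert (M0 : (0 <= m)%R) by apply Cmod_ge_0.
  eapply Rle_trans. apply Cmod_le_sum.
  unfold Cexp. simpl.
  (* With e^a = 1 + a + E, cos b = 1 + Cc and sin b = b + Ss, what is left over is E, Cc or Ss times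
     a bounded factor, and the quadratic product (a + E) b. *)
  replace (exp a * cos b + - (1) + - (1 * a - 0 * b))%R
    with (E + (1 + a + E) * Cc)%R by (unfold E, Cc; ring).
  replace (exp a * sin b + - 0 + - (1 * b + 0 * a))%R
    with ((a + E) * b + (1 + a + E) * Ss)%R by (unfold E, Ss; ring).
  assert (B1 : (Rabs E <= e * m)%R) by (eapply Rle_trans; [apply H1|]; nra).
  assert (B2 : (Rabs Cc <= e * m)%R) by (eapply Rle_trans; [apply H2|]; nra).
  assert (B3 : (Rabs Ss <= e * m)%R) by (eapply Rle_trans; [apply H3|]; nra).
  assert (B4 : (Rabs (1 + a + E) <= 3)%R).
  { eapply Rle_trans. apply Rabs_triang. pose proof (Rabs_triang 1 a).
    rewrite Rabs_R1 in H. nra. }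
  assert (B5 : (Rabs (a + E) <= 2 * m)%R).
  { eapply Rle_trans. apply Rabs_triang. nra. }
  assert (C1 : (Rabs (E + (1 + a + E) * Cc) <= 4 * (e * m))%R).
  { eapply Rle_trans. apply Rabs_triang. rewrite Rabs_mult.
    pose proof (Rmult_le_compat _ _ _ _ (Rabs_pos _) (Rabs_pos _) B4 B2). lra. }
  assert (C2' : (Rabs ((a + E) * b + (1 + a + E) * Ss) <= 2 * m * m + 3 * (e * m))%R).
  { eapply Rle_trans. apply Rabs_triang. rewrite !Rabs_mult.
    pose proof (Rmult_le_compat _ _ _ _ (Rabs_pos _) (Rabs_pos _) B4 B3).
    pose proof (Rmult_le_compat _ _ _ _ (Rabs_pos _) (Rabs_pos _) B5 Rb). lra. }
  assert (e * m <= eps / 8 * m)%R by (apply Rmult_le_compat_r; auto).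
  assert (m * m <= eps / 16 * m)%R by (apply Rmult_le_compat_r; lra).
  lra.
Qed.

Lemma cdiff_Cexp (z : C) : cdiff Cexp z (Cexp z).
Proof.
  assert (H : cdiff (fun x => Cexp z * Cexp (x - z)) z (Cexp z * (1 * (1 - 0)))).
  { apply cdiff_scal. apply (cdiff_comp Cexp (fun x => x - z)).
    replace (z - z) with (RtoC 0) by ring. apply cdiff_Cexp_0.
    apply cdiff_minus. apply cdiff_id. apply cdiff_const. }
  revert H. apply cdiff_ext_all. intros x. rewrite <- Cexp_add. f_equal. ring. ring.
Qed.

Lemma cdiff_Cexp_comp (f : C -> C) (z l : C) :
  cdiff f z l -> cdiff (fun x => Cexp (f x)) z (Cexp (f z) * l).
Proof. intros H. apply (cdiff_comp Cexp f). apply cdiff_Cexp. exact H. Qed.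

(** * Partial derivatives, and the link with Frechet differentiability *)

Lemma hdiff_fst (f : C2 -> C) (z y a b : C) :
  hdiff f (z, y) a b -> cdiff (fun x => f (x, y)) z a.
Proof.
  intros H.
  generalize (hdiff_comp f (fun x => x) (fun _ => y) z 1 0 a b H (cdiff_id z) (cdiff_const y z)).
  apply cdiff_ext_all; auto. ring.
Qed.

Lemma hdiff_snd (f : C2 -> C) (z y a b : C) :
  hdiff f (z, y) a b -> cdiff (fun x => f (z, x)) y b.
Proof.
  intros H.
  generalize (hdiff_comp f (fun _ => z) (fun x => x) y 0 1 a b H (cdiff_const z y) (cdiff_id y)).
  apply cdiff_ext_all; auto. ring.
Qed.

Lemma hdiff_dz (f : C2 -> C) (p : C2) (a b : C) : hdiff f p a b -> dz f p = a.
Proof. destruct p as [z y]. intros H. apply cdiff_C_derive. exact (hdiff_fst _ _ _ _ _ H). Qed.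

Lemma hdiff_dy (f : C2 -> C) (p : C2) (a b : C) : hdiff f p a b -> dy f p = b.
Proof. destruct p as [z y]. intros H. apply cdiff_C_derive. exact (hdiff_snd _ _ _ _ _ H). Qed.

Lemma ball_C_add (z w : C) (d : R) :
  (Cmod w < d)%R -> ball (M := C_UniformSpace) z d (z + w).
Proof.
  intros Hw. split.
  - change (Rabs (Re (z + w) - Re z) < d)%R.
    replace (Re (z + w) - Re z)%R with (Re w) by (unfold Re; simpl; ring).
    eapply Rle_lt_trans. apply re_le_Cmod. auto.
  - change (Rabs (Im (z + w) - Im z) < d)%R.
    replace (Im (z + w) - Im z)%R with (Im w) by (unfold Im; simpl; ring).
    eapply Rle_lt_trans. apply Im_le_Cmod. auto.
Qed.

Lemma C2_norm_le (u : C2) :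
  (norm (K := C_AbsRing) (V := C2_NormedModule) u <= Cmod (fst u) + Cmod (snd u))%R.
Proof.
  destruct u as [a b]. change (sqrt (Cmod a ^ 2 + Cmod b ^ 2) <= Cmod a + Cmod b)%R.
  pose proof (Cmod_ge_0 a). pose proof (Cmod_ge_0 b).
  rewrite <- (sqrt_square (Cmod a + Cmod b)) by lra. apply sqrt_le_1_alt. nra.
Qed.

Lemma C2_norm_ge (u : C2) :
  (Cmod (fst u) <= norm (K := C_AbsRing) (V := C2_NormedModule) u)%R /\
  (Cmod (snd u) <= norm (K := C_AbsRing) (V := C2_NormedModule) u)%R.
Proof.
  destruct u as [a b]. change (norm (K := C_AbsRing) (V := C2_NormedModule) (a, b))
    with (sqrt (Cmod a ^ 2 + Cmod b ^ 2)).
  pose proof (Cmod_ge_0 a). pose proof (Cmod_ge_0 b). simpl.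
  split.
  - rewrite <- (sqrt_square (Cmod a)) at 1 by lra. apply sqrt_le_1_alt. nra.
  - rewrite <- (sqrt_square (Cmod b)) at 1 by lra. apply sqrt_le_1_alt. nra.
Qed.

(** By C-linearity, the four partial derivatives are the components of the values of the
    differential on the two basis vectors. *)
Lemma holo_hdiff (f : C2 -> C2) (p : C2) : holo_at f p ->
  exists a b c d : C, hdiff (fun q => fst (f q)) p a b /\ hdiff (fun q => snd (f q)) p c d.
Proof.
  intros [l [Hl H]].
  specialize (H p (fun P H => H)).
  exists (fst (l (RtoC 1, RtoC 0))), (fst (l (RtoC 0, RtoC 1))),
    (snd (l (RtoC 1, RtoC 0))), (snd (l (RtoC 0, RtoC 1))).
  assert (L : forall h k : C, l (h, k) =
    (fst (l (RtoC 1, RtoC 0)) * h + fst (l (RtoC 0, RtoC 1)) * k,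
     snd (l (RtoC 1, RtoC 0)) * h + snd (l (RtoC 0, RtoC 1)) * k)).
  { intros h k. destruct Hl as [La Ls _].
    replace (h, k) with (plus (G := prod_AbelianGroup C_AbelianGroup C_AbelianGroup)
       (scal (K := C_AbsRing) (V := C2_NormedModule) h (RtoC 1, RtoC 0))
       (scal (K := C_AbsRing) (V := C2_NormedModule) k (RtoC 0, RtoC 1))).
    2: { change ((h * 1 + k * 0, h * 0 + k * 1) = (h, k)). f_equal; ring. }
    etransitivity. apply La. rewrite (Ls h), (Ls k).
    destruct (l (RtoC 1, RtoC 0)) as [a c]. destruct (l (RtoC 0, RtoC 1)) as [b d].
    change ((h * a + k * b, h * c + k * d) = (a * h + b * k, c * h + d * k)). f_equal; ring. }
  assert (M : forall eps : R, (0 < eps)%R -> exists d : R, (0 < d)%R /\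
    forall h k : C, (Cmod h < d)%R -> (Cmod k < d)%R ->
    (norm (K := C_AbsRing) (V := C2_NormedModule)
      (fst (f (fst p + h, snd p + k)) - fst (f p) - fst (l (h, k)),
       snd (f (fst p + h, snd p + k)) - snd (f p) - snd (l (h, k)))%C
     <= eps * (Cmod h + Cmod k))%R).
  { intros eps He. destruct (H (mkposreal eps He)) as [d H']. exists d. split. apply cond_pos.
    intros h k Hh Hk. specialize (H' (fst p + h, snd p + k)).
    assert (B : ball (M := C2_NormedModule) p d (fst p + h, snd p + k)).
    { split; apply ball_C_add; auto. }
    specialize (H' B).
    assert (E : minus (G := C2_NormedModule) (fst p + h, snd p + k) p = (h, k)).
    { destruct p as [z y]. unfold minus. cbn. unfold prod_plus, prod_opp. cbn. f_equal; ring. }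
    rewrite E in H'.
    simpl in H'.
    pose proof (Rmult_le_compat_l eps _ _ (Rlt_le _ _ He) (C2_norm_le (h, k))) as T.
    simpl in T. pose proof (Rle_trans _ _ _ H' T) as T'. clear - T'.
    destruct (f p) as [u v], (l (h, k)) as [m n], (f (fst p + h, snd p + k)) as [s t].
    exact T'. }
  split; intros eps He; destruct (M eps He) as [d [Hd M']]; exists d; split; auto;
    intros h k Hh Hk; specialize (M' h k Hh Hk); rewrite L in M'; simpl in M';
    refine (Rle_trans _ _ _ _ M').
  exact (proj1 (C2_norm_ge (_, _))). exact (proj2 (C2_norm_ge (_, _))).
Qed.

(** Balls of the uniform structure of C are squares in the real and imaginary parts; the loss of a
    factor 2 makes them comparable with discs. *)
Lemma locally_C2 (P : C2 -> Prop) (p : C2) :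
  locally (T := prod_UniformSpace C_UniformSpace C_UniformSpace) p P <->
  exists d : R, (0 < d)%R /\ forall h k : C, (Cmod h < d)%R -> (Cmod k < d)%R ->
    P (fst p + h, snd p + k).
Proof.
  split.
  - intros [d H]. exists d. split. apply cond_pos. intros h k Hh Hk. apply H.
    split; apply ball_C_add; auto.
  - intros [d [Hd H]]. assert (Hd2 : (0 < d / 2)%R) by lra. exists (mkposreal _ Hd2).
    intros [z y] [[B1 B2] [B3 B4]].
    assert (A : forall u v : C, ball (M := R_UniformSpace) (fst u) (d / 2) (fst v) ->
       ball (M := R_UniformSpace) (snd u) (d / 2) (snd v) -> (Cmod (v - u) < d)%R).
    { intros u v X Y. change (Rabs (Re v - Re u) < d / 2)%R in X.
      change (Rabs (Im v - Im u) < d / 2)%R in Y.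
      eapply Rle_lt_trans. apply Cmod_le_sum.
      replace (Re (v - u)) with (Re v - Re u)%R by (unfold Re; simpl; ring).
      replace (Im (v - u)) with (Im v - Im u)%R by (unfold Im; simpl; ring). lra. }
    replace z with (fst p + (z - fst p)) by ring. replace y with (snd p + (y - snd p)) by ring.
    apply H; apply A; auto.
Qed.

(** * Goursat's theorem and Cauchy's estimate *)

Notation CInt := (RInt (V := C_R_CompleteNormedModule)).

Definition hor (f : C -> C) (y a b : R) : C := CInt (fun x => f (x, y)) a b.
Definition ver (f : C -> C) (x c d : R) : C := CInt (fun y => f (x, y)) c d.
(** The integral of f(z) dz along the positively oriented boundary of [a, b] x [c, d]; the factor
    [Ci] comes from dz on the vertical sides. *)
Definition rect (f : C -> C) (a b c d : R) : C :=
  hor f c a b - hor f d a b + Ci * (ver f b c d - ver f a c d).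

Lemma continuous_of_bound (f : R -> C) (x : R) (K d : R) : (0 < d)%R ->
  (forall h : R, (Rabs h < d)%R -> (Cmod (f (x + h)%R - f x) <= K * Rabs h)%R) ->
  continuous (U := C_R_NormedModule) f x.
Proof.
  intros Hd H. apply filterlim_locally. intros eps.
  set (K' := (Rabs K + 1)%R).
  assert (HK : (0 < K')%R) by (unfold K'; pose proof (Rabs_pos K); lra).
  assert (He : (0 < Rmin d (eps / K'))%R).
  { apply Rmin_pos; auto. apply Rdiv_lt_0_compat; auto. apply cond_pos. }
  exists (mkposreal _ He).
  change (forall t : R, ball (M := R_UniformSpace) x (Rmin d (eps / K')) t ->
    ball (M := C_UniformSpace) (f x) eps (f t)). intros t Ht.
  change (Rabs (t - x) < Rmin d (eps / K'))%R in Ht.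
  apply Rmin_Rgt_l in Ht. destruct Ht as [H1 H2].
  specialize (H (t - x)%R H1). replace (x + (t - x))%R with t in H by ring.
  replace (f t) with (f x + (f t - f x)) by ring. apply ball_C_add.
  apply Rle_lt_trans with (1 := H).
  apply Rle_lt_trans with (K' * Rabs (t - x))%R.
  apply Rmult_le_compat_r. apply Rabs_pos. unfold K'. pose proof (Rle_abs K). lra.
  apply Rmult_lt_reg_r with (/ K')%R. now apply Rinv_0_lt_compat.
  replace (K' * Rabs (t - x) * / K')%R with (Rabs (t - x)) by (field; lra). exact H2.
Qed.

Lemma cdiff_continuous_h (f : C -> C) (x y : R) (l : C) : cdiff f (x, y) l ->
  continuous (U := C_R_NormedModule) (fun t => f (t, y)) x.
Proof.
  intros H. destruct (cdiff_cont _ _ _ H) as [d [Hd H']].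
  apply (continuous_of_bound _ _ (Cmod l + 1) d Hd). intros h Hh.
  specialize (H' (RtoC h)). rewrite Cmod_R in H'.
  replace ((x, y) + RtoC h) with ((x + h)%R, y) in H'. now apply H'.
  apply injective_projections; simpl; ring.
Qed.

Lemma cdiff_continuous_v (f : C -> C) (x y : R) (l : C) : cdiff f (x, y) l ->
  continuous (U := C_R_NormedModule) (fun t => f (x, t)) y.
Proof.
  intros H. destruct (cdiff_cont _ _ _ H) as [d [Hd H']].
  apply (continuous_of_bound _ _ (Cmod l + 1) d Hd). intros h Hh.
  specialize (H' (Ci * RtoC h)). rewrite Cmod_mult, Cmod_Ci, Rmult_1_l, Cmod_R in H'.
  replace ((x, y) + Ci * RtoC h) with (x, (y + h)%R) in H'. now apply H'.
  apply injective_projections; simpl; ring.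
Qed.

Lemma ex_RInt_h (f : C -> C) (y a b : R) : (a <= b)%R ->
  (forall x, (a <= x <= b)%R -> exists l, cdiff f (x, y) l) ->
  ex_RInt (V := C_R_CompleteNormedModule) (fun x => f (x, y)) a b.
Proof.
  intros Hab H. apply ex_RInt_continuous. rewrite Rmin_left, Rmax_right by auto.
  intros x Hx. destruct (H x Hx) as [l Hl]. exact (cdiff_continuous_h _ _ _ _ Hl).
Qed.

Lemma ex_RInt_v (f : C -> C) (x c d : R) : (c <= d)%R ->
  (forall y, (c <= y <= d)%R -> exists l, cdiff f (x, y) l) ->
  ex_RInt (V := C_R_CompleteNormedModule) (fun y => f (x, y)) c d.
Proof.
  intros Hab H. apply ex_RInt_continuous. rewrite Rmin_left, Rmax_right by auto.
  intros y Hy. destruct (H y Hy) as [l Hl]. exact (cdiff_continuous_v _ _ _ _ Hl).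
Qed.

Lemma CInt_dist_const (f : R -> C) (a b : R) (k : C) (M : R) : (a <= b)%R ->
  ex_RInt (V := C_R_CompleteNormedModule) f a b ->
  (forall x, (a <= x <= b)%R -> (Cmod (f x - k) <= M)%R) ->
  (Cmod (CInt f a b - RtoC (b - a) * k) <= (b - a) * M)%R.
Proof.
  intros Hab Hf HM.
  assert (I : is_RInt (V := C_R_CompleteNormedModule) (fun x => minus (f x) k) a b
     (minus (CInt f a b) (scal (b - a)%R (k : C_R_CompleteNormedModule)))).
  { apply (is_RInt_minus (V := C_R_NormedModule)). now apply (RInt_correct (V := C_R_CompleteNormedModule)).
    apply (is_RInt_const (V := C_R_NormedModule)). }
  assert (N : (norm (minus (CInt f a b) (scal (b - a)%R (k : C_R_CompleteNormedModule)))
     <= (b - a) * M)%R).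
  { apply (norm_RInt_le_const (V := C_R_NormedModule) (fun x => minus (f x) k) a b); auto.
    intros x Hx. rewrite <- Cmod_norm. now apply HM. }
  rewrite <- Cmod_norm in N.
  replace (RtoC (b - a) * k) with (scal (b - a)%R (k : C_R_NormedModule)). exact N.
  destruct k as [k1 k2]. apply injective_projections;
  simpl; unfold scal; simpl; unfold mult; simpl; ring.
Qed.

Lemma rect_split (f : C -> C) (a m b c n d : R) :
  (a <= m <= b)%R -> (c <= n <= d)%R ->
  (forall x y, (a <= x <= b)%R -> (c <= y <= d)%R -> exists l, cdiff f (x, y) l) ->
  rect f a b c d = rect f a m c n + rect f m b c n + rect f a m n d + rect f m b n d.
Proof.
  intros Hm Hn H.
  assert (EH : forall y, (c <= y <= d)%R -> hor f y a b = hor f y a m + hor f y m b).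
  { intros y Hy. symmetry. apply (RInt_Chasles (V := C_R_CompleteNormedModule)); apply ex_RInt_h; try lra;
    intros x Hx; apply H; lra. }
  assert (EV : forall x, (a <= x <= b)%R -> ver f x c d = ver f x c n + ver f x n d).
  { intros x Hx. symmetry. apply (RInt_Chasles (V := C_R_CompleteNormedModule)); apply ex_RInt_v; try lra;
    intros y Hy; apply H; lra. }
  unfold rect.
  rewrite (EH c), (EH d), (EV a), (EV b) by lra. ring.
Qed.

(** The affine part contributes [- Ci * h * w * l] on the horizontal sides and its opposite on the
    vertical ones. The remainder is at most [e * (w + h)] on a boundary of length [2 * (w + h)]. *)
Lemma rect_affine_bound (f : C -> C) (a c w h : R) (z l : C) (e : R) :
  (0 <= w)%R -> (0 <= h)%R ->
  (a <= Re z <= a + w)%R -> (c <= Im z <= c + h)%R -> (0 <= e)%R ->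
  (forall x y, (a <= x <= a + w)%R -> (c <= y <= c + h)%R -> exists l, cdiff f (x, y) l) ->
  (forall x y, (a <= x <= a + w)%R -> (c <= y <= c + h)%R ->
     (Cmod (f (x, y) - f z - l * ((x, y) - z)) <= e * Cmod ((x, y) - z))%R) ->
  (Cmod (rect f a (a + w) c (c + h)) <= 2 * e * (w + h) ^ 2)%R.
Proof.
  intros Hw Hh Hz1 Hz2 He Hd H.
  assert (D : forall x y, (a <= x <= a + w)%R -> (c <= y <= c + h)%R ->
     (Cmod (f (x, y) - f z - l * ((x, y) - z)) <= e * (w + h))%R).
  { intros x y Hx Hy. eapply Rle_trans. apply H; auto. apply Rmult_le_compat_l; auto.
    eapply Rle_trans. apply Cmod_le_sum. unfold Re, Im in *. simpl.
    apply Rplus_le_compat; apply Rabs_le; lra. }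
  assert (DD : forall u v : C, f u - f v - l * (u - v) =
     (f u - f z - l * (u - z)) - (f v - f z - l * (v - z))) by (intros; ring).
  assert (B1 : (Cmod (hor f c a (a + w) - hor f (c + h) a (a + w)
     - RtoC w * (l * (- Ci * RtoC h))) <= w * (2 * e * (w + h)))%R).
  { assert (I1 : ex_RInt (V := C_R_CompleteNormedModule) (fun x => f (x, c)) a (a + w)%R)
      by (apply ex_RInt_h; [lra | intros; apply Hd; lra]).
    assert (I2 : ex_RInt (V := C_R_CompleteNormedModule) (fun x => f (x, (c + h)%R)) a (a + w)%R)
      by (apply ex_RInt_h; [lra | intros; apply Hd; lra]).
    assert (E : hor f c a (a + w) - hor f (c + h) a (a + w) =
      CInt (fun x => f (x, c) - f (x, (c + h)%R)) a (a + w)).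
    { symmetry. exact (RInt_minus (V := C_R_CompleteNormedModule) _ _ _ _ I1 I2). }
    rewrite E.
    assert (Ew : (a + w - a)%R = w) by ring.
    rewrite <- Ew at 2 3. apply CInt_dist_const. lra.
    exact (ex_RInt_minus (V := C_R_CompleteNormedModule) _ _ _ _ I1 I2).
    intros x Hx.
    replace (- Ci * RtoC h) with ((x, c) - (x, (c + h)%R))
      by (apply injective_projections; simpl; ring).
    rewrite DD. eapply Rle_trans. apply Cmod_sub_le.
    pose proof (D x c). pose proof (D x (c + h)%R). lra. }
  assert (B2 : (Cmod (ver f (a + w) c (c + h) - ver f a c (c + h)
     - RtoC h * (l * RtoC w)) <= h * (2 * e * (w + h)))%R).
  { assert (I1 : ex_RInt (V := C_R_CompleteNormedModule) (fun y => f ((a + w)%R, y)) c (c + h)%R)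
      by (apply ex_RInt_v; [lra | intros; apply Hd; lra]).
    assert (I2 : ex_RInt (V := C_R_CompleteNormedModule) (fun y => f (a, y)) c (c + h)%R)
      by (apply ex_RInt_v; [lra | intros; apply Hd; lra]).
    assert (E : ver f (a + w) c (c + h) - ver f a c (c + h) =
      CInt (fun y => f ((a + w)%R, y) - f (a, y)) c (c + h)).
    { symmetry. exact (RInt_minus (V := C_R_CompleteNormedModule) _ _ _ _ I1 I2). }
    rewrite E.
    assert (Ew : (c + h - c)%R = h) by ring.
    rewrite <- Ew at 2 3. apply CInt_dist_const. lra.
    exact (ex_RInt_minus (V := C_R_CompleteNormedModule) _ _ _ _ I1 I2).
    intros y Hy.
    replace (RtoC w) with (((a + w)%R, y) - (a, y))
      by (apply injective_projections; simpl; ring).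
    rewrite DD. eapply Rle_trans. apply Cmod_sub_le.
    pose proof (D a y). pose proof (D (a + w)%R y). lra. }
  unfold rect.
  match goal with |- (Cmod (?A + Ci * ?B) <= _)%R =>
    replace (A + Ci * B) with
     ((A - RtoC w * (l * (- Ci * RtoC h))) + Ci * (B - RtoC h * (l * RtoC w))) by ring end.
  eapply Rle_trans. apply Cmod_triangle. rewrite Cmod_mult, Cmod_Ci, Rmult_1_l.
  nra.
Qed.

Lemma pow_half_small (K eps : R) : (0 <= K)%R -> (0 < eps)%R ->
  exists n : nat, (K * (/ 2) ^ n < eps)%R.
Proof.
  intros HK He. destruct (pow_lt_1_zero (/ 2) ltac:(rewrite Rabs_pos_eq; lra) (eps / (K + 1))%R) as [n Hn].
  apply Rdiv_lt_0_compat; lra.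
  exists n. specialize (Hn n (le_n n)). rewrite Rabs_pos_eq in Hn by (apply pow_le; lra).
  assert ((/ 2) ^ n * (K + 1) < eps)%R.
  { apply Rmult_lt_reg_r with (/ (K + 1))%R. apply Rinv_0_lt_compat; lra.
    replace ((/ 2) ^ n * (K + 1) * / (K + 1))%R with ((/ 2) ^ n)%R by (field; lra). exact Hn. }
  assert (0 <= (/ 2) ^ n)%R by (apply pow_le; lra). nra.
Qed.

(** Bisection: one of the four quarters carries at least a quarter of the modulus of the integral.
    The nested rectangles shrink to a point, where differentiability and [rect_affine_bound]
    contradict the lower bound [e0 * (/ 4) ^ n]. *)
Lemma goursat (f : C -> C) (a c w h : R) : (0 <= w)%R -> (0 <= h)%R ->
  (forall x y, (a <= x <= a + w)%R -> (c <= y <= c + h)%R -> exists l, cdiff f (x, y) l) ->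
  rect f a (a + w) c (c + h) = 0.
Proof.
  intros Hw Hh Hd. apply Cmod_eq_0. apply NNPP. intros Hne.
  set (e0 := Cmod (rect f a (a + w) c (c + h))) in *.
  assert (He0 : (0 < e0)%R) by (pose proof (Cmod_ge_0 (rect f a (a + w) c (c + h))); fold e0 in H; lra).
  set (bad := fun (n : nat) (p : R * R) =>
    ((a <= fst p /\ fst p + w * (/ 2) ^ n <= a + w) /\
     (c <= snd p /\ snd p + h * (/ 2) ^ n <= c + h) /\
     e0 * (/ 4) ^ n <= Cmod (rect f (fst p) (fst p + w * (/ 2) ^ n) (snd p) (snd p + h * (/ 2) ^ n)))%R).
  assert (pow_pos : forall n, (0 < (/ 2) ^ n)%R) by (intros; apply pow_lt; lra).
  assert (step : forall n p, exists p' : R * R, bad n p ->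
     bad (S n) p' /\
     (fst p <= fst p' /\ fst p' + w * (/ 2) ^ S n <= fst p + w * (/ 2) ^ n)%R /\
     (snd p <= snd p' /\ snd p' + h * (/ 2) ^ S n <= snd p + h * (/ 2) ^ n)%R).
  { intros n [x y]. destruct (classic (bad n (x, y))) as [B|B].
    2: { exists (x, y). intros; contradiction. }
    destruct B as [[B1 B2] [[B3 B4] B5]]. simpl in B1, B2, B3, B4, B5.
    set (w' := (w * (/ 2) ^ n)%R) in *. set (h' := (h * (/ 2) ^ n)%R) in *.
    assert (W0 : (0 <= w')%R) by (unfold w'; apply Rmult_le_pos; auto; apply Rlt_le, pow_pos).
    assert (H0 : (0 <= h')%R) by (unfold h'; apply Rmult_le_pos; auto; apply Rlt_le, pow_pos).
    assert (W1 : (w * (/ 2) ^ S n = w' / 2)%R) by (unfold w'; simpl; field).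
    assert (H1 : (h * (/ 2) ^ S n = h' / 2)%R) by (unfold h'; simpl; field).
    assert (Hs : rect f x (x + w') y (y + h') =
      rect f x (x + w' / 2) y (y + h' / 2) + rect f (x + w' / 2) (x + w' / 2 + w' / 2) y (y + h' / 2)
      + rect f x (x + w' / 2) (y + h' / 2) (y + h' / 2 + h' / 2)
      + rect f (x + w' / 2) (x + w' / 2 + w' / 2) (y + h' / 2) (y + h' / 2 + h' / 2)).
    { rewrite (rect_split f x (x + w' / 2) (x + w') y (y + h' / 2) (y + h')); try lra.
      replace (x + w' / 2 + w' / 2)%R with (x + w')%R by field.
      replace (y + h' / 2 + h' / 2)%R with (y + h')%R by field. reflexivity.
      intros; apply Hd; lra. }
    set (R1 := rect f x (x + w' / 2) y (y + h' / 2)) in *.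
    set (R2 := rect f (x + w' / 2) (x + w' / 2 + w' / 2) y (y + h' / 2)) in *.
    set (R3 := rect f x (x + w' / 2) (y + h' / 2) (y + h' / 2 + h' / 2)) in *.
    set (R4 := rect f (x + w' / 2) (x + w' / 2 + w' / 2) (y + h' / 2) (y + h' / 2 + h' / 2)) in *.
    assert (T : (e0 * (/ 4) ^ n <= Cmod R1 + Cmod R2 + Cmod R3 + Cmod R4)%R).
    { rewrite Hs in B5. eapply Rle_trans. apply B5.
      eapply Rle_trans. apply Cmod_triangle. apply Rplus_le_compat_r.
      eapply Rle_trans. apply Cmod_triangle. apply Rplus_le_compat_r. apply Cmod_triangle. }
    assert (Q : (e0 * (/ 4) ^ S n = e0 * (/ 4) ^ n / 4)%R) by (simpl; field).
    unfold bad. rewrite W1, H1, Q.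
    destruct (Rle_dec (e0 * (/ 4) ^ n / 4) (Cmod R1)) as [L|L1].
    { exists (x, y). intros _. simpl. repeat split; try lra. exact L. }
    destruct (Rle_dec (e0 * (/ 4) ^ n / 4) (Cmod R2)) as [L|L2].
    { exists ((x + w' / 2)%R, y). intros _. simpl. repeat split; try lra. exact L. }
    destruct (Rle_dec (e0 * (/ 4) ^ n / 4) (Cmod R3)) as [L|L3].
    { exists (x, (y + h' / 2)%R). intros _. simpl. repeat split; try lra. exact L. }
    exists ((x + w' / 2)%R, (y + h' / 2)%R). intros _. simpl. repeat split; try lra.
    fold R4. lra. }
  set (next := fun n p => proj1_sig (constructive_indefinite_description _ (step n p))).
  set (u := fix u (n : nat) : R * R := match n with O => (a, c) | S m => next m (u m) end).
  assert (Hu : forall n, bad n (u n)).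
  { induction n.
    - unfold bad. simpl. rewrite !Rmult_1_r. fold e0. repeat split; lra.
    - simpl. unfold next. destruct (constructive_indefinite_description _ _) as [p' Hp']. simpl.
      now apply Hp'. }
  assert (Hn : forall n, (fst (u n) <= fst (u (S n)) /\ fst (u (S n)) + w * (/ 2) ^ S n <= fst (u n) + w * (/ 2) ^ n)%R /\
     (snd (u n) <= snd (u (S n)) /\ snd (u (S n)) + h * (/ 2) ^ S n <= snd (u n) + h * (/ 2) ^ n)%R).
  { intros n. specialize (Hu n). simpl u. unfold next.
    destruct (constructive_indefinite_description _ _) as [p' Hp']. simpl.
    now apply Hp'. }
  assert (lim : forall (v : nat -> R) (l : R), (0 <= l)%R ->
     (forall n, v n <= v (S n) /\ v (S n) + l * (/ 2) ^ S n <= v n + l * (/ 2) ^ n)%R ->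
     exists x, forall n, (v n <= x <= v n + l * (/ 2) ^ n)%R).
  { intros v l Hl Hv.
    assert (M1 : forall n k, (v n <= v (n + k)%nat)%R).
    { intros n k. induction k. rewrite Nat.add_0_r; lra. rewrite Nat.add_succ_r.
      destruct (Hv (n + k)%nat). lra. }
    assert (M2 : forall n k, (v (n + k)%nat + l * (/ 2) ^ (n + k) <= v n + l * (/ 2) ^ n)%R).
    { intros n k. induction k. rewrite Nat.add_0_r; lra. rewrite Nat.add_succ_r.
      destruct (Hv (n + k)%nat). lra. }
    assert (M3 : forall n m, (v m <= v n + l * (/ 2) ^ n)%R).
    { intros n m. assert (P := Rmult_le_pos l _ Hl (Rlt_le _ _ (pow_pos n))).
      destruct (Nat.le_gt_cases m n).
      - pose proof (M1 m (n - m)%nat). replace (m + (n - m))%nat with n in H0 by lia. lra.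
      - pose proof (M2 n (m - n)%nat). replace (n + (m - n))%nat with m in H0 by lia.
        assert (P' := Rmult_le_pos l _ Hl (Rlt_le _ _ (pow_pos m))). lra. }
    destruct (completeness (fun x => exists n, x = v n)) as [x [X1 X2]].
    - exists (v O + l * (/ 2) ^ O)%R. intros y [n ->]. apply M3.
    - exists (v O). now exists O.
    - exists x. intros n. split. apply X1. now exists n. apply X2. intros y [m ->]. apply M3. }
  destruct (lim (fun n => fst (u n)) w Hw ltac:(intros n; apply Hn)) as [x Hx].
  destruct (lim (fun n => snd (u n)) h Hh ltac:(intros n; apply Hn)) as [y Hy].
  destruct (Hd x y) as [l Hl].
  { specialize (Hx O). simpl in Hx. lra. } { specialize (Hy O). simpl in Hy. lra. }
  (* This makes [2 * e * (w + h) ^ 2] smaller than [e0]; the summand 4 also covers [w + h = 0]. *)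
  set (e := (e0 / (4 * (w + h) ^ 2 + 4))%R).
  assert (Hwh : (0 <= (w + h) ^ 2)%R) by (apply pow2_ge_0).
  assert (He : (0 < e)%R) by (unfold e; apply Rdiv_lt_0_compat; lra).
  destruct (Hl e He) as [d [Hd0 Hdd]].
  destruct (pow_half_small (w + h) d ltac:(lra) Hd0) as [n Hnn].
  pose proof (Hu n) as [[B1 B2] [[B3 B4] B5]].
  assert (P : (0 < (/ 2) ^ n)%R) by apply pow_pos.
  pose proof (rect_affine_bound f (fst (u n)) (snd (u n)) (w * (/ 2) ^ n) (h * (/ 2) ^ n) (x, y) l e) as Bd.
  assert (Bd' : (Cmod (rect f (fst (u n)) (fst (u n) + w * (/ 2) ^ n) (snd (u n)) (snd (u n) + h * (/ 2) ^ n))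
     <= 2 * e * (w * (/ 2) ^ n + h * (/ 2) ^ n) ^ 2)%R).
  { apply Bd; try nra. apply Hx. apply Hy.
    intros; apply Hd; lra.
    intros x' y' Hx' Hy'.
    assert (D : (Cmod ((x', y') - (x, y)) < d)%R).
    { eapply Rle_lt_trans. 2: apply Hnn. eapply Rle_trans. apply Cmod_le_sum. unfold Re, Im. simpl.
      specialize (Hx n). specialize (Hy n).
      rewrite Rmult_plus_distr_r. apply Rplus_le_compat; apply Rabs_le; lra. }
    specialize (Hdd _ D). replace ((x, y) + ((x', y') - (x, y))) with ((x', y') : C) in Hdd
      by (apply injective_projections; simpl; ring).
    exact Hdd. }
  replace ((w * (/ 2) ^ n + h * (/ 2) ^ n) ^ 2)%R with ((w + h) ^ 2 * (/ 4) ^ n)%R in Bd'.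
  2: { replace (/ 4)%R with (/ 2 * / 2)%R by field. rewrite Rpow_mult_distr. ring. }
  assert (P4 : (0 < (/ 4) ^ n)%R) by (apply pow_lt; lra).
  assert (F : (e0 * (/ 4) ^ n <= 2 * e * (w + h) ^ 2 * (/ 4) ^ n)%R) by lra.
  apply Rmult_le_reg_r in F; auto.
  assert (E : (e * (4 * (w + h) ^ 2 + 4) = e0)%R) by (unfold e; field; lra).
  lra.
Qed.

Lemma Cexp_2pi (z : C) : Cexp (z + (0, (2 * PI)%R)) = Cexp z.
Proof.
  unfold Cexp, Re, Im. simpl. rewrite Rplus_0_r.
  replace (snd z + 2 * PI)%R with (snd z + 2 * INR 1 * PI)%R by (simpl; ring).
  now rewrite cos_period, sin_period.
Qed.

(* In the coordinate [zeta], [w + Cexp zeta], Goursat's theorem on the rectangle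
   [ln r', ln r] x [0, 2 pi] says that the mean of
   [(f (w + r e^(i t)) - f w) e^(-i t) / r] does not depend on [r]; as
   [r -> 0] it tends to the derivative at [w]. *)
Lemma cauchy_estimate (f : C -> C) (w l : C) (r M : R) : (0 < r)%R ->
  (forall z, (Cmod (z - w) < r)%R -> exists l, cdiff f z l) ->
  (forall z, (Cmod (z - w) < r)%R -> (Cmod (f z) <= M)%R) ->
  cdiff f w l -> (Cmod l <= 4 * M / r)%R.
Proof.
  intros Hr Hf HM Hl.
  assert (M0 : (0 <= M)%R).
  { eapply Rle_trans. apply Cmod_ge_0. apply (HM w).
    replace (w - w) with (RtoC 0) by ring. now rewrite Cmod_0. }
  set (g := fun z => (f (w + Cexp z) - f w) * Cexp (- z)).
  (* The circle of radius r/2 lies inside the disc, and [f - f w] is at most 2 M on it: whence the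
     constant 4 M / r. *)
  set (b := ln (r / 2)).
  assert (Hb : exp b = (r / 2)%R) by (apply exp_ln; lra).
  assert (Hmod : forall z : C, (Re z <= b)%R -> (Cmod (Cexp z) <= r / 2)%R).
  { intros z Hz. rewrite Cmod_Cexp, <- Hb.
    destruct (Rle_lt_or_eq_dec _ _ Hz) as [L| ->]. apply Rlt_le, exp_increasing, L. lra. }
  assert (Hg : forall z : C, (Re z <= b)%R -> exists l, cdiff g z l).
  { intros z Hz. pose proof (Hmod z Hz).
    destruct (Hf (w + Cexp z)) as [l' Hl'].
    { replace (w + Cexp z - w) with (Cexp z) by ring. lra. }
    eexists. unfold g.
    apply (cdiff_mult (fun z => f (w + Cexp z) - f w) (fun z => Cexp (- z))).
    - apply (cdiff_minus (fun z => f (w + Cexp z)) (fun _ => f w)).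
      apply (cdiff_comp f (fun z => w + Cexp z)). exact Hl'.
      apply (cdiff_plus (fun _ => w) Cexp). apply cdiff_const. apply cdiff_Cexp.
      apply cdiff_const.
    - apply (cdiff_Cexp_comp (fun z => - z)).
      generalize (cdiff_scal (-(1)) _ _ _ (cdiff_id z)).
      apply cdiff_ext_all. intros; ring. reflexivity. }
  assert (Hper : forall z, g (z + (0, (2 * PI)%R)) = g z).
  { intros z. unfold g. rewrite Cexp_2pi, !Cexp_opp, Cexp_2pi. reflexivity. }
  pose proof PI_RGT_0 as Ppi.
  assert (Heq : forall a : R, (a <= b)%R -> ver g a 0 (2 * PI) = ver g b 0 (2 * PI)).
  { intros a Ha.
    pose proof (goursat g a 0 (b - a) (2 * PI) ltac:(lra) ltac:(lra)) as G.
    assert (R0 : rect g a (a + (b - a)) 0 (0 + 2 * PI) = 0).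
    { apply G. intros x y Hx Hy. apply Hg. simpl. lra. }
    replace (a + (b - a))%R with b in R0 by ring. rewrite Rplus_0_l in R0.
    unfold rect in R0.
    assert (EH : hor g 0 a b = hor g (2 * PI) a b).
    { unfold hor. apply (RInt_ext (V := C_R_CompleteNormedModule)). intros x Hx.
      rewrite <- (Hper (x, 0%R)). f_equal. apply injective_projections; simpl; ring. }
    rewrite EH in R0.
    assert (Z : Ci * (ver g b 0 (2 * PI) - ver g a 0 (2 * PI)) = 0) by (rewrite <- R0; ring).
    assert (Z2 : ver g b 0 (2 * PI) - ver g a 0 (2 * PI) = 0).
    { replace (ver g b 0 (2 * PI) - ver g a 0 (2 * PI)) with
       (- Ci * (Ci * (ver g b 0 (2 * PI) - ver g a 0 (2 * PI)))).
      rewrite Z. ring. 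
      replace (- Ci * (Ci * (ver g b 0 (2 * PI) - ver g a 0 (2 * PI)))) with
       (- (Ci * Ci) * (ver g b 0 (2 * PI) - ver g a 0 (2 * PI))) by ring.
      replace (Ci * Ci) with (- RtoC 1). ring.
      apply injective_projections; simpl; ring. }
    symmetry. replace (ver g b 0 (2 * PI)) with (ver g b 0 (2 * PI) - ver g a 0 (2 * PI) + ver g a 0 (2 * PI)) by ring.
    rewrite Z2. ring. }
  assert (Vb : (Cmod (ver g b 0 (2 * PI) - RtoC (2 * PI - 0) * 0) <= (2 * PI - 0) * (4 * M / r))%R).
  { apply (CInt_dist_const (fun y => g (b, y))). lra.
    apply ex_RInt_v. lra. intros y _. apply Hg. simpl. lra.
    intros y _. replace (g (b, y) - 0) with (g (b, y)) by ring. unfold g.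
    rewrite Cmod_mult, (Cmod_Cexp (- _)).
    replace (Re (- (b, y))) with (- b)%R by reflexivity. rewrite exp_Ropp, Hb.
    assert (A1 : (Cmod (f (w + Cexp (b, y))%C) <= M)%R).
    { apply HM. replace (w + Cexp (b, y) - w) with (Cexp (b, y)) by ring.
      eapply Rle_lt_trans. apply Hmod. simpl; lra. lra. }
    assert (A2 : (Cmod (f w) <= M)%R).
    { apply HM. replace (w - w) with (RtoC 0) by ring. now rewrite Cmod_0. }
    pose proof (Cmod_sub_le (f (w + Cexp (b, y))) (f w)).
    replace (4 * M / r)%R with (2 * M * / (r / 2))%R by (field; lra).
    apply Rmult_le_compat_r. apply Rlt_le, Rinv_0_lt_compat; lra. lra. }
  rewrite Rminus_0_r in Vb.
  assert (Vl : forall e, (0 < e)%R -> (Cmod (ver g b 0 (2 * PI) - RtoC (2 * PI) * l) <= 2 * PI * e)%R).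
  { intros e He. destruct (Hl e He) as [d [Hd Hdl]].
    set (a := Rmin b (ln (d / 2))).
    assert (Ha1 : (a <= b)%R) by apply Rmin_l. assert (Ha2 : (a <= ln (d / 2))%R) by apply Rmin_r.
    rewrite <- (Heq a Ha1). rewrite <- (Rminus_0_r (2 * PI)) at 2 3.
    apply (CInt_dist_const (fun y => g (a, y))). lra.
    apply ex_RInt_v. lra. intros y _. apply Hg. exact Ha1.
    intros y _. unfold g.
    assert (D : (Cmod (Cexp (a, y)) < d)%R).
    { rewrite Cmod_Cexp. simpl. apply Rle_lt_trans with (d / 2)%R. 2: lra.
      rewrite <- (exp_ln (d / 2)) by lra.
      destruct (Rle_lt_or_eq_dec _ _ Ha2) as [L| ->]. apply Rlt_le, exp_increasing, L. lra. }
    specialize (Hdl _ D).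
    replace ((f (w + Cexp (a, y)) - f w) * Cexp (- (a, y)) - l)
      with ((f (w + Cexp (a, y)) - f w - l * Cexp (a, y)) * Cexp (- (a, y))).
    2: { rewrite Cexp_opp. field. apply Cexp_neq_0. }
    rewrite Cmod_mult.
    apply Rle_trans with (e * Cmod (Cexp (a, y)) * Cmod (Cexp (- (a, y))))%R.
    apply Rmult_le_compat_r; auto. apply Cmod_ge_0.
    rewrite Rmult_assoc, <- Cmod_mult, Cexp_opp, Cinv_r by apply Cexp_neq_0.
    rewrite Cmod_1. lra. }
  replace (ver g b 0 (2 * PI) - RtoC (2 * PI) * 0) with (ver g b 0 (2 * PI)) in Vb by ring.
  apply Rle_plus_epsilon. intros e He.
  specialize (Vl e He).
  pose proof (Cmod_sub_ge (RtoC (2 * PI) * l) (ver g b 0 (2 * PI))) as T.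
  rewrite (Cmod_sub_sym (RtoC (2 * PI) * l)), Cmod_mult, Cmod_R, (Rabs_pos_eq (2 * PI)) in T by lra.
  apply Rmult_le_reg_l with (2 * PI)%R; lra.
Qed.

(** * Consequences of Cauchy's estimate *)

Lemma is_derive_eps (f : R -> R) (x l : R) :
  (forall eps, (0 < eps)%R -> exists d : R, (0 < d)%R /\ forall h, (Rabs h < d)%R ->
    (Rabs (f (x + h)%R - f x - l * h) <= eps * Rabs h)%R) ->
  is_derive f x l.
Proof.
  intros H. split. apply is_linear_scal_l.
  intros y Hy. apply (is_filter_lim_locally_unique (V := R_NormedModule)) in Hy. subst y. intros eps.
  destruct (H eps (cond_pos eps)) as [d [Hd H']].
  exists (mkposreal d Hd).
  change (forall t : R, ball (M := R_UniformSpace) x d t ->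
    (Rabs (f t - f x - (t - x) * l) <= eps * Rabs (t - x))%R).
  intros t Ht. change (Rabs (t - x) < d)%R in Ht. specialize (H' _ Ht).
  replace (x + (t - x))%R with t in H' by ring. rewrite (Rmult_comm _ l). exact H'.
Qed.

(** Multiplication by the conjugate of f b - f a reduces the claim to the real mean value theorem
    for the component of f in the direction of f b - f a. *)
Lemma mean_value_ineq (f : C -> C) (a b : C) (K : R) :
  (forall t : R, (0 <= t <= 1)%R ->
     exists l, cdiff f (a + RtoC t * (b - a)) l /\ (Cmod l <= K)%R) ->
  (Cmod (f b - f a) <= K * Cmod (b - a))%R.
Proof.
  intros H.
  set (u := Cconj (f b - f a)).
  set (g := fun t : R => Re (u * f (a + RtoC t * (b - a)))).
  assert (Dg : forall t, (0 <= t <= 1)%R -> exists l, (Cmod l <= K)%R /\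
     is_derive g t (Re (u * (l * (b - a))))).
  { intros t Ht. destruct (H t Ht) as [l [Hl HK]]. exists l. split; auto.
    assert (Dc : cdiff (fun s => u * f (a + s * (b - a))) (RtoC t) (u * (l * (b - a)))).
    { apply cdiff_scal. apply (cdiff_comp f (fun s => a + s * (b - a))). exact Hl.
      generalize (cdiff_plus _ _ _ _ _ (cdiff_const a (RtoC t))
        (cdiff_scal (b - a) _ _ _ (cdiff_id (RtoC t)))).
      apply cdiff_ext_all. intros; ring. ring. }
    apply is_derive_eps. intros eps He. destruct (Dc eps He) as [d [Hd Hd']].
    exists d. split; auto. intros h Hh. specialize (Hd' (RtoC h)).
    rewrite Cmod_R in Hd'. specialize (Hd' Hh). eapply Rle_trans. 2: apply Hd'.
    eapply Rle_trans. 2: apply re_le_Cmod. unfold g. right. f_equal.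
    rewrite RtoC_plus. unfold Re. simpl. ring. }
  assert (Dg' : forall t, (0 <= t <= 1)%R -> is_derive g t (Derive g t)).
  { intros t Ht. destruct (Dg t Ht) as [l [_ Hl]]. apply Derive_correct. eexists. exact Hl. }
  destruct (MVT_gen g 0 1 (Derive g)) as [c [Hc E]].
  { intros x Hx. rewrite Rmin_left, Rmax_right in Hx by lra. apply Dg'. lra. }
  { intros x Hx. rewrite Rmin_left, Rmax_right in Hx by lra.
    apply continuity_pt_filterlim. apply (ex_derive_continuous g). eexists. now apply Dg'. }
  rewrite Rmin_left, Rmax_right in Hc by lra.
  destruct (Dg c Hc) as [l [Hl D]]. rewrite (is_derive_unique _ _ _ D) in E.
  assert (Eg : (g 1 - g 0 = Cmod (f b - f a) ^ 2)%R).
  { unfold g. replace (a + 1 * (b - a)) with b by ring. replace (a + 0 * (b - a)) with a by ring.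
    rewrite Cmod2_alt. unfold u, Re, Im. simpl. ring. }
  rewrite Eg in E.
  pose proof (Rle_abs (Re (u * (l * (b - a))))) as A1.
  pose proof (re_le_Cmod (u * (l * (b - a)))) as A2.
  rewrite !Cmod_mult in A2. unfold u in A2. rewrite Cmod_conj in A2. fold u in A2.
  pose proof (Cmod_ge_0 (f b - f a)) as P1. pose proof (Cmod_ge_0 (b - a)) as P2.
  assert (A3 : (Cmod (f b - f a) ^ 2 <= Cmod (f b - f a) * (K * Cmod (b - a)))%R).
  { rewrite E, Rminus_0_r, Rmult_1_r. eapply Rle_trans. apply A1. eapply Rle_trans. apply A2.
    apply Rmult_le_compat_l; auto. apply Rmult_le_compat_r; auto. }
  destruct (Rle_lt_or_eq_dec _ _ P1) as [L|Z].
  - apply Rmult_le_reg_l with (1 := L). simpl in A3. lra.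
  - rewrite <- Z. apply Rmult_le_pos; auto. eapply Rle_trans. apply (Cmod_ge_0 l). auto.
Qed.

Lemma segment_dist (a b : C) (t : R) : (0 <= t <= 1)%R ->
  (Cmod (a + RtoC t * (b - a) - a) <= Cmod (b - a))%R.
Proof.
  intros Ht. replace (a + RtoC t * (b - a) - a) with (RtoC t * (b - a)) by ring.
  rewrite Cmod_mult, Cmod_R, Rabs_pos_eq by lra. pose proof (Cmod_ge_0 (b - a)). nra.
Qed.

(** The derivative is Lipschitz at w: its increment over k is the derivative at w of z |-> f (z + k)
    - f z, which is at most (8 M / r) |k| on the disc of radius r/4, so that Cauchy's estimate gives
    128 M |k| / r^2. The mean value inequality for f z - l z concludes. *)
Lemma taylor1 (f : C -> C) (w l : C) (r M : R) : (0 < r)%R ->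
  (forall z, (Cmod (z - w) < r)%R -> exists l, cdiff f z l) ->
  (forall z, (Cmod (z - w) < r)%R -> (Cmod (f z) <= M)%R) ->
  cdiff f w l -> forall h, (Cmod h < r / 4)%R ->
  (Cmod (f (w + h)%C - f w - l * h) <= 128 * M / r ^ 2 * Cmod h ^ 2)%R.
Proof.
  intros Hr Hf HM Hl h Hh.
  assert (D1 : forall z l', (Cmod (z - w) < r / 2)%R -> cdiff f z l' -> (Cmod l' <= 8 * M / r)%R).
  { intros z l' Hz Hl'. replace (8 * M / r)%R with (4 * M / (r / 2))%R by (field; lra).
    apply (cauchy_estimate f z l' (r / 2) M); auto; try lra;
    intros x Hx; [apply Hf | apply HM];
    pose proof (Cmod_triangle (x - z) (z - w)); replace (x - z + (z - w)) with (x - w) in H by ring; lra. }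
  assert (D2 : forall k l', (Cmod k < r / 4)%R -> cdiff f (w + k) l' ->
     (Cmod (l' - l) <= 128 * M / r ^ 2 * Cmod k)%R).
  { intros k l' Hk Hl'.
    replace (128 * M / r ^ 2 * Cmod k)%R with (4 * (8 * M / r * Cmod k) / (r / 4))%R by (field; lra).
    apply (cauchy_estimate (fun z => f (z + k) - f z) w). lra.
    - intros z Hz.
      destruct (Hf (z + k)) as [l1 H1].
      { pose proof (Cmod_triangle (z - w) k). replace (z - w + k) with (z + k - w) in H by ring. lra. }
      destruct (Hf z) as [l2 H2]. lra.
      exists (l1 * (1 + 0) - l2). apply (cdiff_minus (fun z => f (z + k)) f); auto.
      apply (cdiff_comp f (fun z => z + k)); auto. apply (cdiff_plus (fun z => z) (fun _ => k)).
      apply cdiff_id. apply cdiff_const.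
    - intros z Hz. replace (Cmod k) with (Cmod (z + k - z)) by (f_equal; ring).
      apply mean_value_ineq. intros t Ht.
      assert (Dz : (Cmod (z + RtoC t * (z + k - z) - w) < r / 2)%R).
      { pose proof (segment_dist z (z + k) t Ht). replace (z + k - z) with k in * by ring.
        pose proof (Cmod_triangle (z + RtoC t * k - z) (z - w)).
        replace (z + RtoC t * k - z + (z - w)) with (z + RtoC t * k - w) in H0 by ring. lra. }
      destruct (Hf (z + RtoC t * (z + k - z))) as [l1 H1]. lra.
      exists l1. split; auto. eapply D1; eauto.
    - apply (cdiff_minus (fun z => f (z + k)) f); auto.
      replace l' with (l' * (1 + 0)) by ring.
      apply (cdiff_comp f (fun z => z + k)); auto. apply (cdiff_plus (fun z => z) (fun _ => k)).
      apply cdiff_id. apply cdiff_const. }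
  replace (f (w + h) - f w - l * h) with ((f (w + h) - l * (w + h)) - (f w - l * w)) by ring.
  replace (128 * M / r ^ 2 * Cmod h ^ 2)%R with (128 * M / r ^ 2 * Cmod h * Cmod (w + h - w))%R.
  2: { replace (w + h - w) with h by ring. ring. }
  apply (mean_value_ineq (fun z => f z - l * z)).
  intros t Ht. replace (w + h - w) with h by ring.
  assert (Dt : (Cmod (RtoC t * h) <= Cmod h)%R).
  { rewrite Cmod_mult, Cmod_R, Rabs_pos_eq by lra. pose proof (Cmod_ge_0 h). nra. }
  destruct (Hf (w + RtoC t * h)) as [l1 H1].
  { replace (w + RtoC t * h - w) with (RtoC t * h) by ring. lra. }
  exists (l1 - l * 1). split.
  apply (cdiff_minus f (fun z => l * z)); auto. apply cdiff_scal, cdiff_id.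
  replace (l - l * 1) with (RtoC 0) by ring. rewrite Cmult_1_r.
  eapply Rle_trans. apply (D2 (RtoC t * h)); auto. lra.
  apply Rmult_le_compat_l; auto.
  assert (0 <= M)%R.
  { eapply Rle_trans. apply Cmod_ge_0. apply (HM w).
    replace (w - w) with (RtoC 0) by ring. now rewrite Cmod_0. }
  apply Rdiv_le_0_compat; nra.
Qed.

Lemma Cseq_complete (u : nat -> C) :
  (forall eps, (0 < eps)%R -> exists N, forall n m, (N <= n)%nat -> (N <= m)%nat ->
     (Cmod (u n - u m) <= eps)%R) ->
  exists L, forall eps, (0 < eps)%R -> exists N, forall n, (N <= n)%nat -> (Cmod (u n - L) <= eps)%R.
Proof.
  intros H.
  assert (A : forall g : C -> R, (forall a b, (Rabs (g a - g b) <= Cmod (a - b))%R) ->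
     exists l, Un_cv (fun n => g (u n)) l).
  { intros g Hg. assert (Hc : Cauchy_crit (fun n => g (u n))).
    { intros eps He. destruct (H (eps / 2)%R ltac:(lra)) as [N HN]. exists N. intros n m Hn Hm.
    unfold Rdist. eapply Rle_lt_trans. apply Hg. specialize (HN n m Hn Hm). lra. }
    destruct (Rcomplete.R_complete _ Hc) as [l Hl]. now exists l. }
  destruct (A Re) as [x Hx].
  { intros a b. replace (Re a - Re b)%R with (Re (a - b)) by (unfold Re; simpl; ring). apply re_le_Cmod. }
  destruct (A Im) as [y Hy].
  { intros a b. replace (Im a - Im b)%R with (Im (a - b)) by (unfold Im; simpl; ring). apply Im_le_Cmod. }
  exists (x, y). intros eps He.
  destruct (Hx (eps / 2)%R ltac:(lra)) as [N1 H1]. destruct (Hy (eps / 2)%R ltac:(lra)) as [N2 H2].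
  exists (N1 + N2)%nat. intros n Hn. specialize (H1 n ltac:(lia)). specialize (H2 n ltac:(lia)).
  unfold Rdist in *. eapply Rle_trans. apply Cmod_le_sum.
  replace (Re (u n - (x, y))) with (Re (u n) - x)%R by (unfold Re; simpl; ring).
  replace (Im (u n - (x, y))) with (Im (u n) - y)%R by (unfold Im; simpl; ring). lra.
Qed.

Lemma inv_INR_small (eps : R) : (0 < eps)%R -> exists N, forall n, (N <= n)%nat -> (/ INR (S n) <= eps)%R.
Proof.
  intros He. destruct (archimed_cor1 eps He) as [N [HN N0]]. exists N. intros n Hn.
  apply Rlt_le. eapply Rle_lt_trans. 2: apply HN.
  apply Rinv_le_contravar. apply lt_0_INR. lia. apply le_INR. lia.
Qed.

(** Weierstrass's theorem. Cauchy's estimate makes the derivatives of the approximants a Cauchy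
    sequence, and [taylor1] bounds all their remainders by the same multiple of |h|^2, a bound that
    passes to the limit. *)
Lemma cdiff_limit (q : C -> C) (w : C) (r M : R) : (0 < r)%R ->
  (forall e, (0 < e)%R -> exists Q : C -> C,
     (forall z, (Cmod (z - w) < r)%R -> exists l, cdiff Q z l) /\
     (forall z, (Cmod (z - w) < r)%R -> (Cmod (Q z - q z) <= e)%R)) ->
  (forall z, (Cmod (z - w) < r)%R -> (Cmod (q z) <= M)%R) ->
  exists l, cdiff q w l.
Proof.
  intros Hr HQ HM.
  assert (Pn : forall n, (0 < / INR (S n))%R) by (intros; apply Rinv_0_lt_compat, lt_0_INR; lia).
  assert (W : (Cmod (w - w) < r)%R) by (replace (w - w) with (RtoC 0) by ring; now rewrite Cmod_0).
  set (Q := fun n => proj1_sig (constructive_indefinite_description _ (HQ _ (Pn n)))).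
  assert (Q1 : forall n z, (Cmod (z - w) < r)%R -> exists l, cdiff (Q n) z l).
  { intros n. unfold Q. destruct (constructive_indefinite_description _ _) as [Q' [A B]]. exact A. }
  assert (Q2 : forall n z, (Cmod (z - w) < r)%R -> (Cmod (Q n z - q z) <= / INR (S n))%R).
  { intros n. unfold Q. destruct (constructive_indefinite_description _ _) as [Q' [A B]]. exact B. }
  set (l := fun n => proj1_sig (constructive_indefinite_description _ (Q1 n w W))).
  assert (Hl : forall n, cdiff (Q n) w (l n)).
  { intros n. unfold l. destruct (constructive_indefinite_description _ _) as [l' A]. exact A. }
  destruct (Cseq_complete l) as [L HL].
  { intros eps He. destruct (inv_INR_small (eps * r / 8)%R) as [N HN].
    apply Rdiv_lt_0_compat; nra. exists N. intros n m Hn Hm.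
    specialize (HN n Hn) as A. specialize (HN m Hm) as B.
    replace eps with (4 * (eps * r / 8 + eps * r / 8) / r)%R by (field; lra).
    apply (cauchy_estimate (fun z => Q n z - Q m z) w); auto.
    - intros z Hz. destruct (Q1 n z Hz) as [l1 H1]. destruct (Q1 m z Hz) as [l2 H2].
      eexists. apply (cdiff_minus (Q n) (Q m)); eauto.
    - intros z Hz. pose proof (Q2 n z Hz). pose proof (Q2 m z Hz).
      pose proof (Cmod_sub_le (Q n z - q z) (Q m z - q z)).
      replace (Q n z - q z - (Q m z - q z)) with (Q n z - Q m z) in H1 by ring. lra.
    - apply (cdiff_minus (Q n) (Q m)); auto. }
  assert (M0 : (0 <= M)%R) by (eapply Rle_trans; [apply Cmod_ge_0 | apply (HM w W)]).
  assert (T : forall h, (Cmod h < r / 4)%R ->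
    (Cmod (q (w + h)%C - q w - L * h) <= 128 * (M + 1) / r ^ 2 * Cmod h ^ 2)%R).
  { intros h Hh. apply Rle_plus_epsilon. intros eps He.
    pose proof (Cmod_ge_0 h) as Ph.
    assert (E3 : (0 < eps / (r + 3))%R) by (apply Rdiv_lt_0_compat; lra).
    destruct (HL _ E3) as [N1 H1]. destruct (inv_INR_small _ E3) as [N2 H2].
    set (n := (N1 + N2)%nat). specialize (H1 n ltac:(lia)). specialize (H2 n ltac:(lia)).
    set (e := (eps / (r + 3))%R) in *.
    assert (Ee : (e * (r + 3) = eps)%R) by (unfold e; field; lra).
    assert (Wh : (Cmod (w + h - w) < r)%R) by (replace (w + h - w) with h by ring; lra).
    pose proof (taylor1 (Q n) w (l n) r (M + 1) Hr (Q1 n)) as T.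
    assert (T' : (Cmod (Q n (w + h)%C - Q n w - l n * h) <= 128 * (M + 1) / r ^ 2 * Cmod h ^ 2)%R).
    { apply T; auto. intros z Hz. pose proof (Q2 n z Hz). pose proof (HM z Hz).
      assert (/ INR (S n) <= 1)%R.
      { rewrite <- Rinv_1. apply Rinv_le_contravar. lra. rewrite S_INR. pose proof (pos_INR n). lra. }
      pose proof (Cmod_triangle (Q n z - q z) (q z)).
      replace (Q n z - q z + q z) with (Q n z) in H4 by ring. lra. }
    pose proof (Q2 n w W) as A1. pose proof (Q2 n _ Wh) as A2.
    replace (q (w + h) - q w - L * h) with
      ((Q n (w + h) - Q n w - l n * h) + (((Q n w - q w) - (Q n (w + h) - q (w + h))) + (l n - L) * h)) by ring.
    eapply Rle_trans. apply Cmod_triangle.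
    pose proof (Cmod_triangle ((Q n w - q w) - (Q n (w + h) - q (w + h))) ((l n - L) * h)) as B1.
    pose proof (Cmod_sub_le (Q n w - q w) (Q n (w + h) - q (w + h))) as B2.
    rewrite Cmod_mult in B1.
    assert (Cmod (l n - L) * Cmod h <= e * r)%R.
    { apply Rmult_le_compat; auto. apply Cmod_ge_0. lra. }
    lra. }
  exists L. intros eps He.
  set (K := (128 * (M + 1) / r ^ 2)%R) in *.
  assert (HK : (0 < K)%R) by (unfold K; apply Rdiv_lt_0_compat; [lra | now apply pow_lt]).
  exists (Rmin (r / 4) (eps / K)). split. apply Rmin_pos. lra. now apply Rdiv_lt_0_compat.
  intros h Hh. apply Rmin_Rgt_l in Hh. destruct Hh as [h1 h2].
  eapply Rle_trans. apply T; lra. pose proof (Cmod_ge_0 h).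
  replace (K * Cmod h ^ 2)%R with (K * Cmod h * Cmod h)%R by ring.
  apply Rmult_le_compat_r; auto.
  apply Rle_trans with (K * (eps / K))%R. apply Rmult_le_compat_l; lra. right; field; lra.
Qed.

(** The difference quotients in s are holomorphic in x and, by [taylor1], converge to the derivative
    uniformly in x, so that [cdiff_limit] applies. *)
Lemma cdiff_param_derivative (G : C -> C -> C) (Gs : C -> C) (x0 s0 : C) (r M : R) : (0 < r)%R ->
  (forall x s, (Cmod (x - x0) < r)%R -> (Cmod (s - s0) < r)%R ->
     (exists l, cdiff (fun x => G x s) x l) /\ (exists l, cdiff (G x) s l) /\ (Cmod (G x s) <= M)%R) ->
  (forall x, (Cmod (x - x0) < r)%R -> cdiff (G x) s0 (Gs x)) ->
  exists l, cdiff Gs x0 l.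
Proof.
  intros Hr H HG.
  assert (S0 : (Cmod (s0 - s0) < r)%R) by (replace (s0 - s0) with (RtoC 0) by ring; now rewrite Cmod_0).
  assert (X0 : (Cmod (x0 - x0) < r)%R) by (replace (x0 - x0) with (RtoC 0) by ring; now rewrite Cmod_0).
  assert (M0 : (0 <= M)%R) by (eapply Rle_trans; [apply Cmod_ge_0 | apply (H x0 s0 X0 S0)]).
  apply (cdiff_limit Gs x0 r (4 * M / r) Hr).
  - intros e He.
    set (K := (128 * (M + 1) / r ^ 2)%R).
    assert (HK : (0 < K)%R) by (unfold K; apply Rdiv_lt_0_compat; [lra | now apply pow_lt]).
    assert (Hm : (0 < Rmin (r / 4) (e / K))%R) by (apply Rmin_pos; [lra | now apply Rdiv_lt_0_compat]).
    pose proof (Rmin_l (r / 4) (e / K)). pose proof (Rmin_r (r / 4) (e / K)).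
    set (h := (Rmin (r / 4) (e / K) / 2)%R) in *.
    assert (Ph : (0 < h)%R) by (unfold h; lra).
    assert (Eh : Cmod (RtoC h) = h) by (rewrite Cmod_R, Rabs_pos_eq; lra).
    assert (Nh : RtoC h <> 0) by (apply Cmod_gt_0; lra).
    assert (Sh : (Cmod (s0 + RtoC h - s0) < r)%R) by (replace (s0 + RtoC h - s0) with (RtoC h) by ring; unfold h in *; lra).
    exists (fun x => / RtoC h * (G x (s0 + RtoC h) - G x s0)). split.
    + intros z Hz. destruct (H z (s0 + RtoC h) Hz Sh) as [[l1 L1] _].
      destruct (H z s0 Hz S0) as [[l2 L2] _]. eexists. apply cdiff_scal.
      apply (cdiff_minus (fun x => G x (s0 + RtoC h)) (fun x => G x s0)); eauto.
    + intros z Hz.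
      pose proof (taylor1 (G z) s0 (Gs z) r (M + 1) Hr) as T.
      specialize (T ltac:(intros s Hs; apply (H z s Hz Hs))).
      specialize (T ltac:(intros s Hs; destruct (H z s Hz Hs) as [_ [_ B]]; lra)).
      specialize (T (HG z Hz) (RtoC h)). rewrite Eh in T. specialize (T ltac:(unfold h in *; lra)).
      replace (/ RtoC h * (G z (s0 + RtoC h) - G z s0) - Gs z) with
        (/ RtoC h * (G z (s0 + RtoC h) - G z s0 - Gs z * RtoC h)) by (field; auto).
      rewrite Cmod_mult, Cmod_inv, Eh by auto. fold K in T.
      apply Rle_trans with (/ h * (K * h ^ 2))%R.
      apply Rmult_le_compat_l; auto. apply Rlt_le, Rinv_0_lt_compat; auto.
      replace (/ h * (K * h ^ 2))%R with (K * h)%R by (field; lra).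
      apply Rle_trans with (K * (e / K))%R. apply Rmult_le_compat_l; unfold h in *; lra. right; field; lra.
  - intros x Hx. apply (cauchy_estimate (G x) s0 (Gs x) r M); auto; intros s Hs; apply (H x s Hx Hs).
Qed.

(** The derivative at x is the parameter derivative of f (x + s) at s = 0. *)
Lemma cdiff_derivative_cdiff (f f1 : C -> C) (w : C) (r M : R) : (0 < r)%R ->
  (forall z, (Cmod (z - w) < r)%R -> cdiff f z (f1 z)) ->
  (forall z, (Cmod (z - w) < r)%R -> (Cmod (f z) <= M)%R) ->
  exists l, cdiff f1 w l.
Proof.
  intros Hr Hf HM.
  assert (Tr : forall x s : C, (Cmod (x - w) < r / 2)%R -> (Cmod (s - 0) < r / 2)%R -> (Cmod (x + s - w) < r)%R).
  { intros x s A B. pose proof (Cmod_triangle (x - w) (s - 0)).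
    replace (x - w + (s - 0)) with (x + s - w) in H by ring. lra. }
  assert (Sh : forall x s l, cdiff f (x + s) l -> cdiff (fun s => f (x + s)) s l).
  { intros x s l Hl. replace l with (l * (0 + 1)) by ring. apply (cdiff_comp f (fun s => x + s)); auto.
    apply (cdiff_plus (fun _ => x) (fun s => s)). apply cdiff_const. apply cdiff_id. }
  apply (cdiff_param_derivative (fun x s => f (x + s)) f1 w 0 (r / 2) M). lra.
  - intros x s Hx Hs. specialize (Hf _ (Tr x s Hx Hs)). repeat split.
    + exists (f1 (x + s)). generalize (Sh s x (f1 (x + s))). rewrite (Cplus_comm s x). intros A.
      specialize (A Hf). revert A. apply cdiff_ext_all; auto. intros; f_equal; ring.
    + exists (f1 (x + s)). now apply Sh.
    + apply HM. now apply Tr.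
  - intros x Hx. apply Sh. replace (x + 0) with x by ring. apply Hf. lra.
Qed.

(* Each time the strip is shrunk by [16 pi], the bound on [f'] is halved:
   [f'] has mean zero over a period and [f''] is controlled by [f']. *)
Lemma strip_derivative_bound (f : C -> C) (a b M : R) :
  (forall z, f (z + (0, (2 * PI)%R)) = f z) ->
  (forall z, (a < Re z < b)%R -> exists l, cdiff f z l) ->
  (forall z, (a < Re z < b)%R -> (Cmod (f z) <= M)%R) ->
  forall (n : nat) (z l : C),
    (a + (INR n + 1) * (16 * PI) <= Re z <= b - (INR n + 1) * (16 * PI))%R ->
    cdiff f z l -> (Cmod l <= M * (/ 2) ^ n)%R.
Proof.
  intros Hper Hf HM.
  assert (Pp := PI_RGT_0). assert (P3 := PI2_3_2).
  (* Chosen so that Cauchy's bound [4 * B / d] for the second derivative, times the period 2 pi, is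
     B / 2. *)
  set (d := (16 * PI)%R) in *.
  assert (Hre : forall z w : C, (Cmod (w - z) < d)%R -> (Re z - d < Re w < Re z + d)%R).
  { intros z w H. pose proof (re_le_Cmod (w - z)).
    replace (Re (w - z)) with (Re w - Re z)%R in H0 by (unfold Re; simpl; ring).
    assert (H1 : (Rabs (Re w - Re z) < d)%R) by lra. apply Rabs_def2 in H1. lra. }
  set (f1 := fun z => C_derive f z).
  assert (F1 : forall z, (a < Re z < b)%R -> cdiff f z (f1 z)).
  { intros z Hz. destruct (Hf z Hz) as [l Hl]. unfold f1. now rewrite (cdiff_C_derive _ _ _ Hl). }
  assert (M0 : forall z, (a < Re z < b)%R -> (0 <= M)%R).
  { intros z Hz. eapply Rle_trans. apply Cmod_ge_0. now apply (HM z). }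
  assert (Main : forall (n : nat) (z : C),
    (a + (INR n + 1) * d <= Re z <= b - (INR n + 1) * d)%R -> (Cmod (f1 z) <= M * (/ 2) ^ n)%R).
  { induction n.
    - intros z Hz. change (INR 0) with 0%R in Hz. simpl.
      assert (Dz : forall w, (Cmod (w - z) < d)%R -> (a < Re w < b)%R).
      { intros w Hw. apply Hre in Hw. lra. }
      assert (Z : (a < Re z < b)%R) by (unfold d in *; lra).
      apply Rle_trans with (4 * M / d)%R.
      apply (cauchy_estimate f z (f1 z) d M); auto. unfold d; lra.
      specialize (M0 z Z). apply Rle_div_l. unfold d; lra. unfold d. nra.
    - intros z Hz. rewrite S_INR in Hz. pose proof (pos_INR n) as Pn.
      assert (Dz : forall w, (Cmod (w - z) < d)%R -> (a + (INR n + 1) * d <= Re w <= b - (INR n + 1) * d)%R).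
      { intros w Hw. apply Hre in Hw. lra. }
      set (B := (M * (/ 2) ^ n)%R) in *.
      assert (Str : forall w, (a + (INR n + 1) * d <= Re w <= b - (INR n + 1) * d)%R -> (a < Re w < b)%R).
      { intros w Hw. assert (0 < (INR n + 1) * d)%R by (apply Rmult_lt_0_compat; unfold d; lra). lra. }
      assert (F2 : forall w, (a + (INR n + 1) * d <= Re w <= b - (INR n + 1) * d)%R -> exists l, cdiff f1 w l).
      { intros w Hw. apply (cdiff_derivative_cdiff f f1 w d M). unfold d; lra.
        intros x Hx. apply F1. apply Hre in Hx. nra.
        intros x Hx. apply HM. apply Hre in Hx. nra. }
      assert (F2b : forall w, (a + (INR n + 1 + 1) * d <= Re w <= b - (INR n + 1 + 1) * d)%R ->
         exists l, cdiff f1 w l /\ (Cmod l <= 4 * B / d)%R).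
      { intros w Hw. destruct (F2 w) as [l Hl]. unfold d in *; lra. exists l. split; auto.
        apply (cauchy_estimate f1 w l d B); auto. unfold d; lra.
        intros x Hx. apply F2. apply Hre in Hx. lra.
        intros x Hx. apply IHn. apply Hre in Hx. lra. }
      set (P := ((0, (2 * PI)%R) : C)).
      assert (CP : Cmod P = (2 * PI)%R).
      { replace P with (Ci * RtoC (2 * PI)). rewrite Cmod_mult, Cmod_Ci, Cmod_R, Rabs_pos_eq; lra.
        unfold P. apply injective_projections; simpl; ring. }
      assert (Rv : forall t : R, Re (z + RtoC t * P) = Re z).
      { intros t. unfold P, Re. simpl. ring. }
      assert (V : forall t : R, (0 <= t <= 1)%R -> (Cmod (f1 (z + RtoC t * P)%C - f1 z) <= 4 * B / d * (2 * PI))%R).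
      { intros t Ht.
        assert (B0 : (0 <= 4 * B / d)%R).
        { destruct (F2b z Hz) as [l [_ Hl]]. eapply Rle_trans. apply (Cmod_ge_0 l). auto. }
        apply Rle_trans with (4 * B / d * Cmod (z + RtoC t * P - z))%R.
        - apply mean_value_ineq. intros s Hs.
          replace (z + RtoC t * P - z) with (RtoC t * P) by ring.
          replace (RtoC s * (RtoC t * P)) with (RtoC (s * t) * P) by (rewrite RtoC_mult; ring).
          apply F2b. rewrite Rv. lra.
        - apply Rmult_le_compat_l; auto. replace (z + RtoC t * P - z) with (RtoC t * P) by ring.
          rewrite Cmod_mult, Cmod_R, Rabs_pos_eq, CP by lra. nra. }
      (* Since f returns to its value after a period, f x - f1 z * x changes by exactly - f1 z * P;
         its derivative is the variation of [f1], bounded by [V]. This is the vanishing of the mean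
         of f'. *)
      assert (W : (Cmod ((f (z + P)%C - f1 z * (z + P)) - (f z - f1 z * z)) <= 4 * B / d * (2 * PI) * Cmod (z + P - z))%R).
      { apply (mean_value_ineq (fun x => f x - f1 z * x)). intros t Ht.
        replace (z + P - z) with P by ring.
        exists (f1 (z + RtoC t * P) - f1 z). split.
        - replace (f1 (z + RtoC t * P) - f1 z) with (f1 (z + RtoC t * P) - f1 z * 1) by ring.
          apply (cdiff_minus f (fun x => f1 z * x)). 2: apply cdiff_scal, cdiff_id.
          apply F1. rewrite Rv. apply Str. unfold d in *; lra.
        - now apply V. }
      unfold P in W at 1. rewrite Hper in W.
      replace (f z - f1 z * (z + P) - (f z - f1 z * z)) with (- (f1 z * P)) in W by ring.
      replace (z + P - z) with P in W by ring.
      rewrite Cmod_opp, Cmod_mult, CP in W.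
      apply Rmult_le_reg_r in W. 2: lra.
      eapply Rle_trans. apply W. right. unfold d, B. simpl. field. lra. }
  intros n z l Hz Hl.
  rewrite <- (cdiff_C_derive _ _ _ Hl). now apply Main.
Qed.

(** * Cones *)

(* A sector of opening ]- om, PI - om[, where [om = arg sg], described without
   arguments: the opening is [I_1] for [sg = tau] and [I_4] for [sg = 1]. *)
Definition half_plane (sg : C) (k : R) (xi : C) : Prop :=
  (k * Cmod xi <= Im (sg * xi))%R.

Definition annulus (c : R) (z : C) : Prop := (exp (- c) < Cmod z < exp c)%R.

Definition cone (sg : C) (k c M : R) (p : C2) : Prop :=
  snd p <> 0 /\ (M < Cmod (/ snd p))%R /\ half_plane sg k (/ snd p) /\ annulus c (fst p).

(** With th the argument of [sg * xi] in [0, pi], the hypothesis reads sin th >= k / |sg|. Since sin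
    x < x for x > 0, both th and pi - th exceed k / |sg|, and theta is th - om. *)
Lemma half_plane_arg (sg : C) (om k : R) (xi : C) :
  (0 < k)%R -> sg <> 0 -> is_arg sg om -> xi <> 0 -> half_plane sg k xi ->
  exists theta : R,
    (- om + k / (2 * Cmod sg) < theta < PI - om - k / (2 * Cmod sg))%R /\ is_arg xi theta.
Proof.
  intros Hk Hsg Ha Hx H. unfold half_plane in H.
  pose proof (proj1 (Cmod_gt_0 _) Hsg) as Ps. pose proof (proj1 (Cmod_gt_0 _) Hx) as Px.
  set (w := sg * xi) in *.
  assert (Ew : Cmod w = (Cmod sg * Cmod xi)%R) by apply Cmod_mult.
  assert (Pw : (0 < Cmod w)%R) by (rewrite Ew; nra).
  set (a := (Re w / Cmod w)%R). set (b := (Im w / Cmod w)%R).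
  assert (Hab : (a ^ 2 + b ^ 2 = 1)%R).
  { unfold a, b. pose proof (Cmod2_alt w) as E.
    replace ((Re w / Cmod w) ^ 2 + (Im w / Cmod w) ^ 2)%R with
      ((Re w ^ 2 + Im w ^ 2) / Cmod w ^ 2)%R by (field; lra).
    rewrite <- E. field. lra. }
  assert (Hb : (k / Cmod sg <= b)%R).
  { unfold b. apply (Rmult_le_reg_r (Cmod w)); auto.
    replace (Im w / Cmod w * Cmod w)%R with (Im w) by (field; lra).
    rewrite Ew. replace (k / Cmod sg * (Cmod sg * Cmod xi))%R with (k * Cmod xi)%R by (field; lra). exact H. }
  assert (Hk' : (0 < k / Cmod sg)%R) by (apply Rdiv_lt_0_compat; auto).
  assert (Ha1 : (-1 <= a <= 1)%R) by nra.
  set (th := acos a).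
  assert (Hc : cos th = a) by (apply cos_acos; auto).
  assert (Hs : sin th = b).
  { unfold th. rewrite sin_acos by auto. replace (1 - a²)%R with (b * b)%R by (unfold Rsqr; nra).
    apply sqrt_square. lra. }
  pose proof (acos_bound a) as [T1 T2]. fold th in T1, T2.
  assert (th <> 0)%R by (intros E; rewrite E, sin_0 in Hs; lra).
  assert (th <> PI)%R by (intros E; rewrite E, sin_PI in Hs; lra).
  assert (S1 : (sin th < th)%R) by (apply sin_lt_x; lra).
  assert (S2 : (sin (PI - th) < PI - th)%R) by (apply sin_lt_x; lra).
  rewrite sin_PI_x in S2.
  exists (th - om)%R. split.
  - replace (k / (2 * Cmod sg))%R with (k / Cmod sg / 2)%R by (field; lra). lra.
  - unfold is_arg in *.
    assert (E1 : sg * xi = RtoC (Cmod w) * (cos th, sin th)).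
    { fold w. rewrite Hc, Hs. unfold a, b. apply injective_projections; simpl; unfold Re, Im; field; lra. }
    assert (E2 : (cos om, sin om) * (cos (th - om), sin (th - om)) = (cos th, sin th)).
    { apply injective_projections; simpl.
      rewrite <- cos_plus. f_equal; ring.
      rewrite Rplus_comm, <- sin_plus. f_equal; ring. }
    rewrite Ew, RtoC_mult, <- E2 in E1.
    assert (E3 : sg * xi = sg * (RtoC (Cmod xi) * (cos (th - om), sin (th - om)))).
    { rewrite E1. rewrite Ha at 2. ring. }
    transitivity (/ sg * (sg * xi)). field; auto. rewrite E3. field; auto.
Qed.

Lemma half_plane_perturb (sg xi xi' : C) (k r : R) :
  (0 < k)%R -> (0 <= r)%R -> (r * (2 * (k + Cmod sg)) <= k)%R ->
  half_plane sg k xi -> (Cmod (xi' - xi) <= r * Cmod xi')%R -> half_plane sg (k / 2) xi'.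
Proof.
  intros Hk Hr Hrk H D. unfold half_plane in *.
  replace (sg * xi') with (sg * xi + sg * (xi' - xi)) by ring.
  replace (Im (sg * xi + sg * (xi' - xi))) with (Im (sg * xi) + Im (sg * (xi' - xi)))%R
    by (unfold Im; simpl; ring).
  pose proof (Im_le_Cmod (sg * (xi' - xi))) as A. rewrite Cmod_mult in A.
  apply Rabs_le_between in A.
  pose proof (Cmod_sub_ge xi' (xi' - xi)) as B. replace (xi' - (xi' - xi)) with xi in B by ring.
  pose proof (Cmod_ge_0 sg). pose proof (Cmod_ge_0 xi').
  assert (Cmod sg * Cmod (xi' - xi) <= Cmod sg * (r * Cmod xi'))%R by (apply Rmult_le_compat_l; auto).
  assert (k * (Cmod xi' - r * Cmod xi') <= k * Cmod xi)%R by (apply Rmult_le_compat_l; lra).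
  assert (r * (2 * (k + Cmod sg)) * Cmod xi' <= k * Cmod xi')%R by (apply Rmult_le_compat_r; auto).
  lra.
Qed.

Lemma exp_1_ge_2 (c : R) : (2 * exp c <= exp (c + 1))%R.
Proof.
  rewrite exp_plus. pose proof (exp_ineq1_le 1). pose proof (exp_pos c). nra.
Qed.

Lemma annulus_perturb (c : R) (z z' : C) : (0 < c)%R ->
  annulus c z -> (Cmod (z' - z) <= exp (- c) / 2)%R -> annulus (c + 1) z'.
Proof.
  intros Hc [H1 H2] D. unfold annulus.
  pose proof (Cmod_sub_ge z (z - z')) as A. replace (z - (z - z')) with z' in A by ring.
  pose proof (Cmod_triangle z (z' - z)) as B. replace (z + (z' - z)) with z' in B by ring.
  rewrite (Cmod_sub_sym z z') in A.
  pose proof (exp_1_ge_2 c). pose proof (exp_1_ge_2 (- (c + 1))).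
  replace (- (c + 1) + 1)%R with (- c)%R in H0 by ring.
  assert (exp (- c) < exp c)%R by (apply exp_increasing; lra).
  pose proof (exp_pos (-c)). split; lra.
Qed.

(** Small moves keep a point in a cone at the cost of halving k and M and of adding 1 to c:
    estimates are proved on the larger cone and exploited on the smaller one. The condition on r is
    the origin of its recurring definition as a minimum with [k / (2 * (k + Cmod sg))]. *)
Lemma cone_perturb (sg : C) (k c M r : R) (p p' : C2) :
  (0 < k)%R -> (0 < c)%R -> (0 <= r <= 1)%R -> (0 <= M)%R -> (r * (2 * (k + Cmod sg)) <= k)%R ->
  cone sg k c M p -> snd p' <> 0 ->
  (Cmod (/ snd p' - / snd p) <= r * Cmod (/ snd p'))%R ->
  (Cmod (fst p' - fst p) <= exp (- c) / 2)%R ->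
  cone sg (k / 2) (c + 1) (M / 2) p'.
Proof.
  intros Hk Hc Hr HM Hrk [H1 [H2 [H3 H4]]] Hn D1 D2. repeat split; auto.
  - pose proof (Cmod_sub_ge (/ snd p) (/ snd p - / snd p')).
    replace (/ snd p - (/ snd p - / snd p')) with (/ snd p') in H by ring.
    rewrite Cmod_sub_sym in H. pose proof (Cmod_ge_0 (/ snd p')).
    rewrite (Cmod_sub_sym (/ snd p')) in D1.
    pose proof (Cmod_sub_ge (/ snd p) (/ snd p')). nra.
  - now apply (half_plane_perturb sg (/ snd p) _ k r).
  - apply (annulus_perturb c (fst p)); auto.
  - apply (annulus_perturb c (fst p)); auto.
Qed.

Lemma cone_weaken (sg : C) (k k' c c' M M' : R) (p : C2) :
  (k' <= k)%R -> (c <= c')%R -> (M' <= M)%R -> cone sg k c M p -> cone sg k' c' M' p.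
Proof.
  intros Hk Hc HM [H1 [H2 [H3 [H4 H5]]]]. repeat split; auto.
  - lra.
  - unfold half_plane in *. pose proof (Cmod_ge_0 (/ snd p)). nra.
  - eapply Rle_lt_trans. 2: apply H4. destruct (Req_dec c c') as [->|]. lra.
    apply Rlt_le, exp_increasing. lra.
  - eapply Rlt_le_trans. apply H5. destruct (Req_dec c c') as [->|]. lra.
    apply Rlt_le, exp_increasing. lra.
Qed.

Lemma cone_y (sg : C) (k c M : R) (p : C2) : (0 < M)%R -> cone sg k c M p ->
  (0 < Cmod (snd p) < / M)%R /\ Cmod (/ snd p) = (/ Cmod (snd p))%R.
Proof.
  intros HM [H1 [H2 _]]. rewrite Cmod_inv in * by auto.
  pose proof (proj1 (Cmod_gt_0 _) H1) as P. repeat split; auto.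
  rewrite <- (Rinv_inv (Cmod (snd p))). apply Rinv_lt_contravar; auto.
  apply Rmult_lt_0_compat; auto. now apply Rinv_0_lt_compat.
Qed.

(** The data of a sectorial normalization expressed on cones, where small moves are controlled by
    inequalities instead of arguments. It serves for the sector 1 with [sg = tau] and for the sector
    4 with [sg = 1]. *)
Definition cone_normalization (tau : C) (F : C2 -> C2) (Psi : formal_diffeo)
    (sg : C) (S : C2 -> Prop) (psi : C2 -> C2) : Prop :=
  (forall p, S p -> snd p <> 0 /\ fst (psi p) <> 0 /\ snd (psi p) <> 0) /\
  biholo_on S psi /\
  (forall c k : R, (0 < c)%R -> (0 < k)%R ->
    exists M : R, (0 < M)%R /\ (forall p, cone sg k c M p -> S p) /\
      forall N : nat, exists K : R, forall p, cone sg k c M p ->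
        (Cmod (fst (psi p) - fst (jet Psi N p)) <= K * Cmod (snd p) ^ (N + 1))%R /\
        (Cmod (/ snd (psi p) - snd (jet Psi N p)) <= K * Cmod (snd p) ^ (N + 1))%R) /\
  (forall p, S p -> S (F p) -> psi (F p) = F100 tau (psi p)).

Lemma cone_sector (sg : C) (varpi om k c M : R) (i : Z4) (p : C2) :
  (0 < k)%R -> sg <> 0 -> is_arg sg om -> opening varpi i = ((- om)%R, (PI - om)%R) ->
  cone sg k c M p -> sector varpi i c (k / (2 * Cmod sg)) M p.
Proof.
  intros Hk Hsg Hom Ho [H1 [H2 [H3 H4]]]. repeat split; try apply H4; auto.
  assert (Hx : / snd p <> 0).
  { apply Cmod_gt_0. rewrite Cmod_inv by auto. apply Rinv_0_lt_compat. now apply Cmod_gt_0. }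
  destruct (half_plane_arg sg om k (/ snd p) Hk Hsg Hom Hx H3) as [th [T1 T2]].
  exists th. rewrite Ho. simpl. split; auto; lra.
Qed.

Lemma sectorial_cone_normalization (tau sg : C) (varpi om : R) (V : C2 -> Prop) (F : C2 -> C2)
    (Psi : formal_diffeo) (i : Z4) (S : C2 -> Prop) (psi : C2 -> C2) :
  sg <> 0 -> is_arg sg om -> opening varpi i = ((- om)%R, (PI - om)%R) ->
  sectorial_normalization tau varpi V F Psi i S psi -> cone_normalization tau F Psi sg S psi.
Proof.
  intros Hsg Hom Ho [H1 [H2 [H3 H4]]]. split; [|split; [|split]]; auto.
  - intros p Hp. apply (H1 p Hp).
  - intros c k Hc Hk. pose proof (proj1 (Cmod_gt_0 _) Hsg) as Ps.
    destruct (H3 c (k / (2 * Cmod sg))%R Hc ltac:(apply Rdiv_lt_0_compat; lra)) as [M [HM [A B]]].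
    exists M. repeat split; auto.
    + intros p Hp. apply A. now apply (cone_sector sg varpi om).
    + intros N. destruct (B N) as [K HK]. exists K. intros p Hp. apply HK. now apply (cone_sector sg varpi om).
Qed.

(** * Closeness of a normalization to the identity *)

Lemma jet_0 (Psi : formal_diffeo) (p : C2) : jet Psi 0 p = p.
Proof.
  unfold jet. rewrite !sum_n_m_zero by lia. destruct p as [z y].
  apply injective_projections; apply Cplus_0_r.
Qed.

Lemma jet_1_snd (Psi : formal_diffeo) (p : C2) : snd (jet Psi 1 p) = snd p.
Proof. unfold jet. simpl. rewrite sum_n_m_zero by lia. apply Cplus_0_r. Qed.

(** Only the jets of orders 0 and 1 enter. The second component has no correction at order 1, so 1 /
    xi - y is O(y^2), which amounts to xi - 1 / y being bounded. *)
Lemma cone_normalization_near_id (tau : C) (F : C2 -> C2) (Psi : formal_diffeo)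
    (sg : C) (S : C2 -> Prop) (psi : C2 -> C2) :
  cone_normalization tau F Psi sg S psi ->
  forall c k : R, (0 < c)%R -> (0 < k)%R ->
  exists M K : R, (0 < M)%R /\ (0 < K)%R /\ forall p, cone sg k c M p -> S p /\
    (Cmod (fst (psi p) - fst p) <= K * Cmod (snd p))%R /\
    (Cmod (/ snd (psi p) - snd p) <= K * Cmod (snd p) ^ 2)%R /\
    (Cmod (snd (psi p) - / snd p) <= K)%R /\
    (Cmod (snd p) / 2 <= Cmod (/ snd (psi p)) <= 2 * Cmod (snd p))%R.
Proof.
  intros [H1 [H2 [H3 H4]]] c k Hc Hk.
  destruct (H3 c k Hc Hk) as [M [HM [A B]]].
  destruct (B O) as [K0 HK0]. destruct (B 1%nat) as [K1 HK1].
  set (K := (Rabs K0 + 2 * Rabs K1 + 1)%R).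
  pose proof (Rabs_pos K0). pose proof (Rabs_pos K1). pose proof (Rle_abs K0). pose proof (Rle_abs K1).
  exists (M + 2 * K)%R, K. split; [unfold K; lra|]. split; [unfold K; lra|].
  intros p Hp.
  assert (Hp' : cone sg k c M p) by (apply (cone_weaken sg k k c c (M + 2 * K) M); auto; unfold K; lra).
  destruct (cone_y sg k c (M + 2 * K) p ltac:(unfold K; lra) Hp) as [[P1 P2] P3].
  specialize (HK0 p Hp'). specialize (HK1 p Hp'). rewrite jet_0 in HK0. rewrite jet_1_snd in HK1.
  destruct HK0 as [E0 _]. destruct HK1 as [_ E1]. simpl Nat.add in E0, E1. rewrite pow_1 in E0.
  pose proof (A p Hp') as Sp. destruct (H1 p Sp) as [N1 [N2 N3]].
  split; auto. set (y := Cmod (snd p)) in *.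
  assert (Hy : (K * y <= / 2)%R).
  { apply Rle_trans with (K * / (M + 2 * K))%R. apply Rmult_le_compat_l; unfold K in *; lra.
    apply (Rmult_le_reg_r (2 * (M + 2 * K))). unfold K; lra.
    replace (K * / (M + 2 * K) * (2 * (M + 2 * K)))%R with (2 * K)%R by (field; unfold K; lra).
    replace (/ 2 * (2 * (M + 2 * K)))%R with (M + 2 * K)%R by field. lra. }
  assert (E0' : (Cmod (fst (psi p) - fst p) <= K * y)%R).
  { eapply Rle_trans. apply E0. apply Rmult_le_compat_r; unfold K; lra. }
  assert (E1' : (2 * Cmod (/ snd (psi p) - snd p) <= K * y ^ 2)%R).
  { assert (0 <= y ^ 2)%R by (apply pow2_ge_0). unfold K. nra. }
  assert (Y : (y / 2 <= Cmod (/ snd (psi p)) <= 2 * y)%R).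
  { assert (K * y ^ 2 <= y / 2)%R by (simpl; nra).
    pose proof (Cmod_sub_ge (snd p) (snd p - / snd (psi p))) as T1.
    replace (snd p - (snd p - / snd (psi p))) with (/ snd (psi p)) in T1 by ring.
    pose proof (Cmod_triangle (snd p) (/ snd (psi p) - snd p)) as T2.
    replace (snd p + (/ snd (psi p) - snd p)) with (/ snd (psi p)) in T2 by ring.
    rewrite (Cmod_sub_sym (snd p) (/ _)) in T1. fold y in T1, T2. lra. }
  repeat split; auto; try apply Y.
  - assert (0 <= Cmod (/ snd (psi p) - snd p))%R by apply Cmod_ge_0. lra.
  - replace (snd (psi p) - / snd p) with ((snd p - / snd (psi p)) / (snd p * / snd (psi p)))
      by (field; split; auto).
    assert (I : / snd (psi p) <> 0).
    { apply Cmod_gt_0. lra. }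
    rewrite Cmod_div by (apply Cmult_neq_0; auto).
    rewrite Cmod_mult, Cmod_sub_sym. fold y.
    apply (Rmult_le_reg_r (y * Cmod (/ snd (psi p)))). nra.
    replace (Cmod (/ snd (psi p) - snd p) / (y * Cmod (/ snd (psi p))) * (y * Cmod (/ snd (psi p))))%R
      with (Cmod (/ snd (psi p) - snd p)) by (field; lra).
    assert (0 <= K)%R by (unfold K; lra).
    assert (K * (y * (y / 2)) <= K * (y * Cmod (/ snd (psi p))))%R.
    { apply Rmult_le_compat_l; auto. apply Rmult_le_compat_l; lra. }
    simpl in E1'. lra.
Qed.

(** * Compactness, and surjectivity of a normalization on cones *)

Lemma box_uniform (B : R) (Good : C2 -> R -> Prop) :
  (forall x d d', (0 < d' <= d)%R -> Good x d -> Good x d') ->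
  (forall t : C2, exists d : R, (0 < d)%R /\ forall x : C2,
     (Cmod (fst x - fst t) < d)%R -> (Cmod (snd x - snd t) < d)%R -> Good x d) ->
  exists d : R, (0 < d)%R /\ forall x : C2,
     (Cmod (fst x) <= B)%R -> (Cmod (snd x) <= B)%R -> Good x d.
Proof.
  intros Hm Hl.
  set (del := fun t => proj1_sig (constructive_indefinite_description _ (Hl t))).
  assert (Hdel : forall t, (0 < del t)%R /\ forall x : C2,
     (Cmod (fst x - fst t) < del t)%R -> (Cmod (snd x - snd t) < del t)%R -> Good x (del t)).
  { intros t. unfold del. now destruct (constructive_indefinite_description _ _) as [d Hd]. }
  assert (Hp : forall t, (0 < del t / 2)%R) by (intros t; destruct (Hdel t); lra).
  (* The polydisc is contained in a box of R^4. The radii are halved because the gauge controls real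
     and imaginary parts separately. *)
  destruct (compactness_value 4 (-B, (-B, (-B, (-B, tt))))%R (B, (B, (B, (B, tt))))
    (fun t => let '(a, (b, (c, (d, _)))) := t in mkposreal _ (Hp ((a, b) : C, (c, d) : C)))) as [d Hd].
  exists d. split. apply cond_pos.
  intros [[a b] [c e]] H1 H2. simpl in H1, H2. apply NNPP. intros HN.
  assert (Ha := re_le_Cmod (a, b)). assert (Hb := Im_le_Cmod (a, b)).
  assert (Hc := re_le_Cmod (c, e)). assert (He := Im_le_Cmod (c, e)). unfold Re, Im in *. simpl in Ha, Hb, Hc, He.
  apply Rabs_le_between in Ha, Hb, Hc, He.
  apply (Hd (a, (b, (c, (e, tt))))).
  { simpl. repeat split; lra. }
  intros [[t1 [t2 [t3 [t4 []]]]] [_ [Hcl Hdt]]]. simpl in Hcl, Hdt.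
  destruct Hcl as [A1 [A2 [A3 [A4 _]]]].
  set (t := (((t1, t2) : C), ((t3, t4) : C)) : C2).
  change (d <= del t / 2)%R in Hdt.
  change (Rabs (a - t1) < del t / 2)%R in A1. change (Rabs (b - t2) < del t / 2)%R in A2.
  change (Rabs (c - t3) < del t / 2)%R in A3. change (Rabs (e - t4) < del t / 2)%R in A4.
  destruct (Hdel t) as [D1 D2].
  assert (Q : forall x y u v : R, (Rabs (x - u) < del t / 2)%R -> (Rabs (y - v) < del t / 2)%R ->
    (Cmod (((x, y) : C) - ((u, v) : C)) < del t)%R).
  { intros x y u v X Y. eapply Rle_lt_trans. apply Cmod_le_sum. unfold Re, Im. simpl.
    unfold Rminus in *. lra. }
  apply HN. apply (Hm _ (del t)). split. apply cond_pos. lra.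
  apply D2; simpl; apply Q; auto.
Qed.

(** Turns estimates that are locally uniform in z, such as [bigO], into uniform ones on an annulus.
    At the centre 0, which the hypothesis does not cover, the disc of radius exp (- c) misses the
    annulus. *)
Lemma annulus_uniform (c : R) (Good : C -> R -> Prop) :
  (forall z d d', (0 < d' <= d)%R -> Good z d -> Good z d') ->
  (forall t : C, t <> 0 -> exists d : R, (0 < d)%R /\ forall z : C,
     (Cmod (z - t) < d)%R -> Good z d) ->
  exists d : R, (0 < d)%R /\ forall z : C, annulus c z -> Good z d.
Proof.
  intros Hm Hl.
  destruct (box_uniform (exp c) (fun x d => annulus c (fst x) -> Good (fst x) d)) as [d [Hd H]].
  - intros x d d' Hd G A. apply (Hm _ d d'); auto.
  - intros [t s]. destruct (classic (t = 0)) as [->|Hn].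
    + exists (exp (- c)). split. apply exp_pos. intros x H1 _ [A _]. simpl in H1.
      replace (fst x - 0) with (fst x) in H1 by ring. lra.
    + destruct (Hl t Hn) as [d [Hd H]]. exists d. split; auto.
  - exists d. split; auto. intros z Hz. apply (H (z, RtoC 0)); auto.
    simpl. apply Rlt_le, Hz. simpl. rewrite Cmod_0. apply Rlt_le, exp_pos.
Qed.

(** If the infimum were not attained, the gap above it would be positive near each point of the
    polydisc, hence uniformly positive by [box_uniform]. *)
Lemma polydisc_min (Phi : C2 -> R) (p0 : C2) (r1 r2 : R) : (0 <= r1)%R -> (0 <= r2)%R ->
  (forall p, 0 <= Phi p)%R ->
  (forall p, (Cmod (fst p - fst p0) <= r1)%R -> (Cmod (snd p - snd p0) <= r2)%R ->
     forall eps, (0 < eps)%R -> exists d : R, (0 < d)%R /\ forall q : C2,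
       (Cmod (fst q - fst p) < d)%R -> (Cmod (snd q - snd p) < d)%R ->
       (Rabs (Phi q - Phi p) < eps)%R) ->
  exists p, (Cmod (fst p - fst p0) <= r1)%R /\ (Cmod (snd p - snd p0) <= r2)%R /\
    forall q, (Cmod (fst q - fst p0) <= r1)%R -> (Cmod (snd q - snd p0) <= r2)%R -> (Phi p <= Phi q)%R.
Proof.
  intros Hr1 Hr2 Hpos Hc.
  set (K := fun p : C2 => (Cmod (fst p - fst p0) <= r1)%R /\ (Cmod (snd p - snd p0) <= r2)%R).
  assert (K0 : K p0).
  { split. replace (fst p0 - fst p0) with (RtoC 0) by ring. now rewrite Cmod_0.
    replace (snd p0 - snd p0) with (RtoC 0) by ring. now rewrite Cmod_0. }
  destruct (completeness (fun x => exists p, K p /\ x = (- Phi p)%R)) as [m [M1 M2]].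
  { exists 0%R. intros x [p [_ ->]]. specialize (Hpos p). lra. }
  { exists (- Phi p0)%R. now exists p0. }
  assert (Mlb : forall p, K p -> (- m <= Phi p)%R).
  { intros p Hp. specialize (M1 (- Phi p)%R (ex_intro _ p (conj Hp eq_refl))). lra. }
  apply NNPP. intros HN.
  assert (Hgt : forall p, K p -> (- m < Phi p)%R).
  { intros p Hp. destruct (Rle_lt_or_eq_dec _ _ (Mlb p Hp)) as [L|E]; auto.
    exfalso. apply HN. exists p. destruct Hp as [A B]. repeat split; auto.
    intros q Q1 Q2. rewrite <- E. now apply Mlb. }
  destruct (box_uniform (Cmod (fst p0) + Cmod (snd p0) + r1 + r2) (fun x d => K x -> (- m + d <= Phi x)%R))
    as [d [Hd H]].
  - intros x d d' Hd G Kx. specialize (G Kx). lra.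
  - intros t. destruct (classic (K t)) as [Kt|Kt].
    + pose proof (Hgt t Kt) as G. destruct Kt as [A B].
      destruct (Hc t A B ((Phi t + m) / 2)%R ltac:(lra)) as [d [Hd Hd']].
      exists (Rmin d ((Phi t + m) / 2)). split. apply Rmin_pos; lra.
      intros x X1 X2 _. apply Rmin_Rgt_l in X1. apply Rmin_Rgt_l in X2.
      destruct X1 as [X1 _], X2 as [X2 _]. specialize (Hd' x X1 X2). apply Rabs_def2 in Hd'.
      pose proof (Rmin_r d ((Phi t + m) / 2)). lra.
    + apply not_and_or in Kt. destruct Kt as [N|N]; apply Rnot_le_lt in N.
      * exists (Cmod (fst t - fst p0) - r1)%R. split. lra. intros x X1 _ [A _]. exfalso.
        pose proof (Cmod_sub_ge (fst t - fst p0) (fst t - fst x)) as T.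
        rewrite (Cmod_sub_sym (fst t) (fst x)) in T.
        replace (fst t - fst p0 - (fst t - fst x)) with (fst x - fst p0) in T by ring. lra.
      * exists (Cmod (snd t - snd p0) - r2)%R. split. lra. intros x _ X1 [_ A]. exfalso.
        pose proof (Cmod_sub_ge (snd t - snd p0) (snd t - snd x)) as T.
        rewrite (Cmod_sub_sym (snd t) (snd x)) in T.
        replace (snd t - snd p0 - (snd t - snd x)) with (snd x - snd p0) in T by ring. lra.
  - assert (Fin : (m <= m - d)%R); [|lra]. apply M2. intros x [p [Kp ->]].
    assert (G : (- m + d <= Phi p)%R); [|lra]. destruct Kp as [A B].
    pose proof (Cmod_ge_0 (fst p0)). pose proof (Cmod_ge_0 (snd p0)).
    apply H; [| |now split].
    pose proof (Cmod_triangle (fst p - fst p0) (fst p0)).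
    replace (fst p - fst p0 + fst p0) with (fst p) in H2 by ring. lra.
    pose proof (Cmod_triangle (snd p - snd p0) (snd p0)).
    replace (snd p - snd p0 + snd p0) with (snd p) in H2 by ring. lra.
Qed.

Lemma hdiff_continuous (f : C2 -> C) (p : C2) (a b : C) : hdiff f p a b ->
  forall eps, (0 < eps)%R -> exists d : R, (0 < d)%R /\ forall q : C2,
    (Cmod (fst q - fst p) < d)%R -> (Cmod (snd q - snd p) < d)%R ->
    (Cmod (f q - f p) < eps)%R.
Proof.
  intros H eps He. destruct (H 1%R ltac:(lra)) as [d [Hd H']].
  set (K := (Cmod a + Cmod b + 2)%R).
  pose proof (Cmod_ge_0 a). pose proof (Cmod_ge_0 b).
  assert (HK : (0 < K)%R) by (unfold K; lra).
  exists (Rmin d (eps / K)). split. apply Rmin_pos; auto. now apply Rdiv_lt_0_compat.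
  intros q Q1 Q2. apply Rmin_Rgt_l in Q1. apply Rmin_Rgt_l in Q2.
  destruct Q1 as [A1 A2], Q2 as [B1 B2].
  specialize (H' _ _ A1 B1).
  replace (fst p + (fst q - fst p), snd p + (snd q - snd p)) with q in H'
    by (apply injective_projections; simpl; ring).
  set (h := fst q - fst p) in *. set (k := snd q - snd p) in *.
  pose proof (Cmod_triangle (f q - f p - (a * h + b * k)) (a * h + b * k)) as T.
  replace (f q - f p - (a * h + b * k) + (a * h + b * k)) with (f q - f p) in T by ring.
  pose proof (Cmod_triangle (a * h) (b * k)) as T2. rewrite !Cmod_mult in T2.
  pose proof (Cmod_ge_0 h). pose proof (Cmod_ge_0 k).
  assert (Rmax (Cmod h) (Cmod k) < eps / K)%R by (apply Rmax_lub_lt; auto).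
  pose proof (Rmax_l (Cmod h) (Cmod k)). pose proof (Rmax_r (Cmod h) (Cmod k)).
  set (m := Rmax (Cmod h) (Cmod k)) in *.
  apply Rle_lt_trans with (K * m)%R. unfold K. nra.
  replace eps with (K * (eps / K))%R by (field; lra). apply Rmult_lt_compat_l; auto.
Qed.

Lemma open_C2 (S : C2 -> Prop) (p : C2) : open S -> S p ->
  exists d : R, (0 < d)%R /\ forall q : C2,
    (Cmod (fst q - fst p) < d)%R -> (Cmod (snd q - snd p) < d)%R -> S q.
Proof.
  intros HS Hp. destruct (proj1 (locally_C2 S p) (HS p Hp)) as [d [Hd H]].
  exists d. split; auto. intros q Q1 Q2. specialize (H _ _ Q1 Q2).
  replace (fst p + (fst q - fst p), snd p + (snd q - snd p)) with q in H
    by (apply injective_projections; simpl; ring). exact H.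
Qed.

Lemma Cinv_inv (x : C) : / / x = x.
Proof.
  destruct (classic (x = 0)) as [->|H].
  - assert (E : / RtoC 0 = 0) by (apply injective_projections; simpl; unfold Rdiv; ring).
    now rewrite !E.
  - field. auto.
Qed.

(* The distance from [psi] to the target, minimised over a polydisc, is attained at an
   interior point since [psi] is close to the identity; as [psi] is open it must vanish. *)
Lemma cone_surjective (tau : C) (F : C2 -> C2) (Psi : formal_diffeo)
    (sg : C) (S : C2 -> Prop) (psi : C2 -> C2) :
  cone_normalization tau F Psi sg S psi ->
  forall c k M' : R, (0 < c)%R -> (0 < k)%R -> (0 < M')%R ->
  exists M : R, (0 < M)%R /\ forall q : C2,
    (M < Cmod (snd q))%R -> half_plane sg k (snd q) -> annulus c (fst q) ->
    exists p, cone sg (k / 2) (c + 1) M' p /\ S p /\ psi p = q.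
Proof.
  intros HN c k M' Hc Hk HM'.
  destruct (cone_normalization_near_id _ _ _ _ _ _ HN (c + 1) (k / 2) ltac:(lra) ltac:(lra))
    as [M0 [K [HM0 [HK HB]]]].
  destruct HN as [H1 [[HSo [Hol [Hio [g [Hg Hgp]]]]] _]].
  (* Radii of the polydisc around q, in z and in xi. There psi moves z by at most dl / 8 and xi by
     at most rho / 8, so [Phi] is at most 1/4 at the centre and its minimum is reached within half
     the radii, away from the boundary. *)
  set (rho := (8 * K)%R). set (dl := (exp (- c) / 2)%R).
  assert (Hdl : (0 < dl)%R) by (unfold dl; pose proof (exp_pos (- c)); lra).
  pose proof (Cmod_ge_0 sg) as Psg.
  set (r := (Rmin 1 (k / (2 * (k + Cmod sg))))%R).
  assert (Hr : (0 < r <= 1)%R).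
  { split. apply Rmin_pos. lra. apply Rdiv_lt_0_compat; lra. apply Rmin_l. }
  assert (Hr2 : (r * (2 * (k + Cmod sg)) <= k)%R).
  { apply Rle_trans with (k / (2 * (k + Cmod sg)) * (2 * (k + Cmod sg)))%R.
    apply Rmult_le_compat_r. lra. apply Rmin_r. right; field; lra. }
  set (M := (2 * (M0 + M') + rho + rho / r + 8 * K / dl)%R).
  assert (Hrho : (0 < rho)%R) by (unfold rho; lra).
  assert (P1 : (0 < rho / r)%R) by (apply Rdiv_lt_0_compat; lra).
  assert (P2 : (0 < 8 * K / dl)%R) by (apply Rdiv_lt_0_compat; lra).
  exists M. split. unfold M; lra.
  intros q Hq1 Hq2 Hq3.
  assert (Q0 : snd q <> 0) by (apply Cmod_gt_0; unfold M in *; lra).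
  assert (Qc : cone sg k c M (fst q, / snd q)).
  { repeat split; simpl; try apply Hq3.
    apply Cmod_gt_0. rewrite Cmod_inv by auto. apply Rinv_0_lt_compat. unfold M in *; lra.
    now rewrite Cinv_inv. now rewrite Cinv_inv. }
  assert (Box : forall p : C2, (Cmod (fst p - fst q) <= dl)%R -> (Cmod (snd p - snd q) <= rho)%R ->
     snd p <> 0 /\ (M - rho < Cmod (snd p))%R /\
     cone sg (k / 2) (c + 1) (M0 + M') (fst p, / snd p)).
  { intros p A B.
    assert (L : (M - rho < Cmod (snd p))%R).
    { pose proof (Cmod_sub_ge (snd q) (snd q - snd p)) as T.
      replace (snd q - (snd q - snd p)) with (snd p) in T by ring.
      rewrite (Cmod_sub_sym (snd q) (snd p)) in T. lra. }
    assert (N : snd p <> 0) by (apply Cmod_gt_0; unfold M in *; lra).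
    split; auto. split; auto.
    apply (cone_weaken sg (k / 2) _ (c + 1) _ (M / 2)); try lra. unfold M; lra.
    apply (cone_perturb sg k c M r (fst q, / snd q)); auto; simpl; try lra. unfold M; lra.
    apply Cmod_gt_0. rewrite Cmod_inv by auto. apply Rinv_0_lt_compat. unfold M in *; lra.
    rewrite !Cinv_inv. apply Rle_trans with (1 := B).
    apply Rle_trans with (r * (rho / r))%R. right; field; lra.
    apply Rmult_le_compat_l. lra. unfold M in *; lra. }
  set (cl := fun p : C2 => (fst p, / snd p) : C2).
  set (Phi := fun p : C2 => (Cmod (fst (psi (cl p)) - fst q) / dl + Cmod (snd (psi (cl p)) - snd q) / rho)%R).
  assert (BoxB : forall p : C2, (Cmod (fst p - fst q) <= dl)%R -> (Cmod (snd p - snd q) <= rho)%R ->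
     S (cl p) /\ (Cmod (fst (psi (cl p)) - fst p) <= dl / 8)%R /\ (Cmod (snd (psi (cl p)) - snd p) <= K)%R).
  { intros p A B. destruct (Box p A B) as [N [L Hcone]].
    assert (Hcone' : cone sg (k / 2) (c + 1) M0 (cl p)) by (revert Hcone; apply cone_weaken; lra).
    destruct (HB _ Hcone') as [S1 [S2 [_ [S3 _]]]]. simpl in S2, S3. rewrite Cinv_inv in S3.
    split; auto. split; auto. eapply Rle_trans. apply S2.
    rewrite Cmod_inv by auto.
    apply (Rmult_le_reg_r (Cmod (snd p))). now apply Cmod_gt_0.
    rewrite Rmult_assoc, Rinv_l by (apply Rgt_not_eq; now apply Cmod_gt_0).
    apply Rle_trans with (dl / 8 * (8 * K / dl))%R. right; field; lra.
    apply Rmult_le_compat_l. lra. unfold M in *; lra. }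
  assert (Qq : (Cmod (fst q - fst q) <= dl)%R /\ (Cmod (snd q - snd q) <= rho)%R).
  { split; [replace (fst q - fst q) with (RtoC 0) by ring | replace (snd q - snd q) with (RtoC 0) by ring];
    rewrite Cmod_0; lra. }
  assert (Cv : forall a b : R, (0 < b)%R -> (0 <= a)%R -> (0 <= a / b)%R) by (intros; now apply Rdiv_le_0_compat).
  destruct (polydisc_min Phi q dl rho) as [p [Hp1 [Hp2 Hmin]]]; try lra.
  { intros p. unfold Phi. apply Rplus_le_le_0_compat; apply Cv; auto; apply Cmod_ge_0. }
  { intros p A B eps He. destruct (Box p A B) as [N _]. destruct (BoxB p A B) as [S1 _].
    destruct (holo_hdiff _ _ (Hol _ S1)) as [a [b [a' [b' [D1 D2]]]]].
    destruct (hdiff_continuous _ _ _ _ D1 (eps * dl / 2)%R ltac:(nra)) as [e1 [He1 E1]].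
    destruct (hdiff_continuous _ _ _ _ D2 (eps * rho / 2)%R ltac:(nra)) as [e2 [He2 E2]].
    destruct (cdiff_cont _ _ _ (cdiff_inv_id _ N)) as [e3 [He3 E3]].
    set (L := (Cmod (- / (snd p * snd p)) + 1)%R) in *.
    assert (HL : (0 < L)%R) by (unfold L; pose proof (Cmod_ge_0 (- / (snd p * snd p))); lra).
    set (e := Rmin e1 e2). assert (He0 : (0 < e)%R) by (apply Rmin_pos; auto).
    exists (Rmin (Rmin e e3) (e / L)). split. repeat apply Rmin_pos; auto. now apply Rdiv_lt_0_compat.
    intros x X1 X2.
    apply Rmin_Rgt_l in X1. destruct X1 as [X1 _]. apply Rmin_Rgt_l in X1. destruct X1 as [X1 _].
    apply Rmin_Rgt_l in X2. destruct X2 as [X2 X3]. apply Rmin_Rgt_l in X2. destruct X2 as [_ X2].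
    specialize (E3 _ X2). replace (snd p + (snd x - snd p)) with (snd x) in E3 by ring.
    assert (Y : (Cmod (/ snd x - / snd p) < e)%R).
    { eapply Rle_lt_trans. apply E3. replace e with (L * (e / L))%R by (field; lra).
      apply Rmult_lt_compat_l; auto. }
    assert (e <= e1)%R by apply Rmin_l. assert (e <= e2)%R by apply Rmin_r.
    specialize (E1 (cl x)). specialize (E2 (cl x)). simpl in E1, E2.
    specialize (E1 ltac:(lra) ltac:(lra)). specialize (E2 ltac:(lra) ltac:(lra)).
    unfold Phi.
    set (u := fst (psi (cl x))) in *. set (v := snd (psi (cl x))) in *.
    set (u0 := fst (psi (cl p))) in *. set (v0 := snd (psi (cl p))) in *.
    assert (A1 : (Rabs (Cmod (u - fst q) - Cmod (u0 - fst q)) < eps * dl / 2)%R).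
    { apply Rabs_def1.
      pose proof (Cmod_sub_ge (u - fst q) (u0 - fst q)). replace (u - fst q - (u0 - fst q)) with (u - u0) in H2 by ring. lra.
      pose proof (Cmod_sub_ge (u0 - fst q) (u - fst q)). replace (u0 - fst q - (u - fst q)) with (u0 - u) in H2 by ring.
      rewrite (Cmod_sub_sym u0 u) in H2. lra. }
    assert (A2 : (Rabs (Cmod (v - snd q) - Cmod (v0 - snd q)) < eps * rho / 2)%R).
    { apply Rabs_def1.
      pose proof (Cmod_sub_ge (v - snd q) (v0 - snd q)). replace (v - snd q - (v0 - snd q)) with (v - v0) in H2 by ring. lra.
      pose proof (Cmod_sub_ge (v0 - snd q) (v - snd q)). replace (v0 - snd q - (v - snd q)) with (v0 - v) in H2 by ring.
      rewrite (Cmod_sub_sym v0 v) in H2. lra. }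
    replace (Cmod (u - fst q) / dl + Cmod (v - snd q) / rho - (Cmod (u0 - fst q) / dl + Cmod (v0 - snd q) / rho))%R
      with ((Cmod (u - fst q) - Cmod (u0 - fst q)) / dl + (Cmod (v - snd q) - Cmod (v0 - snd q)) / rho)%R
      by (field; lra).
    eapply Rle_lt_trans. apply Rabs_triang. unfold Rdiv. rewrite !Rabs_mult.
    rewrite (Rabs_pos_eq (/ dl)), (Rabs_pos_eq (/ rho)) by (apply Rlt_le, Rinv_0_lt_compat; lra).
    assert ((Rabs (Cmod (u - fst q) - Cmod (u0 - fst q)) * / dl < eps * dl / 2 * / dl)%R)
      by (apply Rmult_lt_compat_r; auto; now apply Rinv_0_lt_compat).
    assert ((Rabs (Cmod (v - snd q) - Cmod (v0 - snd q)) * / rho < eps * rho / 2 * / rho)%R)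
      by (apply Rmult_lt_compat_r; auto; now apply Rinv_0_lt_compat).
    replace (eps * dl / 2 * / dl)%R with (eps / 2)%R in * by (field; lra).
    replace (eps * rho / 2 * / rho)%R with (eps / 2)%R in * by (field; lra). lra. }
  assert (Q1 : (Phi p <= 1 / 4)%R).
  { destruct Qq as [A B]. specialize (Hmin q A B). eapply Rle_trans. apply Hmin.
    destruct (BoxB q A B) as [_ [B1 B2]]. unfold Phi.
    assert (Cmod (fst (psi (cl q)) - fst q) / dl <= 1 / 8)%R.
    { apply (Rmult_le_reg_r dl); auto. replace (Cmod (fst (psi (cl q)) - fst q) / dl * dl)%R
        with (Cmod (fst (psi (cl q)) - fst q)) by (field; lra). lra. }
    assert (Cmod (snd (psi (cl q)) - snd q) / rho <= 1 / 8)%R.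
    { apply (Rmult_le_reg_r rho); auto. replace (Cmod (snd (psi (cl q)) - snd q) / rho * rho)%R
        with (Cmod (snd (psi (cl q)) - snd q)) by (field; lra). unfold rho; lra. }
    lra. }
  destruct (BoxB p Hp1 Hp2) as [Sp [B1 B2]].
  destruct (Box p Hp1 Hp2) as [Np [_ Hcp]].
  exists (cl p). split.
  { revert Hcp. apply cone_weaken; lra. }
  split; auto.
  set (w := psi (cl p)) in *.
  assert (V1 : (Cmod (fst w - fst q) <= dl / 4)%R).
  { assert (0 <= Cmod (snd w - snd q) / rho)%R by (apply Cv; auto; apply Cmod_ge_0).
    unfold Phi in Q1. fold w in Q1. apply (Rmult_le_reg_r (/ dl)). now apply Rinv_0_lt_compat.
    replace (dl / 4 * / dl)%R with (1 / 4)%R by (field; lra). unfold Rdiv in *. lra. }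
  assert (V2 : (Cmod (snd w - snd q) <= rho / 4)%R).
  { assert (0 <= Cmod (fst w - fst q) / dl)%R by (apply Cv; auto; apply Cmod_ge_0).
    unfold Phi in Q1. fold w in Q1. apply (Rmult_le_reg_r (/ rho)). now apply Rinv_0_lt_compat.
    replace (rho / 4 * / rho)%R with (1 / 4)%R by (field; lra). unfold Rdiv in *. lra. }
  assert (W1 : (Cmod (fst p - fst q) <= dl / 2)%R).
  { pose proof (Cmod_sub_le (fst w - fst q) (fst w - fst p)) as T.
    replace (fst w - fst q - (fst w - fst p)) with (fst p - fst q) in T by ring. lra. }
  assert (W2 : (Cmod (snd p - snd q) <= rho / 2)%R).
  { pose proof (Cmod_sub_le (snd w - snd q) (snd w - snd p)) as T.
    replace (snd w - snd q - (snd w - snd p)) with (snd p - snd q) in T by ring.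
    unfold rho in *; lra. }
  apply NNPP. intros Hneq.
  assert (Phi0 : (0 < Phi p)%R).
  { unfold Phi. fold w.
    assert (I1 : (0 <= Cmod (fst w - fst q) / dl)%R) by (apply Cv; auto; apply Cmod_ge_0).
    assert (I2 : (0 <= Cmod (snd w - snd q) / rho)%R) by (apply Cv; auto; apply Cmod_ge_0).
    destruct (Req_dec (Cmod (fst w - fst q)) 0) as [Z1|Z1].
    - destruct (Req_dec (Cmod (snd w - snd q)) 0) as [Z2|Z2].
      + exfalso. apply Hneq. apply Cmod_eq_0 in Z1. apply Cmod_eq_0 in Z2.
        apply injective_projections.
        replace (fst w) with (fst w - fst q + fst q) by ring. rewrite Z1. ring.
        replace (snd w) with (snd w - snd q + snd q) by ring. rewrite Z2. ring.
      + assert (0 < Cmod (snd w - snd q) / rho)%R.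
        { apply Rdiv_lt_0_compat; auto. pose proof (Cmod_ge_0 (snd w - snd q)). lra. } lra.
    - assert (0 < Cmod (fst w - fst q) / dl)%R.
      { apply Rdiv_lt_0_compat; auto. pose proof (Cmod_ge_0 (fst w - fst q)). lra. } lra. }
  assert (Iw : image S psi w) by (exists (cl p); auto).
  destruct (open_C2 _ _ Hio Iw) as [d1 [Hd1 O1]].
  destruct (holo_hdiff _ _ (Hg _ Iw)) as [a [b [a' [b' [D1 D2]]]]].
  assert (Egw : g w = cl p) by (unfold w; now apply Hgp).
  destruct (cdiff_cont _ _ _ (cdiff_inv_id (/ snd p) ltac:(apply Cmod_gt_0; rewrite Cmod_inv by auto;
     apply Rinv_0_lt_compat; now apply Cmod_gt_0))) as [e3 [He3 E3]].
  set (L := (Cmod (- / (/ snd p * / snd p)) + 1)%R) in *.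
  assert (HL : (0 < L)%R) by (unfold L; pose proof (Cmod_ge_0 (- / (/ snd p * / snd p))); lra).
  destruct (hdiff_continuous _ _ _ _ D1 (dl / 2)%R ltac:(lra)) as [e1 [He1 E1]].
  destruct (hdiff_continuous _ _ _ _ D2 (Rmin e3 (rho / 2 / L))%R) as [e2 [He2 E2]].
  { apply Rmin_pos; auto. apply Rdiv_lt_0_compat; lra. }
  set (e := Rmin d1 (Rmin e1 e2)). assert (He : (0 < e)%R) by (repeat apply Rmin_pos; auto).
  assert (e <= d1)%R by apply Rmin_l.
  assert (e <= e1)%R by (eapply Rle_trans; [apply Rmin_r | apply Rmin_l]).
  assert (e <= e2)%R by (eapply Rle_trans; [apply Rmin_r | apply Rmin_r]).
  set (A := (Cmod (fst w - fst q) + Cmod (snd w - snd q) + 1)%R).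
  pose proof (Cmod_ge_0 (fst w - fst q)). pose proof (Cmod_ge_0 (snd w - snd q)).
  (* The value w is moved towards q by the fraction s. Openness of the image provides a preimage,
     and continuity of g keeps it in the polydisc, where [Phi] would be multiplied by 1 - s. *)
  set (s := Rmin (1 / 2) (e / (2 * A))).
  assert (HA : (0 < A)%R) by (unfold A; lra).
  assert (Hs : (0 < s)%R) by (apply Rmin_pos; [lra | apply Rdiv_lt_0_compat; lra]).
  assert (Hs1 : (s <= 1 / 2)%R) by apply Rmin_l.
  assert (Hs2 : (s * A < e)%R).
  { apply Rle_lt_trans with (e / (2 * A) * A)%R. apply Rmult_le_compat_r. lra. apply Rmin_r.
    replace (e / (2 * A) * A)%R with (e / 2)%R by (field; lra). lra. }
  set (w' := (fst w - RtoC s * (fst w - fst q), snd w - RtoC s * (snd w - snd q)) : C2).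
  assert (Y1 : (Cmod (fst w' - fst w) < e)%R).
  { simpl. replace (fst w - RtoC s * (fst w - fst q) - fst w) with (- (RtoC s * (fst w - fst q))) by ring.
    rewrite Cmod_opp, Cmod_mult, Cmod_R, Rabs_pos_eq by lra. unfold A in *; nra. }
  assert (Y2 : (Cmod (snd w' - snd w) < e)%R).
  { simpl. replace (snd w - RtoC s * (snd w - snd q) - snd w) with (- (RtoC s * (snd w - snd q))) by ring.
    rewrite Cmod_opp, Cmod_mult, Cmod_R, Rabs_pos_eq by lra. unfold A in *; nra. }
  destruct (O1 w' ltac:(lra) ltac:(lra)) as [p' [Sp' Ep']].
  assert (Egw' : g w' = p') by (rewrite <- Ep'; now apply Hgp).
  specialize (E1 w' ltac:(lra) ltac:(lra)). specialize (E2 w' ltac:(lra) ltac:(lra)).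
  rewrite Egw, Egw' in E1, E2. simpl in E1, E2.
  assert (Np' : snd p' <> 0) by apply (H1 p' Sp').
  set (p2 := (fst p', / snd p') : C2).
  assert (Ecl : cl p2 = p').
  { unfold cl, p2. simpl. rewrite Cinv_inv. now destruct p'. }
  apply Rmin_Rgt_l in E2. destruct E2 as [E2 E4]. specialize (E3 _ E2).
  replace (/ snd p + (snd p' - / snd p)) with (snd p') in E3 by ring.
  rewrite Cinv_inv in E3.
  assert (X2 : (Cmod (snd p2 - snd p) < rho / 2)%R).
  { simpl. eapply Rle_lt_trans. apply E3. replace (rho / 2)%R with (L * (rho / 2 / L))%R by (field; lra).
    apply Rmult_lt_compat_l; auto. }
  assert (Z1 : (Cmod (fst p2 - fst q) <= dl)%R).
  { pose proof (Cmod_triangle (fst p2 - fst p) (fst p - fst q)) as T.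
    replace (fst p2 - fst p + (fst p - fst q)) with (fst p2 - fst q) in T by ring. simpl in *. lra. }
  assert (Z2 : (Cmod (snd p2 - snd q) <= rho)%R).
  { pose proof (Cmod_triangle (snd p2 - snd p) (snd p - snd q)) as T.
    replace (snd p2 - snd p + (snd p - snd q)) with (snd p2 - snd q) in T by ring. lra. }
  specialize (Hmin p2 Z1 Z2).
  assert (EPhi : Phi p2 = ((1 - s) * Phi p)%R).
  { unfold Phi. rewrite Ecl, Ep'. fold w. simpl.
    replace (fst w - RtoC s * (fst w - fst q) - fst q) with (RtoC (1 - s) * (fst w - fst q))
      by (rewrite RtoC_minus; ring).
    replace (snd w - RtoC s * (snd w - snd q) - snd q) with (RtoC (1 - s) * (snd w - snd q))
      by (rewrite RtoC_minus; ring).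
    rewrite !Cmod_mult, !Cmod_R, !Rabs_pos_eq by lra. field. lra. }
  rewrite EPhi in Hmin. nra.
Qed.

(** * Holomorphic functions of two variables *)

Lemma hdiff_comp2 (G f g : C2 -> C) (p : C2) (A B a b c d : C) :
  hdiff G (f p, g p) A B -> hdiff f p a b -> hdiff g p c d ->
  hdiff (fun q => G (f q, g q)) p (A * a + B * c) (A * b + B * d).
Proof.
  intros HG Hf Hg eps He.
  set (K := (Cmod a + Cmod b + Cmod c + Cmod d + 2)%R).
  set (N := (Cmod A + Cmod B + 1)%R).
  pose proof (Cmod_ge_0 a) as Pa. pose proof (Cmod_ge_0 b) as Pb. pose proof (Cmod_ge_0 c) as Pc.
  pose proof (Cmod_ge_0 d) as Pd. pose proof (Cmod_ge_0 A) as PA. pose proof (Cmod_ge_0 B) as PB.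
  assert (HK : (0 < K)%R) by (unfold K; lra). assert (HN : (0 < N)%R) by (unfold N; lra).
  destruct (HG (eps / (2 * K))%R ltac:(apply Rdiv_lt_0_compat; lra)) as [d1 [Hd1 H1]].
  set (e := Rmin 1 (eps / (2 * N))).
  assert (He0 : (0 < e)%R) by (apply Rmin_pos; [lra | apply Rdiv_lt_0_compat; lra]).
  assert (He1 : (e <= 1)%R) by apply Rmin_l. assert (He2 : (e <= eps / (2 * N))%R) by apply Rmin_r.
  destruct (Hf e He0) as [d2 [Hd2 H2]]. destruct (Hg e He0) as [d3 [Hd3 H3]].
  exists (Rmin (Rmin d2 d3) (d1 / (2 * K)))%R. split.
  repeat apply Rmin_pos; auto. apply Rdiv_lt_0_compat; lra.
  intros h k Hh Hk.
  apply Rmin_Rgt_l in Hh. destruct Hh as [Hh h1]. apply Rmin_Rgt_l in Hh. destruct Hh as [h2 h3].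
  apply Rmin_Rgt_l in Hk. destruct Hk as [Hk k1]. apply Rmin_Rgt_l in Hk. destruct Hk as [k2 k3].
  specialize (H2 h k h2 k2). specialize (H3 h k h3 k3).
  set (q := (fst p + h, snd p + k)) in *.
  set (u := f q - f p) in *. set (v := g q - g p) in *.
  set (m := (Cmod h + Cmod k)%R) in *.
  pose proof (Cmod_ge_0 h) as Ph. pose proof (Cmod_ge_0 k) as Pk.
  assert (Pm : (0 <= m)%R) by (unfold m; lra).
  assert (Tu : (Cmod u <= (Cmod a + Cmod b + 1) * m)%R).
  { pose proof (Cmod_triangle (u - (a * h + b * k)) (a * h + b * k)) as T.
    replace (u - (a * h + b * k) + (a * h + b * k)) with u in T by ring.
    pose proof (Cmod_triangle (a * h) (b * k)) as T2. rewrite !Cmod_mult in T2.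
    assert (Cmod a * Cmod h + Cmod b * Cmod k <= (Cmod a + Cmod b) * m)%R by (unfold m; nra).
    assert (e * m <= 1 * m)%R by (apply Rmult_le_compat_r; auto). lra. }
  assert (Tv : (Cmod v <= (Cmod c + Cmod d + 1) * m)%R).
  { pose proof (Cmod_triangle (v - (c * h + d * k)) (c * h + d * k)) as T.
    replace (v - (c * h + d * k) + (c * h + d * k)) with v in T by ring.
    pose proof (Cmod_triangle (c * h) (d * k)) as T2. rewrite !Cmod_mult in T2.
    assert (Cmod c * Cmod h + Cmod d * Cmod k <= (Cmod c + Cmod d) * m)%R by (unfold m; nra).
    assert (e * m <= 1 * m)%R by (apply Rmult_le_compat_r; auto). lra. }
  assert (Tuv : (Cmod u + Cmod v <= K * m)%R) by (unfold K; lra).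
  assert (Km : (K * m < d1)%R).
  { assert (m < d1 / K)%R.
    { unfold m. replace (d1 / K)%R with (d1 / (2 * K) + d1 / (2 * K))%R by (field; lra). lra. }
    replace d1 with (K * (d1 / K))%R by (field; lra). apply Rmult_lt_compat_l; auto. }
  pose proof (Cmod_ge_0 u) as Pu. pose proof (Cmod_ge_0 v) as Pv.
  specialize (H1 u v ltac:(lra) ltac:(lra)). simpl in H1.
  replace (f p + u) with (f q) in H1 by (unfold u; ring).
  replace (g p + v) with (g q) in H1 by (unfold v; ring).
  replace (G (f q, g q) - G (f p, g p) - ((A * a + B * c) * h + (A * b + B * d) * k))
    with ((G (f q, g q) - G (f p, g p) - (A * u + B * v))
          + (A * (u - (a * h + b * k)) + B * (v - (c * h + d * k)))) by ring.
  eapply Rle_trans. apply Cmod_triangle.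
  pose proof (Cmod_triangle (A * (u - (a * h + b * k))) (B * (v - (c * h + d * k)))) as T.
  rewrite !Cmod_mult in T.
  assert (E1 : (eps / (2 * K) * (Cmod u + Cmod v) <= eps / 2 * m)%R).
  { apply Rle_trans with (eps / (2 * K) * (K * m))%R.
    apply Rmult_le_compat_l; auto. apply Rlt_le, Rdiv_lt_0_compat; lra.
    right. field. lra. }
  assert (E2 : (e * m <= eps / (2 * N) * m)%R) by (apply Rmult_le_compat_r; auto).
  assert (E3 : (eps / (2 * N) * m * N = eps / 2 * m)%R) by (field; lra).
  assert (Cmod A * Cmod (u - (a * h + b * k)) <= Cmod A * (eps / (2 * N) * m))%R
    by (apply Rmult_le_compat_l; auto; lra).
  assert (Cmod B * Cmod (v - (c * h + d * k)) <= Cmod B * (eps / (2 * N) * m))%R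
    by (apply Rmult_le_compat_l; auto; lra).
  assert (0 <= eps / (2 * N) * m)%R by (apply Rmult_le_pos; auto; apply Rlt_le, Rdiv_lt_0_compat; lra).
  unfold N in E3 at 2. lra.
Qed.

Lemma hdiff_of_cdiff_fst (f : C -> C) (p : C2) (l : C) : cdiff f (fst p) l ->
  hdiff (fun q => f (fst q)) p l 0.
Proof.
  intros H eps He. destruct (H eps He) as [d [Hd H']]. exists d. split; auto.
  intros h k Hh _. simpl. specialize (H' h Hh). replace (l * h + 0 * k) with (l * h) by ring.
  pose proof (Cmod_ge_0 k). nra.
Qed.

Lemma hdiff_of_cdiff_snd (f : C -> C) (p : C2) (l : C) : cdiff f (snd p) l ->
  hdiff (fun q => f (snd q)) p 0 l.
Proof.
  intros H eps He. destruct (H eps He) as [d [Hd H']]. exists d. split; auto.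
  intros h k _ Hk. simpl. specialize (H' k Hk). replace (0 * h + l * k) with (l * k) by ring.
  pose proof (Cmod_ge_0 h). nra.
Qed.

(** Since [C_derive] is total, [dz] and [dy] name the partial derivatives without an existential. *)
Definition hd (f : C2 -> C) (p : C2) : Prop := hdiff f p (dz f p) (dy f p).

Lemma hd_intro (f : C2 -> C) (p : C2) (a b : C) : hdiff f p a b -> hd f p.
Proof. intros H. unfold hd. now rewrite (hdiff_dz _ _ _ _ H), (hdiff_dy _ _ _ _ H). Qed.

Lemma holo_hd (f : C2 -> C2) (p : C2) : holo_at f p ->
  hd (fun q => fst (f q)) p /\ hd (fun q => snd (f q)) p.
Proof.
  intros H. destruct (holo_hdiff f p H) as [a [b [c [d [A B]]]]].
  split; eapply hd_intro; eauto.
Qed.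

Lemma hdiff_plus (f g : C2 -> C) (p : C2) (a b c d : C) :
  hdiff f p a b -> hdiff g p c d -> hdiff (fun q => f q + g q) p (a + c) (b + d).
Proof.
  intros Hf Hg. replace (a + c) with (1 * a + 1 * c) by ring. replace (b + d) with (1 * b + 1 * d) by ring.
  apply (hdiff_comp2 (fun q => fst q + snd q) f g); auto. apply hdiff_plus_op.
Qed.

Lemma hdiff_mult (f g : C2 -> C) (p : C2) (a b c d : C) :
  hdiff f p a b -> hdiff g p c d ->
  hdiff (fun q => f q * g q) p (g p * a + f p * c) (g p * b + f p * d).
Proof.
  intros Hf Hg. apply (hdiff_comp2 (fun q => fst q * snd q) f g); auto.
  apply (hdiff_mult_op (f p, g p)).
Qed.

Lemma hdiff_id_fst (p : C2) : hdiff fst p 1 0.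
Proof. exact (hdiff_of_cdiff_fst (fun x => x) p 1 (cdiff_id _)). Qed.

Lemma hdiff_id_snd (p : C2) : hdiff snd p 0 1.
Proof. exact (hdiff_of_cdiff_snd (fun x => x) p 1 (cdiff_id _)). Qed.

Lemma hdiff_minus (f g : C2 -> C) (p : C2) (a b c d : C) :
  hdiff f p a b -> hdiff g p c d -> hdiff (fun q => f q - g q) p (a - c) (b - d).
Proof.
  intros Hf Hg eps He. 
  destruct (Hf (eps / 2)%R ltac:(lra)) as [d1 [Hd1 H1]].
  destruct (Hg (eps / 2)%R ltac:(lra)) as [d2 [Hd2 H2]].
  exists (Rmin d1 d2). split. now apply Rmin_pos.
  intros h k Hh Hk. apply Rmin_Rgt_l in Hh. apply Rmin_Rgt_l in Hk.
  specialize (H1 h k ltac:(lra) ltac:(lra)). specialize (H2 h k ltac:(lra) ltac:(lra)).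
  set (q := (fst p + h, snd p + k)) in *.
  replace (f q - g q - (f p - g p) - ((a - c) * h + (b - d) * k))
    with ((f q - f p - (a * h + b * k)) - (g q - g p - (c * h + d * k))) by ring.
  eapply Rle_trans. apply Cmod_sub_le. lra.
Qed.

Lemma hdiff_inv (f : C2 -> C) (p : C2) (a b : C) : f p <> 0 -> hdiff f p a b ->
  hdiff (fun q => / f q) p (- a / (f p * f p)) (- b / (f p * f p)).
Proof.
  intros Hn Hf.
  pose proof (hdiff_comp2 (fun q => / fst q) f f p (- / (f p * f p)) 0 a b a b
    (hdiff_of_cdiff_fst (fun x => / x) (f p, f p) _ (cdiff_inv_id _ Hn)) Hf Hf) as H.
  simpl in H. unfold Cdiv.
  replace (- a * / (f p * f p)) with (- / (f p * f p) * a + 0 * a) by ring.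
  replace (- b * / (f p * f p)) with (- / (f p * f p) * b + 0 * b) by ring. exact H.
Qed.

Lemma sum_n_m_monomials_hdiff (co : nat -> C -> C) (m N : nat) (p : C2) :
  (forall n, (m <= n)%nat -> exists l, cdiff (co n) (fst p) l) ->
  exists a b, hdiff (fun q => sum_n_m (fun n => co n (fst q) * snd q ^ n) m N) p a b.
Proof.
  intros Hco.
  assert (Z : exists a b, hdiff (fun _ : C2 => 0) p a b).
  { exists 0, 0. apply (hdiff_of_cdiff_fst (fun _ => 0)). apply cdiff_const. }
  assert (Ext : forall f g : C2 -> C, (forall q, f q = g q) ->
     (exists a b, hdiff f p a b) -> exists a b, hdiff g p a b).
  { intros f g E [a [b H]]. exists a, b. intros eps He. destruct (H eps He) as [d [Hd H']].
    exists d. split; auto. intros h k Hh Hk. rewrite <- !E. auto. }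
  assert (T : forall n, (m <= n)%nat -> exists a b, hdiff (fun q => co n (fst q) * snd q ^ n) p a b).
  { intros n Hn. destruct (Hco n Hn) as [l Hl]. destruct (cdiff_pow n (snd p)) as [l' Hl'].
    eexists. eexists. apply (hdiff_mult (fun q => co n (fst q)) (fun q => snd q ^ n)).
    apply (hdiff_of_cdiff_fst (co n)); eauto. apply (hdiff_of_cdiff_snd (fun x => x ^ n)); eauto. }
  induction N as [|N IH].
  - destruct m as [|m].
    + revert T. intros T. generalize (T O (le_n _)). apply Ext. intros q. now rewrite sum_n_n.
    + revert Z. apply Ext. intros q. now rewrite sum_n_m_zero by lia.
  - destruct (Nat.le_gt_cases m (S N)) as [L|L].
    + destruct IH as [a [b IH]]. destruct (T (S N) L) as [a' [b' H']].
      assert (Hs : exists a b, hdiff (fun q => sum_n_m (fun n => co n (fst q) * snd q ^ n) m N + co (S N) (fst q) * snd q ^ S N) p a b).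
      { eexists. eexists. apply (hdiff_plus _ (fun q => co (S N) (fst q) * snd q ^ S N)); eauto. }
      revert Hs. apply Ext. intros q. now rewrite sum_n_Sm by lia.
    + revert Z. apply Ext. intros q. now rewrite sum_n_m_zero by lia.
Qed.

Lemma jet_hd (Psi : formal_diffeo) (N : nat) (p : C2) : fst p <> 0 ->
  hd (fun q => fst (jet Psi N q)) p /\ hd (fun q => snd (jet Psi N q)) p.
Proof.
  intros Hz.
  destruct (sum_n_m_monomials_hdiff (fd_a Psi) 1 N p) as [a [b H]].
  { intros n Hn. destruct (fd_a_holo Psi n (fst p) Hn Hz) as [l Hl]. exists l. now apply cdiff_derive. }
  destruct (sum_n_m_monomials_hdiff (fd_b Psi) 2 N p) as [a' [b' H']].
  { intros n Hn. destruct (fd_b_holo Psi n (fst p) Hn Hz) as [l Hl]. exists l. now apply cdiff_derive. }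
  split; eapply hd_intro.
  exact (hdiff_plus _ _ _ _ _ _ _ (hdiff_id_fst p) H).
  exact (hdiff_plus _ _ _ _ _ _ _ (hdiff_id_snd p) H').
Qed.

(** Cauchy's estimate applies in z on discs of fixed radius exp (- c) / 2, but in y only on discs of
    radius r |y|: a derivative in y costs a factor |y|, and |y|^n grows by at most 2^n on such a
    disc. The constant is the same for all f, M and B. *)
Lemma cone_cauchy (sg : C) (k c : R) (n : nat) : (0 < k)%R -> (0 < c)%R ->
  exists K : R, (0 < K)%R /\ forall (f : C2 -> C) (M B : R), (0 < M)%R ->
    (forall p, cone sg (k / 2) (c + 1) (M / 2) p -> hd f p /\ (Cmod (f p) <= B * Cmod (snd p) ^ n)%R) ->
    forall p, cone sg k c M p ->
      (Cmod (dz f p) <= K * B * Cmod (snd p) ^ n)%R /\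
      (Cmod (dy f p) * Cmod (snd p) <= K * B * Cmod (snd p) ^ n)%R.
Proof.
  intros Hk Hc. pose proof (Cmod_ge_0 sg) as Psg.
  set (r := (Rmin (1 / 2) (k / (2 * (k + Cmod sg))))%R).
  assert (Hr : (0 < r)%R) by (apply Rmin_pos; [lra | apply Rdiv_lt_0_compat; lra]).
  assert (Hr1 : (r <= 1 / 2)%R) by apply Rmin_l.
  assert (Hr2 : (r * (2 * (k + Cmod sg)) <= k)%R).
  { apply Rle_trans with (k / (2 * (k + Cmod sg)) * (2 * (k + Cmod sg)))%R.
    apply Rmult_le_compat_r. lra. apply Rmin_r. right; field; lra. }
  set (dl := (exp (- c) / 2)%R).
  assert (Hdl : (0 < dl)%R) by (unfold dl; pose proof (exp_pos (- c)); lra).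
  assert (P2n : (0 < 2 ^ n)%R) by (apply pow_lt; lra).
  exists (4 / dl + 4 * 2 ^ n / r)%R. split.
  { apply Rplus_lt_0_compat; apply Rdiv_lt_0_compat; lra. }
  intros f M B HM H [z y] Hp.
  destruct (cone_y sg k c M (z, y) HM Hp) as [[Y1 Y2] Y3]. simpl in Y1, Y2, Y3.
  assert (N : y <> 0) by apply Hp.
  assert (Pn : (0 < Cmod y ^ n)%R) by (now apply pow_lt).
  assert (Hs : forall z' y', (Cmod (z' - z) <= dl)%R -> (Cmod (y' - y) <= r * Cmod y)%R ->
     cone sg (k / 2) (c + 1) (M / 2) (z', y')).
  { intros z' y' A A'.
    assert (Ny : y' <> 0).
    { apply Cmod_gt_0. pose proof (Cmod_sub_ge y (y - y')) as T.
      replace (y - (y - y')) with y' in T by ring. rewrite (Cmod_sub_sym y y') in T. nra. }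
    apply (cone_perturb sg k c M r (z, y)); auto; simpl; try lra.
    replace (/ y' - / y) with ((y - y') / y * / y') by (field; auto).
    rewrite Cmod_mult. apply Rmult_le_compat_r. apply Cmod_ge_0.
    rewrite Cmod_div by auto. rewrite Cmod_sub_sym.
    apply (Rmult_le_reg_r (Cmod y)); auto.
    replace (Cmod (y' - y) / Cmod y * Cmod y)%R with (Cmod (y' - y)) by (field; lra). exact A'. }
  assert (Zz : (Cmod (z - z) <= dl)%R) by (replace (z - z) with (RtoC 0) by ring; rewrite Cmod_0; lra).
  assert (Zy : (Cmod (y - y) <= r * Cmod y)%R) by (replace (y - y) with (RtoC 0) by ring; rewrite Cmod_0; nra).
  assert (B0 : (0 <= B)%R).
  { destruct (H _ (Hs z y Zz Zy)) as [_ T]. simpl in T.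
    pose proof (Cmod_ge_0 (f (z, y))). apply (Rmult_le_reg_r (Cmod y ^ n)); auto. lra. }
  assert (BP : (0 <= B * Cmod y ^ n)%R) by (apply Rmult_le_pos; lra).
  destruct (H _ (Hs z y Zz Zy)) as [Hd _].
  simpl. split.
  - apply Rle_trans with (4 * (B * Cmod y ^ n) / dl)%R.
    + apply (cauchy_estimate (fun x => f (x, y)) z); auto.
      * intros x Hx. destruct (H _ (Hs x y (Rlt_le _ _ Hx) Zy)) as [D _]. eexists. apply (hdiff_fst _ _ _ _ _ D).
      * intros x Hx. apply (H _ (Hs x y (Rlt_le _ _ Hx) Zy)).
      * apply (hdiff_fst _ _ _ _ _ Hd).
    + assert (0 < 4 * 2 ^ n / r)%R by (apply Rdiv_lt_0_compat; lra).
      replace (4 * (B * Cmod y ^ n) / dl)%R with (4 / dl * (B * Cmod y ^ n))%R by (field; lra).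
      rewrite Rmult_assoc. apply Rmult_le_compat_r; lra.
  - assert (T : (Cmod (dy f (z, y)) <= 4 * (B * (2 * Cmod y) ^ n) / (r * Cmod y))%R).
    { apply (cauchy_estimate (fun x => f (z, x)) y). nra.
      * intros x Hx. destruct (H _ (Hs z x Zz (Rlt_le _ _ Hx))) as [D _]. eexists. apply (hdiff_snd _ _ _ _ _ D).
      * intros x Hx. destruct (H _ (Hs z x Zz (Rlt_le _ _ Hx))) as [_ D]. simpl in D.
        eapply Rle_trans. apply D. apply Rmult_le_compat_l; auto. apply pow_incr. split. apply Cmod_ge_0.
        pose proof (Cmod_triangle (x - y) y) as T. replace (x - y + y) with x in T by ring. nra.
      * apply (hdiff_snd _ _ _ _ _ Hd). }
    apply (Rmult_le_compat_r (Cmod y)) in T. 2: lra.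
    eapply Rle_trans. apply T. rewrite Rpow_mult_distr.
    replace (4 * (B * (2 ^ n * Cmod y ^ n)) / (r * Cmod y) * Cmod y)%R
      with (4 * 2 ^ n / r * (B * Cmod y ^ n))%R by (field; lra).
    assert (0 < 4 / dl)%R by (apply Rdiv_lt_0_compat; lra).
    rewrite Rmult_assoc. apply Rmult_le_compat_r; lra.
Qed.

(** * Derivatives of the sectorial normalizations *)

(** The target is read in the coordinate y = 1 / xi, for comparison with [jet]. *)
Definition flip (psi : C2 -> C2) (p : C2) : C2 := (fst (psi p), / snd (psi p)).

(** A second, independent member of the pencil: F_oo for finite t and F_0 for t = oo. Slopes are
    measured with respect to this pair. *)
Definition other_member (t : P1) : P1 :=
  match t with Some _ => None | None => Some (RtoC 0) end.

Lemma flip_hd (S : C2 -> Prop) (psi : C2 -> C2) (p : C2) :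
  biholo_on S psi -> S p -> snd (psi p) <> 0 ->
  hd (fun q => fst (psi q)) p /\ hd (fun q => snd (psi q)) p /\ hd (fun q => / snd (psi q))%C p.
Proof.
  intros [_ [H _]] Hp Hn. destruct (holo_hd _ _ (H p Hp)) as [A B]. repeat split; auto.
  eapply hd_intro. apply (hdiff_inv (fun q => snd (psi q))); eauto.
Qed.

Lemma cone_nonzero (sg : C) (k c M : R) (p : C2) : cone sg k c M p -> fst p <> 0 /\ snd p <> 0.
Proof.
  intros [H1 [_ [_ [H2 _]]]]. split; auto. apply Cmod_gt_0. pose proof (exp_pos (- c)). lra.
Qed.

Lemma normalization_derivatives (tau : C) (F : C2 -> C2) (Psi : formal_diffeo)
    (sg : C) (S : C2 -> Prop) (psi : C2 -> C2) :
  cone_normalization tau F Psi sg S psi ->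
  forall c k : R, (0 < c)%R -> (0 < k)%R ->
  exists M K : R, (0 < M)%R /\ (0 < K)%R /\ forall p, cone sg k c M p -> S p /\
    (Cmod (fst (psi p) - fst p) <= K * Cmod (snd p))%R /\
    (Cmod (/ snd (psi p) - snd p) <= K * Cmod (snd p) ^ 2)%R /\
    (Cmod (dz (fun q => fst (psi q)) p - 1) <= K * Cmod (snd p))%R /\
    (Cmod (dy (fun q => fst (psi q)) p) <= K)%R /\
    (Cmod (dz (fun q => / snd (psi q))%C p) <= K * Cmod (snd p) ^ 2)%R /\
    (Cmod (dy (fun q => / snd (psi q))%C p - 1) <= K * Cmod (snd p))%R.
Proof.
  intros HN c k Hc Hk.
  destruct (cone_normalization_near_id _ _ _ _ _ _ HN (c + 1) (k / 2) ltac:(lra) ltac:(lra))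
    as [M0 [K0 [HM0 [HK0 HB]]]].
  destruct HN as [H1 [HS _]].
  destruct (cone_cauchy sg k c 1 Hk Hc) as [K1 [HK1 H1c]].
  destruct (cone_cauchy sg k c 2 Hk Hc) as [K2 [HK2 H2c]].
  set (K := (K0 + K1 * K0 + K2 * K0)%R).
  assert (HK10 : (0 < K1 * K0)%R) by nra. assert (HK20 : (0 < K2 * K0)%R) by nra.
  exists (2 * M0)%R, K. split. lra. split. unfold K; lra.
  assert (A1 := H1c (fun q => fst (psi q) - fst q) (2 * M0)%R K0 ltac:(lra)).
  assert (A2 := H2c (fun q => / snd (psi q) - snd q) (2 * M0)%R K0 ltac:(lra)).
  replace (2 * M0 / 2)%R with M0 in A1, A2 by field.
  assert (Hhd : forall q, cone sg (k / 2) (c + 1) M0 q ->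
    hdiff (fun q => fst (psi q) - fst q) q (dz (fun q => fst (psi q)) q - 1) (dy (fun q => fst (psi q)) q - 0) /\
    hdiff (fun q => / snd (psi q) - snd q) q (dz (fun q => / snd (psi q))%C q - 0) (dy (fun q => / snd (psi q))%C q - 1)).
  { intros q Hq. destruct (HB q Hq) as [Sq _]. destruct (H1 q Sq) as [_ [_ N]].
    destruct (flip_hd S psi q HS Sq N) as [D1 [_ D3]]. split.
    apply (hdiff_minus (fun q => fst (psi q)) fst); auto. apply hdiff_id_fst.
    apply (hdiff_minus (fun q => / snd (psi q))%C snd); auto. apply hdiff_id_snd. }
  specialize (A1 ltac:(intros q Hq; split; [eapply hd_intro; apply (Hhd q Hq) | rewrite pow_1; apply (HB q Hq)])).
  specialize (A2 ltac:(intros q Hq; split; [eapply hd_intro; apply (Hhd q Hq) | apply (HB q Hq)])).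
  intros p Hp.
  assert (Hp' : cone sg (k / 2) (c + 1) M0 p) by (revert Hp; apply cone_weaken; lra).
  destruct (HB p Hp') as [Sp [B1 [B2 _]]]. destruct (Hhd p Hp') as [E1 E2].
  destruct (A1 p Hp) as [C1 C1']. destruct (A2 p Hp) as [C2 C2'].
  rewrite (hdiff_dz _ _ _ _ E1), pow_1 in C1. rewrite (hdiff_dy _ _ _ _ E1), pow_1 in C1'.
  rewrite (hdiff_dz _ _ _ _ E2) in C2. rewrite (hdiff_dy _ _ _ _ E2) in C2'.
  destruct (cone_y sg k c (2 * M0) p ltac:(lra) Hp) as [[Y1 Y2] _].
  set (y := Cmod (snd p)) in *.
  split; auto.
  assert (0 <= y ^ 2)%R by (apply pow2_ge_0).
  split. eapply Rle_trans. apply B1. apply Rmult_le_compat_r; unfold K; lra.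
  split. eapply Rle_trans. apply B2. apply Rmult_le_compat_r; unfold K; lra.
  split. eapply Rle_trans. apply C1. apply Rmult_le_compat_r; unfold K; lra.
  split. apply (Rmult_le_reg_r y); auto.
  replace (dy (fun q => fst (psi q)) p - 0) with (dy (fun q => fst (psi q)) p) in C1' by ring.
  eapply Rle_trans. apply C1'. apply Rmult_le_compat_r; unfold K; lra.
  split. replace (dz (fun q => / snd (psi q))%C p - 0) with (dz (fun q => / snd (psi q))%C p) in C2 by ring.
  eapply Rle_trans. apply C2. apply Rmult_le_compat_r; unfold K; lra.
  apply (Rmult_le_reg_r y); auto. eapply Rle_trans. apply C2'.
  replace (K2 * K0 * y ^ 2)%R with (K2 * K0 * y * y)%R by ring.
  apply Rmult_le_compat_r. lra. apply Rmult_le_compat_r; unfold K; lra.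
Qed.

(** The jet of order N is exact up to O(y^(N+1)), which absorbs the order lost by the derivative in
    y. *)
Lemma normalization_jet_derivatives (tau : C) (F : C2 -> C2) (Psi : formal_diffeo)
    (sg : C) (S : C2 -> Prop) (psi : C2 -> C2) :
  cone_normalization tau F Psi sg S psi ->
  forall (N : nat) (c k : R), (0 < c)%R -> (0 < k)%R ->
  exists M K : R, (0 < M)%R /\ (0 < K)%R /\ forall p, cone sg k c M p ->
    (Cmod (fst (psi p) - fst (jet Psi N p)) <= K * Cmod (snd p) ^ N)%R /\
    (Cmod (/ snd (psi p) - snd (jet Psi N p)) <= K * Cmod (snd p) ^ N)%R /\
    (Cmod (dz (fun q => fst (psi q)) p - dz (fun q => fst (jet Psi N q)) p) <= K * Cmod (snd p) ^ N)%R /\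
    (Cmod (dy (fun q => fst (psi q)) p - dy (fun q => fst (jet Psi N q)) p) <= K * Cmod (snd p) ^ N)%R /\
    (Cmod (dz (fun q => / snd (psi q))%C p - dz (fun q => snd (jet Psi N q)) p) <= K * Cmod (snd p) ^ N)%R /\
    (Cmod (dy (fun q => / snd (psi q))%C p - dy (fun q => snd (jet Psi N q)) p) <= K * Cmod (snd p) ^ N)%R.
Proof.
  intros [H1 [HS [H3 _]]] N c k Hc Hk.
  destruct (H3 (c + 1)%R (k / 2)%R ltac:(lra) ltac:(lra)) as [M0 [HM0 [HS0 HJ]]].
  destruct (HJ N) as [K0' HK0']. set (K0 := (Rabs K0' + 1)%R).
  assert (HK0 : (0 < K0)%R) by (unfold K0; pose proof (Rabs_pos K0'); lra).
  assert (HB : forall q, cone sg (k / 2) (c + 1) M0 q ->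
     (Cmod (fst (psi q) - fst (jet Psi N q)) <= K0 * Cmod (snd q) ^ (N + 1))%R /\
     (Cmod (/ snd (psi q) - snd (jet Psi N q)) <= K0 * Cmod (snd q) ^ (N + 1))%R).
  { intros q Hq. destruct (HK0' q Hq) as [A B].
    assert (P : (0 <= Cmod (snd q) ^ (N + 1))%R) by (apply pow_le, Cmod_ge_0).
    assert (L : (K0' * Cmod (snd q) ^ (N + 1) <= K0 * Cmod (snd q) ^ (N + 1))%R).
    { apply Rmult_le_compat_r; auto. unfold K0. pose proof (Rle_abs K0'). lra. }
    split; lra. }
  destruct (cone_cauchy sg k c (N + 1) Hk Hc) as [K1 [HK1 Hca]].
  set (K := (K0 + K1 * K0)%R).
  assert (HK10 : (0 < K1 * K0)%R) by nra.
  exists (2 * M0 + 1)%R, K. split. lra. split. unfold K; lra.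
  assert (Hhd : forall q, cone sg (k / 2) (c + 1) M0 q ->
    hdiff (fun q => fst (psi q) - fst (jet Psi N q)) q
      (dz (fun q => fst (psi q)) q - dz (fun q => fst (jet Psi N q)) q)
      (dy (fun q => fst (psi q)) q - dy (fun q => fst (jet Psi N q)) q) /\
    hdiff (fun q => / snd (psi q) - snd (jet Psi N q)) q
      (dz (fun q => / snd (psi q))%C q - dz (fun q => snd (jet Psi N q)) q)
      (dy (fun q => / snd (psi q))%C q - dy (fun q => snd (jet Psi N q)) q)).
  { intros q Hq. pose proof (HS0 q Hq) as Sq. destruct (H1 q Sq) as [_ [_ Nq]].
    destruct (flip_hd S psi q HS Sq Nq) as [D1 [_ D3]].
    destruct (jet_hd Psi N q) as [J1 J2]. eapply cone_nonzero; eauto. split.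
    apply (hdiff_minus (fun q => fst (psi q)) (fun q => fst (jet Psi N q))); auto.
    apply (hdiff_minus (fun q => / snd (psi q))%C (fun q => snd (jet Psi N q))); auto. }
  assert (W : forall M' q, (2 * M0 <= M')%R -> cone sg (k / 2) (c + 1) (M' / 2) q -> cone sg (k / 2) (c + 1) M0 q).
  { intros M' q L. apply cone_weaken; lra. }
  assert (A1 := Hca (fun q => fst (psi q) - fst (jet Psi N q)) (2 * M0 + 1)%R K0 ltac:(lra)
    ltac:(intros q Hq; apply W in Hq; [split; [eapply hd_intro; apply (Hhd q Hq) | apply (HB q Hq)] | lra])).
  assert (A2 := Hca (fun q => / snd (psi q) - snd (jet Psi N q)) (2 * M0 + 1)%R K0 ltac:(lra)
    ltac:(intros q Hq; apply W in Hq; [split; [eapply hd_intro; apply (Hhd q Hq) | apply (HB q Hq)] | lra])).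
  intros p Hp.
  assert (Hp' : cone sg (k / 2) (c + 1) M0 p) by (revert Hp; apply cone_weaken; lra).
  destruct (HB p Hp') as [B1 B2]. destruct (Hhd p Hp') as [E1 E2].
  destruct (A1 p Hp) as [C1 C1']. destruct (A2 p Hp) as [C2 C2'].
  rewrite (hdiff_dz _ _ _ _ E1) in C1. rewrite (hdiff_dy _ _ _ _ E1) in C1'.
  rewrite (hdiff_dz _ _ _ _ E2) in C2. rewrite (hdiff_dy _ _ _ _ E2) in C2'.
  destruct (cone_y sg k c (2 * M0 + 1) p ltac:(lra) Hp) as [[Y1 Y2] _].
  set (y := Cmod (snd p)) in *.
  assert (Y3 : (y <= 1)%R).
  { assert (/ (2 * M0 + 1) <= / 1)%R by (apply Rinv_le_contravar; lra). lra. }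
  assert (Pn : (0 < y ^ N)%R) by (now apply pow_lt).
  assert (Q : forall a b, (0 <= a <= K)%R -> (b <= a * y ^ (N + 1))%R -> (b <= K * y ^ N)%R).
  { intros a b Ha Hb. eapply Rle_trans. apply Hb. rewrite pow_add, pow_1.
    apply Rmult_le_compat; try lra. apply Rmult_le_pos; lra. nra. }
  assert (Q' : forall a b, (0 <= a <= K)%R -> (b * y <= a * y ^ (N + 1))%R -> (b <= K * y ^ N)%R).
  { intros a b Ha Hb. rewrite pow_add, pow_1, <- Rmult_assoc in Hb. apply Rmult_le_reg_r in Hb; auto.
    eapply Rle_trans. apply Hb. apply Rmult_le_compat_r; lra. }
  repeat split.
  - apply (Q K0); auto. unfold K; lra.
  - apply (Q K0); auto. unfold K; lra.
  - apply (Q (K1 * K0)%R); auto. unfold K; lra.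
  - apply (Q' (K1 * K0)%R); auto. unfold K; lra.
  - apply (Q (K1 * K0)%R); auto. unfold K; lra.
  - apply (Q' (K1 * K0)%R); auto. unfold K; lra.
Qed.

Lemma Cmod_inv_sub (a a' : C) (m : R) : (0 < m)%R -> (m <= Cmod a)%R -> (m <= Cmod a')%R ->
  (Cmod (/ a - / a') <= Cmod (a - a') / m ^ 2)%R.
Proof.
  intros Hm Ha Ha'.
  assert (N : a <> 0) by (apply Cmod_gt_0; lra). assert (N' : a' <> 0) by (apply Cmod_gt_0; lra).
  replace (/ a - / a') with ((a' - a) / (a * a')) by (field; auto).
  rewrite Cmod_div by (now apply Cmult_neq_0). rewrite Cmod_mult, Cmod_sub_sym.
  unfold Rdiv. apply Rmult_le_compat_l. apply Cmod_ge_0. apply Rinv_le_contravar. now apply pow_lt. nra.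
Qed.

Lemma two_pi_i_neq_0 : two_pi_i <> 0.
Proof.
  unfold two_pi_i. apply Cmod_gt_0. rewrite Cmod_mult, Cmod_Ci, Cmod_R, Rmult_1_r.
  apply Rabs_pos_lt. pose proof PI_RGT_0. lra.
Qed.

(** The first coefficient of the generator is the only one that varies. Its Lipschitz bound away
    from z = 0 carries the closeness of psi to its jets over to the pulled back forms. *)
Lemma pencil_lipschitz (tau : C) (t : P1) (m : R) : tau <> 0 -> (0 < m)%R ->
  exists K : R, (0 < K)%R /\ forall a a' u u' : C,
    (m <= Cmod a)%R -> (m <= Cmod a')%R -> (Cmod u <= 1)%R -> (Cmod u' <= 1)%R ->
    (Cmod (fst (pencil tau t (a, u)) - fst (pencil tau t (a', u')))
       <= K * (Cmod (a - a') + Cmod (u - u')))%R /\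
    (Cmod (fst (pencil tau t (a', u'))) <= K)%R.
Proof.
  intros Ht Hm. pose proof two_pi_i_neq_0 as Np.
  assert (Nt : two_pi_i * tau <> 0) by (now apply Cmult_neq_0).
  set (w := / (two_pi_i * tau)).
  pose proof (Cmod_ge_0 w) as Pw.
  assert (Pm : (0 < / m)%R) by (now apply Rinv_0_lt_compat).
  assert (Pm2 : (0 < / m ^ 2)%R) by (apply Rinv_0_lt_compat; now apply pow_lt).
  set (D := (2 / m + / m ^ 2)%R).
  assert (HD : (0 < D)%R) by (unfold D, Rdiv; lra).
  assert (Main : forall a a' u u' : C,
    (m <= Cmod a)%R -> (m <= Cmod a')%R -> (Cmod u <= 1)%R -> (Cmod u' <= 1)%R ->
    (Cmod (u ^ 2 / a - u' ^ 2 / a') <= D * (Cmod (a - a') + Cmod (u - u')))%R /\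
    (Cmod (u' ^ 2 / a') <= D)%R /\
    (Cmod (/ a - / a') <= D * (Cmod (a - a') + Cmod (u - u')))%R /\ (Cmod (/ a') <= D)%R).
  { intros a a' u u' Ha Ha' Hu Hu'.
    assert (N : a <> 0) by (apply Cmod_gt_0; lra). assert (N' : a' <> 0) by (apply Cmod_gt_0; lra).
    pose proof (Cmod_inv_sub a a' m Hm Ha Ha') as I1.
    assert (I2 : (Cmod (/ a) <= / m)%R) by (rewrite Cmod_inv by auto; apply Rinv_le_contravar; auto).
    assert (I3 : (Cmod (/ a') <= / m)%R) by (rewrite Cmod_inv by auto; apply Rinv_le_contravar; auto).
    pose proof (Cmod_ge_0 (a - a')) as P1. pose proof (Cmod_ge_0 (u - u')) as P2.
    pose proof (Cmod_ge_0 u) as P3. pose proof (Cmod_ge_0 u') as P4.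
    pose proof (Cmod_ge_0 (/ a)) as P5. pose proof (Cmod_ge_0 (/ a')) as P6.
    assert (U2 : (Cmod (u' ^ 2) <= 1)%R) by (rewrite Cmod_pow; simpl; nra).
    assert (DD : (Cmod (a - a') / m ^ 2 <= D * Cmod (a - a'))%R).
    { unfold D, Rdiv. nra. }
    repeat split.
    - replace (u ^ 2 / a - u' ^ 2 / a') with ((u - u') * ((u + u') * / a) + u' ^ 2 * (/ a - / a'))
        by (simpl; field; auto).
      eapply Rle_trans. apply Cmod_triangle. rewrite !Cmod_mult.
      pose proof (Cmod_triangle u u') as T. pose proof (Cmod_ge_0 (u + u')).
      assert (Cmod (u + u') * Cmod (/ a) <= 2 * / m)%R by (apply Rmult_le_compat; lra).
      assert (Cmod (u - u') * (Cmod (u + u') * Cmod (/ a)) <= Cmod (u - u') * (2 * / m))%R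
        by (apply Rmult_le_compat_l; auto).
      assert (Cmod (u' ^ 2) * Cmod (/ a - / a') <= 1 * (Cmod (a - a') / m ^ 2))%R.
      { apply Rmult_le_compat; auto; apply Cmod_ge_0. }
      assert (2 * / m * Cmod (u - u') <= D * Cmod (u - u'))%R.
      { apply Rmult_le_compat_r; auto. unfold D, Rdiv. lra. }
      lra.
    - unfold Cdiv. rewrite Cmod_mult.
      assert (Cmod (u' ^ 2) * Cmod (/ a') <= 1 * / m)%R.
      { apply Rmult_le_compat; auto; apply Cmod_ge_0. }
      unfold D, Rdiv. lra.
    - eapply Rle_trans. apply I1. eapply Rle_trans. apply DD.
      apply Rmult_le_compat_l; lra.
    - unfold D, Rdiv. lra. }
  destruct t as [t|]; simpl.
  - exists ((Cmod t * Cmod w + 1) * D)%R. split.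
    { pose proof (Cmod_ge_0 t). apply Rmult_lt_0_compat; auto. nra. }
    intros a a' u u' Ha Ha' Hu Hu'.
    destruct (Main a a' u u' Ha Ha' Hu Hu') as [M1 [M2 _]].
    assert (N : a <> 0) by (apply Cmod_gt_0; lra). assert (N' : a' <> 0) by (apply Cmod_gt_0; lra).
    pose proof (Cmod_ge_0 t). assert (0 <= Cmod t * Cmod w)%R by (apply Rmult_le_pos; auto).
    assert (P : (0 <= D * (Cmod (a - a') + Cmod (u - u')))%R).
    { eapply Rle_trans. 2: apply M1. apply Cmod_ge_0. }
    change (u * (u * 1)) with (u ^ 2). change (u' * (u' * 1)) with (u' ^ 2).
    replace (t * u ^ 2 / (two_pi_i * tau * a) - t * u' ^ 2 / (two_pi_i * tau * a'))
      with (t * w * (u ^ 2 / a - u' ^ 2 / a')) by (unfold w; field; auto).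
    replace (t * u' ^ 2 / (two_pi_i * tau * a')) with (t * w * (u' ^ 2 / a')) by (unfold w; field; auto).
    rewrite !Cmod_mult. split.
    + rewrite (Rmult_assoc _ D). apply Rmult_le_compat; try lra. apply Cmod_ge_0.
    + apply Rmult_le_compat; try lra. apply Cmod_ge_0.
  - exists ((Cmod w + 1) * D)%R. split.
    { apply Rmult_lt_0_compat; auto. lra. }
    intros a a' u u' Ha Ha' Hu Hu'.
    destruct (Main a a' u u' Ha Ha' Hu Hu') as [_ [_ [M1 M2]]].
    assert (N : a <> 0) by (apply Cmod_gt_0; lra). assert (N' : a' <> 0) by (apply Cmod_gt_0; lra).
    assert (P : (0 <= D * (Cmod (a - a') + Cmod (u - u')))%R).
    { eapply Rle_trans. 2: apply M1. apply Cmod_ge_0. }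
    replace (1 / (two_pi_i * tau * a) - 1 / (two_pi_i * tau * a'))
      with (w * (/ a - / a')) by (unfold w; field; auto).
    replace (1 / (two_pi_i * tau * a')) with (w * / a') by (unfold w; field; auto).
    rewrite !Cmod_mult. split.
    + rewrite (Rmult_assoc _ D). apply Rmult_le_compat; try lra. apply Cmod_ge_0.
    + apply Rmult_le_compat; try lra. apply Cmod_ge_0.
Qed.

Lemma pencil_snd (tau : C) (t : P1) :
  exists b : C, (Cmod b <= 1)%R /\ forall p, snd (pencil tau t p) = b.
Proof.
  destruct t as [t|]; simpl.
  - exists (- (1)). split; auto. rewrite Cmod_m1. lra.
  - exists 0. split; auto. rewrite Cmod_0. lra.
Qed.

Lemma small_of_cone (sg : C) (k c M K : R) (p : C2) : (0 < K)%R -> (K <= M)%R ->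
  cone sg k c M p -> (0 < Cmod (snd p))%R /\ (Cmod (snd p) < / K)%R /\ (K * Cmod (snd p) <= 1)%R.
Proof.
  intros HK HM Hp. destruct (cone_y sg k c M p ltac:(lra) Hp) as [[Y1 Y2] _].
  assert (/ M <= / K)%R by (apply Rinv_le_contravar; lra).
  repeat split; try lra.
  replace 1%R with (K * / K)%R by (field; lra). apply Rmult_le_compat_l; lra.
Qed.

(** The order 3 is dictated by the generator for finite t, which is y^2 times
    [omega_0 + t omega_oo]: after division by y^2 a slope of size O(y) remains. *)
Lemma pullback_flip_jet_close (tau : C) (F : C2 -> C2) (Psi : formal_diffeo)
    (sg : C) (S : C2 -> Prop) (psi : C2 -> C2) (t : P1) : tau <> 0 ->
  cone_normalization tau F Psi sg S psi ->
  forall c k : R, (0 < c)%R -> (0 < k)%R ->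
  exists M K : R, (0 < M)%R /\ (0 < K)%R /\ forall p, cone sg k c M p ->
    (Cmod (fst (pullback (flip psi) (pencil tau t) p) - fst (pullback (jet Psi 3) (pencil tau t) p))
       <= K * Cmod (snd p) ^ 3)%R /\
    (Cmod (snd (pullback (flip psi) (pencil tau t) p) - snd (pullback (jet Psi 3) (pencil tau t) p))
       <= K * Cmod (snd p) ^ 3)%R.
Proof.
  intros Ht HN c k Hc Hk.
  destruct (normalization_derivatives _ _ _ _ _ _ HN c k Hc Hk) as [M1 [K1 [HM1 [HK1 H1]]]].
  destruct (normalization_jet_derivatives _ _ _ _ _ _ HN 3 c k Hc Hk) as [M2 [K2 [HM2 [HK2 H2]]]].
  pose proof (exp_pos (- c)) as Pe.
  destruct (pencil_lipschitz tau t (exp (- c) / 4) Ht ltac:(lra)) as [Kp [HKp Hp]].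
  destruct (pencil_snd tau t) as [b [Hb1 Hb]].
  set (E := (4 * (K1 + K2 + 1))%R). assert (HE : (0 < E)%R) by (unfold E; lra).
  assert (HE2 : (0 < E * exp c)%R) by (apply Rmult_lt_0_compat; auto; apply exp_pos).
  set (M := (M1 + M2 + E + E * exp c)%R).
  exists M, (2 * (Kp * (2 * K2)) + K1 * (Kp * (2 * K2)) + Kp * K2 + K2)%R.
  assert (T0 : (0 < Kp * (2 * K2))%R) by nra.
  assert (T1 : (0 < K1 * (Kp * (2 * K2)))%R) by nra. assert (T2 : (0 < Kp * K2)%R) by nra.
  split. unfold M; lra. split. lra.
  intros p Hcp.
  destruct (H1 p) as [_ [A1 [A2 [A3 [A4 [_ _]]]]]]. { revert Hcp; apply cone_weaken; unfold M; lra. }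
  destruct (H2 p) as [B1 [B2 [B3 [B4 [B5 B6]]]]]. { revert Hcp; apply cone_weaken; unfold M; lra. }
  destruct (small_of_cone sg k c M E p HE ltac:(unfold M; lra) Hcp) as [Y0 [_ Y1]].
  destruct (small_of_cone sg k c M (E * exp c) p HE2 ltac:(unfold M; lra) Hcp) as [_ [_ Y2]].
  set (y := Cmod (snd p)) in *.
  assert (Y2' : (E * y <= exp (- c))%R).
  { apply (Rmult_le_reg_r (exp c)). apply exp_pos. rewrite <- exp_plus.
    replace (- c + c)%R with 0%R by ring. rewrite exp_0. lra. }
  assert (y1 : (y <= 1 / 4)%R) by (unfold E in Y1; nra).
  assert (y2 : (y ^ 2 <= y)%R) by (simpl; nra). assert (y3 : (y ^ 3 <= y)%R) by (simpl in *; nra).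
  assert (y3' : (0 < y ^ 3)%R) by (apply pow_lt; auto).
  destruct Hcp as [_ [_ [_ [Hz _]]]].
  set (a := fst (psi p)) in *. set (u := / snd (psi p)) in *.
  set (a' := fst (jet Psi 3 p)) in *. set (u' := snd (jet Psi 3 p)) in *.
  assert (La : (exp (- c) / 2 <= Cmod a)%R).
  { pose proof (Cmod_sub_ge (fst p) (fst p - a)) as T. replace (fst p - (fst p - a)) with a in T by ring.
    rewrite (Cmod_sub_sym (fst p) a) in T. unfold E in Y2'. nra. }
  assert (La' : (exp (- c) / 4 <= Cmod a')%R).
  { pose proof (Cmod_sub_ge a (a - a')) as T. replace (a - (a - a')) with a' in T by ring.
    assert (K2 * y ^ 3 <= K2 * y)%R by (apply Rmult_le_compat_l; lra). unfold E in Y2'. nra. }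
  assert (Lu : (Cmod u <= 1 / 2)%R).
  { pose proof (Cmod_triangle (u - snd p) (snd p)) as T. replace (u - snd p + snd p) with u in T by ring.
    fold y in T. assert (K1 * y ^ 2 <= K1 * y)%R by (apply Rmult_le_compat_l; lra). unfold E in Y1. nra. }
  assert (Lu' : (Cmod u' <= 1)%R).
  { pose proof (Cmod_sub_le u (u - u')) as T. replace (u - (u - u')) with u' in T by ring.
    assert (K2 * y ^ 3 <= K2 * y)%R by (apply Rmult_le_compat_l; lra). unfold E in Y1. nra. }
  destruct (Hp a a' u u' ltac:(lra) La' ltac:(lra) Lu') as [P1 P2].
  set (A := fst (pencil tau t (a, u))) in *. set (A' := fst (pencil tau t (a', u'))) in *.
  assert (PA : (Cmod (A - A') <= Kp * (2 * K2) * y ^ 3)%R).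
  { eapply Rle_trans. apply P1. rewrite Rmult_assoc. apply Rmult_le_compat_l; lra. }
  assert (Dz : (Cmod (dz (fun q => fst (psi q)) p) <= 2)%R).
  { pose proof (Cmod_triangle (dz (fun q => fst (psi q)) p - 1) 1) as T. rewrite Cmod_1 in T.
    replace (dz (fun q => fst (psi q)) p - 1 + 1) with (dz (fun q => fst (psi q)) p) in T by ring.
    unfold E in Y1. nra. }
  assert (Gen : forall d d' e e' D : C, (Cmod d <= 2 \/ Cmod d <= K1)%R ->
     (Cmod (d - d') <= K2 * y ^ 3)%R -> (Cmod (e - e') <= K2 * y ^ 3)%R ->
     D = A * d + b * e - (A' * d' + b * e') ->
     (Cmod D <= (2 * (Kp * (2 * K2)) + K1 * (Kp * (2 * K2)) + Kp * K2 + K2) * y ^ 3)%R).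
  { intros d d' e e' D Hd Hdd Hee ->.
    replace (A * d + b * e - (A' * d' + b * e')) with ((A - A') * d + (A' * (d - d') + b * (e - e'))) by ring.
    eapply Rle_trans. apply Cmod_triangle.
    pose proof (Cmod_triangle (A' * (d - d')) (b * (e - e'))) as T. rewrite !Cmod_mult in T. rewrite Cmod_mult.
    assert (Q1 : (Cmod A' * Cmod (d - d') <= Kp * (K2 * y ^ 3))%R)
      by (apply Rmult_le_compat; auto; apply Cmod_ge_0).
    assert (Q2 : (Cmod b * Cmod (e - e') <= 1 * (K2 * y ^ 3))%R)
      by (apply Rmult_le_compat; auto; apply Cmod_ge_0).
    assert (Q3 : (Cmod (A - A') * Cmod d <= Kp * (2 * K2) * y ^ 3 * (2 + K1))%R).
    { apply Rmult_le_compat; auto; try apply Cmod_ge_0. destruct Hd; lra. }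
    nra. }
  unfold pullback. unfold flip at 1 4. fold a u a' u'. cbn [fst snd].
  rewrite !Hb. fold A A'. split; eapply Gen; try reflexivity; auto.
Qed.

(** Along y = 0 the jet of order 1 is the identity, and its derivative is the shear of entry a: dz
    is pulled back to dz + a dy, and dy to itself. *)
Lemma pullback_jet_1 (tau : C) (Psi : formal_diffeo) (t : P1) (z0 : C) :
  exists a : C, pullback (jet Psi 1) (pencil tau t) (z0, RtoC 0) =
    (fst (pencil tau t (z0, RtoC 0)),
     fst (pencil tau t (z0, RtoC 0)) * a + snd (pencil tau t (z0, RtoC 0))).
Proof.
  exists (dy (fun q => fst (jet Psi 1 q)) (z0, RtoC 0)).
  assert (E0 : forall z, jet Psi 1 (z, RtoC 0) = (z, RtoC 0)).
  { intros z. apply injective_projections. 2: apply jet_1_snd.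
    unfold jet. simpl. rewrite sum_n_n.
    change (z + fd_a Psi 1 z * (0 * 1) = z). ring. }
  assert (D1 : dz (fun q => fst (jet Psi 1 q)) (z0, RtoC 0) = 1).
  { apply cdiff_C_derive. generalize (cdiff_id z0). apply cdiff_ext_all; auto.
    intros z. cbn [snd]. now rewrite E0. }
  assert (D2 : dz (fun q => snd (jet Psi 1 q)) (z0, RtoC 0) = 0).
  { apply cdiff_C_derive. generalize (cdiff_const (RtoC 0) z0). apply cdiff_ext_all; auto.
    intros z. cbn [snd]. now rewrite E0. }
  assert (D3 : dy (fun q => snd (jet Psi 1 q)) (z0, RtoC 0) = 1).
  { apply cdiff_C_derive. generalize (cdiff_id (RtoC 0)). apply cdiff_ext_all; auto.
    intros z. cbn [fst]. now rewrite jet_1_snd. }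
  unfold pullback. rewrite D1, D2, D3, E0. apply injective_projections; cbn [fst snd]; ring.
Qed.

(** For finite t the curve C is a leaf of F_t, so [om] is a multiple of dy at z0, while the other
    member is close to a multiple of dz. For t = oo the form [om] has a nonzero dz coefficient,
    while the other member is close to - dy. In both cases the wedge product, from which the
    denominator of the slope is obtained, stays away from 0. *)
Lemma wedge_other_member_lower (tau : C) (F : C2 -> C2) (Psi : formal_diffeo)
    (sg : C) (S : C2 -> Prop) (psi om : C2 -> C2) (t : P1) (z0 : C) : tau <> 0 -> z0 <> 0 ->
  cone_normalization tau F Psi sg S psi ->
  holo_at om (z0, RtoC 0) -> om (z0, RtoC 0) <> (RtoC 0, RtoC 0) ->
  wedge (om (z0, RtoC 0)) (pullback (jet Psi 1) (pencil tau t) (z0, RtoC 0)) = 0 ->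
  forall c k : R, (0 < c)%R -> (0 < k)%R ->
  exists d b : R, (0 < d)%R /\ (0 < b)%R /\ forall p, cone sg k c (/ d) p ->
    (Cmod (fst p - z0) < d)%R ->
    (b <= Cmod (wedge (om p) (pullback (flip psi) (pencil tau (other_member t)) p)%C))%R /\
    (Cmod (fst (om p)) <= / b)%R /\ (Cmod (snd (om p)) <= / b)%R.
Proof.
  intros Ht Hz0 HN Hom Hom0 Hw c k Hc Hk.
  destruct (normalization_derivatives _ _ _ _ _ _ HN c k Hc Hk) as [M1 [K1 [HM1 [HK1 H1]]]].
  destruct (pullback_jet_1 tau Psi t z0) as [a Ea]. rewrite Ea in Hw. clear Ea.
  pose proof two_pi_i_neq_0 as Np.
  assert (Nt : two_pi_i * tau <> 0) by (now apply Cmult_neq_0).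
  set (o1 := fst (om (z0, RtoC 0))) in *. set (o2 := snd (om (z0, RtoC 0))) in *.
  destruct (holo_hd _ _ Hom) as [D1 D2].
  set (o := match t with Some _ => Cmod o2 | None => Cmod o1 end).
  assert (Ho : (0 < o)%R /\ (match t with Some _ => o1 = 0 | None => True end)).
  { unfold wedge in Hw. fold o1 o2 in Hw. cbn [fst snd] in Hw.
    unfold o. destruct t as [t|]; cbn [fst snd pencil] in Hw.
    - assert (E : o1 = 0).
      { apply (f_equal (fun x => - x)) in Hw. rewrite <- Copp_0, <- Hw. simpl. field. auto. }
      split; auto. apply Cmod_gt_0. intros E2. apply Hom0. apply injective_projections; auto.
    - split; auto. apply Cmod_gt_0. intros E. apply Hom0. apply injective_projections; auto.
      fold o2. rewrite E in Hw.
      assert (E2 : o2 = - (two_pi_i * tau * z0) * (0 * (1 / (two_pi_i * tau * z0) * a + 0) - o2 * (1 / (two_pi_i * tau * z0))))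
        by (field; auto).
      rewrite Hw, Cmult_0_r in E2. exact E2. }
  destruct Ho as [Ho Ho'].
  set (B := (Cmod o1 + Cmod o2 + o)%R).
  pose proof (Cmod_ge_0 o1) as Po1. pose proof (Cmod_ge_0 o2) as Po2.
  assert (HB : (0 < B)%R) by (unfold B; lra).
  set (e := Rmin (o / 4) (o / (8 * K1))).
  assert (He : (0 < e)%R) by (apply Rmin_pos; apply Rdiv_lt_0_compat; lra).
  assert (He1 : (e <= o / 4)%R) by apply Rmin_l.
  assert (He2 : (e * K1 <= o / 8)%R).
  { apply Rle_trans with (o / (8 * K1) * K1)%R. apply Rmult_le_compat_r. lra. apply Rmin_r.
    right; field; lra. }
  destruct (hdiff_continuous _ _ _ _ D1 e He) as [d1 [Hd1 C1]].
  destruct (hdiff_continuous _ _ _ _ D2 e He) as [d2 [Hd2 C2]].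
  cbn [fst snd] in C1, C2.
  set (w := Cmod (/ (two_pi_i * tau))).
  assert (Pw : (0 < w)%R).
  { apply Cmod_gt_0. intros E. apply (f_equal (fun x => x * (two_pi_i * tau))) in E.
    rewrite Cinv_l, Cmult_0_l in E by auto. apply (f_equal fst) in E. simpl in E. lra. }
  pose proof (exp_pos c) as Pec. pose proof (exp_pos (- c)) as Penc.
  set (b0 := Rmin (o / 4) (w * / (2 * exp c) * (o / 4))).
  assert (Hb0 : (0 < b0)%R).
  { apply Rmin_pos. lra. repeat apply Rmult_lt_0_compat; try lra. apply Rinv_0_lt_compat; lra. }
  set (b := Rmin b0 (/ B)). assert (Hb : (0 < b)%R) by (apply Rmin_pos; auto; now apply Rinv_0_lt_compat).
  set (Q := (M1 + 2 * K1 + K1 * exp c + 8 * B * K1 / o + 1 + / d1 + / d2)%R).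
  assert (Q1 : (0 < 8 * B * K1 / o)%R) by (apply Rdiv_lt_0_compat; auto; nra).
  assert (Q2 : (0 < K1 * exp c)%R) by nra.
  assert (Q3 : (0 < / d1)%R) by now apply Rinv_0_lt_compat.
  assert (Q4 : (0 < / d2)%R) by now apply Rinv_0_lt_compat.
  assert (HQ : (0 < Q)%R) by (unfold Q; lra).
  exists (/ Q)%R, b. split. now apply Rinv_0_lt_compat. split; auto.
  intros p Hp Hpz. rewrite Rinv_inv in Hp.
  destruct (H1 p) as [Sp [A1 [A2 [A3 [A4 [A5 A6]]]]]].
  { revert Hp; apply cone_weaken; unfold Q; lra. }
  destruct (small_of_cone sg k c Q (2 * K1) p ltac:(lra) ltac:(unfold Q; lra) Hp) as [Y0 [_ Y1]].
  destruct (small_of_cone sg k c Q (K1 * exp c) p ltac:(lra) ltac:(unfold Q; lra) Hp) as [_ [_ Y2]].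
  destruct (small_of_cone sg k c Q (8 * B * K1 / o) p ltac:(lra) ltac:(unfold Q; lra) Hp) as [_ [_ Y3]].
  destruct (small_of_cone sg k c Q 1 p ltac:(lra) ltac:(unfold Q; lra) Hp) as [_ [_ Y4]].
  destruct (small_of_cone sg k c Q (/ d1) p ltac:(lra) ltac:(unfold Q; lra) Hp) as [_ [Y5 _]].
  destruct (small_of_cone sg k c Q (/ d2) p ltac:(lra) ltac:(unfold Q; lra) Hp) as [_ [Y6 _]].
  rewrite Rinv_inv in Y5, Y6.
  set (y := Cmod (snd p)) in *.
  assert (Qd1 : (/ Q <= d1)%R).
  { rewrite <- (Rinv_inv d1). apply Rinv_le_contravar; auto. unfold Q; lra. }
  assert (Qd2 : (/ Q <= d2)%R).
  { rewrite <- (Rinv_inv d2). apply Rinv_le_contravar; auto. unfold Q; lra. }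
  assert (S0 : snd p - 0 = snd p) by ring.
  assert (O1 : (Cmod (fst (om p) - o1) < e)%R).
  { apply C1. lra. rewrite S0. exact Y5. }
  assert (O2 : (Cmod (snd (om p) - o2) < e)%R).
  { apply C2. lra. rewrite S0. exact Y6. }
  assert (Bb1 : (Cmod (fst (om p)) <= / b)%R /\ (Cmod (snd (om p)) <= / b)%R).
  { assert (B <= / b)%R.
    { rewrite <- (Rinv_inv B). apply Rinv_le_contravar; auto. apply Rmin_r. }
    pose proof (Cmod_triangle (fst (om p) - o1) o1) as T1. pose proof (Cmod_triangle (snd (om p) - o2) o2) as T2.
    replace (fst (om p) - o1 + o1) with (fst (om p)) in T1 by ring.
    replace (snd (om p) - o2 + o2) with (snd (om p)) in T2 by ring. unfold B in H. lra. }
  split; auto.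
  apply Rle_trans with b0. apply Rmin_l.
  destruct Hp as [_ [_ [_ [Hz1 Hz2]]]].
  set (u1 := fst (om p)) in *. set (u2 := snd (om p)) in *.
  unfold wedge, pullback, flip. fold u1 u2. cbn [fst snd].
  destruct t as [t|]; cbn [other_member pencil fst snd].
  - set (X := dz (fun q => fst (psi q)) p) in *. set (Y := dy (fun q => fst (psi q)) p) in *.
    set (A := fst (psi p)) in *.
    assert (LA : (0 < Cmod A <= 2 * exp c)%R).
    { pose proof (Cmod_triangle (A - fst p) (fst p)) as T. replace (A - fst p + fst p) with A in T by ring.
      assert (exp (-c) <= exp c)%R by (apply Rlt_le, exp_increasing; lra).
      assert (Y2' : (K1 * y <= exp (- c))%R).
      { apply (Rmult_le_reg_r (exp c)). apply exp_pos. rewrite <- exp_plus.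
        replace (- c + c)%R with 0%R by ring. rewrite exp_0. lra. }
      split.
      - pose proof (Cmod_sub_ge (fst p) (fst p - A)) as T3. replace (fst p - (fst p - A)) with A in T3 by ring.
        rewrite (Cmod_sub_sym (fst p) A) in T3. lra.
      - lra. }
    assert (NA : A <> 0) by (apply Cmod_gt_0; lra).
    match goal with |- (_ <= Cmod ?W)%R =>
      replace W with (/ (two_pi_i * tau) * / A * (u1 * Y - u2 * X)) by (field; auto) end.
    rewrite !Cmod_mult. fold w.
    apply Rle_trans with (w * / (2 * exp c) * (o / 4))%R. apply Rmin_r.
    assert (IA : (/ (2 * exp c) <= Cmod (/ A))%R) by (rewrite Cmod_inv by auto; apply Rinv_le_contravar; lra).
    assert (Pi : (0 < / (2 * exp c))%R) by (apply Rinv_0_lt_compat; lra).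
    apply Rmult_le_compat; try lra. apply Rlt_le, Rmult_lt_0_compat; lra.
    apply Rmult_le_compat_l; lra.
    rewrite Ho' in O1. replace (u1 - 0) with u1 in O1 by ring.
    assert (L2 : (3 / 4 * o <= Cmod u2)%R).
    { pose proof (Cmod_sub_ge o2 (o2 - u2)) as T. replace (o2 - (o2 - u2)) with u2 in T by ring.
      rewrite (Cmod_sub_sym o2 u2) in T. unfold o in *. lra. }
    assert (LX : (1 / 2 <= Cmod X)%R).
    { pose proof (Cmod_sub_ge 1 (1 - X)) as T. replace (1 - (1 - X)) with X in T by ring.
      rewrite (Cmod_sub_sym 1 X), Cmod_1 in T. lra. }
    pose proof (Cmod_sub_ge (u2 * X) (u1 * Y)) as T. rewrite (Cmod_sub_sym (u2 * X)), !Cmod_mult in T.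
    assert (3 / 4 * o * (1 / 2) <= Cmod u2 * Cmod X)%R by (apply Rmult_le_compat; lra).
    assert (Cmod u1 * Cmod Y <= e * K1)%R by (apply Rmult_le_compat; try apply Cmod_ge_0; lra).
    lra.
  - set (X := dz (fun q => / snd (psi q))%C p) in *. set (Y := dy (fun q => / snd (psi q))%C p) in *.
    match goal with |- (_ <= Cmod ?W)%R => replace W with (u2 * X - u1 * Y) end.
    2: { unfold Cdiv. ring. }
    apply Rle_trans with (o / 4)%R. apply Rmin_l.
    assert (L1 : (3 / 4 * o <= Cmod u1)%R).
    { pose proof (Cmod_sub_ge o1 (o1 - u1)) as T. replace (o1 - (o1 - u1)) with u1 in T by ring.
      rewrite (Cmod_sub_sym o1 u1) in T. unfold o in *. lra. }
    assert (LY : (1 / 2 <= Cmod Y)%R).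
    { pose proof (Cmod_sub_ge 1 (1 - Y)) as T. replace (1 - (1 - Y)) with Y in T by ring.
      rewrite (Cmod_sub_sym 1 Y), Cmod_1 in T. lra. }
    assert (LU : (Cmod u2 <= B)%R).
    { pose proof (Cmod_triangle (u2 - o2) o2) as T2.
      replace (u2 - o2 + o2) with u2 in T2 by ring. unfold B, o in *. lra. }
    assert (LB : (B * (K1 * y ^ 2) <= o / 8)%R).
    { apply Rle_trans with (B * (K1 * y))%R.
      apply Rmult_le_compat_l. lra. apply Rmult_le_compat_l. lra. simpl; nra.
      apply (Rmult_le_reg_r (8 / o)). apply Rdiv_lt_0_compat; lra.
      replace (B * (K1 * y) * (8 / o))%R with (8 * B * K1 / o * y)%R by (field; lra).
      replace (o / 8 * (8 / o))%R with 1%R by (field; lra). exact Y3. }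
    pose proof (Cmod_sub_ge (u1 * Y) (u2 * X)) as T. rewrite (Cmod_sub_sym (u1 * Y)), !Cmod_mult in T.
    assert (3 / 4 * o * (1 / 2) <= Cmod u1 * Cmod Y)%R by (apply Rmult_le_compat; lra).
    assert (Cmod u2 * Cmod X <= B * (K1 * y ^ 2))%R by (apply Rmult_le_compat; auto; apply Cmod_ge_0).
    lra.
Qed.

(** * The slope of a foliation in a sector *)

Lemma wedge_zero_proportional (u v : C2) : u <> (RtoC 0, RtoC 0) -> v <> (RtoC 0, RtoC 0) ->
  wedge u v = 0 -> exists l : C, l <> 0 /\ v = (l * fst u, l * snd u).
Proof.
  intros Hu Hv H. destruct u as [a b], v as [c d]. unfold wedge in H. cbn [fst snd] in *.
  assert (E : a * d = b * c).
  { replace (a * d) with (a * d - b * c + b * c) by ring. rewrite H. ring. }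
  destruct (classic (a = 0)) as [Ha|Ha].
  - assert (Hb : b <> 0) by (intros Hb; apply Hu; now rewrite Ha, Hb).
    assert (Hc : c = 0).
    { replace c with (b * c / b) by (field; auto). rewrite <- E, Ha. unfold Cdiv. ring. }
    exists (d / b). split.
    + intros Z. apply Hv. rewrite Hc. f_equal. replace d with (d / b * b) by (field; auto). rewrite Z. ring.
    + rewrite Ha, Hc. f_equal. ring. field; auto.
  - assert (Ed : d = c / a * b).
    { replace d with (a * d / a) by (field; auto). rewrite E. field; auto. }
    exists (c / a). split.
    + intros Z. apply Hv. rewrite Ed, Z. f_equal. 2: ring.
      replace c with (c / a * a) by (field; auto). rewrite Z. ring.
    + f_equal; auto. field; auto.
Qed.

Lemma wedge_scal_l (l : C) (u v : C2) : wedge (l * fst u, l * snd u) v = l * wedge u v.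
Proof. unfold wedge. cbn [fst snd]. ring. Qed.

Lemma wedge_scal_r (l : C) (u v : C2) : wedge u (l * fst v, l * snd v) = l * wedge u v.
Proof. unfold wedge. cbn [fst snd]. ring. Qed.

(* The covector [fst l dX/X + snd l dY/Y], where [(X, Y) = Pi o psi]. *)
Definition coframe (tau : C) (psi : C2 -> C2) (l : C2) (p : C2) : C2 :=
  let x1 := dz (fun q => fst (psi q)) p / fst (psi p) in
  let y1 := dy (fun q => fst (psi q)) p / fst (psi p) in
  let x2 := two_pi_i * dz (fun q => snd (psi q)) p in
  let y2 := two_pi_i * dy (fun q => snd (psi q)) p in
  (fst l * x2 + snd l * (x1 + tau * x2), fst l * y2 + snd l * (y1 + tau * y2)).

(* [F_t] is [fst l dX/X + snd l dY/Y = 0] with [l = limit_line tau t]. *)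
Definition limit_line (tau : C) (t : P1) : C2 :=
  match t with Some t => (1 - t, t / tau) | None => (- (1), 1 / tau) end.

(* With [t' = other_member t], [eta] is proportional to the coframe of
   [limit_line t + slope * limit_line t']. *)
Definition slope (tau : C) (psi eta : C2 -> C2) (t : P1) (p : C2) : C :=
  - wedge (eta p) (coframe tau psi (limit_line tau t) p) /
    wedge (eta p) (coframe tau psi (limit_line tau (other_member t)) p).

(** Since dX/X = 2 pi i dxi and dY/Y = dz/z + 2 pi i tau dxi, the form omega_0 + t omega_oo is ((1 -
    t) dX/X + (t / tau) dY/Y) / (2 pi i), and omega_oo is (- dX/X + (1 / tau) dY/Y) / (2 pi i). For
    finite t the factor y^2 of the generator, with y = 1 / xi, enters [s]. *)
Lemma pullback_flip_pencil (tau : C) (S : C2 -> Prop) (psi : C2 -> C2) (t : P1) (p : C2) :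
  tau <> 0 -> biholo_on S psi -> S p -> fst (psi p) <> 0 -> snd (psi p) <> 0 ->
  let s := match t with Some _ => / snd (psi p) ^ 2 / two_pi_i | None => / two_pi_i end in
  pullback (flip psi) (pencil tau t) p =
    (s * fst (coframe tau psi (limit_line tau t) p), s * snd (coframe tau psi (limit_line tau t) p)).
Proof.
  intros Ht HS Sp N1 N2 s. pose proof two_pi_i_neq_0 as Np.
  destruct (flip_hd S psi p HS Sp N2) as [D1 [D2 D3]].
  assert (D4 := hdiff_inv (fun q => snd (psi q)) p _ _ N2 D2).
  unfold pullback, flip. cbn [fst snd].
  change (dz (fun x => / snd (psi x)) p) with (dz (fun x => / snd (psi x))%C p).
  rewrite (hdiff_dz _ _ _ _ D4), (hdiff_dy _ _ _ _ D4).
  unfold coframe, s, limit_line, pencil. destruct t as [t|]; cbn [fst snd].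
  - apply injective_projections; cbn [fst snd]; simpl Cpow; field; repeat split; auto.
  - apply injective_projections; cbn [fst snd]; unfold Cdiv; field; repeat split; auto.
Qed.

(** Convergence at order 1 fixes the direction of the foliation along C, which bounds the
    denominator from below; convergence at order 3 bounds the numerator. Both estimates are local in
    z, as the generator [om] is, and compactness makes them uniform on the annulus. *)
Lemma slope_bound (tau sg : C) (V : C2 -> Prop) (F : C2 -> C2) (Psi : formal_diffeo)
    (S : C2 -> Prop) (psi : C2 -> C2) (t : P1) (W : C2 -> Prop) (eta : C2 -> C2) :
  tau <> 0 -> cone_normalization tau F Psi sg S psi ->
  is_foliation_germ V F W eta ->
  (forall (z0 : C) (om : C2 -> C2),
      z0 <> 0 -> generates_at om eta (z0, RtoC 0) ->
      forall N : nat, exists K : R, locally (z0, RtoC 0) (fun p =>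
        (Cmod (wedge (om p) (pullback (jet Psi N) (pencil tau t) p))
           <= K * Cmod (snd p) ^ N)%R)) ->
  forall c k : R, (0 < c)%R -> (0 < k)%R ->
  exists M K : R, (0 < M)%R /\ (0 < K)%R /\ forall p, cone sg k c M p ->
    S p /\ W p /\ eta p <> (RtoC 0, RtoC 0) /\
    wedge (eta p) (coframe tau psi (limit_line tau (other_member t)) p) <> 0 /\
    (Cmod (slope tau psi eta t p) <= K * Cmod (snd p))%R.
Proof.
  intros Ht HN [HWo [HWV [HW0 [Hfol Hinv]]]] Hconv c k Hc Hk.
  pose proof two_pi_i_neq_0 as Np.
  destruct (pullback_flip_jet_close tau F Psi sg S psi t Ht HN c k Hc Hk) as [M1 [K1 [HM1 [HK1 H1]]]].
  destruct (cone_normalization_near_id _ _ _ _ _ _ HN c k Hc Hk) as [M2 [K2 [HM2 [HK2 H2]]]].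
  set (J0 := pullback (flip psi) (pencil tau t)). set (J1 := pullback (flip psi) (pencil tau (other_member t))).
  (* [d] is at once a radius and the inverse of a constant, which makes the property monotone in
     [d]. *)
  destruct (annulus_uniform c (fun z d => forall y, cone sg k c (/ d) (z, y) ->
     W (z, y) /\ eta (z, y) <> (RtoC 0, RtoC 0) /\ wedge (eta (z, y)) (J1 (z, y)) <> 0 /\
     (d * Cmod (wedge (eta (z, y)) (J0 (z, y))) <= Cmod y ^ 3 * Cmod (wedge (eta (z, y)) (J1 (z, y))))%R))
    as [d [Hd HG]].
  - intros z d d' Hd G y Hy.
    destruct (G y) as [A [B [C D]]].
    { revert Hy. apply cone_weaken; try lra. apply Rinv_le_contravar; lra. }
    repeat split; auto. eapply Rle_trans. 2: apply D. apply Rmult_le_compat_r; try lra. apply Cmod_ge_0.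
  - intros z0 Hz0.
    destruct (Hfol (z0, RtoC 0) (HW0 z0 Hz0)) as [om Hom].
    destruct (Hconv z0 om Hz0 Hom 1%nat) as [L1 HL1]. destruct (Hconv z0 om Hz0 Hom 3%nat) as [L3 HL3].
    apply locally_C2 in HL1. destruct HL1 as [e1 [He1 HL1]].
    apply locally_C2 in HL3. destruct HL3 as [e3 [He3 HL3]].
    apply locally_C2 in Hom. destruct Hom as [e0 [He0 Hom]]. cbn [fst snd] in *.
    assert (Z : forall w : C, w + 0 = w) by (intros; ring).
    assert (Hom00 := Hom 0 0 ltac:(rewrite Cmod_0; lra) ltac:(rewrite Cmod_0; lra)).
    specialize (HL1 0 0 ltac:(rewrite Cmod_0; lra) ltac:(rewrite Cmod_0; lra)).
    rewrite !Z in Hom00, HL1. destruct Hom00 as [G1 [G2 _]].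
    assert (Hw : wedge (om (z0, RtoC 0)) (pullback (jet Psi 1) (pencil tau t) (z0, RtoC 0)) = 0).
    { apply Cmod_eq_0. rewrite Cmod_0 in HL1.
      pose proof (Cmod_ge_0 (wedge (om (z0, RtoC 0)) (pullback (jet Psi 1) (pencil tau t) (z0, RtoC 0)))).
      lra. }
    destruct (wedge_other_member_lower tau F Psi sg S psi om t z0 Ht Hz0 HN G1 G2 Hw c k Hc Hk)
      as [d2 [b [Hd2 [Hb HB]]]].
    destruct (open_C2 W (z0, RtoC 0) HWo (HW0 z0 Hz0)) as [e4 [He4 HW4]]. cbn [fst snd] in HW4.
    set (L := (Rabs L3 + 2 * (/ b * K1))%R).
    assert (Hib : (0 < / b)%R) by now apply Rinv_0_lt_compat.
    assert (Hbk : (0 < / b * K1)%R) by nra.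
    assert (HL : (0 < L)%R) by (unfold L; pose proof (Rabs_pos L3); lra).
    set (d := Rmin (Rmin (Rmin e0 e3) (Rmin e4 d2)) (Rmin (/ M1) (b / L))).
    assert (Hd : (0 < d)%R).
    { repeat apply Rmin_pos; auto. now apply Rinv_0_lt_compat. now apply Rdiv_lt_0_compat. }
    assert (D0 : (d <= Rmin (Rmin e0 e3) (Rmin e4 d2))%R) by apply Rmin_l.
    assert (D0' : (d <= Rmin (/ M1) (b / L))%R) by apply Rmin_r.
    pose proof (Rmin_l (Rmin e0 e3) (Rmin e4 d2)). pose proof (Rmin_r (Rmin e0 e3) (Rmin e4 d2)).
    pose proof (Rmin_l e0 e3). pose proof (Rmin_r e0 e3). pose proof (Rmin_l e4 d2). pose proof (Rmin_r e4 d2).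
    pose proof (Rmin_l (/ M1) (b / L)). pose proof (Rmin_r (/ M1) (b / L)).
    exists d. split; auto. intros z Hz y Hy.
    assert (Hy1 : cone sg k c M1 (z, y)).
    { revert Hy. apply cone_weaken; try lra. rewrite <- (Rinv_inv M1). apply Rinv_le_contravar; lra. }
    assert (Hy2 : cone sg k c (/ d2) (z, y)).
    { revert Hy. apply cone_weaken; try lra. apply Rinv_le_contravar; lra. }
    destruct (cone_y sg k c (/ d) (z, y) ltac:(now apply Rinv_0_lt_compat) Hy) as [[Y1 Y2] _].
    rewrite Rinv_inv in Y2. cbn [snd] in Y1, Y2.
    destruct (H1 _ Hy1) as [A1 A2]. cbn [fst snd] in A1, A2. fold J0 in A1, A2.
    destruct (HB _ Hy2) as [B1 [B2 B3]]. cbn [fst]; lra. fold J1 in B1.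
    specialize (HL3 (z - z0) y ltac:(lra) ltac:(lra)). specialize (Hom (z - z0) y ltac:(lra) ltac:(lra)).
    replace (z0 + (z - z0)) with z in * by ring. replace (0 + y) with y in * by ring.
    destruct Hom as [_ [O1 [O2 O3]]].
    split. { apply HW4; cbn [fst snd]. lra. replace (y - 0) with y by ring. lra. }
    split; auto.
    destruct (wedge_zero_proportional _ _ O1 O2 O3) as [l [Hl El]].
    rewrite El, !wedge_scal_l.
    assert (P : wedge (om (z, y)) (J1 (z, y)) <> 0) by (apply Cmod_gt_0; lra).
    split. { now apply Cmult_neq_0. }
    rewrite !Cmod_mult.
    set (j := pullback (jet Psi 3) (pencil tau t) (z, y)) in *.
    assert (E : wedge (om (z, y)) (J0 (z, y)) = wedge (om (z, y)) j +
      (fst (om (z, y)) * (snd (J0 (z, y)) - snd j) - snd (om (z, y)) * (fst (J0 (z, y)) - fst j)))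
      by (unfold wedge; ring).
    assert (Y3 : (0 < Cmod y ^ 3)%R) by now apply pow_lt.
    assert (Bd : (Cmod (wedge (om (z, y)) (J0 (z, y))) <= L * Cmod y ^ 3)%R).
    { rewrite E. eapply Rle_trans. apply Cmod_triangle.
      pose proof (Cmod_sub_le (fst (om (z, y)) * (snd (J0 (z, y)) - snd j)) (snd (om (z, y)) * (fst (J0 (z, y)) - fst j))) as T.
      rewrite !Cmod_mult in T.
      assert (Cmod (fst (om (z, y))) * Cmod (snd (J0 (z, y)) - snd j) <= / b * (K1 * Cmod y ^ 3))%R
        by (apply Rmult_le_compat; auto; apply Cmod_ge_0).
      assert (Cmod (snd (om (z, y))) * Cmod (fst (J0 (z, y)) - fst j) <= / b * (K1 * Cmod y ^ 3))%R
        by (apply Rmult_le_compat; auto; apply Cmod_ge_0).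
      assert (L3 * Cmod y ^ 3 <= Rabs L3 * Cmod y ^ 3)%R by (apply Rmult_le_compat_r; [lra | apply Rle_abs]).
      unfold L. lra. }
    assert (Pl : (0 <= Cmod l)%R) by apply Cmod_ge_0.
    assert (d * L <= b)%R.
    { apply Rle_trans with (b / L * L)%R. apply Rmult_le_compat_r; lra. right; field; lra. }
    assert (Q : (d * Cmod (wedge (om (z, y)) (J0 (z, y))) <= Cmod y ^ 3 * Cmod (wedge (om (z, y)) (J1 (z, y))))%R).
    { apply Rle_trans with (d * (L * Cmod y ^ 3))%R. apply Rmult_le_compat_l; lra.
      replace (d * (L * Cmod y ^ 3))%R with (Cmod y ^ 3 * (d * L))%R by ring.
      apply Rmult_le_compat_l; lra. }
    apply (Rmult_le_compat_l (Cmod l)) in Q; auto. lra.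
  - set (M := (M2 + / d + 1)%R).
    assert (Hid : (0 < / d)%R) by now apply Rinv_0_lt_compat.
    exists M, (4 * / d)%R. split. unfold M; lra. split. lra.
    intros [z y] Hp.
    destruct (HG z ltac:(apply Hp) y) as [A1 [A2 [A3 A4]]].
    { revert Hp; apply cone_weaken; unfold M; lra. }
    destruct (H2 (z, y)) as [B0 [_ [_ [_ B4]]]].
    { revert Hp; apply cone_weaken; unfold M; lra. }
    destruct (small_of_cone sg k c M 1 (z, y) ltac:(lra) ltac:(unfold M; lra) Hp) as [Y0 [_ Y1]].
    cbn [snd] in *. rewrite Rmult_1_l in Y1.
    destruct HN as [N1 [N2 _]]. destruct (N1 _ B0) as [_ [N3 N4]].
    assert (E0 := pullback_flip_pencil tau S psi t (z, y) Ht N2 B0 N3 N4).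
    assert (E1 := pullback_flip_pencil tau S psi (other_member t) (z, y) Ht N2 B0 N3 N4).
    cbv zeta in E0, E1. fold J0 in E0. fold J1 in E1.
    rewrite E1, wedge_scal_r in A3, A4. rewrite E0, wedge_scal_r in A4. clear E0 E1.
    set (w0 := wedge (eta (z, y)) (coframe tau psi (limit_line tau t) (z, y))) in *.
    set (w1 := wedge (eta (z, y)) (coframe tau psi (limit_line tau (other_member t)) (z, y))) in *.
    set (s0 := match t with Some _ => / snd (psi (z, y)) ^ 2 / two_pi_i | None => / two_pi_i end) in *.
    set (s1 := match other_member t with Some _ => / snd (psi (z, y)) ^ 2 / two_pi_i | None => / two_pi_i end) in *.
    assert (W1 : w1 <> 0) by (intros E; apply A3; rewrite E; ring).
    repeat split; auto.
    unfold slope. fold w0 w1.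
    assert (P1 := proj1 (Cmod_gt_0 _) W1).
    unfold Cdiv. rewrite Cmod_mult, Cmod_opp, Cmod_inv by auto.
    apply (Rmult_le_reg_r (Cmod w1)); auto. rewrite Rmult_assoc, Rinv_l, Rmult_1_r by lra.
    rewrite !Cmod_mult in A4.
    assert (Pp : (0 < Cmod (/ two_pi_i))%R).
    { rewrite Cmod_inv by auto. apply Rinv_0_lt_compat. now apply Cmod_gt_0. }
    set (x := Cmod (/ two_pi_i)) in *. set (y0 := Cmod y) in *.
    set (v := Cmod (/ snd (psi (z, y)))) in *.
    assert (Ev : Cmod (/ snd (psi (z, y)) ^ 2) = (v ^ 2)%R).
    { unfold v. rewrite Cmod_inv, (Cmod_inv (snd _)), Cmod_pow by (auto; simpl; now repeat apply Cmult_neq_0; auto; apply C1_nz).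
      rewrite pow_inv. reflexivity. }
    pose proof (Cmod_ge_0 w0) as P0.
    assert (V2 : (y0 ^ 2 / 4 <= v ^ 2 <= 4 * y0 ^ 2)%R) by (simpl; nra).
    assert (y2 : (0 < y0 ^ 2)%R) by now apply pow_lt.
    assert (Fin : (d * Cmod w0 <= 4 * y0 * Cmod w1)%R).
    (* For finite t the factor v^2, comparable to |y|^2, sits with the numerator and uses up two of
       the three powers of |y|. For t = oo it sits with the denominator, and |y| <= 1 suffices. *)
    { unfold s0, s1 in A4. destruct t as [t|]; cbn [other_member] in A4; unfold Cdiv in A4; rewrite ?Cmod_mult, ?Ev in A4; fold x in A4.
      - assert (Q1 : (d * (v ^ 2 * Cmod w0) <= y0 ^ 3 * Cmod w1)%R).
        { apply (Rmult_le_reg_r x); auto. lra. }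
        assert (Q2 : (d * Cmod w0 * (y0 ^ 2 / 4) <= d * Cmod w0 * v ^ 2)%R).
        { apply Rmult_le_compat_l. nra. apply V2. }
        apply (Rmult_le_reg_r (y0 ^ 2 / 4)). lra. 
        replace (4 * y0 * Cmod w1 * (y0 ^ 2 / 4))%R with (y0 ^ 3 * Cmod w1)%R by field. lra.
      - assert (Q1 : (d * Cmod w0 <= y0 ^ 3 * (v ^ 2 * Cmod w1))%R).
        { apply (Rmult_le_reg_r x); auto. lra. }
        assert (Q2 : (y0 ^ 3 * (v ^ 2 * Cmod w1) <= y0 * (4 * Cmod w1))%R).
        { assert (Y : (y0 ^ 2 <= 1)%R) by (simpl; nra).
          replace (y0 ^ 3)%R with (y0 * y0 ^ 2)%R by ring. rewrite Rmult_assoc.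
          apply Rmult_le_compat_l. lra. rewrite <- Rmult_assoc. apply Rmult_le_compat_r. lra. nra. }
        lra. }
    apply (Rmult_le_reg_l d); auto.
    replace (d * (4 * / d * y0 * Cmod w1))%R with (4 * y0 * Cmod w1)%R by (field; lra). exact Fin.
Qed.

(** * Invariance of the slope under the gluing map *)

Lemma hdiff_ext (f g : C2 -> C) (p : C2) (a b : C) (d : R) : (0 < d)%R ->
  (forall q : C2, (Cmod (fst q - fst p) < d)%R -> (Cmod (snd q - snd p) < d)%R -> f q = g q) ->
  hdiff f p a b -> hdiff g p a b.
Proof.
  intros Hd E H eps He. destruct (H eps He) as [d' [Hd' H']].
  exists (Rmin d d'). split. now apply Rmin_pos.
  intros h k Hh Hk. apply Rmin_Rgt_l in Hh. apply Rmin_Rgt_l in Hk.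
  rewrite <- (E (fst p + h, snd p + k)), <- (E p). apply H'; lra.
  replace (fst p - fst p) with (RtoC 0) by ring. now rewrite Cmod_0.
  replace (snd p - snd p) with (RtoC 0) by ring. now rewrite Cmod_0.
  cbn [fst]. replace (fst p + h - fst p) with h by ring. lra.
  cbn [snd]. replace (snd p + k - snd p) with k by ring. lra.
Qed.

Lemma hdiff_comp_map (G : C2 -> C) (f : C2 -> C2) (p : C2) : hd G (f p) ->
  hd (fun q => fst (f q)) p -> hd (fun q => snd (f q)) p ->
  hdiff (fun q => G (f q)) p
    (dz G (f p) * dz (fun q => fst (f q)) p + dy G (f p) * dz (fun q => snd (f q)) p)
    (dz G (f p) * dy (fun q => fst (f q)) p + dy G (f p) * dy (fun q => snd (f q)) p).
Proof.
  intros HG H1 H2. apply (hdiff_ext (fun q => G (fst (f q), snd (f q))) _ _ _ _ 1 ltac:(lra)).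
  intros q _ _. now destruct (f q).
  apply (hdiff_comp2 G (fun q => fst (f q)) (fun q => snd (f q))); auto.
  destruct (f p). exact HG.
Qed.

Lemma holo_continuous (f : C2 -> C2) (p : C2) : holo_at f p ->
  forall eps, (0 < eps)%R -> exists d : R, (0 < d)%R /\ forall q : C2,
    (Cmod (fst q - fst p) < d)%R -> (Cmod (snd q - snd p) < d)%R ->
    (Cmod (fst (f q) - fst (f p)) < eps)%R /\ (Cmod (snd (f q) - snd (f p)) < eps)%R.
Proof.
  intros H eps He. destruct (holo_hd f p H) as [A B].
  destruct (hdiff_continuous _ _ _ _ A eps He) as [d1 [Hd1 H1]].
  destruct (hdiff_continuous _ _ _ _ B eps He) as [d2 [Hd2 H2]].
  exists (Rmin d1 d2). split. now apply Rmin_pos.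
  intros q Q1 Q2. apply Rmin_Rgt_l in Q1. apply Rmin_Rgt_l in Q2. split; [apply H1 | apply H2]; lra.
Qed.

Definition jacobian (f : C2 -> C2) (p : C2) : C :=
  dz (fun q => fst (f q)) p * dy (fun q => snd (f q)) p -
  dy (fun q => fst (f q)) p * dz (fun q => snd (f q)) p.

Lemma biholo_jacobian (S : C2 -> Prop) (f : C2 -> C2) (p : C2) :
  biholo_on S f -> S p -> jacobian f p <> 0.
Proof.
  intros [HS [Hf [_ [g [Hg Hgf]]]]] Sp.
  destruct (holo_hd _ _ (Hf p Sp)) as [F1 F2].
  destruct (holo_hd _ _ (Hg (f p) (ex_intro _ p (conj Sp eq_refl)))) as [G1 G2].
  destruct (open_C2 S p HS Sp) as [d [Hd HO]].
  assert (A1 := hdiff_comp_map (fun q => fst (g q)) f p G1 F1 F2).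
  assert (A2 := hdiff_comp_map (fun q => snd (g q)) f p G2 F1 F2).
  apply (hdiff_ext _ fst p _ _ d Hd) in A1. 2: { intros q Q1 Q2. now rewrite Hgf by auto. }
  apply (hdiff_ext _ snd p _ _ d Hd) in A2. 2: { intros q Q1 Q2. now rewrite Hgf by auto. }
  assert (E1 := hdiff_dz _ _ _ _ A1). assert (E2 := hdiff_dy _ _ _ _ A1).
  assert (E3 := hdiff_dz _ _ _ _ A2). assert (E4 := hdiff_dy _ _ _ _ A2).
  rewrite (hdiff_dz _ _ _ _ (hdiff_id_fst p)) in E1. rewrite (hdiff_dy _ _ _ _ (hdiff_id_fst p)) in E2.
  rewrite (hdiff_dz _ _ _ _ (hdiff_id_snd p)) in E3. rewrite (hdiff_dy _ _ _ _ (hdiff_id_snd p)) in E4.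
  intros J. unfold jacobian in J.
  set (a := dz (fun q => fst (f q)) p) in *. set (b := dy (fun q => fst (f q)) p) in *.
  set (c := dz (fun q => snd (f q)) p) in *. set (e := dy (fun q => snd (f q)) p) in *.
  set (a' := dz (fun q => fst (g q)) (f p)) in *. set (b' := dy (fun q => fst (g q)) (f p)) in *.
  set (c' := dz (fun q => snd (g q)) (f p)) in *. set (e' := dy (fun q => snd (g q)) (f p)) in *.
  assert (Z : RtoC 1 = 0).
  { transitivity ((a' * a + b' * c) * (c' * b + e' * e) - (a' * b + b' * e) * (c' * a + e' * c)).
    rewrite <- E1, <- E2, <- E3, <- E4. ring.
    transitivity ((a' * e' - b' * c') * (a * e - b * c)). ring. rewrite J. ring. }
  apply (f_equal fst) in Z. simpl in Z. lra.
Qed.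

(** [F100] multiplies z by q and translates xi, so it preserves dz/z and dxi, of which dX/X and dY/Y
    are constant combinations. The right-hand side is the pullback by F of the coframe at F p. *)
Lemma coframe_F_invariant (tau : C) (S : C2 -> Prop) (F psi : C2 -> C2) (l : C2) (p : C2) :
  qpar tau <> 0 -> biholo_on S psi ->
  (forall p, S p -> S (F p) -> psi (F p) = F100 tau (psi p)) ->
  S p -> S (F p) -> holo_at F p -> fst (psi p) <> 0 -> fst (psi (F p)) <> 0 ->
  let th := coframe tau psi l (F p) in
  coframe tau psi l p =
    (fst th * dz (fun q => fst (F q)) p + snd th * dz (fun q => snd (F q)) p,
     fst th * dy (fun q => fst (F q)) p + snd th * dy (fun q => snd (F q)) p).
Proof.
  intros Hq [HS [Hh _]] Hc Sp SFp HF N1 N2 th.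
  destruct (holo_hd _ _ HF) as [F1 F2].
  destruct (holo_hd _ _ (Hh p Sp)) as [P1 P2].
  destruct (holo_hd _ _ (Hh (F p) SFp)) as [Q1 Q2].
  assert (A1 := hdiff_comp_map (fun q => fst (psi q)) F p Q1 F1 F2).
  assert (A2 := hdiff_comp_map (fun q => snd (psi q)) F p Q2 F1 F2).
  destruct (open_C2 S p HS Sp) as [d1 [Hd1 HO1]].
  destruct (open_C2 S (F p) HS SFp) as [d2 [Hd2 HO2]].
  destruct (holo_continuous F p HF d2 Hd2) as [d3 [Hd3 HO3]].
  assert (Hd : (0 < Rmin d1 d3)%R) by (now apply Rmin_pos).
  assert (Loc : forall q : C2, (Cmod (fst q - fst p) < Rmin d1 d3)%R -> (Cmod (snd q - snd p) < Rmin d1 d3)%R ->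
     psi (F q) = F100 tau (psi q)).
  { intros q X1 X2. apply Rmin_Rgt_l in X1. apply Rmin_Rgt_l in X2. apply Hc.
    apply HO1; lra. destruct (HO3 q ltac:(lra) ltac:(lra)). apply HO2; auto. }
  apply (hdiff_ext _ (fun q => qpar tau * fst (psi q)) p _ _ _ Hd) in A1.
  2: { intros q X1 X2. now rewrite (Loc q X1 X2). }
  apply (hdiff_ext _ (fun q => snd (psi q) - 1) p _ _ _ Hd) in A2.
  2: { intros q X1 X2. now rewrite (Loc q X1 X2). }
  assert (B1 : hdiff (fun q => qpar tau * fst (psi q)) p (qpar tau * dz (fun q => fst (psi q)) p) (qpar tau * dy (fun q => fst (psi q)) p)).
  { pose proof (hdiff_mult (fun _ => qpar tau) (fun q => fst (psi q)) p 0 0 _ _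
      (hdiff_of_cdiff_fst (fun _ => qpar tau) p 0 (cdiff_const _ _)) P1) as B.
    replace (qpar tau * dz (fun q => fst (psi q)) p) with (fst (psi p) * 0 + qpar tau * dz (fun q => fst (psi q)) p) by ring.
    replace (qpar tau * dy (fun q => fst (psi q)) p) with (fst (psi p) * 0 + qpar tau * dy (fun q => fst (psi q)) p) by ring.
    exact B. }
  assert (B2 : hdiff (fun q => snd (psi q) - 1) p (dz (fun q => snd (psi q)) p - 0) (dy (fun q => snd (psi q)) p - 0)).
  { apply (hdiff_minus (fun q => snd (psi q)) (fun _ => 1)); auto.
    apply (hdiff_of_cdiff_fst (fun _ => 1) p 0 (cdiff_const _ _)). }
  assert (E1 := hdiff_dz _ _ _ _ A1). rewrite (hdiff_dz _ _ _ _ B1) in E1.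
  assert (E2 := hdiff_dy _ _ _ _ A1). rewrite (hdiff_dy _ _ _ _ B1) in E2.
  assert (E3 := hdiff_dz _ _ _ _ A2). rewrite (hdiff_dz _ _ _ _ B2) in E3.
  assert (E4 := hdiff_dy _ _ _ _ A2). rewrite (hdiff_dy _ _ _ _ B2) in E4.
  assert (E0 : fst (psi (F p)) = qpar tau * fst (psi p)) by (now rewrite Hc).
  unfold th, coframe. cbn [fst snd]. rewrite E0 in *.
  set (X1 := dz (fun q => fst (psi q)) p) in *. set (Y1 := dy (fun q => fst (psi q)) p) in *.
  set (X2 := dz (fun q => snd (psi q)) p) in *. set (Y2 := dy (fun q => snd (psi q)) p) in *.
  assert (G1 : X1 = / qpar tau * (qpar tau * X1)) by (field; auto).
  assert (G2 : Y1 = / qpar tau * (qpar tau * Y1)) by (field; auto).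
  assert (G3 : X2 = X2 - 0) by ring. assert (G4 : Y2 = Y2 - 0) by ring.
  rewrite G1, G2, G3, G4, E1, E2, E3, E4.
  apply injective_projections; cbn [fst snd]; field; auto.
Qed.

(** Pulling back by F multiplies both wedge products by the Jacobian, and [eta] is proportional to
    its pullback; the two factors cancel in the quotient. *)
Lemma slope_F_invariant (tau : C) (S : C2 -> Prop) (F psi eta : C2 -> C2) (V : C2 -> Prop) (t : P1) (p : C2) :
  qpar tau <> 0 -> biholo_on S psi -> biholo_on V F -> V p ->
  (forall p, S p -> S (F p) -> psi (F p) = F100 tau (psi p)) ->
  S p -> S (F p) -> fst (psi p) <> 0 -> fst (psi (F p)) <> 0 ->
  wedge (pullback F eta p) (eta p) = 0 ->
  eta p <> (RtoC 0, RtoC 0) -> eta (F p) <> (RtoC 0, RtoC 0) ->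
  slope tau psi eta t (F p) = slope tau psi eta t p.
Proof.
  intros Hq HS HF Vp Hc Sp SFp N1 N2 Hw He1 He2.
  pose proof (biholo_jacobian V F p HF Vp) as HJ.
  assert (HFp : holo_at F p) by (apply HF; auto).
  assert (Cf : forall l, coframe tau psi l p = _) by
    (intros l; exact (coframe_F_invariant tau S F psi l p Hq HS Hc Sp SFp HFp N1 N2)).
  set (e := eta (F p)) in *.
  assert (Wd : forall l, wedge (pullback F eta p) (coframe tau psi l p) =
     jacobian F p * wedge e (coframe tau psi l (F p))).
  { intros l. rewrite Cf. unfold wedge, pullback, jacobian. fold e. cbn [fst snd]. ring. }
  assert (Np : pullback F eta p <> (RtoC 0, RtoC 0)).
  { intros E. apply He2. unfold pullback in E. fold e in E.
    apply (f_equal fst) in E as E1. apply (f_equal snd) in E as E2. cbn [fst snd] in E1, E2.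
    unfold jacobian in HJ.
    set (a := dz (fun q => fst (F q)) p) in *. set (b := dy (fun q => fst (F q)) p) in *.
    set (c := dz (fun q => snd (F q)) p) in *. set (d := dy (fun q => snd (F q)) p) in *.
    apply injective_projections; cbn [fst snd].
    - transitivity ((d * (fst e * a + snd e * c) - c * (fst e * b + snd e * d)) / (a * d - b * c)).
      field; auto. rewrite E1, E2. field; auto.
    - transitivity ((a * (fst e * b + snd e * d) - b * (fst e * a + snd e * c)) / (a * d - b * c)).
      field; auto. rewrite E1, E2. field; auto. }
  destruct (wedge_zero_proportional _ _ Np He1 Hw) as [m [Hm Em]].
  unfold slope. fold e. rewrite Em, !wedge_scal_l, !Wd.
  set (w0 := wedge e (coframe tau psi (limit_line tau t) (F p))).
  set (w1 := wedge e (coframe tau psi (limit_line tau (other_member t)) (F p))).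
  (* If the denominator vanishes, both slopes are 0, because / 0 = 0. *)
  destruct (classic (w1 = 0)) as [Z|Z].
  - rewrite Z. replace (m * (jacobian F p * 0)) with (RtoC 0) by ring.
    assert (I0 : / RtoC 0 = 0) by (apply injective_projections; simpl; unfold Rdiv; ring).
    unfold Cdiv. rewrite I0. ring.
  - field. auto.
Qed.

Lemma Cmod_qpar (tau : C) : Cmod (qpar tau) = exp (- (2 * PI * Im tau)).
Proof.
  unfold qpar. rewrite Cmod_Cexp. f_equal. unfold two_pi_i, Re, Im. simpl. ring.
Qed.

Lemma qpar_neq_0 (tau : C) : qpar tau <> 0.
Proof. apply Cexp_neq_0. Qed.

(** To leading order F is (q z, y), with errors O(y^2) in both components: it only widens the
    annulus by Q = - ln |q|, up to the margins of [cone_perturb]. *)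
Lemma cone_F_stable (tau sg : C) (V : C2 -> Prop) (F : C2 -> C2) (Psi : formal_diffeo)
    (S : C2 -> Prop) (psi : C2 -> C2) :
  (0 < Im tau)%R -> is_neighborhood tau V F -> cone_normalization tau F Psi sg S psi ->
  forall c k : R, (0 < c)%R -> (0 < k)%R ->
  exists M : R, (0 < M)%R /\ forall p, cone sg k c M p -> S (F p).
Proof.
  intros Htau [_ [_ [_ [HF1 HF2]]]] HN c k Hc Hk.
  set (Q := (2 * PI * Im tau)%R).
  assert (HQ : (0 < Q)%R) by (unfold Q; pose proof PI_RGT_0; apply Rmult_lt_0_compat; lra).
  destruct (cone_normalization_near_id _ _ _ _ _ _ HN (c + Q + 1) (k / 2) ltac:(lra) ltac:(lra))
    as [M0 [K0 [HM0 [HK0 HB]]]].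
  destruct (annulus_uniform c (fun z d => forall y, (Cmod y < d)%R ->
     (d * Cmod (fst (F (z, y)) - qpar tau * z) <= Cmod y ^ 2)%R /\
     (d * Cmod (snd (F (z, y)) - (y + y ^ 2 + y ^ 3)) <= Cmod y ^ 4)%R)) as [d [Hd HG]].
  - intros z d d' Hd G y Hy. destruct (G y ltac:(lra)) as [A B].
    pose proof (Cmod_ge_0 (fst (F (z, y)) - qpar tau * z)).
    pose proof (Cmod_ge_0 (snd (F (z, y)) - (y + y ^ 2 + y ^ 3))). split; nra.
  - intros z0 Hz0. destruct (HF1 z0 Hz0) as [L1 H1]. destruct (HF2 z0 Hz0) as [L2 H2].
    apply locally_C2 in H1. destruct H1 as [e1 [He1 H1]].
    apply locally_C2 in H2. destruct H2 as [e2 [He2 H2]]. cbn [fst snd] in H1, H2.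
    set (L := (Rabs L1 + Rabs L2 + 1)%R).
    pose proof (Rabs_pos L1). pose proof (Rabs_pos L2). pose proof (Rle_abs L1). pose proof (Rle_abs L2).
    assert (HL : (0 < L)%R) by (unfold L; lra).
    set (d := Rmin (Rmin e1 e2) (/ L)).
    assert (Hd : (0 < d)%R) by (repeat apply Rmin_pos; auto; now apply Rinv_0_lt_compat).
    exists d. split; auto. intros z Hz y Hy.
    assert (D1 : (d <= Rmin e1 e2)%R) by apply Rmin_l. assert (D2 : (d <= / L)%R) by apply Rmin_r.
    pose proof (Rmin_l e1 e2). pose proof (Rmin_r e1 e2).
    specialize (H1 (z - z0) y ltac:(lra) ltac:(lra)). specialize (H2 (z - z0) y ltac:(lra) ltac:(lra)).
    replace (z0 + (z - z0)) with z in * by ring. replace (0 + y) with y in * by ring.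
    assert (D3 : (d * L <= 1)%R).
    { apply Rle_trans with (/ L * L)%R. apply Rmult_le_compat_r; lra. right; field; lra. }
    assert (Y2 : (0 <= Cmod y ^ 2)%R) by (apply pow_le, Cmod_ge_0).
    assert (Y4 : (0 <= Cmod y ^ 4)%R) by (apply pow_le, Cmod_ge_0).
    assert (T : forall a m n : R, (a <= n * m)%R -> (n <= L)%R -> (0 <= m)%R -> (d * a <= m)%R).
    { intros a m n A B Pm. apply Rle_trans with (d * (n * m))%R. apply Rmult_le_compat_l; lra.
      replace (d * (n * m))%R with (d * n * m)%R by ring.
      assert (d * n <= d * L)%R by (apply Rmult_le_compat_l; lra). nra. }
    split; [apply (T _ _ L1) | apply (T _ _ L2)]; auto; unfold L; lra.
  - pose proof (Cmod_ge_0 sg) as Psg.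
    set (r := (Rmin 1 (k / (2 * (k + Cmod sg))))%R).
    assert (Hr : (0 < r)%R) by (apply Rmin_pos; [lra | apply Rdiv_lt_0_compat; lra]).
    assert (Hr1 : (r <= 1)%R) by apply Rmin_l.
    assert (Hr2 : (r * (2 * (k + Cmod sg)) <= k)%R).
    { apply Rle_trans with (k / (2 * (k + Cmod sg)) * (2 * (k + Cmod sg)))%R.
      apply Rmult_le_compat_r. lra. apply Rmin_r. right; field; lra. }
    set (e := exp (- (c + Q))). assert (He : (0 < e)%R) by apply exp_pos.
    assert (Hid : (0 < / d)%R) by (now apply Rinv_0_lt_compat).
    assert (Hier : (0 < 6 / r)%R) by (apply Rdiv_lt_0_compat; lra).
    assert (Hde : (0 < 2 / (d * e))%R) by (apply Rdiv_lt_0_compat; nra).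
    set (M := (2 * M0 + / d + 6 / r + 2 / (d * e) + 4)%R).
    exists M. split. unfold M; lra.
    intros [z y] Hp.
    destruct (small_of_cone sg k c M (/ d) (z, y) Hid ltac:(unfold M; lra) Hp) as [Y0 [Y1 Y1']].
    destruct (small_of_cone sg k c M (6 / r) (z, y) Hier ltac:(unfold M; lra) Hp) as [_ [_ Y2]].
    destruct (small_of_cone sg k c M (2 / (d * e)) (z, y) Hde ltac:(unfold M; lra) Hp) as [_ [_ Y3]].
    destruct (small_of_cone sg k c M 4 (z, y) ltac:(lra) ltac:(unfold M; lra) Hp) as [_ [_ Y4]].
    rewrite Rinv_inv in Y1. cbn [snd] in *.
    destruct (HG z ltac:(apply Hp) y Y1) as [A1 A2].
    destruct (F (z, y)) as [z' y'] eqn:EF. cbn [fst snd] in A1, A2.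
    set (v := Cmod y) in *.
    assert (B1 : (Cmod (z' - qpar tau * z) <= e / 2)%R).
    { apply (Rmult_le_reg_l d); auto. eapply Rle_trans. apply A1.
      assert (v <= d * e / 2)%R.
      { apply (Rmult_le_reg_l (2 / (d * e))); auto.
        replace (2 / (d * e) * (d * e / 2))%R with 1%R by (field; nra). exact Y3. }
      simpl. nra. }
    assert (B2 : (Cmod (y' - y) <= 3 * v ^ 2)%R).
    { replace (y' - y) with (y' - (y + y ^ 2 + y ^ 3) + (y ^ 2 + y ^ 3)) by ring.
      eapply Rle_trans. apply Cmod_triangle.
      pose proof (Cmod_triangle (y ^ 2) (y ^ 3)) as T. rewrite !Cmod_pow in T. fold v in T.
      assert (Q1 : (Cmod (y' - (y + y ^ 2 + y ^ 3)) <= v ^ 3)%R).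
      { apply (Rmult_le_reg_l d); auto. eapply Rle_trans. apply A2.
        replace (v ^ 4)%R with (v * v ^ 3)%R by ring. apply Rmult_le_compat_r; try lra.
        apply pow_le; lra. }
      assert (v ^ 3 <= v ^ 2)%R.
      { replace (v ^ 3)%R with (v * v ^ 2)%R by ring. assert (0 <= v ^ 2)%R by (apply pow_le; lra). nra. }
      lra. }
    assert (v2 : (v ^ 2 = v * v)%R) by ring.
    assert (Ny' : y' <> 0).
    { apply Cmod_gt_0. pose proof (Cmod_sub_ge y (y - y')) as T.
      replace (y - (y - y')) with y' in T by ring. rewrite (Cmod_sub_sym y y') in T. fold v in T. nra. }
    assert (Ny : y <> 0) by apply Hp.
    apply HB.
    assert (Cn : cone sg k (c + Q) (2 * M0) (qpar tau * z, y)).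
    { destruct Hp as [P1 [P2 [P3 [P4 P5]]]]. cbn [fst snd] in *. repeat split; auto; cbn [fst snd].
      - unfold M in P2. lra.
      - rewrite Cmod_mult, Cmod_qpar. fold Q. replace (- (c + Q))%R with (- Q + - c)%R by ring.
        rewrite exp_plus. apply Rmult_lt_compat_l; auto. apply exp_pos.
      - rewrite Cmod_mult, Cmod_qpar. fold Q. apply Rlt_trans with (exp (- Q) * exp c)%R.
        apply Rmult_lt_compat_l; auto. apply exp_pos. rewrite <- exp_plus. apply exp_increasing. lra. }
    replace M0 with (2 * M0 / 2)%R by field.
    apply (cone_perturb sg k (c + Q) (2 * M0) r (qpar tau * z, y)); auto; cbn [fst snd]; try lra.
    replace (/ y' - / y) with ((y - y') / y * / y') by (field; auto).
    rewrite Cmod_mult. apply Rmult_le_compat_r. apply Cmod_ge_0.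
    rewrite Cmod_div by auto. rewrite Cmod_sub_sym. fold v.
    apply (Rmult_le_reg_r v); auto.
    replace (Cmod (y' - y) / v * v)%R with (Cmod (y' - y)) by (field; lra).
    assert (v * 6 <= r)%R.
    { apply (Rmult_le_reg_l (/ r)). now apply Rinv_0_lt_compat. rewrite Rinv_l by lra. unfold Rdiv in Y2. lra. }
    nra.
Qed.

(** * Logarithmic coordinates *)

Definition cd (f : C -> C) (z : C) : Prop := exists l, cdiff f z l.

Lemma cd_ext (f g : C -> C) (z : C) (d : R) : (0 < d)%R ->
  (forall w, (Cmod (w - z) < d)%R -> f w = g w) -> cd f z -> cd g z.
Proof.
  intros Hd E [l H]. exists l. apply (cdiff_ext f g z l d); auto.
  intros h Hh. apply E. now replace (z + h - z) with h by ring.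
Qed.

Lemma cd_const (c z : C) : cd (fun _ => c) z.
Proof. exists 0. apply cdiff_const. Qed.

Lemma cd_plus (f g : C -> C) (z : C) : cd f z -> cd g z -> cd (fun x => f x + g x) z.
Proof. intros [a A] [b B]. eexists. apply cdiff_plus; eauto. Qed.

Lemma cd_minus (f g : C -> C) (z : C) : cd f z -> cd g z -> cd (fun x => f x - g x) z.
Proof. intros [a A] [b B]. eexists. apply cdiff_minus; eauto. Qed.

Lemma cd_mult (f g : C -> C) (z : C) : cd f z -> cd g z -> cd (fun x => f x * g x) z.
Proof. intros [a A] [b B]. eexists. apply cdiff_mult; eauto. Qed.

Lemma cd_div (f g : C -> C) (z : C) : cd f z -> cd g z -> g z <> 0 -> cd (fun x => f x / g x) z.
Proof.
  intros Hf [b B] Hz. apply cd_mult; auto. eexists. apply cdiff_inv; eauto.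
Qed.

Lemma hd_slice_fst (f : C2 -> C) (x s : C) : hd f (x, s) -> cd (fun w => f (w, s)) x.
Proof. intros H. eexists. apply (hdiff_fst _ _ _ _ _ H). Qed.

Lemma hd_slice_snd (f : C2 -> C) (x s : C) : hd f (x, s) -> cd (fun w => f (x, w)) s.
Proof. intros H. eexists. apply (hdiff_snd _ _ _ _ _ H). Qed.

Lemma hd_comp_map (G : C2 -> C) (f : C2 -> C2) (p : C2) : hd G (f p) ->
  hd (fun q => fst (f q)) p -> hd (fun q => snd (f q)) p -> hd (fun q => G (f q)) p.
Proof. intros A B D. eapply hd_intro. apply hdiff_comp_map; auto. Qed.

(** In logarithmic coordinates the slope contains the partial derivatives of the inverse of psi,
    which have to be differentiated once more. Repeated derivatives come from
    [cdiff_derivative_cdiff], mixed ones from [cdiff_param_derivative]. *)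
Lemma hd_partials (f : C2 -> C) (x0 s0 : C) (d : R) : (0 < d)%R ->
  (forall x s, (Cmod (x - x0) < d)%R -> (Cmod (s - s0) < d)%R -> hd f (x, s)) ->
  (cd (fun x => dz f (x, s0)) x0 /\ cd (fun x => dy f (x, s0)) x0) /\
  (cd (fun s => dz f (x0, s)) s0 /\ cd (fun s => dy f (x0, s)) s0).
Proof.
  intros Hd H.
  assert (X0 : forall w : C, Cmod (w - w) = 0%R) by (intros w; replace (w - w) with (RtoC 0) by ring; apply Cmod_0).
  assert (H0 := H x0 s0 ltac:(rewrite X0; lra) ltac:(rewrite X0; lra)).
  destruct (hdiff_continuous _ _ _ _ H0 1%R ltac:(lra)) as [d' [Hd' HB]]. cbn [fst snd] in HB.
  set (r := Rmin d d'). assert (Hr : (0 < r)%R) by (now apply Rmin_pos).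
  assert (R1 : (r <= d)%R) by apply Rmin_l. assert (R2 : (r <= d')%R) by apply Rmin_r.
  set (M := (Cmod (f (x0, s0)) + 1)%R).
  assert (B : forall x s, (Cmod (x - x0) < r)%R -> (Cmod (s - s0) < r)%R -> (Cmod (f (x, s)) <= M)%R).
  { intros x s A A'. specialize (HB (x, s) ltac:(cbn [fst]; lra) ltac:(cbn [snd]; lra)).
    pose proof (Cmod_triangle (f (x, s) - f (x0, s0)) (f (x0, s0))) as T.
    replace (f (x, s) - f (x0, s0) + f (x0, s0)) with (f (x, s)) in T by ring. unfold M. lra. }
  assert (Hs : forall x s, (Cmod (x - x0) < r)%R -> (Cmod (s - s0) < r)%R -> hd f (x, s)) by (intros; apply H; lra).
  repeat split.
  - apply (cdiff_derivative_cdiff (fun x => f (x, s0)) _ x0 r M Hr).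
    + intros x Hx. apply (hdiff_fst _ _ _ _ _ (Hs x s0 Hx ltac:(rewrite X0; lra))).
    + intros x Hx. apply B; auto. rewrite X0; lra.
  - apply (cdiff_param_derivative (fun x s => f (x, s)) _ x0 s0 r M Hr).
    + intros x s A A'. repeat split; [apply hd_slice_fst | apply hd_slice_snd | apply B]; auto.
    + intros x Hx. apply (hdiff_snd _ _ _ _ _ (Hs x s0 Hx ltac:(rewrite X0; lra))).
  - apply (cdiff_param_derivative (fun s x => f (x, s)) _ s0 x0 r M Hr).
    + intros s x A A'. repeat split; [apply hd_slice_snd | apply hd_slice_fst | apply B]; auto.
    + intros s A. apply (hdiff_fst _ _ _ _ _ (Hs x0 s ltac:(rewrite X0; lra) A)).
  - apply (cdiff_derivative_cdiff (fun s => f (x0, s)) _ s0 r M Hr).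
    + intros s A. apply (hdiff_snd _ _ _ _ _ (Hs x0 s ltac:(rewrite X0; lra) A)).
    + intros s A. apply B; auto. rewrite X0; lra.
Qed.

Lemma hdiff_eq (f : C2 -> C) (p : C2) (a b a' b' : C) :
  hdiff f p a b -> a = a' -> b = b' -> hdiff f p a' b'.
Proof. now intros H <- <-. Qed.

(* The coordinates [x = log X], [s = log Y], where [(X, Y) = Pi tau (z, xi)]. *)
Definition log_chart (tau : C) (q : C2) : C2 := (Cexp (snd q - tau * fst q), fst q / two_pi_i).

Lemma log_chart_hdiff (tau : C) (q : C2) :
  hdiff (fun q => fst (log_chart tau q)) q (fst (log_chart tau q) * - tau) (fst (log_chart tau q)) /\
  hdiff (fun q => snd (log_chart tau q)) q (/ two_pi_i) 0.
Proof.
  split.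
  - assert (A : hdiff (fun q => snd q - tau * fst q) q (0 - (fst q * 0 + tau * 1)) (1 - (fst q * 0 + tau * 0))).
    { apply (hdiff_minus snd (fun q => tau * fst q)). apply hdiff_id_snd.
      apply (hdiff_mult (fun _ => tau) fst). apply (hdiff_of_cdiff_fst (fun _ => tau) q 0 (cdiff_const _ _)).
      apply hdiff_id_fst. }
    pose proof (hdiff_comp2 (fun u => Cexp (fst u)) _ _ q _ _ _ _ _ _
      (hdiff_of_cdiff_fst Cexp (snd q - tau * fst q, snd q - tau * fst q) _ (cdiff_Cexp _)) A A) as B.
    apply (hdiff_eq _ _ _ _ _ _ B); unfold log_chart; cbn [fst snd]; ring.
  - pose proof (hdiff_mult fst (fun _ => / two_pi_i) q _ _ _ _ (hdiff_id_fst q)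
      (hdiff_of_cdiff_fst (fun _ => / two_pi_i) q 0 (cdiff_const _ _))) as B.
    apply (hdiff_eq _ _ _ _ _ _ B); ring.
Qed.

(** As [eta] need not be continuous, it is replaced by a local holomorphic generator [om], to which
    it is proportional. In the coordinates (x, s) the coframe of l is fst l dx + snd l ds, and the
    slope becomes a quotient of holomorphic functions. *)
Lemma slope_log_chart_cd (tau : C) (S : C2 -> Prop) (psi g eta : C2 -> C2) (W : C2 -> Prop) (t : P1) (x0 s0 : C) (p0 : C2) :
  biholo_on S psi -> (forall p, S p -> g (psi p) = p) -> holo_on (image S psi) g ->
  (forall p, S p -> fst (psi p) <> 0) ->
  is_foliation W eta -> S p0 -> W p0 -> psi p0 = log_chart tau (x0, s0) ->
  wedge (eta p0) (coframe tau psi (limit_line tau (other_member t)) p0) <> 0 ->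
  cd (fun x => slope tau psi eta t (g (log_chart tau (x, s0)))) x0 /\
  cd (fun s => slope tau psi eta t (g (log_chart tau (x0, s)))) s0.
Proof.
  intros HS Hgp Hg HN1 Hfol Sp0 Wp0 Ep0 Hw0.
  pose proof two_pi_i_neq_0 as Np.
  destruct (Hfol p0 Wp0) as [om Hom]. apply locally_C2 in Hom. destruct Hom as [d0 [Hd0 Hom]].
  assert (Hom' : forall q : C2, (Cmod (fst q - fst p0) < d0)%R -> (Cmod (snd q - snd p0) < d0)%R ->
    holo_at om q /\ om q <> (RtoC 0, RtoC 0) /\ eta q <> (RtoC 0, RtoC 0) /\ wedge (om q) (eta q) = 0).
  { intros q A B. specialize (Hom _ _ A B).
    replace (fst p0 + (fst q - fst p0), snd p0 + (snd q - snd p0)) with q in Hom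
      by (apply injective_projections; cbn [fst snd]; ring). exact Hom. }
  clear Hom.
  set (E := log_chart tau) in *. set (G := fun q => g (E q)).
  assert (HSi : open (image S psi)) by apply HS.
  assert (Ei : image S psi (E (x0, s0))) by (rewrite <- Ep0; exists p0; auto).
  assert (EG0 : G (x0, s0) = p0) by (unfold G; rewrite <- Ep0; now apply Hgp).
  assert (HE : forall q, hd (fun q => fst (E q)) q /\ hd (fun q => snd (E q)) q).
  { intros q. destruct (log_chart_hdiff tau q) as [A B]. split; eapply hd_intro; eauto. }
  destruct (open_C2 _ _ HSi Ei) as [d1 [Hd1 HO1]].
  destruct (HE (x0, s0)) as [E1 E2].
  destruct (hdiff_continuous _ _ _ _ E1 d1 Hd1) as [d2 [Hd2 HO2]].
  destruct (hdiff_continuous _ _ _ _ E2 d1 Hd1) as [d3 [Hd3 HO3]]. cbn [fst snd] in HO2, HO3.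
  assert (Him : forall q : C2, (Cmod (fst q - x0) < Rmin d2 d3)%R -> (Cmod (snd q - s0) < Rmin d2 d3)%R ->
     image S psi (E q)).
  { intros q A B. pose proof (Rmin_l d2 d3). pose proof (Rmin_r d2 d3). apply HO1; [apply HO2 | apply HO3]; lra. }
  assert (HG : forall q : C2, image S psi (E q) -> hd (fun q => fst (G q)) q /\ hd (fun q => snd (G q)) q).
  { intros q Hq. destruct (holo_hd _ _ (Hg _ Hq)) as [A B]. destruct (HE q).
    split; [apply (hd_comp_map (fun q => fst (g q)) E) | apply (hd_comp_map (fun q => snd (g q)) E)]; auto. }
  destruct (HG _ Ei) as [GG1 GG2].
  destruct (hdiff_continuous _ _ _ _ GG1 d0 Hd0) as [d4 [Hd4 HO4]].
  destruct (hdiff_continuous _ _ _ _ GG2 d0 Hd0) as [d5 [Hd5 HO5]]. cbn [fst snd] in HO4, HO5.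
  rewrite EG0 in HO4, HO5.
  set (d := Rmin (Rmin d2 d3) (Rmin d4 d5)).
  assert (Hd : (0 < d)%R) by (repeat apply Rmin_pos; auto).
  assert (D1 : (d <= Rmin d2 d3)%R) by apply Rmin_l. assert (D2 : (d <= Rmin d4 d5)%R) by apply Rmin_r.
  pose proof (Rmin_l d4 d5) as D3. pose proof (Rmin_r d4 d5) as D4.
  (* [ax] dx + [as_] ds is the pullback of [om] by G, and [num l] is its wedge product with the
     constant covector l. The factor D in [Key] is the Jacobian of G. *)
  set (ax := fun q => fst (om (G q)) * dz (fun q => fst (G q)) q + snd (om (G q)) * dz (fun q => snd (G q)) q).
  set (as_ := fun q => fst (om (G q)) * dy (fun q => fst (G q)) q + snd (om (G q)) * dy (fun q => snd (G q)) q).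
  set (num := fun (l : C2) (q : C2) => ax q * snd l - as_ q * fst l).
  assert (Key : forall q : C2, (Cmod (fst q - x0) < d)%R -> (Cmod (snd q - s0) < d)%R ->
     exists D : C, D <> 0 /\ (forall l, num l q = D * wedge (om (G q)) (coframe tau psi l (G q))) /\
       slope tau psi eta t (G q) = - num (limit_line tau t) q / num (limit_line tau (other_member t)) q).
  { intros q A B.
    assert (Hiq := Him q ltac:(lra) ltac:(lra)).
    destruct Hiq as [p [Sp Ep]].
    assert (EGp : G q = p) by (unfold G; rewrite <- Ep; now apply Hgp).
    destruct (HG q (ex_intro _ p (conj Sp Ep))) as [G1 G2].
    destruct HS as [HSo [HSh [_ _]]].
    destruct (holo_hd _ _ (HSh p Sp)) as [P1 P2].
    rewrite <- EGp in P1, P2.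
    assert (A1 := hdiff_comp_map (fun q => fst (psi q)) G q P1 G1 G2).
    assert (A2 := hdiff_comp_map (fun q => snd (psi q)) G q P2 G1 G2).
    destruct (log_chart_hdiff tau q) as [L1 L2]. fold E in L1, L2.
    assert (Loc : forall r : C2, (Cmod (fst r - fst q) < d - Rmax (Cmod (fst q - x0)) (Cmod (snd q - s0)))%R ->
      (Cmod (snd r - snd q) < d - Rmax (Cmod (fst q - x0)) (Cmod (snd q - s0)))%R -> psi (G r) = E r).
    { intros r X Y. pose proof (Rmax_l (Cmod (fst q - x0)) (Cmod (snd q - s0))).
      pose proof (Rmax_r (Cmod (fst q - x0)) (Cmod (snd q - s0))).
      pose proof (Cmod_triangle (fst r - fst q) (fst q - x0)) as T1.
      replace (fst r - fst q + (fst q - x0)) with (fst r - x0) in T1 by ring.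
      pose proof (Cmod_triangle (snd r - snd q) (snd q - s0)) as T2.
      replace (snd r - snd q + (snd q - s0)) with (snd r - s0) in T2 by ring.
      destruct (Him r ltac:(lra) ltac:(lra)) as [p' [Sp' Ep']]. unfold G. rewrite <- Ep'. now rewrite Hgp. }
    assert (Hdd : (0 < d - Rmax (Cmod (fst q - x0)) (Cmod (snd q - s0)))%R)
      by (assert (Rmax (Cmod (fst q - x0)) (Cmod (snd q - s0)) < d)%R by (apply Rmax_lub_lt; auto); lra).
    apply (hdiff_ext _ (fun q => fst (E q)) q _ _ _ Hdd) in A1. 2: { intros r X Y. now rewrite Loc. }
    apply (hdiff_ext _ (fun q => snd (E q)) q _ _ _ Hdd) in A2. 2: { intros r X Y. now rewrite Loc. }
    assert (Q1 := hdiff_dz _ _ _ _ A1). rewrite (hdiff_dz _ _ _ _ L1) in Q1.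
    assert (Q2 := hdiff_dy _ _ _ _ A1). rewrite (hdiff_dy _ _ _ _ L1) in Q2.
    assert (Q3 := hdiff_dz _ _ _ _ A2). rewrite (hdiff_dz _ _ _ _ L2) in Q3.
    assert (Q4 := hdiff_dy _ _ _ _ A2). rewrite (hdiff_dy _ _ _ _ L2) in Q4.
    assert (EE : fst (E q) = fst (psi (G q))) by (rewrite EGp, Ep; reflexivity).
    assert (N1 : fst (psi (G q)) <> 0) by (rewrite EGp; auto).
    rewrite EE in Q1, Q2.
    set (X1 := dz (fun q => fst (psi q)) (G q)) in *. set (Y1 := dy (fun q => fst (psi q)) (G q)) in *.
    set (X2 := dz (fun q => snd (psi q)) (G q)) in *. set (Y2 := dy (fun q => snd (psi q)) (G q)) in *.
    set (g1x := dz (fun q => fst (G q)) q) in *. set (g1s := dy (fun q => fst (G q)) q) in *.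
    set (g2x := dz (fun q => snd (G q)) q) in *. set (g2s := dy (fun q => snd (G q)) q) in *.
    set (P := fst (psi (G q))) in *.
    exists (g1x * g2s - g1s * g2x).
    assert (HD : g1x * g2s - g1s * g2x <> 0).
    { intros Z. 
      assert (Z2 : P * / two_pi_i = 0).
      { transitivity (- ((X1 * g1x + Y1 * g2x) * (X2 * g1s + Y2 * g2s) - (X1 * g1s + Y1 * g2s) * (X2 * g1x + Y2 * g2x))).
        rewrite <- Q1, <- Q2, <- Q3, <- Q4. ring.
        transitivity (- ((X1 * Y2 - Y1 * X2) * (g1x * g2s - g1s * g2x))). ring. rewrite Z. ring. }
      apply N1. replace P with (P * / two_pi_i * two_pi_i) by (field; auto). rewrite Z2. ring. }
    assert (Hnum : forall l, num l q = (g1x * g2s - g1s * g2x) * wedge (om (G q)) (coframe tau psi l (G q))).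
    { intros l. unfold num, ax, as_. fold g1x g1s g2x g2s.
      set (c1 := fst (coframe tau psi l (G q))). set (c2 := snd (coframe tau psi l (G q))).
      assert (Cx : c1 * g1x + c2 * g2x = fst l).
      { unfold c1, c2, coframe. cbn [fst snd]. fold X1 Y1 X2 Y2 P.
        transitivity (fst l * two_pi_i * (X2 * g1x + Y2 * g2x) + snd l * (/ P * (X1 * g1x + Y1 * g2x) + tau * two_pi_i * (X2 * g1x + Y2 * g2x))).
        unfold Cdiv; ring. rewrite <- Q1, <- Q3. field. auto. }
      assert (Cs : c1 * g1s + c2 * g2s = snd l).
      { unfold c1, c2, coframe. cbn [fst snd]. fold X1 Y1 X2 Y2 P.
        transitivity (fst l * two_pi_i * (X2 * g1s + Y2 * g2s) + snd l * (/ P * (X1 * g1s + Y1 * g2s) + tau * two_pi_i * (X2 * g1s + Y2 * g2s))).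
        unfold Cdiv; ring. rewrite <- Q2, <- Q4. field. auto. }
      rewrite <- Cx, <- Cs. unfold wedge. fold c1 c2. ring. }
    split; auto. split; auto.
    specialize (HO4 q ltac:(lra) ltac:(lra)). specialize (HO5 q ltac:(lra) ltac:(lra)).
    destruct (Hom' (G q) HO4 HO5) as [_ [O1 [O2 O3]]].
    destruct (wedge_zero_proportional _ _ O1 O2 O3) as [m [Hm Em]].
    unfold slope. rewrite !Hnum, Em, !wedge_scal_l.
    set (w0 := wedge (om (G q)) (coframe tau psi (limit_line tau t) (G q))).
    set (w1 := wedge (om (G q)) (coframe tau psi (limit_line tau (other_member t)) (G q))).
    destruct (classic (w1 = 0)) as [Z|Z].
    - rewrite Z, !Cmult_0_r.
      assert (I0 : / RtoC 0 = 0) by (apply injective_projections; simpl; unfold Rdiv; ring).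
      unfold Cdiv. rewrite I0. ring.
    - field. auto. }
  assert (X0 : forall w : C, Cmod (w - w) = 0%R) by (intros w; replace (w - w) with (RtoC 0) by ring; apply Cmod_0).
  assert (Hden : num (limit_line tau (other_member t)) (x0, s0) <> 0).
  { destruct (Key (x0, s0)) as [D [HD [Hn _]]]. cbn [fst]; rewrite X0; lra. cbn [snd]; rewrite X0; lra.
    rewrite Hn. apply Cmult_neq_0; auto. rewrite EG0.
    destruct (Hom' p0) as [_ [O1 [O2 O3]]]. rewrite X0; lra. rewrite X0; lra.
    destruct (wedge_zero_proportional _ _ O1 O2 O3) as [m [Hm Em]].
    intros Z. apply Hw0. rewrite Em, wedge_scal_l, Z. ring. }
  destruct (Hom' p0) as [Ho _]. rewrite X0; lra. rewrite X0; lra.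
  destruct (holo_hd _ _ Ho) as [Ho1 Ho2]. rewrite <- EG0 in Ho1, Ho2.
  assert (OG1 := hd_comp_map (fun q => fst (om q)) G (x0, s0) Ho1 GG1 GG2).
  assert (OG2 := hd_comp_map (fun q => snd (om q)) G (x0, s0) Ho2 GG1 GG2).
  destruct (hd_partials (fun q => fst (G q)) x0 s0 d Hd) as [[P1 P2] [P3 P4]].
  { intros x s A B. apply HG. apply Him; cbn [fst snd]; lra. }
  destruct (hd_partials (fun q => snd (G q)) x0 s0 d Hd) as [[P5 P6] [P7 P8]].
  { intros x s A B. apply HG. apply Him; cbn [fst snd]; lra. }
  assert (O1x := hd_slice_fst _ _ _ OG1). assert (O1s := hd_slice_snd _ _ _ OG1).
  assert (O2x := hd_slice_fst _ _ _ OG2). assert (O2s := hd_slice_snd _ _ _ OG2).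
  assert (Nx : forall l, cd (fun x => num l (x, s0)) x0).
  { intros l. unfold num, ax, as_.
    apply (cd_minus (fun x => (_ + _) * snd l) (fun x => (_ + _) * fst l));
    (apply cd_mult; [apply cd_plus; apply cd_mult; assumption | apply cd_const]). }
  assert (Ns : forall l, cd (fun s => num l (x0, s)) s0).
  { intros l. unfold num, ax, as_.
    apply (cd_minus (fun x => (_ + _) * snd l) (fun x => (_ + _) * fst l));
    (apply cd_mult; [apply cd_plus; apply cd_mult; assumption | apply cd_const]). }
  split.
  - apply (cd_ext (fun x => (0 - num (limit_line tau t) (x, s0)) / num (limit_line tau (other_member t)) (x, s0)) _ x0 d Hd).
    + intros x Hx. destruct (Key (x, s0)) as [D [_ [_ K]]]; cbn [fst snd]; auto. rewrite X0; lra.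
      unfold G in K at 1. rewrite K. unfold Cdiv. ring.
    + apply cd_div; auto. apply cd_minus; auto. apply cd_const.
  - apply (cd_ext (fun s => (0 - num (limit_line tau t) (x0, s)) / num (limit_line tau (other_member t)) (x0, s)) _ s0 d Hd).
    + intros s Hs. destruct (Key (x0, s)) as [D [_ [_ K]]]; cbn [fst snd]; auto. rewrite X0; lra.
      unfold G in K at 1. rewrite K. unfold Cdiv. ring.
    + apply cd_div; auto. apply cd_minus; auto. apply cd_const.
Qed.

(** * Continuation of the slope by periodicity *)

Lemma two_pi_i_eq : two_pi_i = (0%R, (2 * PI)%R).
Proof. unfold two_pi_i. apply injective_projections; simpl; ring. Qed.

Lemma cd_shift (f : C -> C) (z c : C) : cd f (z + c) -> cd (fun x => f (x + c)) z.
Proof.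
  intros [l H]. exists (l * (1 + 0)). apply (cdiff_comp f (fun x => x + c)); auto.
  apply (cdiff_plus (fun x => x) (fun _ => c)). apply cdiff_id. apply cdiff_const.
Qed.

Lemma Re_period (tau x s : C) (k : Z) :
  (Re (s - tau * (x + RtoC (IZR k) * two_pi_i)) = Re (s - tau * x) + IZR k * (2 * PI * Im tau))%R.
Proof. rewrite two_pi_i_eq. unfold Re, Im. simpl. ring. Qed.

(** The period 2 pi i of x is the deck transformation of the quotient by [F100]: it adds 1 to xi and
    divides z by q. *)
Lemma log_chart_period_F100 (tau x s : C) :
  F100 tau (log_chart tau (x + two_pi_i, s)) = log_chart tau (x, s).
Proof.
  unfold F100, log_chart. cbn [fst snd]. apply injective_projections; cbn [fst snd].
  - unfold qpar. rewrite <- Cexp_add. f_equal. ring.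
  - field. apply two_pi_i_neq_0.
Qed.

Lemma log_chart_period_s (tau x s : C) : log_chart tau (x, s + two_pi_i) = log_chart tau (x, s).
Proof.
  unfold log_chart. cbn [fst snd]. f_equal.
  replace (s + two_pi_i - tau * x) with (s - tau * x + two_pi_i) by ring.
  rewrite two_pi_i_eq. apply Cexp_2pi.
Qed.

(** A normalization is controlled only on bounded annuli of z, that is, for Re (s - tau x) = ln |z|
    in a bounded window. Adding 2 pi i to x shifts this quantity by 2 pi Im tau and, by invariance
    under F, does not change the slope; f is the slope at the translate lying in a fundamental
    window. [Dom] sees real parts only, so it is stable under these translations; it stands for
    [dom1] or [dom4]. *)
Lemma slope_extension (tau sg : C) (V : C2 -> Prop) (F : C2 -> C2) (Psi : formal_diffeo)
    (S : C2 -> Prop) (psi : C2 -> C2) (t : P1) (W : C2 -> Prop) (eta : C2 -> C2)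
    (Dom : R -> C -> C -> Prop) :
  (0 < Im tau)%R -> is_neighborhood tau V F ->
  cone_normalization tau F Psi sg S psi ->
  is_foliation_germ V F W eta ->
  (forall (z0 : C) (om : C2 -> C2),
      z0 <> 0 -> generates_at om eta (z0, RtoC 0) ->
      forall N : nat, exists K : R, locally (z0, RtoC 0) (fun p =>
        (Cmod (wedge (om p) (pullback (jet Psi N) (pencil tau t) p))
           <= K * Cmod (snd p) ^ N)%R)) ->
  (forall M x s x' s', Re x = Re x' -> Re s = Re s' -> Dom M x s -> Dom M x' s') ->
  (forall M x s, Dom M x s -> exists d : R, (0 < d)%R /\ forall x' s',
     (Cmod (x' - x) < d)%R -> (Cmod (s' - s) < d)%R -> Dom M x' s') ->
  (exists k : R, (0 < k)%R /\ forall M' : R, exists M : R, forall x s, Dom M x s ->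
     (- (PI * Im tau) <= Re (s - tau * x) <= 3 * (PI * Im tau))%R ->
     half_plane sg k (x / two_pi_i) /\ (M' < Cmod (x / two_pi_i))%R) ->
  forall eps : R, (0 < eps)%R -> exists (M : R) (f : C -> C -> C),
    (forall x s n, f (x + RtoC (IZR n) * two_pi_i) s = f x s) /\
    (forall x s, f x (s + two_pi_i) = f x s) /\
    (forall x s, Dom M x s -> cd (fun x => f x s) x /\ cd (f x) s /\ (Cmod (f x s) <= eps)%R) /\
    (forall x s p, Dom M x s ->
       (- (PI * Im tau) <= Re (s - tau * x) <= 3 * (PI * Im tau))%R ->
       S p -> psi p = log_chart tau (x, s) ->
       f x s = slope tau psi eta t p /\ eta p <> (RtoC 0, RtoC 0) /\
       wedge (eta p) (coframe tau psi (limit_line tau (other_member t)) p) <> 0).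
Proof.
  intros Htau HF HN Hfol Hconv HRe Hopen [k [Hk Hgeo]] eps Heps.
  pose proof PI_RGT_0 as Ppi. set (h := (PI * Im tau)%R) in *.
  assert (Hh : (0 < h)%R) by (unfold h; apply Rmult_lt_0_compat; lra).
  assert (Ntau : tau <> 0) by (intros E; rewrite E in Htau; simpl in Htau; lra).
  (* The annulus contains the window [- h, 3 h], larger than the fundamental window ]0, 2 h]: this
     leaves room for open neighbourhoods and for comparing neighbouring translates. *)
  set (c := (3 * h + 1)%R).
  destruct (slope_bound tau sg V F Psi S psi t W eta Ntau HN Hfol Hconv (c + 1) (k / 2) ltac:(unfold c; lra) ltac:(lra))
    as [M1 [K1 [HM1 [HK1 HSl]]]].
  destruct (cone_F_stable tau sg V F Psi S psi Htau HF HN (c + 1) (k / 2) ltac:(unfold c; lra) ltac:(lra))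
    as [M2 [HM2 HSF]].
  assert (HKe : (0 < K1 / eps)%R) by (now apply Rdiv_lt_0_compat).
  set (M3 := (M1 + M2 + K1 / eps)%R).
  destruct (cone_surjective tau F Psi sg S psi HN c k M3 ltac:(unfold c; lra) Hk ltac:(unfold M3; lra))
    as [M4 [HM4 Hsurj]].
  destruct (Hgeo M4) as [M Hgeo'].
  destruct HN as [HN1 [HNb [_ HNF]]].
  destruct (HNb) as [HSo [_ [_ [g [Hg Hgp]]]]].
  destruct Hfol as [_ [HWV [_ [Hfol Hinv]]]].
  set (Good := fun x s => Dom M x s /\ (- h <= Re (s - tau * x) <= 3 * h)%R).
  set (P := fun p : C2 => cone sg (k / 2) (c + 1) M3 p).
  assert (HP : forall p, P p -> S p /\ W p /\ eta p <> (RtoC 0, RtoC 0) /\ S (F p) /\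
     wedge (eta p) (coframe tau psi (limit_line tau (other_member t)) p) <> 0 /\
     (Cmod (slope tau psi eta t p) <= eps)%R).
  { intros p Hp.
    destruct (HSl p) as [A1 [A2 [A3 [A4 A5]]]]. { revert Hp. apply cone_weaken; unfold M3; lra. }
    repeat split; auto.
    - apply HSF. revert Hp. apply cone_weaken; unfold M3; lra.
    - eapply Rle_trans. apply A5.
      destruct (small_of_cone sg (k / 2) (c + 1) M3 (K1 / eps) p HKe ltac:(unfold M3; lra) Hp) as [_ [_ B]].
      apply (Rmult_le_reg_l (/ eps)). now apply Rinv_0_lt_compat. rewrite Rinv_l by lra. unfold Rdiv in B. lra. }
  assert (HG : forall x s, Good x s -> exists p, P p /\ psi p = log_chart tau (x, s)).
  { intros x s [HD HR]. destruct (Hgeo' x s HD HR) as [A B].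
    destruct (Hsurj (log_chart tau (x, s))) as [p [P1 [_ P2]]]; unfold log_chart; cbn [fst snd]; auto.
    - unfold annulus. rewrite Cmod_Cexp. split; apply exp_increasing; unfold c; lra.
    - exists p. split; auto. }
  set (v := fun x s => slope tau psi eta t (g (log_chart tau (x, s)))).
  assert (Hv : forall x s p, S p -> psi p = log_chart tau (x, s) -> v x s = slope tau psi eta t p).
  { intros x s p Sp Ep. unfold v. now rewrite <- Ep, Hgp. }
  assert (Hstep : forall x s, Good x s -> Good (x + two_pi_i) s -> v (x + two_pi_i) s = v x s).
  { intros x s G1 G2. destruct (HG _ _ G1) as [p [Pp Ep]]. destruct (HG _ _ G2) as [p' [Pp' Ep']].
    destruct (HP p Pp) as [Sp [Wp [ep [_ [_ _]]]]]. destruct (HP p' Pp') as [Sp' [Wp' [ep' [SFp' _]]]].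
    assert (EF : F p' = p).
    { rewrite <- (Hgp p Sp), Ep, <- (log_chart_period_F100 tau x s), <- Ep', <- HNF by auto.
      now rewrite Hgp. }
    rewrite (Hv _ _ p Sp Ep), (Hv _ _ p' Sp' Ep'), <- EF. symmetry.
    apply (slope_F_invariant tau S F psi eta V t p'); auto; try apply HN1; auto.
    apply qpar_neq_0. apply HF. apply Hinv; auto. now rewrite EF. now rewrite EF. }
  assert (Q2 : (2 * PI * Im tau = 2 * h)%R) by (unfold h; ring).
  (* The integer whose translate falls in the fundamental window. As r < up r <= r + 1, that window
     is open at 0 and closed at 2 h. *)
  set (k0 := fun x s => up (- Re (s - tau * x) / (2 * h))).
  assert (Hk0 : forall x s, (0 < Re (s - tau * x) + IZR (k0 x s) * (2 * h) <= 2 * h)%R).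
  { intros x s. unfold k0. destruct (archimed (- Re (s - tau * x) / (2 * h))) as [A B].
    set (u := IZR (up (- Re (s - tau * x) / (2 * h)))) in *.
    apply Rgt_lt, (Rmult_lt_compat_r (2 * h)) in A; try lra. apply (Rmult_le_compat_r (2 * h)) in B; try lra.
    replace (- Re (s - tau * x) / (2 * h) * (2 * h))%R with (- Re (s - tau * x))%R in A by (field; lra).
    replace ((u - - Re (s - tau * x) / (2 * h)) * (2 * h))%R with (u * (2 * h) + Re (s - tau * x))%R in B by (field; lra).
    lra. }
  assert (Huniq : forall x s (n : Z), (0 < Re (s - tau * x) + IZR n * (2 * h) <= 2 * h)%R -> n = k0 x s).
  { intros x s n Hn. specialize (Hk0 x s). set (a := Re (s - tau * x)) in *. set (m := k0 x s) in *.
    assert (E : (n - m = 0)%Z).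
    { apply one_IZR_lt1. rewrite minus_IZR. split; apply (Rmult_lt_reg_r (2 * h)); lra. }
    lia. }
  set (f := fun x s => v (x + RtoC (IZR (k0 x s)) * two_pi_i) s).
  assert (Hshift : forall x s n, f (x + RtoC (IZR n) * two_pi_i) s = f x s).
  { intros x s n. unfold f. f_equal.
    assert (E : k0 (x + RtoC (IZR n) * two_pi_i) s = (k0 x s - n)%Z).
    { symmetry. apply Huniq. rewrite Re_period, minus_IZR, Q2. specialize (Hk0 x s). lra. }
    rewrite E, minus_IZR, RtoC_minus. ring. }
  (* From the large window the fundamental one is reached by at most one translation, so a single
     use of [Hstep] suffices. *)
  assert (Hval : forall x s, Good x s -> f x s = v x s).
  { intros x s G. destruct G as [HD HR]. pose proof (Hk0 x s) as K. unfold f.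
    assert (Kr : (-2 < IZR (k0 x s) < 2)%R) by (split; apply (Rmult_lt_reg_r (2 * h)); lra).
    assert (Kz : (k0 x s = -1 \/ k0 x s = 0 \/ k0 x s = 1)%Z).
    { destruct Kr as [A B]. apply lt_IZR in A. apply lt_IZR in B. lia. }
    assert (GN : Good (x + RtoC (IZR (k0 x s)) * two_pi_i) s).
    { split. revert HD. apply HRe; auto. rewrite two_pi_i_eq. unfold Re. simpl. ring.
      rewrite Re_period, Q2. lra. }
    destruct Kz as [E|[E|E]]; rewrite E in *.
    - symmetry. replace x with (x + RtoC (IZR (-1)) * two_pi_i + two_pi_i) at 1 by ring.
      apply Hstep; auto. replace (x + RtoC (IZR (-1)) * two_pi_i + two_pi_i) with x by ring. split; auto.
    - f_equal. ring.
    - replace (x + RtoC 1 * two_pi_i) with (x + two_pi_i) in * by ring. apply Hstep; auto. split; auto. }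
  exists M, f. repeat split.
  - apply Hshift.
  - intros x s. unfold f.
    assert (E : k0 x (s + two_pi_i) = k0 x s).
    { unfold k0. do 3 f_equal. rewrite two_pi_i_eq. unfold Re. simpl. ring. }
    rewrite E. unfold v. now rewrite log_chart_period_s.
  - set (x1 := x + RtoC (IZR (k0 x s)) * two_pi_i).
    assert (D1 : Dom M x1 s).
    { revert H. apply HRe; auto. unfold x1. rewrite two_pi_i_eq. unfold Re. simpl. ring. }
    assert (R1 : (0 < Re (s - tau * x1) <= 2 * h)%R).
    { unfold x1. rewrite Re_period, Q2. apply Hk0. }
    destruct (Hopen M x1 s D1) as [d [Hd HO]].
    (* Within this radius Re (s - tau w) moves by at most h, so the integer chosen at x still lands
       in the large window; the jumps of [k0] therefore do no harm to differentiability. *)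
    set (d' := Rmin d (h / (Cmod tau + 1))).
    pose proof (Cmod_ge_0 tau) as Pt.
    assert (Hd' : (0 < d')%R) by (apply Rmin_pos; auto; apply Rdiv_lt_0_compat; lra).
    assert (Gx : forall w, (Cmod (w - x) < d')%R -> Good (w + RtoC (IZR (k0 x s)) * two_pi_i) s).
    { intros w Hw. apply Rmin_Rgt_l in Hw. destruct Hw as [W1 W2].
      split.
      - apply HO. unfold x1. replace (w + RtoC (IZR (k0 x s)) * two_pi_i - (x + RtoC (IZR (k0 x s)) * two_pi_i)) with (w - x) by ring. exact W1.
        replace (s - s) with (RtoC 0) by ring. now rewrite Cmod_0.
      - replace (s - tau * (w + RtoC (IZR (k0 x s)) * two_pi_i)) with (s - tau * x1 + - (tau * (w - x))) by (unfold x1; ring).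
        replace (Re (s - tau * x1 + - (tau * (w - x)))) with (Re (s - tau * x1) + Re (- (tau * (w - x))))%R by (unfold Re; simpl; ring).
        pose proof (re_le_Cmod (- (tau * (w - x)))) as T. rewrite Cmod_opp, Cmod_mult in T. apply Rabs_le_between in T.
        assert (Cmod tau * Cmod (w - x) <= h)%R.
        { apply Rle_trans with ((Cmod tau + 1) * (h / (Cmod tau + 1)))%R.
          apply Rmult_le_compat; try apply Cmod_ge_0; lra. right; field; lra. }
        lra. }
    apply (cd_ext (fun w => v (w + RtoC (IZR (k0 x s)) * two_pi_i) s) _ x d' Hd').
    + intros w Hw. rewrite <- (Hval _ _ (Gx w Hw)). apply Hshift.
    + apply (cd_shift (fun w => v w s)). fold x1. unfold v.
      assert (G1 : Good x1 s) by (split; auto; lra).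
      destruct (HG _ _ G1) as [p [Pp Ep]]. destruct (HP p Pp) as [Sp [Wp [_ [_ [Wn _]]]]].
      apply (slope_log_chart_cd tau S psi g eta W t x1 s p); auto. intros q Hq. apply (HN1 q Hq).
  - set (x1 := x + RtoC (IZR (k0 x s)) * two_pi_i).
    assert (D1 : Dom M x1 s).
    { revert H. apply HRe; auto. unfold x1. rewrite two_pi_i_eq. unfold Re. simpl. ring. }
    assert (R1 : (0 < Re (s - tau * x1) <= 2 * h)%R).
    { unfold x1. rewrite Re_period, Q2. apply Hk0. }
    destruct (Hopen M x1 s D1) as [d [Hd HO]].
    set (d' := Rmin d h).
    assert (Hd' : (0 < d')%R) by (apply Rmin_pos; auto).
    assert (Gs : forall w, (Cmod (w - s) < d')%R -> Good x1 w).
    { intros w Hw. apply Rmin_Rgt_l in Hw. destruct Hw as [W1 W2].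
      split.
      - apply HO; auto. replace (x1 - x1) with (RtoC 0) by ring. now rewrite Cmod_0.
      - replace (Re (w - tau * x1)) with (Re (s - tau * x1) + Re (w - s))%R by (unfold Re; simpl; ring).
        pose proof (re_le_Cmod (w - s)) as T. apply Rabs_le_between in T. lra. }
    apply (cd_ext (fun w => v x1 w) _ s d' Hd').
    + intros w Hw. rewrite <- (Hval _ _ (Gs w Hw)). apply Hshift.
    + unfold v. assert (G1 : Good x1 s) by (split; auto; lra).
      destruct (HG _ _ G1) as [p [Pp Ep]]. destruct (HP p Pp) as [Sp [Wp [_ [_ [Wn _]]]]].
      apply (slope_log_chart_cd tau S psi g eta W t x1 s p); auto. intros q Hq. apply (HN1 q Hq).
  - assert (G1 : Good (x + RtoC (IZR (k0 x s)) * two_pi_i) s).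
    { split. revert H. apply HRe; auto. rewrite two_pi_i_eq. unfold Re. simpl. ring.
      rewrite Re_period, Q2. specialize (Hk0 x s). lra. }
    destruct (HG _ _ G1) as [p [Pp Ep]]. destruct (HP p Pp) as [Sp [_ [_ [_ [_ B]]]]].
    unfold f. now rewrite (Hv _ _ p Sp Ep).
  - assert (G : Good x s) by (split; auto). rewrite Hval by auto. now apply Hv.
  - assert (G : Good x s) by (split; auto). destruct (HG _ _ G) as [p' [Pp' Ep']].
    destruct (HP p' Pp') as [Sp' [_ [A _]]].
    replace p with p'; auto. rewrite <- (Hgp p), <- (Hgp p'), Ep' by auto. now rewrite H2.
  - assert (G : Good x s) by (split; auto). destruct (HG _ _ G) as [p' [Pp' Ep']].
    destruct (HP p' Pp') as [Sp' [_ [_ [_ [A _]]]]].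
    replace p with p'; auto. rewrite <- (Hgp p), <- (Hgp p'), Ep' by auto. now rewrite H2.
Qed.

(** * Periodic functions on wide strips *)

Lemma pow_half_exp (n : nat) (L : R) : (8 * L <= INR n)%R -> (0 <= L)%R -> ((/ 2) ^ n <= exp (- 4 * L))%R.
Proof.
  intros H HL. rewrite <- (exp_ln (/ 2)) by lra. rewrite ln_Rinv by lra.
  assert (E : forall m, (exp (- ln 2) ^ m = exp (- (INR m * ln 2)))%R).
  { induction m. simpl. now rewrite Rmult_0_l, Ropp_0, exp_0.
    rewrite S_INR. simpl. rewrite IHm, <- exp_plus. f_equal. ring. }
  rewrite E. pose proof ln_lt_2.
  assert (- (INR n * ln 2) <= - 4 * L)%R by nra.
  destruct H1 as [A|A]. apply Rlt_le, exp_increasing, A. rewrite A. lra.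
Qed.

(** The bound on the derivative is halved between 8 L and 8 L + 1 times, and 2^(- 8 L) <= exp (- 4
    L). Each halving costs 16 pi <= 64 on either side, and 64 (8 L + 2) + 2 L <= 600 L for L >= 2.
    With L close to - ln lam the error is of order lam^4, one degree beyond X^2 Y. *)
Lemma strip_near_constant (f : C -> C) (eps L : R) (u v : C) : (2 <= L)%R ->
  (forall z, f (z + two_pi_i) = f z) ->
  (forall z, (Rabs (Re z) < 600 * L)%R -> cd f z /\ (Cmod (f z) <= eps)%R) ->
  (Rabs (Re u) <= 2 * L)%R -> (Rabs (Re v) <= 2 * L)%R ->
  (Cmod (f v - f u) <= eps * exp (- 4 * L) * Cmod (v - u))%R.
Proof.
  intros HL Hp H Hu Hv.
  set (n := Z.to_nat (up (8 * L))). destruct (archimed (8 * L)) as [A B].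
  assert (En : INR n = IZR (up (8 * L))).
  { unfold n. rewrite INR_IZR_INZ, Z2Nat.id; auto. apply le_IZR. lra. }
  assert (Pp := PI_RGT_0). assert (P4 := PI_4).
  pose proof (PI2_3_2) as P32.
  assert (Ppi : (PI <= 4)%R) by lra.
  assert (eps0 : (0 <= eps)%R).
  { eapply Rle_trans. apply (Cmod_ge_0 (f 0)). apply H. unfold Re. simpl. rewrite Rabs_R0. lra. }
  assert (Hb : forall z, (- (600 * L) < Re z < 600 * L)%R -> cd f z /\ (Cmod (f z) <= eps)%R).
  { intros z Hz. apply H. apply Rabs_def1; lra. }
  apply mean_value_ineq. intros t Ht.
  assert (Rz : (Rabs (Re (u + RtoC t * (v - u))) <= 2 * L)%R).
  { replace (Re (u + RtoC t * (v - u))) with ((1 - t) * Re u + t * Re v)%R by (unfold Re; simpl; ring).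
    apply Rabs_le_between in Hu. apply Rabs_le_between in Hv. apply Rabs_le_between. split; nra. }
  apply Rabs_le_between in Rz.
  destruct (Hb (u + RtoC t * (v - u))) as [[l Hl] _]. lra.
  exists l. split; auto.
  apply Rle_trans with (eps * (/ 2) ^ n)%R.
  - apply (strip_derivative_bound f (- (600 * L)) (600 * L) eps) with (z := u + RtoC t * (v - u)); auto.
    + intros z. rewrite <- (Hp z), two_pi_i_eq. reflexivity.
    + intros z Hz. apply (Hb z Hz).
    + intros z Hz. apply (Hb z Hz).
    + assert ((INR n + 1) * (16 * PI) <= (8 * L + 2) * (16 * 4))%R by (apply Rmult_le_compat; lra).
      lra.
  - apply Rmult_le_compat_l; auto. apply pow_half_exp; lra.
Qed.

(* The real parts of [log X], [log Y] in the cone of the [n]-th sector: [Y -> 0] in the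
   sector 1, [X -> 0] in the sector 4, the other coordinate being allowed to be any fixed
   power of it; [2000] leaves room for iterating [strip_derivative_bound]. *)
Definition dom1 (M : R) (x s : C) : Prop := (Re s < - M /\ Rabs (Re x) < 2000 * - Re s)%R.
Definition dom4 (M : R) (x s : C) : Prop := (Re x < - M /\ Rabs (Re s) < 2000 * - Re x)%R.

Lemma dom1_re (M : R) (x s x' s' : C) : Re x = Re x' -> Re s = Re s' -> dom1 M x s -> dom1 M x' s'.
Proof. unfold dom1. now intros <- <-. Qed.

Lemma dom4_re (M : R) (x s x' s' : C) : Re x = Re x' -> Re s = Re s' -> dom4 M x s -> dom4 M x' s'.
Proof. unfold dom4. now intros <- <-. Qed.

Lemma dom1_open (M : R) (x s : C) : dom1 M x s -> exists d : R, (0 < d)%R /\ forall x' s',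
  (Cmod (x' - x) < d)%R -> (Cmod (s' - s) < d)%R -> dom1 M x' s'.
Proof.
  intros [H1 H2]. set (d := Rmin (- M - Re s) ((2000 * - Re s - Rabs (Re x)) / 2001)).
  exists d. split. apply Rmin_pos; lra.
  intros x' s' Hx Hs. apply Rmin_Rgt_l in Hx. apply Rmin_Rgt_l in Hs.
  pose proof (re_le_Cmod (x' - x)) as A. pose proof (re_le_Cmod (s' - s)) as B.
  replace (Re (x' - x)) with (Re x' - Re x)%R in A by (unfold Re; simpl; ring).
  replace (Re (s' - s)) with (Re s' - Re s)%R in B by (unfold Re; simpl; ring).
  pose proof (Rabs_triang (Re x' - Re x) (Re x)) as T. replace (Re x' - Re x + Re x)%R with (Re x') in T by ring.
  apply Rabs_le_between in B. split; lra.
Qed.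

Lemma dom4_open (M : R) (x s : C) : dom4 M x s -> exists d : R, (0 < d)%R /\ forall x' s',
  (Cmod (x' - x) < d)%R -> (Cmod (s' - s) < d)%R -> dom4 M x' s'.
Proof.
  intros H. destruct (dom1_open M s x H) as [d [Hd HO]]. exists d. split; auto.
  intros x' s' A B. now apply HO.
Qed.

Lemma Im_div_two_pi_i (w : C) : Im (w / two_pi_i) = (- Re w / (2 * PI))%R.
Proof.
  pose proof PI_RGT_0.
  replace (w / two_pi_i) with (RtoC (/ (2 * PI)) * - (Ci * w)).
  - unfold Re, Im. simpl. field. lra.
  - assert (E : w = two_pi_i * (RtoC (/ (2 * PI)) * - (Ci * w))).
    { unfold two_pi_i. apply injective_projections; simpl; field; lra. }
    rewrite E at 2. field. apply two_pi_i_neq_0.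
Qed.

Lemma Cmod_div_two_pi_i (w : C) : Cmod (w / two_pi_i) = (Cmod w / (2 * PI))%R.
Proof.
  pose proof PI_RGT_0. rewrite Cmod_div by apply two_pi_i_neq_0. unfold two_pi_i.
  now rewrite Cmod_mult, Cmod_Ci, Cmod_R, Rmult_1_r, Rabs_pos_eq by lra.
Qed.

(* [x] is recovered from [Re x] and [Re (tau x)], which is close to [Re s]. *)
Lemma Cmod_x_bound (tau x s : C) (h : R) : (0 < Im tau)%R -> (0 <= h)%R ->
  (- h <= Re (s - tau * x) <= 3 * h)%R ->
  (Cmod x <= Rabs (Re x) + (Cmod tau * Rabs (Re x) + Rabs (Re s) + 3 * h) / Im tau)%R.
Proof.
  intros Ht Hh H. eapply Rle_trans. apply Cmod_le_sum. apply Rplus_le_compat_l.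
  apply (Rmult_le_reg_r (Im tau)); auto.
  replace ((Cmod tau * Rabs (Re x) + Rabs (Re s) + 3 * h) / Im tau * Im tau)%R
    with (Cmod tau * Rabs (Re x) + Rabs (Re s) + 3 * h)%R by (field; lra).
  rewrite <- (Rabs_pos_eq (Im tau)) at 1 by lra. rewrite <- Rabs_mult.
  replace (Im x * Im tau)%R with (Re tau * Re x + - Re s + Re (s - tau * x))%R by (unfold Re, Im; simpl; ring).
  eapply Rle_trans. apply Rabs_triang. eapply Rle_trans. apply Rplus_le_compat_r, Rabs_triang.
  rewrite Rabs_mult, Rabs_Ropp.
  pose proof (re_le_Cmod tau). pose proof (Rabs_pos (Re x)).
  assert (Rabs (Re tau) * Rabs (Re x) <= Cmod tau * Rabs (Re x))%R by (apply Rmult_le_compat_r; auto).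
  assert (Rabs (Re (s - tau * x)) <= 3 * h)%R by (apply Rabs_le; lra). lra.
Qed.

(** With xi = x / (2 pi i), Im (tau xi) is - Re (tau x) / (2 pi), which the window makes comparable
    to - Re s, while |x| is at most D (- Re s) by [Cmod_x_bound]. In D, 2000 bounds |Re x| and the
    summands 1 and 3 account for Re s and the window. *)
Lemma dom1_half_plane (tau : C) : (0 < Im tau)%R ->
  exists k : R, (0 < k)%R /\ forall M' : R, exists M : R, forall x s, dom1 M x s ->
     (- (PI * Im tau) <= Re (s - tau * x) <= 3 * (PI * Im tau))%R ->
     half_plane tau k (x / two_pi_i) /\ (M' < Cmod (x / two_pi_i))%R.
Proof.
  intros Ht. pose proof PI_RGT_0 as Pp. set (h := (PI * Im tau)%R).
  assert (Hh : (0 < h)%R) by (unfold h; apply Rmult_lt_0_compat; lra).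
  pose proof (Cmod_ge_0 tau) as Pt.
  assert (Pt' : (0 < Cmod tau)%R).
  { pose proof (Im_le_Cmod tau) as T. rewrite Rabs_pos_eq in T; lra. }
  set (D := (2000 + (Cmod tau * 2000 + 1 + 3) / Im tau)%R).
  assert (HD : (0 < D)%R).
  { assert (0 < (Cmod tau * 2000 + 1 + 3) / Im tau)%R by (apply Rdiv_lt_0_compat; lra). unfold D; lra. }
  exists (/ (2 * D))%R. split. apply Rinv_0_lt_compat; lra.
  intros M'. exists (2 * h + 4 * PI * Cmod tau * Rabs M')%R. intros x s [H1 H2] HR.
  assert (Pm : (0 <= 4 * PI * Cmod tau * Rabs M')%R).
  { pose proof (Rabs_pos M'). assert (0 <= 4 * PI * Cmod tau)%R by nra. nra. }
  set (a := (- Re s)%R) in *. assert (Ha : (2 * h + 4 * PI * Cmod tau * Rabs M' < a)%R) by (unfold a; lra).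
  pose proof (Cmod_x_bound tau x s h Ht ltac:(lra) HR) as B.
  assert (Rs : Rabs (Re s) = a) by (unfold a; rewrite Rabs_left; lra).
  rewrite Rs in B.
  assert (B' : (Cmod x <= D * a)%R).
  { eapply Rle_trans. apply B. unfold D. rewrite Rmult_plus_distr_r. apply Rplus_le_compat. lra.
    unfold Rdiv. rewrite Rmult_assoc, (Rmult_comm (/ Im tau)), <- Rmult_assoc.
    apply Rmult_le_compat_r. apply Rlt_le, Rinv_0_lt_compat; auto.
    assert (Cmod tau * Rabs (Re x) <= Cmod tau * (2000 * a))%R by (apply Rmult_le_compat_l; lra).
    lra. }
  assert (Hr : (a / 2 <= - Re (tau * x))%R).
  { replace (Re (s - tau * x)) with (Re s - Re (tau * x))%R in HR by (unfold Re; simpl; ring). unfold a in *. lra. }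
  assert (Ip : (a / 2 / (2 * PI) <= Im (tau * (x / two_pi_i)))%R).
  { replace (tau * (x / two_pi_i)) with (tau * x / two_pi_i) by (unfold Cdiv; ring).
    rewrite Im_div_two_pi_i. unfold Rdiv at 1 3. apply Rmult_le_compat_r; auto.
    apply Rlt_le, Rinv_0_lt_compat; lra. }
  split.
  - unfold half_plane. rewrite Cmod_div_two_pi_i. eapply Rle_trans. 2: apply Ip.
    apply Rle_trans with (/ (2 * D) * (D * a / (2 * PI)))%R.
    apply Rmult_le_compat_l. apply Rlt_le, Rinv_0_lt_compat; lra.
    unfold Rdiv. apply Rmult_le_compat_r; auto. apply Rlt_le, Rinv_0_lt_compat; lra.
    right. field. lra.
  - apply (Rmult_lt_reg_l (Cmod tau)); auto. rewrite <- Cmod_mult.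
    pose proof (Im_le_Cmod (tau * (x / two_pi_i))) as T. pose proof (Rle_abs (Im (tau * (x / two_pi_i)))) as T2.
    assert (Cmod tau * Rabs M' < a / 2 / (2 * PI))%R.
    { apply (Rmult_lt_reg_r (4 * PI)). lra. replace (a / 2 / (2 * PI) * (4 * PI))%R with a by (field; lra). lra. }
    pose proof (Rle_abs M'). assert (Cmod tau * M' <= Cmod tau * Rabs M')%R by (apply Rmult_le_compat_l; auto). lra.
Qed.

(** Here Im xi is - Re x / (2 pi) exactly; the window enters only through the bound on |x|. *)
Lemma dom4_half_plane (tau : C) : (0 < Im tau)%R ->
  exists k : R, (0 < k)%R /\ forall M' : R, exists M : R, forall x s, dom4 M x s ->
     (- (PI * Im tau) <= Re (s - tau * x) <= 3 * (PI * Im tau))%R ->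
     half_plane 1 k (x / two_pi_i) /\ (M' < Cmod (x / two_pi_i))%R.
Proof.
  intros Ht. pose proof PI_RGT_0 as Pp. set (h := (PI * Im tau)%R).
  assert (Hh : (0 < h)%R) by (unfold h; apply Rmult_lt_0_compat; lra).
  pose proof (Cmod_ge_0 tau) as Pt.
  set (D := (1 + (Cmod tau + 2000 + 3) / Im tau)%R).
  assert (HD : (0 < D)%R).
  { assert (0 < (Cmod tau + 2000 + 3) / Im tau)%R by (apply Rdiv_lt_0_compat; lra). unfold D; lra. }
  exists (/ D)%R. split. apply Rinv_0_lt_compat; lra.
  intros M'. exists (h + 2 * PI * Rabs M')%R. intros x s [H1 H2] HR.
  assert (Pm : (0 <= 2 * PI * Rabs M')%R).
  { pose proof (Rabs_pos M'). nra. }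
  set (a := (- Re x)%R) in *. assert (Ha : (h + 2 * PI * Rabs M' < a)%R) by (unfold a; lra).
  pose proof (Cmod_x_bound tau x s h Ht ltac:(lra) HR) as B.
  assert (Rs : Rabs (Re x) = a) by (unfold a; rewrite Rabs_left; lra).
  rewrite Rs in B.
  assert (B' : (Cmod x <= D * a)%R).
  { eapply Rle_trans. apply B. unfold D. rewrite Rmult_plus_distr_r. apply Rplus_le_compat. lra.
    unfold Rdiv. rewrite Rmult_assoc, (Rmult_comm (/ Im tau)), <- Rmult_assoc.
    apply Rmult_le_compat_r. apply Rlt_le, Rinv_0_lt_compat; auto. lra. }
  assert (Ip : Im (1 * (x / two_pi_i)) = (a / (2 * PI))%R).
  { rewrite Cmult_1_l. apply Im_div_two_pi_i. }
  split.
  - unfold half_plane. rewrite Cmod_div_two_pi_i, Ip.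
    apply Rle_trans with (/ D * (D * a / (2 * PI)))%R.
    apply Rmult_le_compat_l. apply Rlt_le, Rinv_0_lt_compat; lra.
    unfold Rdiv. apply Rmult_le_compat_r; auto. apply Rlt_le, Rinv_0_lt_compat; lra.
    right. field. lra.
  - rewrite Cmult_1_l in Ip.
    pose proof (Im_le_Cmod (x / two_pi_i)) as T. pose proof (Rle_abs (Im (x / two_pi_i))) as T2.
    rewrite Ip in T, T2.
    assert (Rabs M' < a / (2 * PI))%R.
    { apply (Rmult_lt_reg_r (2 * PI)). lra. replace (a / (2 * PI) * (2 * PI))%R with a by (field; lra). lra. }
    pose proof (Rle_abs M'). lra.
Qed.

Lemma dom1_near_constant (f : C -> C -> C) (M eps a : R) (x x' s : R) :
  (forall x s, f (x + two_pi_i) s = f x s) ->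
  (forall x s, dom1 M x s -> cd (fun x => f x s) x /\ (Cmod (f x s) <= eps)%R) ->
  (a <= - 12)%R -> (a + 3 < - M)%R ->
  (Rabs (x - a) <= 3)%R -> (Rabs (x' - a) <= 3)%R -> (Rabs (s - a) <= 3)%R ->
  (Cmod (f (RtoC x) (RtoC s) - f (RtoC x') (RtoC s)) <= eps * exp (4 * a + 12) * Rabs (x - x'))%R.
Proof.
  intros Hp H Ha HM Hx Hx' Hs.
  (* As L <= - Re s, the strip |Re x| < 600 L lies in the domain; and 3 - a <= 2 L because a <= -
     12. *)
  set (L := (- a - 3)%R).
  apply Rabs_le_between in Hx. apply Rabs_le_between in Hx'. apply Rabs_le_between in Hs.
  pose proof (strip_near_constant (fun z => f z (RtoC s)) eps L (RtoC x') (RtoC x) ltac:(unfold L; lra)) as T.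
  cbv beta in T. rewrite <- RtoC_minus, Cmod_R in T.
  replace (- 4 * L)%R with (4 * a + 12)%R in T by (unfold L; ring).
  apply T; auto.
  - intros z Hz. apply H. split; simpl. lra. unfold L in Hz. lra.
  - simpl. apply Rabs_le. unfold L. lra.
  - simpl. apply Rabs_le. unfold L. lra.
Qed.

(** Cauchy's estimate on unit discs. A plain Lipschitz bound is enough in this variable, since the
    values of s to be compared are O(lam^3) apart. *)
Lemma dom1_lipschitz (f : C -> C -> C) (M eps a : R) (x s s' : R) :
  (forall x s, dom1 M x s -> cd (f x) s /\ (Cmod (f x s) <= eps)%R) ->
  (a <= - 12)%R -> (a + 4 < - M)%R ->
  (Rabs (x - a) <= 3)%R -> (Rabs (s - a) <= 3)%R -> (Rabs (s' - a) <= 3)%R ->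
  (Cmod (f (RtoC x) (RtoC s) - f (RtoC x) (RtoC s')) <= 4 * eps * Rabs (s - s'))%R.
Proof.
  intros H Ha HM Hx Hs Hs'.
  apply Rabs_le_between in Hx. apply Rabs_le_between in Hs. apply Rabs_le_between in Hs'.
  rewrite <- Cmod_R, RtoC_minus.
  apply mean_value_ineq. intros t Ht.
  set (w := RtoC s' + RtoC t * (RtoC s - RtoC s')).
  assert (Rw : (a - 3 <= Re w <= a + 3)%R).
  { unfold w. replace (Re (RtoC s' + RtoC t * (RtoC s - RtoC s'))) with ((1 - t) * s' + t * s)%R by (unfold Re; simpl; ring).
    split; nra. }
  assert (Dm : forall z, (Cmod (z - w) < 1)%R -> dom1 M (RtoC x) z).
  { intros z Hz. pose proof (re_le_Cmod (z - w)) as T.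
    replace (Re (z - w)) with (Re z - Re w)%R in T by (unfold Re; simpl; ring).
    apply Rabs_le_between in T. split; simpl. lra. apply Rabs_def1; lra. }
  destruct (H (RtoC x) w) as [[l Hl] _].
  { apply Dm. replace (w - w) with (RtoC 0) by ring. rewrite Cmod_0. lra. }
  exists l. split; auto. replace (4 * eps)%R with (4 * eps / 1)%R by field.
  apply (cauchy_estimate (f (RtoC x)) w l 1 eps); auto; try lra; intros z Hz; apply H; auto.
Qed.

(** * The transition between the sectors 4 and 1 *)

(** The action of [phi_14] on covectors: with u = X Y / (1 + X Y) and v = X^2 Y / (1 + X^2 Y), it
    pulls dX/X back to (1 + u) dX/X + u dY/Y and dY/Y to 2 v dX/X + (1 + v) dY/Y. *)
Definition twist (u v : C) (l : C2) : C2 :=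
  ((1 + u) * fst l + 2 * v * snd l, u * fst l + (1 + v) * snd l).

Lemma Pi_log_chart (tau : C) (x s : C) : Pi tau (log_chart tau (x, s)) = (Cexp x, Cexp s).
Proof.
  pose proof two_pi_i_neq_0. unfold Pi, log_chart. cbn [fst snd]. f_equal.
  - f_equal. field. auto.
  - rewrite <- Cexp_add. f_equal. field. auto.
Qed.

Lemma Pi_hdiff (tau : C) (psi : C2 -> C2) (p : C2) : holo_at psi p -> fst (psi p) <> 0 ->
  hdiff (fun q => fst (Pi tau (psi q))) p
    (fst (Pi tau (psi p)) * fst (coframe tau psi (RtoC 1, RtoC 0) p))
    (fst (Pi tau (psi p)) * snd (coframe tau psi (RtoC 1, RtoC 0) p)) /\
  hdiff (fun q => snd (Pi tau (psi q))) p
    (snd (Pi tau (psi p)) * fst (coframe tau psi (RtoC 0, RtoC 1) p))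
    (snd (Pi tau (psi p)) * snd (coframe tau psi (RtoC 0, RtoC 1) p)).
Proof.
  intros H N. destruct (holo_hd _ _ H) as [A B].
  assert (Ex : forall c : C, hdiff (fun q => Cexp (c * snd (psi q))) p
    (Cexp (c * snd (psi p)) * (c * dz (fun q => snd (psi q)) p))
    (Cexp (c * snd (psi p)) * (c * dy (fun q => snd (psi q)) p))).
  { intros c.
    pose proof (hdiff_comp2 (fun u => Cexp (c * fst u)) _ _ p _ _ _ _ _ _
      (hdiff_of_cdiff_fst (fun w => Cexp (c * w)) (snd (psi p), snd (psi p)) _
         (cdiff_Cexp_comp (fun w => c * w) _ _ (cdiff_scal c _ _ _ (cdiff_id _)))) B B) as D.
    cbn [fst snd] in D. apply (hdiff_eq _ _ _ _ _ _ D); ring. }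
  split.
  - apply (hdiff_eq _ _ _ _ _ _ (Ex two_pi_i)); unfold Pi, coframe; cbn [fst snd]; ring.
  - apply (hdiff_eq _ _ _ _ _ _ (hdiff_mult _ _ _ _ _ _ _ A (Ex (two_pi_i * tau))));
      unfold Pi, coframe; cbn [fst snd]; field; auto.
Qed.

Lemma coframe_linear (tau : C) (psi : C2 -> C2) (l p : C2) :
  coframe tau psi l p =
   (fst l * fst (coframe tau psi (RtoC 1, RtoC 0) p) + snd l * fst (coframe tau psi (RtoC 0, RtoC 1) p),
    fst l * snd (coframe tau psi (RtoC 1, RtoC 0) p) + snd l * snd (coframe tau psi (RtoC 0, RtoC 1) p)).
Proof. unfold coframe. apply injective_projections; cbn [fst snd]; ring. Qed.

(** The transition relation holds on a neighbourhood of p and can be differentiated; dividing by the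
    coordinates turns the differentials into logarithmic ones. *)
Lemma coframe_transition (tau : C) (psi1 psi4 : C2 -> C2) (p : C2) (d X Y : C) (e : R) :
  holo_at psi1 p -> holo_at psi4 p -> fst (psi1 p) <> 0 -> fst (psi4 p) <> 0 -> (0 < e)%R ->
  (forall q : C2, (Cmod (fst q - fst p) < e)%R -> (Cmod (snd q - snd p) < e)%R ->
     Pi tau (psi1 q) = phi_14 (Pi tau (psi4 q))) ->
  Pi tau (psi4 p) = (X, Y) -> X <> 0 -> Y <> 0 -> 1 + X * Y <> 0 -> 1 + X ^ 2 * Y <> 0 ->
  forall l, coframe tau psi1 l p =
    coframe tau psi4 (twist (X * Y / (1 + X * Y)) (X ^ 2 * Y / (1 + X ^ 2 * Y)) l) p.
Proof.
  intros H1 H4 N1 N4 He Hrel EP NX NY NXY NXXY l.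
  destruct (Pi_hdiff tau psi1 p H1 N1) as [A1 B1]. destruct (Pi_hdiff tau psi4 p H4 N4) as [A4 B4].
  assert (E0 : Pi tau (psi1 p) = phi_14 (X, Y)).
  { rewrite <- EP. apply Hrel; [replace (fst p - fst p) with (RtoC 0) by ring | replace (snd p - snd p) with (RtoC 0) by ring];
    now rewrite Cmod_0. }
  rewrite E0 in A1, B1. rewrite EP in A4, B4. unfold phi_14 in A1, B1. cbn [fst snd] in A1, B1, A4, B4.
  apply (hdiff_ext _ (fun q => fst (phi_14 (Pi tau (psi4 q)))) p _ _ e He) in A1.
  2: { intros q Q1 Q2. now rewrite Hrel. }
  apply (hdiff_ext _ (fun q => snd (phi_14 (Pi tau (psi4 q)))) p _ _ e He) in B1.
  2: { intros q Q1 Q2. now rewrite Hrel. }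
  set (X4 := fun q => fst (Pi tau (psi4 q))) in *. set (Y4 := fun q => snd (Pi tau (psi4 q))) in *.
  assert (EX : X4 p = X) by (unfold X4; now rewrite EP). assert (EY : Y4 p = Y) by (unfold Y4; now rewrite EP).
  assert (K1 : hdiff (fun _ : C2 => 1) p 0 0) by exact (hdiff_of_cdiff_fst (fun _ => 1) p 0 (cdiff_const _ _)).
  assert (C1 := hdiff_mult _ _ _ _ _ _ _ A4 (hdiff_plus _ _ _ _ _ _ _ K1 (hdiff_mult _ _ _ _ _ _ _ A4 B4))).
  assert (D1 := hdiff_mult _ _ _ _ _ _ _ B4 (hdiff_plus _ _ _ _ _ _ _ K1
     (hdiff_mult _ _ _ _ _ _ _ (hdiff_mult _ _ _ _ _ _ _ A4 A4) B4))).
  apply (hdiff_ext _ (fun q => fst (phi_14 (Pi tau (psi4 q)))) p _ _ 1 ltac:(lra)) in C1.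
  2: { intros q _ _. reflexivity. }
  apply (hdiff_ext _ (fun q => snd (phi_14 (Pi tau (psi4 q)))) p _ _ 1 ltac:(lra)) in D1.
  2: { intros q _ _. unfold phi_14. cbn [fst snd]. fold (X4 q) (Y4 q). simpl Cpow. ring. }
  rewrite EX, EY in C1, D1.
  assert (F1 := hdiff_dz _ _ _ _ A1). rewrite (hdiff_dz _ _ _ _ C1) in F1.
  assert (F2 := hdiff_dy _ _ _ _ A1). rewrite (hdiff_dy _ _ _ _ C1) in F2.
  assert (F3 := hdiff_dz _ _ _ _ B1). rewrite (hdiff_dz _ _ _ _ D1) in F3.
  assert (F4 := hdiff_dy _ _ _ _ B1). rewrite (hdiff_dy _ _ _ _ D1) in F4.
  rewrite (coframe_linear tau psi1), (coframe_linear tau psi4). unfold twist. cbn [fst snd].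
  set (x1 := fst (coframe tau psi1 (RtoC 1, RtoC 0) p)) in *. set (x2 := snd (coframe tau psi1 (RtoC 1, RtoC 0) p)) in *.
  set (s1 := fst (coframe tau psi1 (RtoC 0, RtoC 1) p)) in *. set (s2 := snd (coframe tau psi1 (RtoC 0, RtoC 1) p)) in *.
  set (u1 := fst (coframe tau psi4 (RtoC 1, RtoC 0) p)) in *. set (u2 := snd (coframe tau psi4 (RtoC 1, RtoC 0) p)) in *.
  set (v1 := fst (coframe tau psi4 (RtoC 0, RtoC 1) p)) in *. set (v2 := snd (coframe tau psi4 (RtoC 0, RtoC 1) p)) in *.
  assert (G1 : x1 = / (X * (1 + X * Y)) * (X * (1 + X * Y) * x1)) by (field; auto).
  assert (G2 : x2 = / (X * (1 + X * Y)) * (X * (1 + X * Y) * x2)) by (field; auto).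
  assert (G3 : s1 = / (Y * (1 + X ^ 2 * Y)) * (Y * (1 + X ^ 2 * Y) * s1)) by (field; auto).
  assert (G4 : s2 = / (Y * (1 + X ^ 2 * Y)) * (Y * (1 + X ^ 2 * Y) * s2)) by (field; auto).
  rewrite G1, G2, G3, G4, <- F1, <- F2, <- F3, <- F4.
  cbv beta. rewrite ?EX, ?EY.
  assert (NXXY' : 1 + X * X * Y <> 0) by (intros Z; apply NXXY; rewrite <- Z; simpl Cpow; ring).
  apply injective_projections; cbn [fst snd]; simpl Cpow; field; repeat split; auto.
Qed.

Lemma Cexp_period (a : C) (n : Z) : Cexp (a + RtoC (IZR n) * two_pi_i) = Cexp a.
Proof.
  assert (P : forall b (m : nat), Cexp (b + RtoC (INR m) * two_pi_i) = Cexp b).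
  { intros b m. induction m. simpl. f_equal; ring.
    rewrite S_INR, RtoC_plus. replace (b + (RtoC (INR m) + 1) * two_pi_i) with (b + RtoC (INR m) * two_pi_i + two_pi_i) by ring.
    rewrite two_pi_i_eq, Cexp_2pi, <- two_pi_i_eq. exact IHm. }
  destruct (Z_le_gt_dec 0 n) as [H|H].
  - rewrite <- (Z2Nat.id n H), <- INR_IZR_INZ. apply P.
  - rewrite <- (P (a + RtoC (IZR n) * two_pi_i) (Z.to_nat (- n))).
    rewrite INR_IZR_INZ, Z2Nat.id, opp_IZR, RtoC_opp by lia. f_equal. ring.
Qed.

(** Selects the branch of the logarithm: d will be the logarithm of the ratio of the two values of
    X, small because both normalizations have the same expansion. *)
Lemma Cexp_real (d : C) (r : R) : (0 < r)%R -> (Rabs (Im d) < PI)%R -> Cexp d = RtoC r -> d = RtoC (ln r).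
Proof.
  intros Hr Hd E. apply Rabs_def2 in Hd.
  assert (M : exp (Re d) = r).
  { rewrite <- Cmod_Cexp, E, Cmod_R. apply Rabs_pos_eq. lra. }
  assert (S : sin (Im d) = 0%R).
  { apply (f_equal snd) in E. simpl in E. pose proof (exp_pos (Re d)).
    destruct (Rmult_integral _ _ E); auto. lra. }
  assert (I : Im d = 0%R).
  { destruct (Rtotal_order (Im d) 0) as [L|[Z|G]]; auto.
    - pose proof (sin_lt_0_var (Im d)). lra.
    - pose proof (sin_gt_0 (Im d)). lra. }
  rewrite <- M, ln_exp. destruct d as [a b]. unfold Re, Im in *. simpl in *. now rewrite I.
Qed.

Lemma half_plane_weaken (sg xi : C) (k k' : R) : (k' <= k)%R -> half_plane sg k xi -> half_plane sg k' xi.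
Proof. unfold half_plane. intros H A. pose proof (Cmod_ge_0 xi). nra. Qed.

Lemma exp_le_inv (a b : R) : (exp a <= exp b)%R -> (a <= b)%R.
Proof. intros H. destruct (Rle_dec a b); auto. pose proof (exp_increasing b a). lra. Qed.

Lemma cone_neighborhood (sg : C) (k c M r : R) (p : C2) :
  (0 < k)%R -> (0 < c)%R -> (0 < r <= 1 / 2)%R -> (0 <= M)%R -> (r * (2 * (k + Cmod sg)) <= k)%R ->
  cone sg k c M p -> forall q : C2, (Cmod (fst q - fst p) <= exp (- c) / 2)%R ->
  (Cmod (snd q - snd p) <= r * Cmod (snd p))%R -> cone sg (k / 2) (c + 1) (M / 2) q.
Proof.
  intros Hk Hc Hr HM Hrk Hp q Q1 Q2.
  assert (N : snd p <> 0) by apply Hp. assert (P := proj1 (Cmod_gt_0 _) N).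
  assert (Nq : snd q <> 0).
  { apply Cmod_gt_0. pose proof (Cmod_sub_ge (snd p) (snd p - snd q)) as T.
    replace (snd p - (snd p - snd q)) with (snd q) in T by ring. rewrite (Cmod_sub_sym (snd p) (snd q)) in T. nra. }
  apply (cone_perturb sg k c M r p); auto; try lra.
  replace (/ snd q - / snd p) with ((snd p - snd q) / snd p * / snd q) by (field; auto).
  rewrite Cmod_mult. apply Rmult_le_compat_r. apply Cmod_ge_0.
  rewrite Cmod_div by auto. rewrite Cmod_sub_sym.
  apply (Rmult_le_reg_r (Cmod (snd p))); auto.
  replace (Cmod (snd q - snd p) / Cmod (snd p) * Cmod (snd p))%R with (Cmod (snd q - snd p)) by (field; lra). exact Q2.
Qed.

(** Positive X and Y of comparable size correspond to points of both cones, and make the logarithms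
    of 1 + X Y and 1 + X^2 Y real. The integer n brings z into the fundamental annulus; it is common
    to the two normalizations because these nearly agree, so that [psi1 p] is known exactly, branch
    included. *)
Lemma overlap_point (tau : C) (F : C2 -> C2) (Psi : formal_diffeo) (S1 S4 : C2 -> Prop)
    (psi1 psi4 phi : C2 -> C2) (delta : R) :
  (0 < Im tau)%R ->
  cone_normalization tau F Psi tau S1 psi1 -> cone_normalization tau F Psi 1 S4 psi4 ->
  (forall c k : R, (0 < c)%R -> (0 < k)%R -> exists M : R, forall p, S4 p -> S1 p ->
     cone tau k c M p -> cone 1 k c M p -> Pi tau (psi4 p) = phi (Pi tau (psi1 p))) ->
  (0 < delta)%R ->
  (forall q : C2, (Cmod (fst q) < delta)%R -> (Cmod (snd q) < delta)%R -> phi_14 (phi q) = q) ->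
  exists A : R, forall a x s : R, (a <= - A)%R -> (Rabs (x - a) <= 3)%R -> (Rabs (s - a) <= 3)%R ->
  let X := exp x in let Y := exp s in
  let x1 := (x + ln (1 + X * Y))%R in let s1 := (s + ln (1 + X ^ 2 * Y))%R in
  exists (p : C2) (n : Z),
    S1 p /\ S4 p /\
    psi4 p = log_chart tau (RtoC x + RtoC (IZR n) * two_pi_i, RtoC s) /\
    psi1 p = log_chart tau (RtoC x1 + RtoC (IZR n) * two_pi_i, RtoC s1) /\
    (- (PI * Im tau) <= Re (RtoC s - tau * (RtoC x + RtoC (IZR n) * two_pi_i)) <= 3 * (PI * Im tau))%R /\
    (- (PI * Im tau) <= Re (RtoC s1 - tau * (RtoC x1 + RtoC (IZR n) * two_pi_i)) <= 3 * (PI * Im tau))%R /\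
    forall l, coframe tau psi1 l p =
      coframe tau psi4 (twist (RtoC X * RtoC Y / (1 + RtoC X * RtoC Y))
        (RtoC X ^ 2 * RtoC Y / (1 + RtoC X ^ 2 * RtoC Y)) l) p.
Proof.
  intros Ht HN1 HN4 Hco Hdel Hphi.
  pose proof PI_RGT_0 as Pp. set (h := (PI * Im tau)%R).
  assert (Hh : (0 < h)%R) by (unfold h; apply Rmult_lt_0_compat; lra).
  pose proof (Cmod_ge_0 tau) as Pt. pose proof two_pi_i_neq_0 as N2.
  destruct (dom1_half_plane tau Ht) as [k1 [Hk1 Hg1]]. destruct (dom4_half_plane tau Ht) as [k4 [Hk4 Hg4]].
  set (k := Rmin k1 k4). assert (Hk : (0 < k)%R) by (now apply Rmin_pos).
  assert (Kk1 : (k <= k1)%R) by apply Rmin_l. assert (Kk4 : (k <= k4)%R) by apply Rmin_r.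
  set (c := (3 * h + 1)%R). assert (Hc : (0 < c)%R) by (unfold c; lra).
  destruct (normalization_jet_derivatives _ _ _ _ _ _ HN1 3 (c + 1 + 1) (k / 2 / 2) ltac:(lra) ltac:(lra)) as [Mj1 [Kj1 [HMj1 [HKj1 HJ1]]]].
  destruct (normalization_jet_derivatives _ _ _ _ _ _ HN4 3 (c + 1 + 1) (k / 2 / 2) ltac:(lra) ltac:(lra)) as [Mj4 [Kj4 [HMj4 [HKj4 HJ4]]]].
  destruct (cone_normalization_near_id _ _ _ _ _ _ HN1 (c + 1 + 1) (k / 2 / 2) ltac:(lra) ltac:(lra)) as [Mn1 [Kn1 [HMn1 [HKn1 HI1]]]].
  destruct (cone_normalization_near_id _ _ _ _ _ _ HN4 (c + 1 + 1) (k / 2 / 2) ltac:(lra) ltac:(lra)) as [Mn4 [Kn4 [HMn4 [HKn4 HI4]]]].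
  destruct (Hco (c + 1 + 1)%R (k / 2 / 2)%R ltac:(lra) ltac:(lra)) as [Mc' HMc].
  set (Mc := Rabs Mc'). assert (HMc0 : (0 <= Mc)%R) by apply Rabs_pos. assert (HMc1 : (Mc' <= Mc)%R) by apply Rle_abs.
  set (r := Rmin (1 / 2) (k / (4 * (k + Cmod tau + 1)))).
  assert (Hr : (0 < r)%R) by (apply Rmin_pos; [lra | apply Rdiv_lt_0_compat; lra]).
  assert (Hr1 : (r <= 1 / 2)%R) by apply Rmin_l.
  assert (Hr2 : (r * (4 * (k + Cmod tau + 1)) <= k)%R).
  { apply Rle_trans with (k / (4 * (k + Cmod tau + 1)) * (4 * (k + Cmod tau + 1)))%R.
    apply Rmult_le_compat_r. lra. apply Rmin_r. right; field; lra. }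
  assert (Hrt : (0 <= r * Cmod tau)%R) by nra. assert (Hrk : (0 <= r * k)%R) by nra.
  set (KJ := (Kj1 + Kj4)%R). assert (HKJ : (0 < KJ)%R) by (unfold KJ; lra).
  assert (Eh : (exp (- h) < 1)%R) by (rewrite <- exp_0; apply exp_increasing; lra).
  (* Bound for the distance between [psi1 p] and [psi4 p]: 1/4 keeps the imaginary part of d below
     pi, and 1 - exp (- h) keeps the annulus coordinate of [psi1 p] in the large window. *)
  set (ka := Rmin (1 / 4) (1 - exp (- h))). assert (Hka : (0 < ka)%R) by (apply Rmin_pos; lra).
  assert (Hka1 : (ka <= 1 / 4)%R) by apply Rmin_l. assert (Hka2 : (ka <= 1 - exp (- h))%R) by apply Rmin_r.
  assert (P1 : (0 < Kn4 / r)%R) by (now apply Rdiv_lt_0_compat).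
  assert (P2 : (0 < 4 * KJ / ka)%R) by (apply Rdiv_lt_0_compat; lra).
  set (M' := (2 * (Mj1 + Mj4 + Mn1 + Mn4 + Mc) + Kn4 / r + 4 * KJ / ka + 1)%R).
  assert (HM' : (0 < M')%R) by (unfold M'; lra).
  destruct (cone_surjective tau F Psi 1 S4 psi4 HN4 c k M' Hc Hk HM') as [Ms [HMs Hsurj]].
  destruct (Hg1 Ms) as [A1 HA1]. destruct (Hg4 Ms) as [A4 HA4].
  (* Bounds e^d and e^(tau d). Together with a factor 2 for the ratio of the values of z, it keeps
     the coordinates of [Pi tau (psi1 p)] below delta / 4 once X and Y are below delta / (8 E1). *)
  set (E1 := exp (2 * PI * (Cmod tau + 1))). assert (HE1 : (0 < E1)%R) by apply exp_pos.
  set (A := (12 + Rabs A1 + Rabs A4 + 4 + Rabs (ln (delta / (8 * E1))))%R).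
  exists A. intros a x s Ha Hx Hs X Y x1 s1.
  pose proof (Rabs_pos A1). pose proof (Rabs_pos A4). pose proof (Rabs_pos (ln (delta / (8 * E1)))).
  pose proof (Rle_abs A1). pose proof (Rle_abs A4). pose proof (Rle_abs (- ln (delta / (8 * E1)))) as La.
  rewrite Rabs_Ropp in La.
  apply Rabs_le_between in Hx. apply Rabs_le_between in Hs.
  assert (HX : (0 < X)%R) by apply exp_pos. assert (HY : (0 < Y)%R) by apply exp_pos.
  assert (Sm : (exp (a + 3) <= delta / (8 * E1))%R).
  { assert (Pd : (0 < delta / (8 * E1))%R) by (apply Rdiv_lt_0_compat; lra).
    rewrite <- (exp_ln (delta / (8 * E1))) by auto.
    apply Rlt_le, exp_increasing. unfold A in Ha. lra. }
  assert (SX : (X <= delta / (8 * E1))%R).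
  { eapply Rle_trans. 2: apply Sm. unfold X. destruct (Req_dec x (a + 3)) as [->|]; [lra|]. apply Rlt_le, exp_increasing. lra. }
  assert (SY : (Y <= delta / (8 * E1))%R).
  { eapply Rle_trans. 2: apply Sm. unfold Y. destruct (Req_dec s (a + 3)) as [->|]; [lra|]. apply Rlt_le, exp_increasing. lra. }
  set (a0 := Re (RtoC s - tau * RtoC x)).
  set (n := up (- a0 / (2 * h))).
  set (xh := RtoC x + RtoC (IZR n) * two_pi_i).
  assert (Rn : (0 < Re (RtoC s - tau * xh) <= 2 * h)%R).
  { unfold xh. rewrite Re_period. fold a0. replace (2 * PI * Im tau)%R with (2 * h)%R by (unfold h; ring).
    destruct (archimed (- a0 / (2 * h))) as [U1 U2]. fold n in U1, U2.
    apply Rgt_lt, (Rmult_lt_compat_r (2 * h)) in U1; try lra. apply (Rmult_le_compat_r (2 * h)) in U2; try lra.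
    replace (- a0 / (2 * h) * (2 * h))%R with (- a0)%R in U1 by (field; lra).
    replace ((IZR n - - a0 / (2 * h)) * (2 * h))%R with (IZR n * (2 * h) + a0)%R in U2 by (field; lra). lra. }
  assert (Rxh : Re xh = x) by (unfold xh; rewrite two_pi_i_eq; unfold Re; simpl; ring).
  assert (D1 : dom1 A1 xh (RtoC s)).
  { split. simpl. unfold A in Ha. lra. rewrite Rxh. simpl. apply Rabs_def1; unfold A in Ha; lra. }
  assert (D4 : dom4 A4 xh (RtoC s)).
  { split. rewrite Rxh. unfold A in Ha. lra. rewrite Rxh. simpl. apply Rabs_def1; unfold A in Ha; lra. }
  destruct (HA1 _ _ D1 ltac:(fold h; lra)) as [G1 G1']. destruct (HA4 _ _ D4 ltac:(fold h; lra)) as [G4 G4'].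
  apply (half_plane_weaken _ _ _ k Kk1) in G1. apply (half_plane_weaken _ _ _ k Kk4) in G4.
  set (q0 := log_chart tau (xh, RtoC s)).
  destruct (Hsurj q0) as [p [Hp [S4p Ep]]]; auto.
  { unfold q0, log_chart, annulus. cbn [fst snd]. rewrite Cmod_Cexp. split; apply exp_increasing; unfold c; lra. }
  assert (Wk : forall sg, cone sg (k / 2) (c + 1) M' p -> cone sg (k / 2 / 2) (c + 1 + 1) (M' / 2) p).
  { intros sg. apply cone_weaken; lra. }
  assert (B4 : forall M q, (M <= Mj1 + Mj4 + Mn1 + Mn4 + Mc)%R -> forall sg, cone sg (k / 2 / 2) (c + 1 + 1) (M' / 2) q -> cone sg (k / 2 / 2) (c + 1 + 1) M q).
  { intros M q HM sg. apply cone_weaken; try lra. unfold M'; lra. }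
  destruct (HI4 p (B4 Mn4 p ltac:(lra) 1 (Wk 1 Hp))) as [_ [_ [_ [I4 I4']]]].
  (* Surjectivity places p only in the cone of the sector 4. Its image has xi = xh / (2 pi i), which
     lies in both half planes and is close to 1 / y, so p lies in the cone of the sector 1 as
     well. *)
  assert (Hpt : cone tau (k / 2) (c + 1) M' p).
  { destruct Hp as [Q1 [Q2 [Q3 Q4]]]. split; auto. split; auto. split; auto.
    apply (half_plane_perturb tau (xh / two_pi_i) _ k r); auto; try lra.
    - rewrite Ep in I4. unfold q0, log_chart in I4. cbn [fst snd] in I4. rewrite Cmod_sub_sym.
      eapply Rle_trans. apply I4. apply Rle_trans with (r * (Kn4 / r))%R. right; field; lra.
      apply Rmult_le_compat_l. lra. unfold M' in Q2. lra. }
  destruct (HI1 p (B4 Mn1 p ltac:(lra) tau (Wk tau Hpt))) as [S1p [_ [_ [_ I1']]]].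
  destruct HN1 as [HN1a [HN1b _]]. destruct HN4 as [HN4a [HN4b _]].
  destruct (HN1a p S1p) as [_ [Nz1 Nx1]]. destruct (HN4a p S4p) as [Ny [Nz4 Nx4]].
  destruct (small_of_cone 1 (k / 2) (c + 1) M' (4 * KJ / ka) p P2 ltac:(unfold M'; lra) Hp) as [Y0 [_ Y1]].
  destruct (small_of_cone 1 (k / 2) (c + 1) M' 1 p ltac:(lra) ltac:(unfold M'; lra) Hp) as [_ [_ Y2]].
  destruct (HJ1 p (B4 Mj1 p ltac:(lra) tau (Wk tau Hpt))) as [J1a [J1b _]].
  destruct (HJ4 p (B4 Mj4 p ltac:(lra) 1 (Wk 1 Hp))) as [J4a [J4b _]].
  set (y := Cmod (snd p)) in *.
  assert (Yk : (4 * (KJ * y) <= ka)%R).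
  { apply (Rmult_le_reg_l (/ ka)). now apply Rinv_0_lt_compat. rewrite Rinv_l by lra. unfold Rdiv in Y1. lra. }
  assert (Y3 : (y ^ 3 <= y)%R) by (clear - Y0 Y2; simpl; assert (y * y <= 1)%R by nra; nra).
  assert (Dz : (Cmod (fst (psi1 p) - fst (psi4 p)) <= ka)%R).
  { replace (fst (psi1 p) - fst (psi4 p)) with
      ((fst (psi1 p) - fst (jet Psi 3 p)) - (fst (psi4 p) - fst (jet Psi 3 p))) by ring.
    eapply Rle_trans. apply Cmod_sub_le.
    assert (KJ * y ^ 3 <= KJ * y)%R by (apply Rmult_le_compat_l; lra).
    assert (0 <= KJ * y)%R by (apply Rmult_le_pos; lra). unfold KJ in *. lra. }
  (* Both xi are of size 1 / |y|, so passing from 1 / xi to xi costs a factor y^(-2): this is why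
     the jets are taken at order 3. *)
  assert (Dx : (Cmod (snd (psi1 p) - snd (psi4 p)) <= ka)%R).
  { set (x1' := snd (psi1 p)) in *. set (x4' := snd (psi4 p)) in *.
    assert (Q1 : (Cmod x1' <= 2 / y)%R).
    { rewrite <- (Cinv_inv x1'). rewrite (Cmod_inv (/ x1')).
      replace (2 / y)%R with (/ (y / 2))%R by (field; lra). apply Rinv_le_contravar; lra.
      apply Cmod_gt_0. lra. }
    assert (Q4 : (Cmod x4' <= 2 / y)%R).
    { rewrite <- (Cinv_inv x4'). rewrite (Cmod_inv (/ x4')).
      replace (2 / y)%R with (/ (y / 2))%R by (field; lra). apply Rinv_le_contravar; lra.
      apply Cmod_gt_0. lra. }
    replace (x1' - x4') with (x1' * x4' * ((/ x4' - snd (jet Psi 3 p)) - (/ x1' - snd (jet Psi 3 p)))) by (field; auto).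
    rewrite !Cmod_mult.
    pose proof (Cmod_sub_le (/ x4' - snd (jet Psi 3 p)) (/ x1' - snd (jet Psi 3 p))) as T.
    apply Rle_trans with (2 / y * (2 / y) * (KJ * y ^ 3))%R.
    { apply Rmult_le_compat. apply Rmult_le_pos; apply Cmod_ge_0. apply Cmod_ge_0.
      apply Rmult_le_compat; auto; apply Cmod_ge_0. unfold KJ. lra. }
    replace (2 / y * (2 / y) * (KJ * y ^ 3))%R with (4 * (KJ * y))%R by (field; lra). exact Yk. }
  assert (EP4 : Pi tau (psi4 p) = (RtoC X, RtoC Y)).
  { rewrite Ep. unfold q0. rewrite Pi_log_chart. unfold xh. now rewrite Cexp_period, !Cexp_R. }
  set (d := two_pi_i * (snd (psi1 p) - snd (psi4 p))).
  assert (Cd : (Cmod d <= 2 * PI * ka)%R).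
  { unfold d. rewrite Cmod_mult. unfold two_pi_i. rewrite Cmod_mult, Cmod_Ci, Cmod_R, Rmult_1_r, Rabs_pos_eq by lra.
    apply Rmult_le_compat_l; lra. }
  assert (Lz4 : (1 < Cmod (fst (psi4 p)) <= exp (2 * h))%R).
  { rewrite Ep. unfold q0, log_chart. cbn [fst snd]. rewrite Cmod_Cexp. split.
    rewrite <- exp_0. apply exp_increasing. lra.
    destruct (Req_dec (Re (RtoC s - tau * xh)) (2 * h)) as [->|]; [lra|]. apply Rlt_le, exp_increasing. lra. }
  assert (Lz1 : (1 - ka <= Cmod (fst (psi1 p)) <= Cmod (fst (psi4 p)) + ka)%R).
  { pose proof (Cmod_triangle (fst (psi4 p)) (fst (psi1 p) - fst (psi4 p))) as T1.
    replace (fst (psi4 p) + (fst (psi1 p) - fst (psi4 p))) with (fst (psi1 p)) in T1 by ring.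
    pose proof (Cmod_sub_ge (fst (psi4 p)) (fst (psi4 p) - fst (psi1 p))) as T2.
    replace (fst (psi4 p) - (fst (psi4 p) - fst (psi1 p))) with (fst (psi1 p)) in T2 by ring.
    rewrite (Cmod_sub_sym (fst (psi4 p)) (fst (psi1 p))) in T2. lra. }
  assert (Ebound : forall w : C, (Cmod w <= Cmod tau + 1)%R -> (Cmod (Cexp (w * d)) <= E1)%R).
  { intros w Hw. rewrite Cmod_Cexp. unfold E1.
    assert (Re (w * d) <= 2 * PI * (Cmod tau + 1))%R.
    { eapply Rle_trans. apply Rle_abs. eapply Rle_trans. apply re_le_Cmod. rewrite Cmod_mult.
      assert (2 * PI * ka <= 2 * PI * 1)%R by (apply Rmult_le_compat_l; lra). assert (Cmod d <= 2 * PI)%R by lra. pose proof (Cmod_ge_0 d). pose proof (Cmod_ge_0 w).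
      apply Rle_trans with ((Cmod tau + 1) * (2 * PI))%R. apply Rmult_le_compat; lra. lra. }
    destruct (Req_dec (Re (w * d)) (2 * PI * (Cmod tau + 1))) as [->|]; [lra|]. apply Rlt_le, exp_increasing. lra. }
  assert (X1e : fst (Pi tau (psi1 p)) = RtoC X * Cexp d).
  { assert (T : fst (Pi tau (psi4 p)) = RtoC X) by now rewrite EP4. rewrite <- T. unfold Pi. cbn [fst].
    rewrite <- Cexp_add. f_equal. unfold d. ring. }
  assert (Y1e : snd (Pi tau (psi1 p)) = RtoC Y * (fst (psi1 p) / fst (psi4 p)) * Cexp (tau * d)).
  { assert (T : snd (Pi tau (psi4 p)) = RtoC Y) by now rewrite EP4. rewrite <- T. unfold Pi. cbn [snd].
    transitivity (fst (psi1 p) * (Cexp (two_pi_i * tau * snd (psi4 p)) * Cexp (tau * d))).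
    rewrite <- Cexp_add. do 2 f_equal. unfold d. ring. field. auto. }
  assert (EE : (delta / (8 * E1) * E1 = delta / 8)%R) by (field; lra).
  assert (Bx : (Cmod (fst (Pi tau (psi1 p))) <= delta / 4)%R).
  { rewrite X1e, Cmod_mult, Cmod_R, Rabs_pos_eq by lra.
    assert (T : (Cmod (Cexp d) <= E1)%R) by (replace d with (1 * d) by ring; apply Ebound; rewrite Cmod_1; lra).
    assert (X * Cmod (Cexp d) <= delta / (8 * E1) * E1)%R by (apply Rmult_le_compat; try lra; apply Cmod_ge_0). lra. }
  assert (By : (Cmod (snd (Pi tau (psi1 p))) <= delta / 4)%R).
  { rewrite Y1e, !Cmod_mult, Cmod_R, Rabs_pos_eq, Cmod_div by (auto; lra).
    assert (T : (Cmod (Cexp (tau * d)) <= E1)%R) by (apply Ebound; lra).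
    assert (T2 : (Cmod (fst (psi1 p)) / Cmod (fst (psi4 p)) <= 2)%R).
    { apply (Rmult_le_reg_r (Cmod (fst (psi4 p)))). lra.
      replace (Cmod (fst (psi1 p)) / Cmod (fst (psi4 p)) * Cmod (fst (psi4 p)))%R with (Cmod (fst (psi1 p))) by (field; lra). lra. }
    assert (T3 : (0 <= Cmod (fst (psi1 p)) / Cmod (fst (psi4 p)))%R) by (apply Rdiv_le_0_compat; [apply Cmod_ge_0 | lra]).
    assert (Y * (Cmod (fst (psi1 p)) / Cmod (fst (psi4 p))) * Cmod (Cexp (tau * d)) <= delta / (8 * E1) * 2 * E1)%R.
    { apply Rmult_le_compat; auto; try apply Cmod_ge_0. apply Rmult_le_pos; lra. apply Rmult_le_compat; lra. }
    lra. }
  destruct HN1b as [HS1o [HS1h _]]. destruct HN4b as [HS4o [HS4h _]].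
  assert (Hol1 := HS1h p S1p). assert (Hol4 := HS4h p S4p).
  destruct (Pi_hdiff tau psi1 p Hol1 Nz1) as [PA PB].
  destruct (hdiff_continuous _ _ _ _ PA (delta / 4) ltac:(lra)) as [e1 [He1 Cx]].
  destruct (hdiff_continuous _ _ _ _ PB (delta / 4) ltac:(lra)) as [e2 [He2 Cy]].
  destruct (open_C2 S1 p HS1o S1p) as [e3 [He3 O3]]. destruct (open_C2 S4 p HS4o S4p) as [e4 [He4 O4]].
  pose proof (exp_pos (- (c + 1))) as Pe.
  set (e := Rmin (Rmin (Rmin e1 e2) (Rmin e3 e4)) (Rmin (exp (- (c + 1)) / 2) (r * y))).
  assert (He : (0 < e)%R) by (repeat apply Rmin_pos; auto; [lra | apply Rmult_lt_0_compat; lra]).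
  assert (L1 : (e <= Rmin (Rmin e1 e2) (Rmin e3 e4))%R) by apply Rmin_l.
  assert (L2 : (e <= Rmin (exp (- (c + 1)) / 2) (r * y))%R) by apply Rmin_r.
  pose proof (Rmin_l (Rmin e1 e2) (Rmin e3 e4)). pose proof (Rmin_r (Rmin e1 e2) (Rmin e3 e4)).
  pose proof (Rmin_l e1 e2). pose proof (Rmin_r e1 e2). pose proof (Rmin_l e3 e4). pose proof (Rmin_r e3 e4).
  pose proof (Rmin_l (exp (- (c + 1)) / 2) (r * y)). pose proof (Rmin_r (exp (- (c + 1)) / 2) (r * y)).
  assert (Hrel : forall q : C2, (Cmod (fst q - fst p) < e)%R -> (Cmod (snd q - snd p) < e)%R ->
     Pi tau (psi1 q) = phi_14 (Pi tau (psi4 q))).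
  { intros q Q1 Q2.
    specialize (Cx q ltac:(lra) ltac:(lra)). specialize (Cy q ltac:(lra) ltac:(lra)).
    assert (Cq : forall sg, (Cmod sg <= Cmod tau + 1)%R -> cone sg (k / 2) (c + 1) M' p -> cone sg (k / 2 / 2) (c + 1 + 1) (M' / 2) q).
    { intros sg Hsg Cp.
      assert (r * (k / 2 + Cmod sg) <= r * (k + Cmod tau + 1))%R by (apply Rmult_le_compat_l; lra).
      apply (cone_neighborhood sg (k / 2) (c + 1) M' r p); auto; try lra. fold y. lra. }
    rewrite (HMc q).
    - symmetry. apply Hphi.
      pose proof (Cmod_triangle (fst (Pi tau (psi1 q)) - fst (Pi tau (psi1 p))) (fst (Pi tau (psi1 p)))) as T.
      replace (fst (Pi tau (psi1 q)) - fst (Pi tau (psi1 p)) + fst (Pi tau (psi1 p))) with (fst (Pi tau (psi1 q))) in T by ring. lra.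
      pose proof (Cmod_triangle (snd (Pi tau (psi1 q)) - snd (Pi tau (psi1 p))) (snd (Pi tau (psi1 p)))) as T.
      replace (snd (Pi tau (psi1 q)) - snd (Pi tau (psi1 p)) + snd (Pi tau (psi1 p))) with (snd (Pi tau (psi1 q))) in T by ring. lra.
    - apply O4; lra.
    - apply O3; lra.
    - apply B4; [lra|]. apply Cq; auto. lra.
    - apply B4; [lra|]. apply Cq; auto. rewrite Cmod_1. lra. }
  assert (EP1 : Pi tau (psi1 p) = phi_14 (RtoC X, RtoC Y)).
  { rewrite <- EP4. apply Hrel; [replace (fst p - fst p) with (RtoC 0) by ring | replace (snd p - snd p) with (RtoC 0) by ring];
    rewrite Cmod_0; lra. }
  assert (PXY : (0 < 1 + X * Y)%R) by (assert (0 < X * Y)%R by (apply Rmult_lt_0_compat; auto); lra).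
  assert (PXXY : (0 < 1 + X ^ 2 * Y)%R).
  { assert (0 < X ^ 2 * Y)%R by (apply Rmult_lt_0_compat; [apply pow_lt|]; auto). lra. }
  assert (NX : RtoC X <> 0) by (apply Cmod_gt_0; rewrite Cmod_R; apply Rabs_pos_lt; lra).
  assert (NY : RtoC Y <> 0) by (apply Cmod_gt_0; rewrite Cmod_R; apply Rabs_pos_lt; lra).
  assert (RXY : 1 + RtoC X * RtoC Y = RtoC (1 + X * Y)) by (rewrite RtoC_plus, RtoC_mult; reflexivity).
  assert (RXXY : 1 + RtoC X ^ 2 * RtoC Y = RtoC (1 + X ^ 2 * Y)) by (rewrite RtoC_plus, RtoC_mult, RtoC_pow; reflexivity).
  assert (Ed : d = RtoC (ln (1 + X * Y))).
  { apply Cexp_real; auto.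
    - eapply Rle_lt_trans. apply Im_le_Cmod.
      assert (2 * PI * ka <= 2 * PI * (1 / 4))%R by (apply Rmult_le_compat_l; lra). lra.
    - rewrite <- RXY. apply (f_equal fst) in EP1. unfold phi_14 in EP1. cbn [fst snd] in EP1. rewrite X1e in EP1.
      transitivity (RtoC X * Cexp d / RtoC X). field; auto. rewrite EP1. field; auto. }
  assert (Ex : snd (psi1 p) = (RtoC x1 + RtoC (IZR n) * two_pi_i) / two_pi_i).
  { unfold x1. rewrite RtoC_plus, <- Ed.
    replace (RtoC x + d + RtoC (IZR n) * two_pi_i) with (xh + d) by (unfold xh; ring).
    unfold d. rewrite Ep. unfold q0, log_chart. cbn [fst snd]. field. auto. }
  assert (Ez : fst (psi1 p) = Cexp (RtoC s1 - tau * (RtoC x1 + RtoC (IZR n) * two_pi_i))).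
  { assert (T := f_equal snd EP1). unfold phi_14 in T. cbn [fst snd] in T. rewrite RXXY in T.
    assert (T2 : RtoC Y * RtoC (1 + X ^ 2 * Y) = Cexp (RtoC s1)).
    { unfold s1. rewrite (RtoC_plus s), Cexp_add, !Cexp_R, exp_ln by auto. reflexivity. }
    rewrite T2 in T. unfold Pi in T. cbn [snd] in T. rewrite Ex in T.
    replace (two_pi_i * tau * ((RtoC x1 + RtoC (IZR n) * two_pi_i) / two_pi_i)) with (tau * (RtoC x1 + RtoC (IZR n) * two_pi_i)) in T
      by (field; auto).
    replace (RtoC s1 - tau * (RtoC x1 + RtoC (IZR n) * two_pi_i)) with
      (RtoC s1 + - (tau * (RtoC x1 + RtoC (IZR n) * two_pi_i))) by ring.
    rewrite Cexp_add, <- T, Cexp_opp. field. apply Cexp_neq_0. }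
  exists p, n. split; auto. split; auto. split. exact Ep.
  split. { unfold log_chart. cbn [fst snd]. apply injective_projections; cbn [fst snd]; auto. }
  split. { fold xh. fold h. lra. }
  split.
  - assert (Lz : Cmod (fst (psi1 p)) = exp (Re (RtoC s1 - tau * (RtoC x1 + RtoC (IZR n) * two_pi_i)))) by (now rewrite Ez, Cmod_Cexp).
    fold h. split; apply exp_le_inv; rewrite <- Lz. lra.
    (* The upper bound is exp (2 h) + 1 - exp (- h) <= exp (3 h), the sum of the two nonnegative
       products below. *)
    assert (U1 : exp (3 * h) = (exp (2 * h) * exp h)%R) by (rewrite <- exp_plus; f_equal; ring).
    assert (U2 : (exp h * exp (- h) = 1)%R) by (rewrite <- exp_plus, Rplus_opp_r; apply exp_0).
    assert (U3 : (1 < exp (2 * h))%R) by (rewrite <- exp_0; apply exp_increasing; lra).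
    assert (U4 : (1 < exp h)%R) by (rewrite <- exp_0; apply exp_increasing; lra).
    assert (0 <= (exp (2 * h) - 1) * (exp h - 1))%R by (apply Rmult_le_pos; lra).
    assert (0 <= (exp h - 1) * (1 - exp (- h)))%R by (apply Rmult_le_pos; lra). lra.
  - intros l. apply (coframe_transition tau psi1 psi4 p 0 (RtoC X) (RtoC Y) e); auto.
    rewrite RXY. apply Cmod_gt_0. rewrite Cmod_R. apply Rabs_pos_lt. lra.
    rewrite RXXY. apply Cmod_gt_0. rewrite Cmod_R. apply Rabs_pos_lt. lra.
Qed.

(** * Mixed second differences *)

Definition line_at (l m : C2) (f : C) : C2 := (fst l + f * fst m, snd l + f * snd m).

Lemma slope_line (tau : C) (psi eta : C2 -> C2) (t : P1) (p : C2) :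
  wedge (eta p) (coframe tau psi (limit_line tau (other_member t)) p) <> 0 ->
  wedge (eta p) (coframe tau psi (line_at (limit_line tau t) (limit_line tau (other_member t))
    (slope tau psi eta t p)) p) = 0.
Proof.
  intros H.
  assert (E : forall l m f, wedge (eta p) (coframe tau psi (line_at l m f) p) =
    wedge (eta p) (coframe tau psi l p) + f * wedge (eta p) (coframe tau psi m p))
    by (intros; unfold wedge, line_at, coframe; cbn [fst snd]; ring).
  rewrite E. unfold slope. field. auto.
Qed.

(** Both lines define covectors proportional to [eta p]. Were they independent, every covector of
    the coframe of [psi4] would have zero wedge product with [eta p], contrary to the hypothesis on
    m. *)
Lemma line_relation (tau : C) (psi1 psi4 eta : C2 -> C2) (u v : C) (l1 l4 m p : C2) :
  (forall l, coframe tau psi1 l p = coframe tau psi4 (twist u v l) p) ->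
  wedge (eta p) (coframe tau psi1 l1 p) = 0 -> wedge (eta p) (coframe tau psi4 l4 p) = 0 ->
  wedge (eta p) (coframe tau psi4 m p) <> 0 -> wedge (twist u v l1) l4 = 0.
Proof.
  intros H E1 E4 Nm. rewrite H in E1. set (l := twist u v l1) in *.
  set (a := wedge (eta p) (coframe tau psi4 (RtoC 1, RtoC 0) p)).
  set (b := wedge (eta p) (coframe tau psi4 (RtoC 0, RtoC 1) p)).
  assert (L : forall l, wedge (eta p) (coframe tau psi4 l p) = fst l * a + snd l * b).
  { intros l'. unfold a, b. rewrite (coframe_linear tau psi4 l'). unfold wedge. cbn [fst snd]. ring. }
  rewrite L in E1, E4, Nm.
  assert (Ha : wedge l l4 * a = 0).
  { unfold wedge. transitivity (snd l4 * (fst l * a + snd l * b) - snd l * (fst l4 * a + snd l4 * b)). ring. rewrite E1, E4. ring. }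
  assert (Hb : wedge l l4 * b = 0).
  { unfold wedge. transitivity (fst l * (fst l4 * a + snd l4 * b) - fst l4 * (fst l * a + snd l * b)). ring. rewrite E1, E4. ring. }
  apply NNPP. intros N. apply Nm.
  assert (Za : a = 0) by (transitivity (/ wedge l l4 * (wedge l l4 * a)); [field; auto | rewrite Ha; ring]).
  assert (Zb : b = 0) by (transitivity (/ wedge l l4 * (wedge l l4 * b)); [field; auto | rewrite Hb; ring]).
  rewrite Za, Zb. ring.
Qed.

Lemma Cmod_mult_le (a b : C) (x y : R) : (Cmod a <= x)%R -> (Cmod b <= y)%R -> (Cmod (a * b) <= x * y)%R.
Proof. intros A B. rewrite Cmod_mult. apply Rmult_le_compat; auto; apply Cmod_ge_0. Qed.

Lemma Cmod_plus_le (a b : C) (x y : R) : (Cmod a <= x)%R -> (Cmod b <= y)%R -> (Cmod (a + b) <= x + y)%R.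
Proof. intros A B. eapply Rle_trans. apply Cmod_triangle. lra. Qed.

Lemma Cmod_minus_le (a b : C) (x y : R) : (Cmod a <= x)%R -> (Cmod b <= y)%R -> (Cmod (a - b) <= x + y)%R.
Proof. intros A B. eapply Rle_trans. apply Cmod_sub_le. lra. Qed.

Lemma frac_bounds (w W : R) : (0 <= w <= W)%R ->
  (Cmod (RtoC w / (1 + RtoC w)) <= W)%R /\ (Cmod (RtoC w / (1 + RtoC w) - RtoC w) <= W ^ 2)%R.
Proof.
  intros H. rewrite <- RtoC_plus, <- RtoC_div, <- RtoC_minus, !Cmod_R by lra.
  assert (A : (0 <= w / (1 + w) <= w)%R).
  { split. apply Rdiv_le_0_compat; lra. apply (Rmult_le_reg_r (1 + w)). lra.
    replace (w / (1 + w) * (1 + w))%R with w by (field; lra). nra. }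
  rewrite Rabs_pos_eq by lra. split. lra.
  rewrite Rabs_left1 by lra.
  replace (- (w / (1 + w) - w))%R with (w / (1 + w) * w)%R by (field; lra). simpl. nra.
Qed.

Section SecondDifferences.
Variables (l m : C2) (c0 : R).
Hypothesis Hc0 : (Cmod (fst l) + Cmod (snd l) + Cmod (fst m) + Cmod (snd m) + 1 <= c0)%R.

(** [cA] and [cB] are the coefficients of u and v in the relation between the two slopes. At f = g =
    0 and l = (a, b) they are a (b - a) and b (2 b - a). *)
Let cA (f g : C) : C := fst (line_at l m f) * (snd (line_at l m g) - fst (line_at l m g)).
Let cB (f g : C) : C := snd (line_at l m f) * (2 * snd (line_at l m g) - fst (line_at l m g)).

Lemma wedge_twist_expand (u v f g : C) :
  wedge (twist u v (line_at l m f)) (line_at l m g) =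
  (g - f) * wedge l m + u * cA f g + v * cB f g.
Proof. unfold cA, cB, wedge, twist, line_at. cbn [fst snd]. ring. Qed.

Lemma line_coef_bound (f : C) : (Cmod f <= 1)%R ->
  (Cmod (fst (line_at l m f)) <= c0)%R /\ (Cmod (snd (line_at l m f)) <= c0)%R.
Proof.
  intros Hf. pose proof (Cmod_ge_0 (fst l)). pose proof (Cmod_ge_0 (snd l)).
  pose proof (Cmod_ge_0 (fst m)). pose proof (Cmod_ge_0 (snd m)).
  unfold line_at. cbn [fst snd]. split.
  - pose proof (Cmod_plus_le _ _ _ _ (Rle_refl (Cmod (fst l))) (Cmod_mult_le _ _ _ _ Hf (Rle_refl (Cmod (fst m))))). lra.
  - pose proof (Cmod_plus_le _ _ _ _ (Rle_refl (Cmod (snd l))) (Cmod_mult_le _ _ _ _ Hf (Rle_refl (Cmod (snd m))))). lra.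
Qed.

Lemma c0_pos : (1 <= c0)%R.
Proof.
  pose proof (Cmod_ge_0 (fst l)). pose proof (Cmod_ge_0 (snd l)).
  pose proof (Cmod_ge_0 (fst m)). pose proof (Cmod_ge_0 (snd m)). lra.
Qed.

Lemma Cmod_2_mult (x : C) (b : R) : (Cmod x <= b)%R -> (Cmod (2 * x) <= 2 * b)%R.
Proof. intros H. apply Cmod_mult_le; auto. rewrite Cmod_R, Rabs_pos_eq; lra. Qed.

Lemma cAB_bound (f g : C) : (Cmod f <= 1)%R -> (Cmod g <= 1)%R ->
  (Cmod (cA f g) <= 2 * c0 ^ 2)%R /\ (Cmod (cB f g) <= 3 * c0 ^ 2)%R.
Proof.
  intros Hf Hg. destruct (line_coef_bound f Hf) as [F1 F2]. destruct (line_coef_bound g Hg) as [G1 G2].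
  split.
  - replace (2 * c0 ^ 2)%R with (c0 * (c0 + c0))%R by ring. apply Cmod_mult_le; auto. now apply Cmod_minus_le.
  - replace (3 * c0 ^ 2)%R with (c0 * (2 * c0 + c0))%R by ring. apply Cmod_mult_le; auto.
    apply Cmod_minus_le; auto. now apply Cmod_2_mult.
Qed.

Lemma cAB_lipschitz (f g f0 : C) (k : R) : (Cmod f <= 1)%R -> (Cmod g <= 1)%R -> (Cmod f0 <= 1)%R ->
  (Cmod (f - f0) <= k)%R -> (Cmod (g - f0) <= k)%R ->
  (Cmod (cA f g - cA f0 f0) <= 4 * c0 ^ 2 * k)%R /\ (Cmod (cB f g - cB f0 f0) <= 6 * c0 ^ 2 * k)%R.
Proof.
  intros Hf Hg Hf0 D1 D2. pose proof c0_pos as Pc.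
  pose proof (Cmod_ge_0 (fst l)). pose proof (Cmod_ge_0 (snd l)).
  pose proof (Cmod_ge_0 (fst m)). pose proof (Cmod_ge_0 (snd m)).
  assert (M1 : (Cmod (fst m) <= c0)%R) by lra. assert (M2 : (Cmod (snd m) <= c0)%R) by lra.
  destruct (line_coef_bound g Hg) as [G1 G2]. destruct (line_coef_bound f0 Hf0) as [F1 F2].
  split.
  - replace (cA f g - cA f0 f0) with
     ((f - f0) * fst m * (snd (line_at l m g) - fst (line_at l m g)) + fst (line_at l m f0) * ((g - f0) * (snd m - fst m)))
     by (unfold cA, line_at; cbn [fst snd]; ring).
    replace (4 * c0 ^ 2 * k)%R with (k * c0 * (c0 + c0) + c0 * (k * (c0 + c0)))%R by ring.
    apply Cmod_plus_le; repeat apply Cmod_mult_le; auto; apply Cmod_minus_le; auto.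
  - replace (cB f g - cB f0 f0) with
     ((f - f0) * snd m * (2 * snd (line_at l m g) - fst (line_at l m g)) + snd (line_at l m f0) * ((g - f0) * (2 * snd m - fst m)))
     by (unfold cB, line_at; cbn [fst snd]; ring).
    replace (6 * c0 ^ 2 * k)%R with (k * c0 * (2 * c0 + c0) + c0 * (k * (2 * c0 + c0)))%R by ring.
    apply Cmod_plus_le; [apply Cmod_mult_le; [apply Cmod_mult_le; auto|] | apply Cmod_mult_le; auto; apply Cmod_mult_le; auto];
      apply Cmod_minus_le; auto; now apply Cmod_2_mult.
Qed.

(* With [X_i = i lam] and [Y_j = j lam], [F] almost independent of [i] and [G] of [j],
   the mixed second differences of [(F - G) (l /\ m) = u A + v B], where [u ~ X Y] and
   [v ~ X^2 Y], isolate the limits of [A] and [B]. *)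
Lemma second_differences (w e lam : R) (F G : R -> R -> C) :
  w = Cmod (wedge l m) -> (0 < w)%R -> (0 < lam <= 1)%R -> (0 <= e <= 1)%R ->
  (forall i j : R, (1 <= i <= 3)%R -> (1 <= j <= 2)%R ->
     let X := RtoC (i * lam) in let Y := RtoC (j * lam) in
     (Cmod (F i j) <= e)%R /\ (Cmod (G i j) <= e)%R /\
     (Cmod (F i j - F 1%R j) <= e * lam ^ 3)%R /\ (Cmod (G i j - G i 1%R) <= e * lam ^ 3)%R /\
     wedge (twist (X * Y / (1 + X * Y)) (X ^ 2 * Y / (1 + X ^ 2 * Y)) (line_at l m (F i j)))
       (line_at l m (G i j)) = 0) ->
  let K2 := (3 * (66 * c0 ^ 2 / w) + 2)%R in
  let K3 := (c0 ^ 2 * (1044 + 132 * K2))%R in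
  (Cmod (cA 0 0) <= 40 * (w + K3) * (e + lam) + 6 * c0 ^ 2 * e)%R /\
  (Cmod (cB 0 0) <= 40 * (w + K3) * (e + lam) + 6 * c0 ^ 2 * e)%R.
Proof.
  intros Hw Pw Hlam He H K2 K3.
  pose proof c0_pos as Pc. assert (Pc2 : (1 <= c0 ^ 2)%R) by (simpl; nra).
  set (K1 := (66 * c0 ^ 2 / w)%R) in *.
  assert (PK1 : (0 < K1)%R) by (unfold K1; apply Rdiv_lt_0_compat; lra).
  assert (PK2 : (0 < K2)%R) by (unfold K2; lra).
  assert (PK3 : (0 < K3)%R) by (unfold K3; apply Rmult_lt_0_compat; lra).
  assert (L2 : (0 < lam ^ 2)%R) by (apply pow_lt; lra).
  assert (L3 : (0 < lam ^ 3 <= lam ^ 2)%R).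
  { split. apply pow_lt; lra. replace (lam ^ 3)%R with (lam * lam ^ 2)%R by ring. nra. }
  assert (L4 : (0 < lam ^ 4)%R) by (apply pow_lt; lra).
  assert (L5 : (lam ^ 5 <= lam ^ 4)%R) by (replace (lam ^ 5)%R with (lam * lam ^ 4)%R by ring; nra).
  assert (L6 : (lam ^ 6 <= lam ^ 4)%R).
  { replace (lam ^ 6)%R with (lam ^ 2 * lam ^ 4)%R by ring. assert (lam ^ 2 <= 1)%R by (simpl; nra). nra. }
  set (u := fun i j : R => RtoC (i * lam) * RtoC (j * lam) / (1 + RtoC (i * lam) * RtoC (j * lam))).
  set (v := fun i j : R => RtoC (i * lam) ^ 2 * RtoC (j * lam) / (1 + RtoC (i * lam) ^ 2 * RtoC (j * lam))).
  assert (Uv : forall i j : R, (1 <= i <= 3)%R -> (1 <= j <= 2)%R ->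
     (Cmod (u i j) <= 6 * lam ^ 2)%R /\ (Cmod (u i j - RtoC (i * j * lam ^ 2)) <= (6 * lam ^ 2) ^ 2)%R /\
     (Cmod (v i j) <= 18 * lam ^ 3)%R /\ (Cmod (v i j - RtoC (i ^ 2 * j * lam ^ 3)) <= (18 * lam ^ 3) ^ 2)%R).
  { intros i j Hi Hj.
    assert (U : u i j = RtoC (i * j * lam ^ 2) / (1 + RtoC (i * j * lam ^ 2))).
    { unfold u. rewrite <- RtoC_mult. replace (i * lam * (j * lam))%R with (i * j * lam ^ 2)%R by ring. reflexivity. }
    assert (V : v i j = RtoC (i ^ 2 * j * lam ^ 3) / (1 + RtoC (i ^ 2 * j * lam ^ 3))).
    { unfold v. rewrite <- RtoC_pow, <- RtoC_mult. replace ((i * lam) ^ 2 * (j * lam))%R with (i ^ 2 * j * lam ^ 3)%R by ring. reflexivity. }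
    assert (I1 : (0 <= i * j <= 6)%R) by nra. assert (I2 : (0 <= i ^ 2 * j <= 18)%R) by (simpl; nra).
    rewrite U, V.
    destruct (frac_bounds (i * j * lam ^ 2) (6 * lam ^ 2) ltac:(nra)) as [A B].
    destruct (frac_bounds (i ^ 2 * j * lam ^ 3) (18 * lam ^ 3) ltac:(nra)) as [A' B']. auto. }
  assert (Rel : forall i j : R, (1 <= i <= 3)%R -> (1 <= j <= 2)%R ->
     (F i j - G i j) * wedge l m = u i j * cA (F i j) (G i j) + v i j * cB (F i j) (G i j)).
  { intros i j Hi Hj. destruct (H i j Hi Hj) as [_ [_ [_ [_ E]]]].
    rewrite wedge_twist_expand in E. fold (u i j) (v i j) in E.
    transitivity (u i j * cA (F i j) (G i j) + v i j * cB (F i j) (G i j) -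
      ((G i j - F i j) * wedge l m + u i j * cA (F i j) (G i j) + v i j * cB (F i j) (G i j))).
    ring. rewrite E. ring. }
  assert (B1 : forall i j : R, (1 <= i <= 3)%R -> (1 <= j <= 2)%R -> (Cmod (F i j) <= 1)%R /\ (Cmod (G i j) <= 1)%R).
  { intros i j Hi Hj. destruct (H i j Hi Hj) as [A [B _]]. lra. }
  (* A rough bound comes first: u and v are O(lam^2), hence so is F - G, with 66 = 6 * 2 + 18 * 3.
     Combined with the hypotheses on F and G, it shows that both stay within O(lam^2) of the single
     value [f0]. *)
  assert (FG : forall i j : R, (1 <= i <= 3)%R -> (1 <= j <= 2)%R -> (Cmod (F i j - G i j) <= K1 * lam ^ 2)%R).
  { intros i j Hi Hj. destruct (B1 i j Hi Hj) as [A B]. destruct (cAB_bound _ _ A B) as [CA CB].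
    destruct (Uv i j Hi Hj) as [U [_ [V _]]].
    apply (Rmult_le_reg_r w); auto. rewrite Hw at 1. rewrite <- Cmod_mult, Rel by auto.
    eapply Rle_trans. apply Cmod_plus_le; apply Cmod_mult_le; eauto.
    replace (K1 * lam ^ 2 * w)%R with (66 * c0 ^ 2 * lam ^ 2)%R by (unfold K1; field; lra). nra. }
  assert (Hel : (e * lam ^ 3 <= lam ^ 2)%R) by nra.
  set (f0 := F 1%R 1%R).
  assert (D : forall i j : R, (1 <= i <= 3)%R -> (1 <= j <= 2)%R ->
     (Cmod (F i j - f0) <= K2 * lam ^ 2)%R /\ (Cmod (G i j - f0) <= K2 * lam ^ 2)%R).
  { intros i j Hi Hj.
    destruct (H i j Hi Hj) as [_ [_ [A1 [_ _]]]]. destruct (H 1%R j ltac:(lra) Hj) as [_ [_ [_ [A2 _]]]].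
    pose proof (FG 1%R j ltac:(lra) Hj) as A3. pose proof (FG 1%R 1%R ltac:(lra) ltac:(lra)) as A4.
    pose proof (FG i j Hi Hj) as A5. rewrite Cmod_sub_sym in A4, A5. fold f0 in A4.
    assert (P : (Cmod (F i j - f0) <= e * lam ^ 3 + (K1 * lam ^ 2 + (e * lam ^ 3 + K1 * lam ^ 2)))%R).
    { replace (F i j - f0) with ((F i j - F 1%R j) + ((F 1%R j - G 1%R j) + ((G 1%R j - G 1%R 1%R) + (G 1%R 1%R - f0)))) by ring.
      repeat apply Cmod_plus_le; auto. }
    split. unfold K2. nra.
    replace (G i j - f0) with ((G i j - F i j) + (F i j - f0)) by ring.
    eapply Rle_trans. apply Cmod_plus_le; eauto. unfold K2. nra. }
  set (As := cA f0 f0). set (Bs := cB f0 f0).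
  assert (Hf0 : (Cmod f0 <= 1)%R) by (apply (B1 1%R 1%R); lra).
  (* Bootstrap: since [cA] and [cB] now vary by O(lam^2) only, freezing them at [f0] and replacing u
     and v by their leading monomials costs O(lam^4). *)
  assert (Rm : forall i j : R, (1 <= i <= 3)%R -> (1 <= j <= 2)%R ->
     (Cmod ((F i j - G i j) * wedge l m - (RtoC (i * j * lam ^ 2) * As + RtoC (i ^ 2 * j * lam ^ 3) * Bs)) <= K3 * lam ^ 4)%R).
  { intros i j Hi Hj. rewrite Rel by auto.
    destruct (B1 i j Hi Hj) as [A B]. destruct (cAB_bound _ _ A B) as [CA CB].
    destruct (D i j Hi Hj) as [D1 D2]. destruct (cAB_lipschitz _ _ f0 _ A B Hf0 D1 D2) as [LA LB]. fold As in LA. fold Bs in LB.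
    destruct (Uv i j Hi Hj) as [U1 [U2 [V1 V2]]].
    replace (u i j * cA (F i j) (G i j) + v i j * cB (F i j) (G i j) - (RtoC (i * j * lam ^ 2) * As + RtoC (i ^ 2 * j * lam ^ 3) * Bs))
     with (((u i j - RtoC (i * j * lam ^ 2)) * cA (F i j) (G i j) + RtoC (i * j * lam ^ 2) * (cA (F i j) (G i j) - As)) +
           ((v i j - RtoC (i ^ 2 * j * lam ^ 3)) * cB (F i j) (G i j) + RtoC (i ^ 2 * j * lam ^ 3) * (cB (F i j) (G i j) - Bs))) by ring.
    assert (R1 : (Cmod (RtoC (i * j * lam ^ 2)) <= 6 * lam ^ 2)%R).
    { assert (0 <= i * j <= 6)%R by nra. rewrite Cmod_R, Rabs_pos_eq by nra. nra. }
    assert (R2 : (Cmod (RtoC (i ^ 2 * j * lam ^ 3)) <= 18 * lam ^ 3)%R).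
    { assert (0 <= i ^ 2 * j <= 18)%R by (simpl; nra). rewrite Cmod_R, Rabs_pos_eq by nra. nra. }
    eapply Rle_trans. repeat apply Cmod_plus_le; apply Cmod_mult_le; eauto.
    unfold K3.
    replace ((6 * lam ^ 2) ^ 2 * (2 * c0 ^ 2) + 6 * lam ^ 2 * (4 * c0 ^ 2 * (K2 * lam ^ 2)) +
      ((18 * lam ^ 3) ^ 2 * (3 * c0 ^ 2) + 18 * lam ^ 3 * (6 * c0 ^ 2 * (K2 * lam ^ 2))))%R
      with (c0 ^ 2 * ((72 + 24 * K2) * lam ^ 4 + 972 * lam ^ 6 + 108 * K2 * lam ^ 5))%R by ring.
    rewrite (Rmult_assoc (c0 ^ 2)). apply Rmult_le_compat_l. lra.
    assert (108 * K2 * lam ^ 5 <= 108 * K2 * lam ^ 4)%R by (apply Rmult_le_compat_l; lra). lra. }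
  set (rho := (4 * w * (e * lam) + 4 * K3 * lam ^ 2)%R).
  (* The mixed difference, from 1 to i in the first variable and from 1 to 2 in the second, divided
     by lam^2. The difference in i removes F and that in j removes G, each up to multiples of e
     lam^3. *)
  assert (DD : forall i : R, (1 <= i <= 3)%R ->
     (Cmod (RtoC (i - 1) * As + RtoC ((i ^ 2 - 1) * lam) * Bs) <= rho)%R).
  { intros i Hi.
    assert (S : forall j, (1 <= j <= 2)%R -> (Cmod (F i j - F 1%R j) <= e * lam ^ 3)%R) by (intros j Hj; apply (H i j Hi Hj)).
    assert (T : forall i, (1 <= i <= 3)%R -> (Cmod (G i 2%R - G i 1%R) <= e * lam ^ 3)%R) by (intros i' Hi'; apply (H i' 2%R Hi'); lra).
    apply (Rmult_le_reg_l (lam ^ 2)); auto. rewrite <- (Rabs_pos_eq (lam ^ 2)) at 1 by lra. rewrite <- Cmod_R, <- Cmod_mult.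
    set (r := fun i j => (F i j - G i j) * wedge l m - (RtoC (i * j * lam ^ 2) * As + RtoC (i ^ 2 * j * lam ^ 3) * Bs)) in *.
    replace (RtoC (lam ^ 2) * (RtoC (i - 1) * As + RtoC ((i ^ 2 - 1) * lam) * Bs)) with
      ((((F i 2%R - F 1%R 2%R) - (F i 1%R - F 1%R 1%R)) - ((G i 2%R - G i 1%R) - (G 1%R 2%R - G 1%R 1%R))) * wedge l m
        - ((r i 2%R - r i 1%R) - (r 1%R 2%R - r 1%R 1%R))).
    2: { unfold r. rewrite !RtoC_mult, !RtoC_minus, ?RtoC_mult, !RtoC_pow. ring. }
    replace (lam ^ 2 * rho)%R with
      (((e * lam ^ 3 + e * lam ^ 3) + (e * lam ^ 3 + e * lam ^ 3)) * w + ((K3 * lam ^ 4 + K3 * lam ^ 4) + (K3 * lam ^ 4 + K3 * lam ^ 4)))%R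
      by (unfold rho; ring).
    apply Cmod_minus_le.
    - apply Cmod_mult_le. 2: lra. repeat apply Cmod_minus_le; try apply S; try apply T; lra.
    - repeat apply Cmod_minus_le; apply Rm; lra. }
  (* The values i = 2 and i = 3 control As + 3 lam Bs and 2 As + 8 lam Bs, whence 2 lam Bs by
     elimination. Dividing by lam is affordable because rho is O(lam (e + lam)). *)
  assert (D2 := DD 2%R ltac:(lra)). assert (D3 := DD 3%R ltac:(lra)).
  assert (Pe : (0 <= e * lam)%R) by nra.
  assert (Prho : (0 <= rho)%R) by (eapply Rle_trans; [apply Cmod_ge_0 | apply D2]).
  assert (BsB : (lam * Cmod Bs <= 2 * rho)%R).
  { assert (Q : (Cmod (RtoC (2 * lam) * Bs) <= rho + 2 * rho)%R).
    { replace (RtoC (2 * lam) * Bs) with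
        ((RtoC (3 - 1) * As + RtoC ((3 ^ 2 - 1) * lam) * Bs) - 2 * (RtoC (2 - 1) * As + RtoC ((2 ^ 2 - 1) * lam) * Bs)).
      apply Cmod_minus_le; auto. now apply Cmod_2_mult.
      rewrite !RtoC_mult, !RtoC_minus, !RtoC_pow. ring. }
    rewrite Cmod_mult, Cmod_R, Rabs_pos_eq in Q by lra. lra. }
  assert (AsB : (Cmod As <= 7 * rho)%R).
  { replace As with ((RtoC (2 - 1) * As + RtoC ((2 ^ 2 - 1) * lam) * Bs) - RtoC (3 * lam) * Bs)
      by (rewrite !RtoC_mult, !RtoC_minus, !RtoC_pow; ring).
    assert (Q : (Cmod (RtoC (3 * lam) * Bs) <= 6 * rho)%R) by (rewrite Cmod_mult, Cmod_R, Rabs_pos_eq by lra; lra).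
    pose proof (Cmod_minus_le _ _ _ _ D2 Q). lra. }
  assert (Bsf : (Cmod Bs <= 40 * (w + K3) * (e + lam))%R).
  { apply (Rmult_le_reg_l lam). lra. eapply Rle_trans. apply BsB. unfold rho.
    replace (lam ^ 2)%R with (lam * lam)%R by ring.
    assert (0 <= w * lam * lam)%R by (apply Rmult_le_pos; [apply Rmult_le_pos|]; lra).
    assert (0 <= K3 * e * lam)%R by (apply Rmult_le_pos; [apply Rmult_le_pos|]; lra).
    assert (0 <= w * e * lam)%R by (apply Rmult_le_pos; [apply Rmult_le_pos|]; lra).
    assert (0 <= K3 * lam * lam)%R by (apply Rmult_le_pos; [apply Rmult_le_pos|]; lra). lra. }
  assert (Asf : (Cmod As <= 40 * (w + K3) * (e + lam))%R).
  { eapply Rle_trans. apply AsB. unfold rho.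
    assert (lam ^ 2 <= lam)%R by (simpl; nra). assert (K3 * lam ^ 2 <= K3 * lam)%R by (apply Rmult_le_compat_l; lra).
    assert (w * (e * lam) <= w * e)%R by (apply Rmult_le_compat_l; nra).
    assert (0 <= w * e)%R by nra. assert (0 <= K3 * e)%R by nra. assert (0 <= w * lam)%R by nra. assert (0 <= K3 * lam)%R by nra. nra. }
  assert (Z1 : (Cmod 0 <= 1)%R) by (rewrite Cmod_0; lra).
  assert (Fe : (Cmod (0 - f0) <= e)%R).
  { replace (0 - f0) with (- f0) by ring. rewrite Cmod_opp. apply (H 1%R 1%R); lra. }
  destruct (cAB_lipschitz 0 0 f0 e Z1 Z1 Hf0 Fe Fe) as [LA LB]. fold As in LA. fold Bs in LB.
  split.
  - replace (cA 0 0) with (As + (cA 0 0 - As)) by ring. eapply Rle_trans. apply Cmod_plus_le; eauto.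
    assert (0 <= c0 ^ 2 * e)%R by nra. lra.
  - replace (cB 0 0) with (Bs + (cB 0 0 - Bs)) by ring. apply Cmod_plus_le; auto.
Qed.

End SecondDifferences.

(** * Vanishing of the limit line, and the contradiction *)

Lemma Cmod_small_zero (x : C) (K : R) : (0 <= K)%R ->
  (forall eps, (0 < eps <= 1)%R -> (Cmod x <= K * eps)%R) -> x = 0.
Proof.
  intros HK H. apply Cmod_eq_0. apply Rle_antisym. 2: apply Cmod_ge_0.
  apply Rle_plus_epsilon. intros e He. rewrite Rplus_0_l.
  set (d := Rmin 1 (e / (K + 1))). assert (Hd : (0 < d <= 1)%R).
  { split. apply Rmin_pos. lra. apply Rdiv_lt_0_compat; lra. apply Rmin_l. }
  eapply Rle_trans. apply (H d Hd).
  assert (d <= e / (K + 1))%R by apply Rmin_r.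
  apply Rle_trans with ((K + 1) * (e / (K + 1)))%R. apply Rmult_le_compat; lra. right; field; lra.
Qed.

(** As eps tends to 0, [second_differences] makes both coefficients vanish at l = (a, b). The first
    leaves a = 0 or a = b; the second is then 2 b^2 or b^2, so that l = 0, which contradicts the
    independence of l and m. *)
Lemma no_common_lines (l m : C2) : wedge l m <> 0 ->
  (forall eps, (0 < eps <= 1)%R -> exists (lam : R) (F G : R -> R -> C), (0 < lam <= eps)%R /\
    forall i j : R, (1 <= i <= 3)%R -> (1 <= j <= 2)%R ->
     let X := RtoC (i * lam) in let Y := RtoC (j * lam) in
     (Cmod (F i j) <= eps)%R /\ (Cmod (G i j) <= eps)%R /\
     (Cmod (F i j - F 1%R j) <= eps * lam ^ 3)%R /\ (Cmod (G i j - G i 1%R) <= eps * lam ^ 3)%R /\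
     wedge (twist (X * Y / (1 + X * Y)) (X ^ 2 * Y / (1 + X ^ 2 * Y)) (line_at l m (F i j)))
       (line_at l m (G i j)) = 0) -> False.
Proof.
  intros Hw H.
  set (c0 := (Cmod (fst l) + Cmod (snd l) + Cmod (fst m) + Cmod (snd m) + 1)%R).
  pose proof (Cmod_ge_0 (fst l)). pose proof (Cmod_ge_0 (snd l)).
  pose proof (Cmod_ge_0 (fst m)). pose proof (Cmod_ge_0 (snd m)).
  assert (Pw := proj1 (Cmod_gt_0 _) Hw). set (w := Cmod (wedge l m)) in *.
  set (K3 := (c0 ^ 2 * (1044 + 132 * (3 * (66 * c0 ^ 2 / w) + 2)))%R).
  assert (Pc : (0 < c0 ^ 2)%R) by (apply pow_lt; unfold c0; lra).
  assert (PK3 : (0 < K3)%R).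
  { unfold K3. assert (0 < 66 * c0 ^ 2 / w)%R by (apply Rdiv_lt_0_compat; lra). apply Rmult_lt_0_compat; lra. }
  assert (Main : forall eps, (0 < eps <= 1)%R ->
    (Cmod (fst l * (snd l - fst l)) <= (80 * (w + K3) + 6 * c0 ^ 2) * eps)%R /\
    (Cmod (snd l * (2 * snd l - fst l)) <= (80 * (w + K3) + 6 * c0 ^ 2) * eps)%R).
  { intros eps He. destruct (H eps He) as [lam [F [G [Hlam HFG]]]].
    destruct (second_differences l m c0 (Rle_refl c0) w eps lam F G eq_refl Pw ltac:(lra) ltac:(lra) HFG) as [A B].
    fold K3 in A, B. unfold line_at in A, B. cbn [fst snd] in A, B.
    replace ((fst l + 0 * fst m) * (snd l + 0 * snd m - (fst l + 0 * fst m))) with (fst l * (snd l - fst l)) in A by ring.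
    replace ((snd l + 0 * snd m) * (2 * (snd l + 0 * snd m) - (fst l + 0 * fst m))) with (snd l * (2 * snd l - fst l)) in B by ring.
    assert (40 * (w + K3) * (eps + lam) <= 40 * (w + K3) * (eps + eps))%R by (apply Rmult_le_compat_l; lra).
    split; lra. }
  assert (PK : (0 <= 80 * (w + K3) + 6 * c0 ^ 2)%R) by lra.
  assert (Z1 : fst l * (snd l - fst l) = 0) by (apply (Cmod_small_zero _ _ PK); intros; now apply Main).
  assert (Z2 : snd l * (2 * snd l - fst l) = 0) by (apply (Cmod_small_zero _ _ PK); intros; now apply Main).
  assert (Int : forall a b : C, a * b = 0 -> a = 0 \/ b = 0).
  { intros a b E. destruct (classic (a = 0)); auto. right.
    transitivity (/ a * (a * b)). field; auto. rewrite E. ring. }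
  assert (Hl : fst l = 0 /\ snd l = 0).
  { destruct (Int _ _ Z1) as [E|E].
    - rewrite E in Z2. split; auto.
      destruct (Int _ _ Z2) as [E2|E2]; auto.
      transitivity (/ 2 * (2 * snd l - 0)); [field | rewrite E2; ring].
    - assert (E' : snd l = fst l) by (transitivity (snd l - fst l + fst l); [ring | rewrite E; ring]).
      rewrite E' in Z2. replace (2 * fst l - fst l) with (fst l) in Z2 by ring.
      destruct (Int _ _ Z2) as [E2|E2]; rewrite E'; auto. }
  apply Hw. unfold wedge. destruct Hl as [-> ->]. ring.
Qed.

Lemma ln_bounds (w : R) : (0 <= w)%R -> (0 <= ln (1 + w) <= w)%R.
Proof.
  intros H. split.
  - rewrite <- ln_1. apply ln_le; lra.
  - pose proof (exp_ineq1_le (ln (1 + w))) as T. rewrite exp_ln in T by lra. lra.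
Qed.

Lemma limit_line_independent (tau : C) (t : P1) : tau <> 0 ->
  wedge (limit_line tau t) (limit_line tau (other_member t)) <> 0.
Proof.
  intros Ht. unfold wedge. destruct t as [t|]; cbn [limit_line other_member fst snd].
  - replace ((1 - t) * (1 / tau) - t / tau * - (1)) with (/ tau) by (field; auto).
    intros E. apply (f_equal (fun x => x * tau)) in E. rewrite Cinv_l, Cmult_0_l in E by auto.
    apply (f_equal fst) in E. simpl in E. lra.
  - intros E. apply (f_equal (fun x => - x * tau)) in E.
    replace (- (- (1) * (0 / tau) - 1 / tau * (1 - 0)) * tau) with (RtoC 1) in E by (field; auto).
    apply (f_equal fst) in E. simpl in E. lra.
Qed.

Lemma sector_weaken (varpi : R) (i : Z4) (c eps eps' M : R) (p : C2) : (eps' <= eps)%R ->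
  sector varpi i c eps M p -> sector varpi i c eps' M p.
Proof.
  intros He [A [B [[th [D E]] G]]]. split; auto. split; auto. split; auto. exists th. split; auto. lra.
Qed.

Theorem theorem7p11 (tau : C) (varpi : R)
    (Htau : (0 < Im tau)%R)
    (Hvarpi : (0 < varpi < PI)%R) (Harg : is_arg tau varpi)
    (V : C2 -> Prop) (F : C2 -> C2) (HF : is_neighborhood tau V F)
    (Psi : formal_diffeo) (HPsi : formal_conjugacy tau F Psi)
    (phi : Z4 -> C2 -> C2) (Hphi : has_cocycle tau varpi V F Psi phi)
    (H14 : germ_inverse (phi i4) phi_14) :
  forall t : P1, divergent tau V F Psi t.
Proof.
  intros t [W [eta [Hfol Hconv]]].
  assert (Ntau : tau <> 0) by (intros E; rewrite E in Htau; simpl in Htau; lra).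
  assert (Ptau := proj1 (Cmod_gt_0 _) Ntau).
  destruct Hphi as [_ [S [psi [Hsn Hrel]]]].
  assert (N1 : RtoC 1 <> 0) by (apply Cmod_gt_0; rewrite Cmod_1; lra).
  assert (Arg1 : is_arg 1 0) by (unfold is_arg; rewrite Cmod_1, cos_0, sin_0; apply injective_projections; simpl; ring).
  assert (Op4 : opening varpi i4 = ((- 0)%R, (PI - 0)%R)) by (simpl; f_equal; ring).
  assert (HN1 := sectorial_cone_normalization tau tau varpi varpi V F Psi i1 _ _ Ntau Harg eq_refl (Hsn i1)).
  assert (HN4 := sectorial_cone_normalization tau 1 varpi 0 V F Psi i4 _ _ N1 Arg1 Op4 (Hsn i4)).
  assert (Hco : forall c k : R, (0 < c)%R -> (0 < k)%R -> exists M : R, forall p, S i4 p -> S i1 p ->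
     cone tau k c M p -> cone 1 k c M p -> Pi tau (psi i4 p) = phi i4 (Pi tau (psi i1 p))).
  { intros c k Hc Hk.
    set (eps := Rmin (k / (2 * Cmod tau)) (k / (2 * Cmod 1))).
    assert (He : (0 < eps)%R) by (apply Rmin_pos; apply Rdiv_lt_0_compat; rewrite ?Cmod_1; lra).
    destruct (Hrel i4 c eps Hc He) as [M [_ HM]]. exists M. intros p S4p S1p C1 C4.
    apply (HM p S4p S1p).
    - apply (sector_weaken _ _ _ _ _ _ _ (Rmin_r _ _)). now apply (cone_sector 1 varpi 0).
    - apply (sector_weaken _ _ _ _ _ _ _ (Rmin_l _ _)). now apply (cone_sector tau varpi varpi). }
  destruct H14 as [_ [_ [_ Hger]]]. apply locally_C2 in Hger. destruct Hger as [delta [Hdelta Hger]].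
  assert (Hinv : forall q : C2, (Cmod (fst q) < delta)%R -> (Cmod (snd q) < delta)%R -> phi_14 (phi i4 q) = q).
  { intros q A B. specialize (Hger (fst q) (snd q) A B). cbn [fst snd origin] in Hger.
    rewrite !Cplus_0_l in Hger. now destruct q. }
  destruct (overlap_point tau F Psi (S i1) (S i4) (psi i1) (psi i4) (phi i4) delta Htau HN1 HN4 Hco Hdelta Hinv)
    as [A HA].
  apply (no_common_lines _ _ (limit_line_independent tau t Ntau)).
  intros eps Heps.
  pose proof (exp_pos 12) as P12.
  (* The variation of f1 below is at most (3 exp 12 + 72) e lam^3, that of f4 at most 3 exp 12 e
     lam^3. *)
  set (e := (eps / (6 * exp 12 + 100))%R).
  assert (He : (0 < e)%R) by (apply Rdiv_lt_0_compat; lra).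
  assert (Ee : (e * (6 * exp 12 + 100) = eps)%R) by (unfold e; field; lra).
  assert (Pe12 : (0 < e * exp 12)%R) by nra.
  destruct (slope_extension tau tau V F Psi (S i1) (psi i1) t W eta dom1 Htau HF HN1 Hfol Hconv
    dom1_re dom1_open (dom1_half_plane tau Htau) e He) as [M1 [f1 [Per1 [_ [Hol1 Val1]]]]].
  destruct (slope_extension tau 1 V F Psi (S i4) (psi i4) t W eta dom4 Htau HF HN4 Hfol Hconv
    dom4_re dom4_open (dom4_half_plane tau Htau) e He) as [M4 [f4 [Per4 [Per4s [Hol4 Val4]]]]].
  (* The logarithm of lam, negative enough for all points within 3 of it to lie in the domains, and
     for lam to be at most eps and 1/21. *)
  set (a := (- (Rabs A + Rabs M1 + Rabs M4 + 21 + Rabs (ln eps)))%R).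
  pose proof (Rabs_pos A). pose proof (Rabs_pos M1). pose proof (Rabs_pos M4). pose proof (Rabs_pos (ln eps)).
  pose proof (Rle_abs A). pose proof (Rle_abs M1). pose proof (Rle_abs M4). pose proof (Rle_abs (- ln eps)) as Le.
  rewrite Rabs_Ropp in Le.
  set (lam := exp a). assert (Plam : (0 < lam)%R) by apply exp_pos.
  assert (Llam : (lam <= / 21)%R).
  { replace (/ 21)%R with (exp (- ln 21)) by (rewrite exp_Ropp, exp_ln; lra).
    apply Rlt_le, exp_increasing. pose proof (ln_bounds 20 ltac:(lra)) as T.
    replace (1 + 20)%R with 21%R in T by ring.
    unfold a. lra. }
  assert (Leps : (lam <= eps)%R).
  { rewrite <- (exp_ln eps) by lra. unfold lam. destruct (Req_dec a (ln eps)) as [->|]; [lra|].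
    apply Rlt_le, exp_increasing. unfold a in *. lra. }
  set (xf := fun i : R => ln (i * lam)).
  assert (Xf : forall i, (1 <= i <= 3)%R -> (a <= xf i <= a + 2)%R /\ exp (xf i) = (i * lam)%R).
  { intros i Hi. unfold xf. split. 2: apply exp_ln; nra.
    rewrite ln_mult by lra. unfold lam. rewrite ln_exp.
    pose proof (ln_bounds (i - 1) ltac:(lra)) as T. replace (1 + (i - 1))%R with i in T by ring. lra. }
  (* [x1] and [s1] are the logarithms of the coordinates of the image of (i lam, j lam) by
     [phi_14]. *)
  set (x1 := fun i j => (xf i + ln (1 + exp (xf i) * exp (xf j)))%R).
  set (s1 := fun i j => (xf j + ln (1 + exp (xf i) ^ 2 * exp (xf j)))%R).
  assert (L2 : (0 < lam ^ 2)%R) by (apply pow_lt; lra). assert (L3 : (0 < lam ^ 3)%R) by (apply pow_lt; lra).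
  assert (l2 : (lam ^ 2 <= / 21 * lam)%R) by (simpl; nra).
  assert (l3 : (lam ^ 3 <= / 21 * lam)%R).
  { replace (lam ^ 3)%R with (lam ^ 2 * lam)%R by ring. apply Rmult_le_compat_r; lra. }
  (* The second coordinate of the image depends on i only through a term O(lam^3); f1, nearly a
     function of that coordinate alone, therefore hardly depends on i. *)
  assert (X1 : forall i j, (1 <= i <= 3)%R -> (1 <= j <= 2)%R ->
    (a <= x1 i j <= a + 3)%R /\ (xf j <= s1 i j <= xf j + 18 * lam ^ 3)%R).
  { intros i j Hi Hj. destruct (Xf i Hi) as [A1 A2]. destruct (Xf j ltac:(lra)) as [B1 B2].
    unfold x1, s1. rewrite A2, B2.
    assert (I1 : (0 <= i * j <= 6)%R) by nra. assert (I2 : (0 <= i ^ 2 * j <= 18)%R) by (simpl; nra).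
    replace (i * lam * (j * lam))%R with (i * j * lam ^ 2)%R by ring.
    replace ((i * lam) ^ 2 * (j * lam))%R with (i ^ 2 * j * lam ^ 3)%R by ring.
    pose proof (ln_bounds (i * j * lam ^ 2) ltac:(nra)). pose proof (ln_bounds (i ^ 2 * j * lam ^ 3) ltac:(nra)).
    split; nra. }
  assert (Ex4 : (exp (4 * a + 12) <= exp 12 * lam ^ 3)%R).
  { rewrite Rplus_comm, exp_plus. apply Rmult_le_compat_l. lra.
    replace (4 * a)%R with (a + (a + (a + a)))%R by ring. rewrite !exp_plus. fold lam.
    replace (lam * (lam * (lam * lam)))%R with (lam * lam ^ 3)%R by ring. nra. }
  (* The slope of the sector 1 is taken at the image by [phi_14], that of the sector 4 at the point
     itself. *)
  exists lam, (fun i j => f1 (RtoC (x1 i j)) (RtoC (s1 i j))), (fun i j => f4 (RtoC (xf i)) (RtoC (xf j))).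
  split. lra.
  intros i j Hi Hj. cbv zeta.
  assert (Xi := Xf i Hi). assert (Xj := Xf j ltac:(lra)). assert (Xo := Xf 1%R ltac:(lra)).
  assert (Y1 := X1 i j Hi Hj). assert (Y2 := X1 1%R j ltac:(lra) Hj).
  assert (Dm1 : forall x s : R, (Rabs (x - a) <= 3)%R -> (Rabs (s - a) <= 3)%R -> dom1 M1 (RtoC x) (RtoC s)).
  { intros x s Hx Hs. apply Rabs_le_between in Hx. apply Rabs_le_between in Hs.
    split; simpl. unfold a in *; lra. apply Rabs_def1; unfold a in *; lra. }
  assert (Dm4 : forall x s : R, (Rabs (x - a) <= 3)%R -> (Rabs (s - a) <= 3)%R -> dom4 M4 (RtoC x) (RtoC s)).
  { intros x s Hx Hs. apply Rabs_le_between in Hx. apply Rabs_le_between in Hs.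
    split; simpl. unfold a in *; lra. apply Rabs_def1; unfold a in *; lra. }
  assert (R1 : (Rabs (x1 i j - a) <= 3)%R) by (apply Rabs_le; lra).
  assert (R2 : (Rabs (s1 i j - a) <= 3)%R) by (apply Rabs_le; lra).
  assert (R3 : (Rabs (x1 1%R j - a) <= 3)%R) by (apply Rabs_le; lra).
  assert (R4 : (Rabs (s1 1%R j - a) <= 3)%R) by (apply Rabs_le; lra).
  assert (R5 : (Rabs (xf i - a) <= 3)%R) by (apply Rabs_le; lra).
  assert (R6 : (Rabs (xf j - a) <= 3)%R) by (apply Rabs_le; lra).
  assert (R7 : (Rabs (xf 1%R - a) <= 3)%R) by (apply Rabs_le; lra).
  assert (eeps : (e <= eps)%R) by nra.
  split. { eapply Rle_trans. apply (Hol1 _ _ (Dm1 _ _ R1 R2)). lra. }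
  split. { eapply Rle_trans. apply (Hol4 _ _ (Dm4 _ _ R5 R6)). lra. }
  split.
  { replace (f1 (RtoC (x1 i j)) (RtoC (s1 i j)) - f1 (RtoC (x1 1%R j)) (RtoC (s1 1%R j))) with
      ((f1 (RtoC (x1 i j)) (RtoC (s1 i j)) - f1 (RtoC (x1 1%R j)) (RtoC (s1 i j))) +
       (f1 (RtoC (x1 1%R j)) (RtoC (s1 i j)) - f1 (RtoC (x1 1%R j)) (RtoC (s1 1%R j)))) by ring.
    eapply Rle_trans. apply Cmod_plus_le.
    - apply (dom1_near_constant f1 M1 e a); auto.
      + intros x s. rewrite <- (Per1 x s 1%Z). f_equal. ring.
      + intros x s Hd. split; apply (Hol1 x s Hd).
      + unfold a; lra.
      + unfold a; lra.
    - apply (dom1_lipschitz f1 M1 e a); auto.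
      + intros x s Hd. split; apply (Hol1 x s Hd).
      + unfold a; lra.
      + unfold a; lra.
    - assert (T1 : (Rabs (x1 i j - x1 1%R j) <= 3)%R) by (apply Rabs_le; lra).
      assert (T2 : (Rabs (s1 i j - s1 1%R j) <= 18 * lam ^ 3)%R) by (apply Rabs_le; lra).
      assert (T3 : (e * exp (4 * a + 12) * Rabs (x1 i j - x1 1%R j) <= e * (exp 12 * lam ^ 3) * 3)%R).
      { apply Rmult_le_compat; auto. apply Rmult_le_pos; [lra | apply Rlt_le, exp_pos]. apply Rabs_pos.
        apply Rmult_le_compat_l; lra. }
      assert (T4 : (4 * e * Rabs (s1 i j - s1 1%R j) <= 4 * e * (18 * lam ^ 3))%R) by (apply Rmult_le_compat_l; lra).
      rewrite <- Ee. nra. }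
  split.
  (* [dom4 M x s] is [dom1 M s x], so the estimate of the sector 1 applies with the variables
     exchanged. *)
  { eapply Rle_trans. apply (dom1_near_constant (fun s x => f4 x s) M4 e a); auto.
    - intros s x Hd. split; apply (Hol4 x s Hd).
    - unfold a; lra.
    - unfold a; lra.
    - assert (T1 : (Rabs (xf j - xf 1%R) <= 3)%R) by (apply Rabs_le; lra).
      assert (T3 : (e * exp (4 * a + 12) * Rabs (xf j - xf 1%R) <= e * (exp 12 * lam ^ 3) * 3)%R).
      { apply Rmult_le_compat; auto. apply Rmult_le_pos; [lra | apply Rlt_le, exp_pos]. apply Rabs_pos.
        apply Rmult_le_compat_l; lra. }
      rewrite <- Ee. nra. }
  destruct (HA a (xf i) (xf j) ltac:(unfold a; lra) R5 R6) as [p [n [S1p [S4p [E4 [E1 [Ra4 [Ra1 Hcf]]]]]]]].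
  fold (x1 i j) (s1 i j) in E1, Ra1.
  destruct Xi as [_ Xi]. destruct Xj as [_ Xj]. rewrite Xi, Xj in Hcf.
  (* [overlap_point] describes p over the translate by n periods; the domains depend on real parts
     only, and the periodicity of f1 and f4 removes n. *)
  assert (Rn : forall x : C, Re x = Re (x + RtoC (IZR n) * two_pi_i)) by (intros [u v]; simpl; ring).
  destruct (Val1 _ _ p (dom1_re _ _ _ _ _ (Rn _) eq_refl (Dm1 _ _ R1 R2)) Ra1 S1p E1) as [V1 [Ne W1]].
  destruct (Val4 _ _ p (dom4_re _ _ _ _ _ (Rn _) eq_refl (Dm4 _ _ R5 R6)) Ra4 S4p E4) as [V4 [_ W4]].
  rewrite Per1 in V1. rewrite Per4 in V4. rewrite V1, V4.
  apply (line_relation tau (psi i1) (psi i4) eta _ _ _ _ (limit_line tau (other_member t)) p Hcf); auto; now apply slope_line.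
Qed.
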